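(* Let $E$ be a complex Banach space, $A$ a closed linear operator on $E$, and $C\in L(E)$ injective with $CA\subset AC$. Let $0<\alpha\le\frac\pi2$, let $K\in L^1_{loc}([0,\infty))$ be not identically zero and Laplace transformable, and let $\omega\ge\max(0,\mathrm{abs}(K))$. Suppose that $\{\lambda\in\mathbb C:\operatorname{Re}\lambda>\omega,\ \tilde K(\lambda)\ne0\}\subset\rho_C(A)$ and that the function $$\lambda\mapsto\tilde K(\lambda)(\lambda-A)^{-1}C,\qquad\operatorname{Re}\lambda>\omega,\ \tilde K(\lambda)\ne0,$$ can be analytically extended to a function $\tilde q:\omega+\Sigma_{\frac\pi2+\alpha}\to L(E)$ satisfying $$\sup_{\lambda\in\omega+\Sigma_{\frac\pi2+\gamma}}\|(\lambda-\omega)\tilde q(\lambda)\|<\infty\ \text{ for all }\gamma\in(0,\alpha),\qquad\text{and}\qquad\lim_{\lambda\to+\infty}\lambda\tilde q(\lambda)=0.$$ Then $A$ is a subgenerator of an exponentially bounded, analytic $K$-convoluted $C$-semigroup of angle $\alpha$.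
   Context: $K$ is Laplace transformable if there is $\beta\in\mathbb R$ such that $\tilde K(\lambda)=\int_0^\infty e^{-\lambda t}K(t)dt$ exists for all $\operatorname{Re}\lambda>\beta$; $\mathrm{abs}(K)=\inf\{\operatorname{Re}\lambda:\tilde K(\lambda)\text{ exists}\}$. For $0<\alpha\le\pi$, $\Sigma_\alpha=\{re^{i\theta}:r>0,|\theta|<\alpha\}$. $\rho_C(A)=\{\lambda\in\mathbb C:R(C)\subset R(\lambda-A),\ \lambda-A\text{ injective}\}$. With $\Theta(t)=\int_0^tK(s)ds$, $A$ is a subgenerator of a $K$-convoluted $C$-semigroup $(S_K(t))_{t\ge0}$ if $(S_K(t))_{t\ge0}\subset L(E)$ is strongly continuous, $S_K(t)C=CS_K(t)$, $S_K(t)A\subset AS_K(t)$, and for all $x\in E$, $t\ge0$: $\int_0^tS_K(s)x\,ds\in D(A)$ and $A\int_0^tS_K(s)x\,ds=S_K(t)x-\Theta(t)Cx$. Such an $(S_K(t))_{t\ge0}$ is an analytic $K$-convoluted $C$-semigroup of angle $\alpha\in(0,\frac\pi2]$ (with subgenerator $A$) if there is an analytic function $\mathbf S_K:\Sigma_\alpha\to L(E)$ with $\mathbf S_K(t)=S_K(t)$ for $t>0$ and $\lim_{z\to0,z\in\Sigma_\gamma}\mathbf S_K(z)x=0$ for all $\gamma\in(0,\alpha)$, $x\in E$. It is an exponentially bounded, analytic $K$-convoluted $C$-semigroup of angle $\alpha$ if moreover for every $\gamma\in(0,\alpha)$ there are $M_\gamma>0$, $\omega_\gamma>0$ with $\|\mathbf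 S_K(z)\|\le M_\gamma e^{\omega_\gamma\operatorname{Re}z}$, $z\in\Sigma_\gamma$. *)

(* Defs.v *)
From HB Require Import structures.
From mathcomp Require Import all_boot all_order all_algebra complex.
From mathcomp Require Import all_classical all_reals all_analysis.

Set Implicit Arguments.
Unset Strict Implicit.
Unset Printing Implicit Defensive.
Import Order.TTheory GRing.Theory Num.Theory numFieldNormedType.Exports.
Local Open Scope classical_set_scope.
Local Open Scope complex_scope.
Local Open Scope ring_scope.

(* The topology of the complex plane lives on the alias R[i]^o of R[i]. Norms
   over a normedModType R[i] take their values in R[i]; being real, they are
   read in R through the real part. *)

Section Scalars.
Context {R : realType}.
Implicit Types (K : R -> R[i]) (l z : R[i]).

Definition cexp z : R[i] :=
  (expR (complex.Re z))%:C * (cos (complex.Im z) +i* sin (complex.Im z)).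

Definition sector (a : R) : set R[i]^o :=
  [set z | exists r t : R,
     [/\ 0 < r, `|t| < a & z = r%:C * (cos t +i* sin t)]].

Definition shifted_sector (w a : R) : set R[i]^o :=
  [set z | sector a (z - w%:C)].

Definition cintegral (D : set R) (f : R -> R[i]) : R[i] :=
  (\int[lebesgue_measure]_(t in D) complex.Re (f t)) +i*
  (\int[lebesgue_measure]_(t in D) complex.Im (f t)).

Definition locally_integrable_halfline K : Prop :=
  forall T : R, 0 <= T ->
    lebesgue_measure.-integrable `[0, T] (fun t => (complex.Re (K t))%:E) /\
    lebesgue_measure.-integrable `[0, T] (fun t => (complex.Im (K t))%:E).

(* As an element of L^1_loc, a function is identically zero when it vanishes
   almost everywhere. *)
Definition zero_kernel K : Prop :=
  {ae lebesgue_measure, forall t : R, 0 <= t -> K t = 0}.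

(* The integral over [0, oo) is the limit of the integrals over [0, T]; it is
   not required to converge absolutely. *)
Definition laplace_upto K l (T : R) : R[i]^o :=
  cintegral `[0, T] (fun t => cexp (- (l * t%:C)) * K t).

Definition laplace_exists K l : Prop := cvg (laplace_upto K l T @[T --> +oo]).

Definition laplace K l : R[i] := lim (laplace_upto K l T @[T --> +oo]).

Definition laplace_transformable K : Prop :=
  exists b : R, forall l, b < complex.Re l -> laplace_exists K l.

Definition laplace_abs K : \bar R :=
  ereal_inf [set (complex.Re l)%:E | l in laplace_exists K].

Definition kernel_primitive K (t : R) : R[i] := cintegral `[0, t] K.

End Scalars.

Section Operators.
Context {R : realType} {E : completeNormedModType R[i]}.
Implicit Types (T C : E -> E) (K : R -> R[i]) (S : R -> E -> E).

Definition bounded_operator T : Prop := linear T /\ continuous T.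

(* Only meaningful on bounded operators: sup is 0 on unbounded sets. *)
Definition opnorm T : R :=
  sup [set complex.Re `|T x| | x in [set x : E | `|x| <= 1]].

(* Complex differentiability in the operator norm, with values in L(E);
   the operations on operators are the pointwise ones. *)
Definition analytic_on (U : set R[i]^o) (F : R[i]^o -> E -> E) : Prop :=
  (forall z, U z -> bounded_operator (F z)) /\
  (forall z, U z -> exists2 T, bounded_operator T &
     opnorm (h^-1 *: (F (z + h) - F z) - T) @[h --> (0 : R[i]^o)^'] -->
       (0 : R)).

(* The values of op outside dom are irrelevant. *)
Record linear_operator := LinearOperator {
  dom : set E;
  op :> E -> E;
  dom0 : dom 0;
  domP : forall (a : R[i]) x y, dom x -> dom y -> dom (a *: x + y);
  opP : forall (a : R[i]) x y, dom x -> dom y ->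
    op (a *: x + y) = a *: op x + op y }.
Implicit Types A : linear_operator.

Definition closed_operator A : Prop :=
  closed [set p : E * E | dom A p.1 /\ p.2 = A p.1].

(* T A `<=` A T, as partially defined operators *)
Definition commutes_with T A : Prop :=
  forall x, dom A x -> dom A (T x) /\ A (T x) = T (A x).

Definition rhoC A C : set R[i] :=
  [set l | range C `<=` [set l *: y - A y | y in dom A] /\
           set_inj (dom A) (fun y => l *: y - A y)].

(* (l - A)^-1 C x, the unique preimage of C x under l - A when l is in rhoC *)
Definition resolventC A C (l : R[i]) (x : E) : E :=
  xget 0 [set y | dom A y /\ l *: y - A y = C x].

Definition riemann_sum (f : R -> E) (a : R) (s : seq R) (xi : nat -> R) : E :=
  \sum_(i < size s) (s`_i - (a :: s)`_i)%:C *: f (xi i).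

(* v is the Riemann integral of f over [a, b], a <= b; the list s holds the
   points of the subdivision other than a. *)
Definition is_Rint (f : R -> E) (a b : R) (v : E) : Prop :=
  forall e : R, 0 < e -> exists2 d : R, 0 < d &
    forall (s : seq R) (xi : nat -> R), itv_partition a b s ->
      (forall i, (i < size s)%N ->
         (a :: s)`_i <= xi i <= s`_i /\ s`_i - (a :: s)`_i < d) ->
      complex.Re `|riemann_sum f a s xi - v| < e.

Definition is_subgenerator A K C S : Prop :=
  [/\ forall t, 0 <= t -> bounded_operator (S t),
      forall x, {within [set t : R | 0 <= t], continuous (fun t => S t x)},
      forall t, 0 <= t -> forall x, S t (C x) = C (S t x),
      forall t, 0 <= t -> commutes_with (S t) A &
      forall x t, 0 <= t -> exists v,
        [/\ is_Rint (fun s => S s x) 0 t v, dom A v &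
            A v = S t x - kernel_primitive K t *: C x]].

Definition analytic_extension (a : R) S (F : R[i]^o -> E -> E) : Prop :=
  [/\ analytic_on (sector a) F,
      forall t : R, 0 < t -> F t%:C = S t &
      forall g : R, 0 < g < a -> forall x,
        F z x @[z --> within (sector g) (nbhs (0 : R[i]^o))] --> (0 : E)].

Definition exp_bounded_on_sectors (a : R) (F : R[i]^o -> E -> E) : Prop :=
  forall g : R, 0 < g < a -> exists M w : R,
    [/\ 0 < M, 0 < w & forall z, sector g z ->
          opnorm (F z) <= M * expR (w * complex.Re z)].

Definition exp_bounded_analytic_convoluted A K C (a : R) S : Prop :=
  is_subgenerator A K C S /\
  exists F, analytic_extension a S F /\ exp_bounded_on_sectors a F.

End Operators.

Arguments linear_operator {R} E.

(* Main.v *)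
(* Put S(z) = (2 pi i)^-1 int e^{l z} q(l) dl over a contour around the sector
   omega + Sigma_{pi/2 + gamma}.  Writing l = omega + e^w turns the contour into
   the boundary of a half-strip |Im w| <= th and q(l) dl into h(w) dw with
   h(w) = e^w q(omega + e^w), which is bounded; only primitives of holomorphic
   vector-valued functions on strips (Goursat) are then needed.  Starting the
   contour at Re w = - ln |z| bounds S by a constant times e^{omega Re z}, and
   S(z) -> 0 because h(w) -> 0 as Re w -> oo in smaller strips (three lines).

   Each algebraic relation for S comes from a relation between values of q on
   Re l > omega, read in a closed subspace of E x E (the graph of A or of C): the
   relation is integrated along arcs of circles of growing radius, after
   dividing by e^{2w} for convergence, and the result is differentiated twice.
   The scalar term this produces is the inverse Laplace transform of the primitive
   of K.  The relations for q hold where the Laplace transform of K is not zero,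
   hence everywhere by closedness: these points are dense since otherwise K = 0 by
   the identity theorem and the uniqueness of the Laplace transform. *)

Require Import Defs.
From HB Require Import structures.
From mathcomp Require Import all_boot all_order all_algebra complex.
From mathcomp Require Import all_classical all_reals all_analysis.
From mathcomp Require Import measurable_realfun ring lra.
Set Implicit Arguments.
Unset Strict Implicit.
Unset Printing Implicit Defensive.
Import Order.TTheory GRing.Theory Num.Theory numFieldNormedType.Exports.
Local Open Scope classical_set_scope.
Local Open Scope complex_scope.
Local Open Scope ring_scope.

(** The resolvent is known only for Re l > omega, while the contours that give good estimates leave
    this half-plane. Hence two kinds of paths: rays for analyticity and bounds, arcs inside Re mu >=
    1 (with mu = e^w = l - omega) for algebra. The parts of the circles left out lie in Re mu <= 1,
    where e^{t mu} is merely bounded, so powers of 1 / mu are needed to discard them. The power 2 is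
    dictated by the scalar term: the arc integral of e^{u mu} / mu^2 is 2 pi i max(u, 0) with an
    error that tends to 0 with the radius, uniformly for bounded u, whereas 1 / mu would produce a
    jump at u = 0. A second obstacle is regularity: one complex derivative of [q] is given, and the
    maximum principle used for three lines takes two. Averaging over a translation in w supplies the
    missing one. Vector-valued integrals are increments of primitives, so that each integral is a
    relation whose existence, uniqueness and estimates are separate statements; Lebesgue integration
    is confined to K and enters through its primitive. *)

(* Module equalities are proved by reification: two expressions are equal as soon as
   each atom has the same coefficient, which is left to ring. *)
Inductive mexp (K : Type) := MAtom of nat | MZero | MAdd of mexp K & mexp K
  | MOpp of mexp K | MScale of K & mexp K.
Arguments MAtom {K}. Arguments MZero {K}.

Section Mexp.
Context {K : pzRingType} {V : lmodType K}.
Fixpoint meval (env : seq V) (e : mexp K) : V :=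
  match e with
  | MAtom n => nth 0 env n | MZero => 0
  | MAdd a b => meval env a + meval env b
  | MOpp a => - meval env a | MScale c a => c *: meval env a end.
Fixpoint mcoef (k : nat) (e : mexp K) : K :=
  match e with
  | MAtom n => if eqn n k then 1 else 0 | MZero => 0
  | MAdd a b => mcoef k a + mcoef k b
  | MOpp a => - mcoef k a | MScale c a => c * mcoef k a end.
Fixpoint mok (n : nat) (a b : mexp K) : Prop :=
  match n with 0 => True | m.+1 => mok m a b /\ mcoef m a = mcoef m b end.

Lemma mevalE env e : meval env e = \sum_(k < size env) mcoef k e *: nth 0 env k.
Proof.
elim: e => /= [n||a -> b ->|a ->|c a ->].
- case: (ltnP n (size env)) => h.
    rewrite (bigD1 (Ordinal h)) //= eqnE eqxx scale1r big1 ?addr0 // => j.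
    by rewrite -val_eqE /= eq_sym => /negbTE ->; rewrite scale0r.
  rewrite nth_default // big1 // => j _; rewrite eqnE gtn_eqF ?scale0r //.
  exact: leq_trans h.
- by rewrite big1 // => j _; rewrite scale0r.
- by rewrite -big_split /=; apply: eq_bigr => j _; rewrite scalerDl.
- by rewrite -sumrN; apply: eq_bigr => j _; rewrite scaleNr.
- by rewrite scaler_sumr; apply: eq_bigr => j _; rewrite scalerA.
Qed.

Lemma meval_eq env a b : mok (size env) a b -> meval env a = meval env b.
Proof.
move=> h; rewrite !mevalE; apply: eq_bigr => -[k kn] _ /=; congr (_ *: _).
move: h; elim: (size env) kn => // n ih.
rewrite ltnS leq_eqVlt => /predU1P[-> [_]|] // kn [h _]; exact: ih.
Qed.
End Mexp.

Lemma regE {K : pzRingType} (a b : K) : a *: (b : K^o) = a * b.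
Proof. by []. Qed.

Ltac m_find x env :=
  lazymatch env with
  | ?y :: ?t => let b := match constr:(Set) with
                  | _ => let _ := match constr:(Set) with _ => constr_eq x y end in constr:(true)
                  | _ => constr:(false) end in
     lazymatch b with true => constr:(0%N) | false =>
       let n := m_find x t in constr:(n.+1) end
  end.
Ltac m_mem x env :=
  lazymatch env with
  | nil => constr:(false)
  | ?y :: ?t => match constr:(Set) with
                  | _ => let _ := match constr:(Set) with _ => constr_eq x y end in constr:(true)
                  | _ => m_mem x t end
  end.
Ltac m_atoms t env :=
  lazymatch t with
  | (?a + ?b)%R => let e := m_atoms a env in m_atoms b e
  | (- ?a)%R => m_atoms a env
  | (_ *: ?a)%R => m_atoms a env
  | (0)%R => env
  | _ => let b := m_mem t env in lazymatch b with true => env | false => constr:(t :: env) end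
  end.
Ltac m_reify K t env :=
  lazymatch t with
  | (?a + ?b)%R => let x := m_reify K a env in let y := m_reify K b env in constr:(@MAdd K x y)
  | (- ?a)%R => let x := m_reify K a env in constr:(@MOpp K x)
  | (?c *: ?a)%R => let x := m_reify K a env in constr:(@MScale K c x)
  | (0)%R => constr:(@MZero K)
  | _ => let n := m_find t env in constr:(@MAtom K n)
  end.
Ltac modring K :=
  lazymatch goal with |- @eq ?V ?a ?b =>
    let e0 := m_atoms a (@nil V) in let env := m_atoms b e0 in
    let x := m_reify K a env in let y := m_reify K b env in
    apply: (@meval_eq _ _ env x y); cbn [mok size mcoef eqn]; do ?split; rewrite ?regE; try ring
  end.

(** * Real-valued norms and sequential completeness *)

Section Norm.
Context {R : realType}.
Implicit Types V : normedZmodType R[i].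

Definition nrm {V} (x : V) : R := complex.Re `|x|.

Lemma nrmE V (x : V) : `|x| = (nrm x)%:C.
Proof. by rewrite /nrm RRe_real // normr_real. Qed.

Lemma nrm_ge0 V (x : V) : 0 <= nrm x.
Proof. by rewrite -ler0c -nrmE. Qed.

Lemma nrm0 V : nrm (0 : V) = 0.
Proof. by rewrite /nrm normr0. Qed.

Lemma nrmN V (x : V) : nrm (- x) = nrm x.
Proof. by rewrite /nrm normrN. Qed.

Lemma nrmB V (x y : V) : nrm (x - y) = nrm (y - x).
Proof. by rewrite -nrmN opprB. Qed.

Lemma nrm_eq0 V (x : V) : nrm x = 0 -> x = 0.
Proof. by move=> h; apply/normr0_eq0; rewrite nrmE h. Qed.

Lemma ler_nrmD V (x y : V) : nrm (x + y) <= nrm x + nrm y.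
Proof. by rewrite -lecR rmorphD /= -!nrmE ler_normD. Qed.

Lemma ler_nrmB V (x y : V) : nrm (x - y) <= nrm x + nrm y.
Proof. by rewrite -(nrmN y) ler_nrmD. Qed.

Lemma nrm_tri V (y x z : V) : nrm (x - z) <= nrm (x - y) + nrm (y - z).
Proof. by rewrite -[x - z](subrKA y) ler_nrmD. Qed.

Lemma nrm_sub_le V (x y : V) : nrm x <= nrm (x - y) + nrm y.
Proof. by rewrite -{1}[x](subrK y) ler_nrmD. Qed.

Lemma nrmZ (E : normedModType R[i]) (a : R[i]) (x : E) :
  nrm (a *: x) = nrm a * nrm x.
Proof. by apply: complexI; rewrite rmorphM /= -!nrmE normrZ. Qed.

Lemma nrmM (a b : R[i]) : nrm (a * b) = nrm a * nrm b.
Proof. by apply: complexI; rewrite rmorphM /= -!nrmE normrM. Qed.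

Lemma nrm1 : nrm (1 : R[i]) = 1.
Proof. by rewrite /nrm normr1. Qed.

Lemma nrmV (a : R[i]) : nrm a^-1 = (nrm a)^-1.
Proof. by apply: complexI; rewrite fmorphV /= -!nrmE normfV. Qed.

Lemma nrmX (a : R[i]) n : nrm (a ^+ n) = nrm a ^+ n.
Proof. by elim: n => [|n ih]; rewrite ?expr0 ?nrm1 // !exprS nrmM ih. Qed.

Lemma nrmC (a : R) : nrm (a%:C : R[i]) = `|a|.
Proof. by rewrite /nrm normc_def /= expr0n /= addr0 sqrtr_sqr. Qed.

Lemma nrm_i : nrm ('i%C : R[i]) = 1.
Proof. by rewrite /nrm normc_def /= expr0n /= add0r expr1n sqrtr1. Qed.

Lemma ler_nrm_Re (z : R[i]) : `|complex.Re z| <= nrm z.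
Proof. by have := normc_ge_Re z; rewrite nrmE lecR. Qed.

Lemma ler_nrm_Im (z : R[i]) : `|complex.Im z| <= nrm z.
Proof.
by have := ler_nrm_Re (z * 'i%C); rewrite ReiNIm normrN nrmM nrm_i mulr1.
Qed.

Lemma ler_nrm_ReIm (z : R[i]) : nrm z <= `|complex.Re z| + `|complex.Im z|.
Proof.
rewrite [z in nrm z]complexE (le_trans (ler_nrmD _ _)) //.
by rewrite nrmM nrm_i mul1r !nrmC.
Qed.

Lemma nrm_le_eps V (x : V) (M : R) :
  (forall e : R, 0 < e -> nrm x <= e * M) -> x = 0.
Proof.
move=> h; apply: nrm_eq0; apply/eqP; rewrite eq_le nrm_ge0 andbT.
apply/ler_addgt0Pl => e e0; rewrite addr0.
have M0 : 0 < `|M| + 1 by rewrite ltr_wpDl.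
apply: le_trans (h (e / (`|M| + 1)) _) _; first by rewrite divr_gt0.
rewrite -mulrA ger_pMr // ler_pdivrMl // mulr1.
by rewrite (le_trans (ler_norm _)) // lerDl.
Qed.

(** Sequential and phrased with [nrm], so that one hypothesis serves both [E] and the scalars
    [R[i]^o], in which the inversion kernels and Laplace integrals take their values. *)
Definition seq_complete V : Prop := forall u : nat -> V,
  (forall e : R, 0 < e -> exists N, forall m n,
     (N <= m)%N -> (N <= n)%N -> nrm (u m - u n) <= e) ->
  exists l, forall e : R, 0 < e -> exists N, forall n,
     (N <= n)%N -> nrm (u n - l) <= e.

End Norm.

Section Complete.
Context {R : realType}.

Lemma cmod_complete (E : completeNormedModType R[i]) : @seq_complete R E.
Proof.
move=> u cu.
have : cauchy (u @ \oo).
  apply/cauchy_exP => e e0.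
  have eE : e = (complex.Re e)%:C by rewrite RRe_real // gtr0_real.
  have e1 : 0 < complex.Re e by move: e0; rewrite eE -[0]/((0:R)%:C) ltcR.
  have e2 : 0 < complex.Re e / 2 by rewrite divr_gt0.
  have [N hN] := cu _ e2.
  exists (u N); exists N => // n /= Nn.
  rewrite -ball_normE /ball_ /= nrmE eE ltcR.
  by rewrite (le_lt_trans (hN N n _ _)) // ltr_pdivrMr // ltr_pMr // ltr1n.
move=> /cauchy_cvgP cvu; exists (lim (u @ \oo)) => e e0.
have e0' : 0 < e%:C :> R[i] by rewrite -[0]/((0:R)%:C) ltcR.
move/cvgrPdist_le : (cvu) => /(_ _ e0')[N _ hN].
by exists N => n /hN /=; rewrite nrmE lecR nrmB.
Qed.

Lemma complex_complete : @seq_complete R (R[i]^o : normedModType R[i]).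
Proof.
move=> u cu.
have H (p : R[i] -> R) : (forall x y, p (x - y) = p x - p y) ->
    (forall z, `|p z| <= nrm z) -> exists l : R, forall e : R, 0 < e ->
    exists N, forall n, (N <= n)%N -> `|p (u n) - l| <= e.
  move=> pB pn.
  have : cauchy ((p \o u) @ \oo).
    apply/cauchy_exP => e e0.
    have e2 : 0 < e / 2 by rewrite divr_gt0.
    have [N hN] := cu _ e2.
    exists (p (u N)); exists N => // n /= Nn.
    rewrite -ball_normE /ball_ /= -pB (le_lt_trans (pn _)) //.
    by rewrite (le_lt_trans (hN N n _ _)) // ltr_pdivrMr // ltr_pMr // ltr1n.
  move=> /cauchy_cvgP cvu; exists (lim ((p \o u) @ \oo)) => e e0.
  move/cvgrPdist_le : (cvu) => /(_ _ e0)[N _ hN].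
  by exists N => n /hN /=; rewrite distrC.
have [a ha] := H (@complex.Re R) (fun x y => raddfB (@complex.Re R : Rcomplex R -> R) x y)
  ler_nrm_Re.
have [b hb] := H (@complex.Im R) (fun x y => raddfB (@complex.Im R : Rcomplex R -> R) x y)
  ler_nrm_Im.
exists (a +i* b) => e e0.
have e2 : 0 < e / 2 by rewrite divr_gt0.
have [N1 h1] := ha _ e2; have [N2 h2] := hb _ e2.
exists (maxn N1 N2) => n; rewrite geq_max => /andP[n1 n2].
have := h1 _ n1; have := h2 _ n2.
have := ler_nrm_ReIm (u n - (a +i* b)).
case: (u n) => x y /=; lra.
Qed.

End Complete.

(** * Cousin's lemma *)

Section Interval.
Context {R : realType}.

(** The supremum of the points reachable from [a] is itself reachable and cannot lie below [b],
    since the local property covers intervals straddling it. This takes the place of compactness in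
    the mean value inequality, the construction of primitives, uniform continuity and the passage of
    integrals to closed subspaces. *)
Lemma cousin (Q : R -> R -> Prop) (a b : R) : a <= b ->
  (forall x y z, a <= x -> x <= y -> y <= z -> z <= b ->
     Q x y -> Q y z -> Q x z) ->
  (forall c, a <= c <= b -> exists2 d, 0 < d & forall x y,
     a <= x -> x <= c -> c <= y -> y <= b -> y - x < d -> Q x y) ->
  Q a b.
Proof.
move=> ab Qtr Qloc.
pose S := [set x : R | a <= x <= b /\ Q a x].
have Sa : S a.
  have aab : a <= a <= b by rewrite lexx ab.
  by split => //; have [d d0 h] := Qloc _ aab; apply: h; rewrite // subrr.
have Sb : has_sup S by split; [exists a | exists b => x [/andP[]]].
have sab : a <= sup S <= b.
  apply/andP; split; first exact: ub_le_sup (proj2 Sb) _ Sa.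
  by apply: ge_sup; [exists a | move=> x [/andP[]]].
have /andP[s1 s2] := sab.
have [d d0 h] := Qloc _ sab.
have d2 : 0 < d / 2 by rewrite divr_gt0.
have [x [/andP[ax xb] Qx] xs] := sup_adherent d2 Sb.
have xs' : x <= sup S by apply: ub_le_sup (proj2 Sb) _ _; split; rewrite ?ax.
(* [x] lies within [d / 2] to the left of the supremum, so going [d / 3] beyond it keeps the length
   below [d]. *)
pose y := Num.min b (sup S + d / 3).
have yb : y <= b by rewrite ge_min lexx.
have sy : sup S <= y by rewrite le_min s2; lra.
have yd : y <= sup S + d / 3 by rewrite ge_min lexx orbT.
have Qy : Q a y.
  apply: (Qtr a x y) => //; first by rewrite (le_trans xs').
  by apply: h => //; lra.
have : y <= sup S by apply: ub_le_sup (proj2 Sb) _ _; split; rewrite ?yb ?(le_trans s1).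
rewrite /y; case: (leP b (sup S + d/3)) => bs hy; last by exfalso; lra.
by move: Qy; rewrite /y (min_l bs).
Qed.

End Interval.

(** * Differential calculus in one real or complex variable *)

Section DerE.
Context {R : realType} {T : Type} (i : T -> R[i]) {E : normedModType R[i]}.
Implicit Types (D : set T) (f g : T -> E) (t : T).

(* The map i embeds the variable into the complex numbers: it is real_complex for
   functions of a real variable and the identity for functions of a complex one. *)
Definition cont D f t : Prop := forall e : R, 0 < e -> exists2 d : R, 0 < d &
  forall s, D s -> nrm (i s - i t) < d -> nrm (f s - f t) <= e.

Definition der D f t (v : E) : Prop :=
  forall e : R, 0 < e -> exists2 d : R, 0 < d &
  forall s, D s -> nrm (i s - i t) < d ->
    nrm (f s - f t - (i s - i t) *: v) <= e * nrm (i s - i t).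

Lemma cont_sub D D' f t : D' `<=` D -> cont D f t -> cont D' f t.
Proof. by move=> DD h e /h[d d0 H]; exists d => // s /DD; exact: H. Qed.

Lemma der_sub D D' f t v : D' `<=` D -> der D f t v -> der D' f t v.
Proof. by move=> DD h e /h[d d0 H]; exists d => // s /DD; exact: H. Qed.

Lemma der_ext D f g t v : (forall s, D s -> f s = g s) -> D t ->
  der D f t v -> der D g t v.
Proof.
by move=> fg Dt h e /h[d d0 H]; exists d => // s Ds; rewrite -!fg //; exact: H.
Qed.

Lemma cont_ext D f g t : (forall s, D s -> f s = g s) -> D t ->
  cont D f t -> cont D g t.
Proof.
by move=> fg Dt h e /h[d d0 H]; exists d => // s Ds; rewrite -!fg //; exact: H.
Qed.

Lemma der_lip D f t v : der D f t v -> exists2 d : R, 0 < d &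
  forall s, D s -> nrm (i s - i t) < d ->
    nrm (f s - f t) <= (nrm v + 1) * nrm (i s - i t).
Proof.
move=> /(_ 1 ltr01)[d d0 H]; exists d => // s Ds sd.
have := H s Ds sd; have := nrm_sub_le (f s - f t) ((i s - i t) *: v).
rewrite nrmZ; lra.
Qed.

Lemma der_cont D f t v : der D f t v -> cont D f t.
Proof.
move=> /der_lip[d d0 H] e e0.
have v0 : 0 < nrm v + 1 by rewrite ltr_wpDl ?nrm_ge0.
exists (Num.min d (e / (nrm v + 1))); first by rewrite lt_min d0 divr_gt0.
move=> s Ds; rewrite lt_min => /andP[sd se].
by rewrite (le_trans (H s Ds sd)) // mulrC -ler_pdivlMr // ltW.
Qed.

Lemma der_cst D (c : E) t : der D (fun=> c) t 0.
Proof.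
by move=> e e0; exists 1 => // s _ _; rewrite subrr scaler0 subrr nrm0 mulr_ge0 ?nrm_ge0 // ltW.
Qed.

Lemma contD D f g t : cont D f t -> cont D g t -> cont D (fun s => f s + g s) t.
Proof.
move=> hf hg e e0; have e2 : 0 < e / 2 by rewrite divr_gt0.
have [d1 d10 H1] := hf _ e2; have [d2 d20 H2] := hg _ e2.
exists (Num.min d1 d2); first by rewrite lt_min d10.
move=> s Ds; rewrite lt_min => /andP[s1 s2].
have := H1 s Ds s1; have := H2 s Ds s2.
rewrite opprD addrACA; have := ler_nrmD (f s - f t) (g s - g t); lra.
Qed.

Lemma derD D f g t v w : der D f t v -> der D g t w ->
  der D (fun s => f s + g s) t (v + w).
Proof.
move=> hf hg e e0; have e2 : 0 < e / 2 by rewrite divr_gt0.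
have [d1 d10 H1] := hf _ e2; have [d2 d20 H2] := hg _ e2.
exists (Num.min d1 d2); first by rewrite lt_min d10.
move=> s Ds; rewrite lt_min => /andP[s1 s2].
have := H1 s Ds s1; have := H2 s Ds s2.
have -> : f s + g s - (f t + g t) - (i s - i t) *: (v + w) =
  (f s - f t - (i s - i t) *: v) + (g s - g t - (i s - i t) *: w).
  modring R[i].
have := ler_nrmD (f s - f t - (i s - i t) *: v) (g s - g t - (i s - i t) *: w).
by move=> h h1 h2; apply: (le_trans h); rewrite [e]splitr mulrDl lerD.
Qed.

Lemma derZ D f t v (c : R[i]) : der D f t v -> der D (fun s => c *: f s) t (c *: v).
Proof.
move=> hf e e0.
have c0 : 0 < nrm c + 1 by rewrite ltr_wpDl ?nrm_ge0.
have [d d0 H] := hf _ (divr_gt0 e0 c0); exists d => // s Ds sd.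
rewrite scalerA [_ * c]mulrC -scalerA -!scalerBr nrmZ.
apply: le_trans (_ : (nrm c + 1) * (e / (nrm c + 1) * nrm (i s - i t)) <= _); last first.
  by rewrite mulrA mulrCA divff ?mulr1 // gt_eqF.
by apply: ler_pM; rewrite ?nrm_ge0 // ?H // lerDl.
Qed.

Lemma derN D f t v : der D f t v -> der D (fun s => - f s) t (- v).
Proof.
move=> /(derZ (-1)); rewrite scaleN1r => h e /h[d d0 H]; exists d => // s Ds sd.
by have := H s Ds sd; rewrite !scaleN1r.
Qed.

Lemma derB D f g t v w : der D f t v -> der D g t w ->
  der D (fun s => f s - g s) t (v - w).
Proof. by move=> hf /derN hg; exact: derD. Qed.

Lemma der_eq D f t v w : v = w -> der D f t v -> der D f t w.
Proof. by move->. Qed.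

Lemma contZ D f t (c : R[i]) : cont D f t -> cont D (fun s => c *: f s) t.
Proof.
move=> hf e e0.
have c0 : 0 < nrm c + 1 by rewrite ltr_wpDl ?nrm_ge0.
have [d d0 H] := hf _ (divr_gt0 e0 c0); exists d => // s Ds sd.
rewrite -!scalerBr nrmZ.
apply: le_trans (_ : (nrm c + 1) * (e / (nrm c + 1)) <= _); last first.
  by rewrite mulrCA divff ?mulr1 // gt_eqF.
by apply: ler_pM; rewrite ?nrm_ge0 // ?H // lerDl.
Qed.

Lemma cont_cst D (c : E) t : cont D (fun=> c) t.
Proof. exact: der_cont (der_cst D c t). Qed.

Lemma contB D f g t : cont D f t -> cont D g t -> cont D (fun s => f s - g s) t.
Proof.
move=> hf hg; apply: contD => // e e0.
have [d d0 H] := hg e e0; exists d => // s Ds sd.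
by rewrite -opprD nrmN; exact: H.
Qed.

End DerE.

Section DerScale.
Context {R : realType} {T : Type} (i : T -> R[i]) {E : normedModType R[i]}.
Implicit Types (D : set T) (t : T).

Lemma contS D (f : T -> R[i]^o) (g : T -> E) t :
  cont i D f t -> cont i D g t -> cont i D (fun s => f s *: g s) t.
Proof.
move=> hf hg e e0.
have f0 : 0 < nrm (f t) + 1 by rewrite ltr_wpDl ?nrm_ge0.
have g0 : 0 < nrm (g t) + 1 by rewrite ltr_wpDl ?nrm_ge0.
have e2 : 0 < e / 2 by rewrite divr_gt0.
have [d1 d10 H1] := hf _ (divr_gt0 e2 g0).
have [d2 d20 H2] := hg _ (divr_gt0 e2 f0).
have [d3 d30 H3] := hf _ ltr01.
exists (Num.min d1 (Num.min d2 d3)); first by rewrite !lt_min d10 d20.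
move=> s Ds; rewrite !lt_min => /and3P[s1 s2 s3].
have -> : f s *: g s - f t *: g t = f s *: (g s - g t) + (f s - f t) *: g t.
  by rewrite scalerBr scalerBl subrKA.
apply: (le_trans (ler_nrmD _ _)); rewrite [e]splitr lerD // nrmZ.
  have := H2 s Ds s2; rewrite ler_pdivlMr // mulrC; apply: le_trans.
  rewrite ler_wpM2r ?nrm_ge0 //.
  have := H3 s Ds s3; have := nrm_sub_le (f s) (f t); lra.
have := H1 s Ds s1; rewrite ler_pdivlMr //; apply: le_trans.
by rewrite ler_wpM2l ?nrm_ge0 // lerDl.
Qed.

Lemma derS D (f : T -> R[i]^o) (g : T -> E) t (a : R[i]^o) (v : E) : 
  der i D f t a -> der i D g t v ->
  der i D (fun s => f s *: g s) t (a *: g t + f t *: v).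
Proof.
move=> hf hg e e0.
have e2 : 0 < e / 3 by rewrite divr_gt0.
have f0 : 0 < nrm (f t) + 1 by rewrite ltr_wpDl ?nrm_ge0.
have g0 : 0 < nrm (g t) + 1 by rewrite ltr_wpDl ?nrm_ge0.
have v0 : 0 < nrm v + 1 by rewrite ltr_wpDl ?nrm_ge0.
have [d1 d10 H1] := hf _ (divr_gt0 e2 g0).
have [d2 d20 H2] := hg _ (divr_gt0 e2 f0).
have [d3 d30 H3] := der_cont hf (divr_gt0 e2 v0).
have [d5 d50 H5] := der_cont hf ltr01.
exists (Num.min (Num.min d1 d5) (Num.min d2 d3)); first by rewrite !lt_min d10 d20 d50.
move=> s Ds; rewrite !lt_min => /andP[/andP[s1 s5] /andP[s2 s3]].
set h := i s - i t.
have -> : f s *: g s - f t *: g t - h *: (a *: g t + f t *: v) =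
   f s *: (g s - g t - h *: v) + (f s - f t) *: (h *: v)
   + (f s - f t - h *: a) *: g t.
  modring R[i].
have h0 := nrm_ge0 h.
apply: le_trans (ler_nrmD _ _) _; rewrite [e](_ : _ = e/3 + e/3 + e/3); last by field.
rewrite !mulrDl lerD //; first apply: le_trans (ler_nrmD _ _) _; first rewrite lerD // !nrmZ.
- apply: le_trans (_ : (nrm (f t) + 1) * (e / 3 / (nrm (f t) + 1) * nrm h) <= _).
    apply: ler_pM; rewrite ?nrm_ge0 ?H2 //.
    have := H5 s Ds s5; have := nrm_sub_le (f s) (f t); lra.
  by rewrite mulrA mulrCA divff ?mulr1 // gt_eqF.
- rewrite ?nrmZ mulrCA mulrC ler_wpM2r //.
  have := H3 s Ds s3; rewrite ler_pdivlMr //; apply: le_trans.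
  by rewrite ler_wpM2l ?nrm_ge0 // lerDl.
- have := H1 s Ds s1; rewrite nrmZ mulrAC ler_pdivlMr //; apply: le_trans.
  by rewrite ler_wpM2l ?nrm_ge0 // lerDl.
Qed.

End DerScale.

Section DerComp.
Context {R : realType} {T : Type} (i : T -> R[i]) {T' : Type} (i' : T' -> R[i]).
Context {E : normedModType R[i]}.

Lemma der_comp (D : set T) (D' : set T') (g : T -> T') (f : T' -> E) t
    (a : R[i]^o) (v : E) : (forall s, D s -> D' (g s)) ->
  der i D (i' \o g : T -> R[i]^o) t a -> der i' D' f (g t) v ->
  der i D (f \o g) t (a *: v).
Proof.
move=> DD hg hf e e0.
have a0 : 0 < nrm a + 1 by rewrite ltr_wpDl ?nrm_ge0.
have v0 : 0 < nrm v + 1 by rewrite ltr_wpDl ?nrm_ge0.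
have e2 : 0 < e / 2 by rewrite divr_gt0.
have [d1 d10 H1] := hf _ (divr_gt0 e2 a0).
have [d2 d20 H2] := hg _ (divr_gt0 e2 v0).
have [d3 d30 H3] := der_lip hg.
have d12 : 0 < d1 / 2 by rewrite divr_gt0.
have [d4 d40 H4] := der_cont hg d12.
exists (Num.min d2 (Num.min d3 d4)); first by rewrite !lt_min d20 d30.
move=> s Ds; rewrite !lt_min => /and3P[s2 s3 s4] /=.
have L4 : nrm (i' (g s) - i' (g t)) <= d1 / 2 := H4 s Ds s4.
have L5 : nrm (i' (g s) - i' (g t)) < d1.
  by apply: (le_lt_trans L4); rewrite ltr_pdivrMr // ltr_pMr // ltr1n.
have K1 := H1 (g s) (DD s Ds) L5.
have K2 : nrm (i' (g s) - i' (g t) - (i s - i t) *: a) <= _ := H2 s Ds s2.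
have K3 : nrm (i' (g s) - i' (g t)) <= _ := H3 s Ds s3.
set k := i' (g s) - i' (g t) in K1 K2 K3 *; set h := i s - i t in K2 K3 *.
have -> : f (g s) - f (g t) - h *: (a *: v) =
  (f (g s) - f (g t) - k *: v) + (k - h *: a) *: v.
  by modring R[i].
have h0 := nrm_ge0 h.
apply: le_trans (ler_nrmD _ _) _; rewrite [e]splitr mulrDl lerD //.
  apply: le_trans K1 _.
  apply: le_trans (_ : e / 2 / (nrm a + 1) * ((nrm a + 1) * nrm h) <= _).
    by rewrite ler_wpM2l // divr_ge0 ?ltW.
  by rewrite mulrA divfK // gt_eqF.
rewrite nrmZ; move: K2; rewrite mulrAC ler_pdivlMr //; apply: le_trans.
by rewrite ler_wpM2l ?nrm_ge0 // lerDl.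
Qed.

Lemma cont_comp (D : set T) (D' : set T') (g : T -> T') (f : T' -> E) t :
  (forall s, D s -> D' (g s)) ->
  cont i D (i' \o g : T -> R[i]^o) t -> cont i' D' f (g t) ->
  cont i D (f \o g) t.
Proof.
move=> DD hg hf e /hf[d d0 H].
have d2 : 0 < d / 2 by rewrite divr_gt0.
have [d1 d10 H1] := hg _ d2.
exists d1 => // s Ds sd; apply: H; first exact: DD.
apply: le_lt_trans (H1 s Ds sd) _; lra.
Qed.

End DerComp.

(** * Mean value inequality and primitives on a real interval *)

Section RealVar.
Context {R : realType} {E : normedModType R[i]}.
Local Notation rc := (real_complex R).

Lemma der_id {T} (i : T -> R[i]) D t : der i D (i : T -> R[i]^o) t 1.
Proof.
move=> e e0; exists 1 => // s _ _; rewrite [_ *: _]mulr1 subrr nrm0.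
by rewrite mulr_ge0 ?nrm_ge0 // ltW.
Qed.

Lemma nrmRB (s t : R) : nrm (s%:C - t%:C : R[i]) = `|s - t|.
Proof. by rewrite -rmorphB nrmC. Qed.

Lemma abs_le (x c : R) : x <= c -> `|x - c| = c - x.
Proof. by move=> xc; rewrite ler0_norm ?subr_le0 // opprB. Qed.

Lemma abs_ge (x c : R) : c <= x -> `|x - c| = x - c.
Proof. by move=> xc; rewrite ger0_norm ?subr_ge0. Qed.

(** The distances of [x] and [y] to [c] add up to [y - x] because [c] lies between them, so the two
    errors add without loss. This is the form that [cousin] asks for. *)
Lemma der_straddle (D : set R) (f : R -> E) c v (e : R) : der rc D f c v -> 0 < e ->
  exists2 d : R, 0 < d & forall x y, D x -> D y -> x <= c -> c <= y -> y - x < d ->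
    nrm (f y - f x - (y - x)%:C *: v) <= e * (y - x).
Proof.
move=> h e0; have [d d0 H] := h _ e0; exists d => // x y Dx Dy xc cy xy.
have Hx := H x Dx _; have Hy := H y Dy _.
have {}Hx := Hx ltac:(rewrite nrmRB ?(abs_le xc) ?(abs_ge cy); lra).
have {}Hy := Hy ltac:(rewrite nrmRB ?(abs_le xc) ?(abs_ge cy); lra).
move: Hx Hy; rewrite !nrmRB => Hx Hy.
have -> : f y - f x - (y - x)%:C *: v =
   (f y - f c - (y%:C - c%:C) *: v) - (f x - f c - (x%:C - c%:C) *: v).
  by rewrite rmorphB; modring R[i].
apply: le_trans (ler_nrmB _ _) _; apply: le_trans (lerD Hy Hx) _.
rewrite -mulrDr ler_wpM2l ?(ltW e0) //.
by rewrite (abs_le xc) (abs_ge cy); lra.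
Qed.

(** By [cousin], as the inequality adds up over adjacent intervals. The majorant [phi] enters
    through its increments alone; in [laplace_parts] it is a multiple of [varK], for which
    continuity and monotonicity are at hand but no derivative. *)
Lemma mvt_gen (f : R -> E) (phi : R -> R) (a b : R) : a <= b ->
  (forall c, a <= c <= b -> forall e : R, 0 < e -> exists2 d : R, 0 < d & forall x y,
     a <= x -> x <= c -> c <= y -> y <= b -> y - x < d ->
     nrm (f y - f x) <= phi y - phi x + e * (y - x)) ->
  nrm (f b - f a) <= phi b - phi a.
Proof.
move=> ab H; apply/ler_addgt0Pl => e e0.
have e1 : 0 < e / (b - a + 1) by rewrite divr_gt0 //; lra.
have : nrm (f b - f a) <= phi b - phi a + e / (b - a + 1) * (b - a).
  apply: (@cousin _ (fun x y => nrm (f y - f x) <= phi y - phi x + e / (b - a + 1) * (y - x))) ab _ _.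
    move=> x y z ax xy yz zb h1 h2.
    have := nrm_tri (f y) (f z) (f x); lra.
  by move=> c cab; exact: H.
move=> h; apply: le_trans h _; rewrite addrC lerD2r.
rewrite -mulrA ger_pMr // mulrC ler_pdivrMr; lra.
Qed.

Lemma mvt (f f' : R -> E) (phi phi' : R -> R) (D : set R) (a b : R) : a <= b ->
  (forall c, a <= c <= b -> D c) ->
  (forall c, a <= c <= b -> der rc D f c (f' c)) ->
  (forall c, a <= c <= b ->
     der rc D (fun t => (phi t)%:C : R[i]^o) c ((phi' c)%:C : R[i]^o)) ->
  (forall c, a <= c <= b -> nrm (f' c) <= phi' c) ->
  nrm (f b - f a) <= phi b - phi a.
Proof.
move=> ab Dab hf hphi hle; apply: mvt_gen => // c cab e e0.
have e2 : 0 < e / 2 by rewrite divr_gt0.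
have [d1 d10 H1] := der_straddle (hf c cab) e2.
have [d2 d20 H2] : exists2 d : R, 0 < d & forall x y, D x -> D y -> x <= c -> c <= y -> y - x < d ->
    `|phi y - phi x - (y - x) * phi' c| <= e / 2 * (y - x).
  have [d d0 h] := hphi c cab _ e2; exists d => // x y Dx Dy xc cy xy.
  have := h x Dx; have := h y Dy; rewrite !nrmRB !regE -!rmorphB -!rmorphM -!rmorphB !nrmC.
    rewrite (abs_le xc) (abs_ge cy) => /(_ ltac:(lra)) hy /(_ ltac:(lra)) hx.
  move: hy hx; rewrite !ler_norml => /andP[h1 h2] /andP[h3 h4].
  by apply/andP; split; nra.
exists (Num.min d1 d2); first by rewrite lt_min d10.
move=> x y ax xc cy yb; rewrite lt_min => /andP[s1 s2].
have Dx : D x by apply: Dab; rewrite ax (le_trans xc) //; case/andP: cab.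
have Dy : D y by apply: Dab; rewrite yb (le_trans _ cy) //; case/andP: cab.
have := H1 x y Dx Dy xc cy s1; have := H2 x y Dx Dy xc cy s2.
rewrite ler_norml => /andP[h1 h2] h3.
have := nrm_sub_le (f y - f x) ((y - x)%:C *: f' c).
rewrite nrmZ nrmC ger0_norm ?subr_ge0 ?(le_trans xc) // => h4.
have h5 : (y - x) * nrm (f' c) <= (y - x) * phi' c.
  by rewrite ler_wpM2l ?subr_ge0 ?(le_trans xc) // hle.
lra.
Qed.

Lemma mvt_cst (f f' : R -> E) (M : R) (D : set R) (a b : R) : a <= b ->
  (forall c, a <= c <= b -> D c) ->
  (forall c, a <= c <= b -> der rc D f c (f' c)) ->
  (forall c, a <= c <= b -> nrm (f' c) <= M) ->
  nrm (f b - f a) <= M * (b - a).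
Proof.
move=> ab Dab hf hM; rewrite mulrBr.
apply: (@mvt f f' (fun t => M * t) (fun=> M) D) => // c cab.
apply: (@der_eq _ _ _ _ _ _ _ (M%:C *: (1 : R[i]^o))); first exact: mulr1.
apply: der_ext (derZ M%:C (der_id rc D c)); last exact: Dab.
by move=> s _; rewrite regE -rmorphM.
Qed.

Lemma der0_cst (f : R -> E) (D : set R) (a b : R) : a <= b ->
  (forall c, a <= c <= b -> D c) ->
  (forall c, a <= c <= b -> der rc D f c 0) -> f b = f a.
Proof.
move=> ab Dab hf; apply/eqP; rewrite -subr_eq0; apply/eqP/nrm_eq0/eqP.
rewrite eq_le nrm_ge0 andbT -(mul0r (b - a)).
by apply: (@mvt_cst f (fun=> 0) 0 D) => // c _; rewrite nrm0.
Qed.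

Hypothesis Ec : seq_complete E.

(** Tagged as in a gauge integral: only intervals containing [c] are tested against [f c]. For fixed
    [e] such a [P] is glued from affine pieces, and [prim_ex] lets [e] tend to 0. *)
Definition approx_prim (f P : R -> E) (e x y : R) : Prop :=
  forall c, x <= c <= y -> exists2 d : R, 0 < d &
  forall s t, x <= s -> s <= c -> c <= t -> t <= y -> t - s < d ->
    nrm (P t - P s - (t - s)%:C *: f c) <= e * (t - s).

Lemma approx_prim_ex (f : R -> E) (e a b : R) : a <= b -> 0 < e ->
  (forall c, a <= c <= b -> cont rc `[a, b] f c) ->
  exists P, approx_prim f P e a b.
Proof.
move=> ab e0 fc; apply: (@cousin _ (fun x y => exists P, approx_prim f P e x y)) => //.
  move=> x y z ax xy yz zb [P hP] [P' hP'].
  (* The added constant makes the two pieces agree at [y], where an interval straddling the junction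
     is cut in two. *)
  exists (fun t => if t <= y then P t else P' t + (P y - P' y)).
  set F := fun t => _.
  have F1 t : t <= y -> F t = P t by rewrite /F => ->.
  have F2 t : y <= t -> F t = P' t + (P y - P' y).
    rewrite /F le_eqVlt => /predU1P[<-|ty]; first by rewrite lexx addrC subrK.
    by rewrite leNgt ty.
  move=> c /andP[xc cz].
  case: (ltgtP c y) => cy.
  - have [d d0 H] := hP c ltac:(lra).
    exists (Num.min d (y - c)); first by rewrite lt_min d0; lra.
    move=> s t xs sc ct tz; rewrite lt_min => /andP[s1 s2].
    by rewrite !F1; [apply: H => //|..]; lra.
  - have [d d0 H] := hP' c ltac:(lra).
    exists (Num.min d (c - y)); first by rewrite lt_min d0; lra.
    move=> s t xs sc ct tz; rewrite lt_min => /andP[s1 s2].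
    rewrite !F2; [|lra|lra].
    rewrite (_ : _ + _ - _ - _ = P' t - P' s - (t - s)%:C *: f c); last by modring R[i].
    by apply: H => //; lra.
  - have [d d0 H] := hP c ltac:(lra).
    have [d' d'0 H'] := hP' c ltac:(lra).
    exists (Num.min d d'); first by rewrite lt_min d0.
    move=> s t xs sc ct tz; rewrite lt_min => /andP[s1 s2].
    rewrite (F1 s) ?(F2 t); [|lra|lra].
    have := H s c xs sc (lexx _) ltac:(lra) ltac:(lra).
    have := H' c t ltac:(lra) (lexx _) ct ltac:(lra) ltac:(lra).
    rewrite -cy; set u := _ - _ - _; set w := _ - _ - _ => hu hw.
    have -> : P' t + (P c - P' c) - P s - (t - s)%:C *: f c = u + w.
      by rewrite /u /w !rmorphB /=; modring R[i].
    by have := ler_nrmD u w; lra.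
move=> c cab; have [d d0 H] := fc c cab _ e0.
exists d => // x y ax xc cy yb xyd; exists (fun t => t%:C *: f c).
move=> c' /andP[xc' cy']; exists 1 => // s t xs sc ct ty _.
rewrite -scalerBl -rmorphB -scalerBr nrmZ nrmC ger0_norm; last lra.
rewrite mulrC ler_wpM2r //; first lra.
rewrite nrmB; apply: H; first by rewrite /= in_itv /=; lra.
rewrite nrmRB ltr_norml; lra.
Qed.

Lemma approx_prim_close (f P Q : R -> E) (e e' a b : R) : a <= b ->
  approx_prim f P e a b -> approx_prim f Q e' a b ->
  nrm ((P b - Q b) - (P a - Q a)) <= (e + e') * (b - a).
Proof.
move=> ab hP hQ.
apply: (@cousin _ (fun x y => nrm ((P y - Q y) - (P x - Q x)) <= (e + e') * (y - x))) => //.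
  move=> x y z ax xy yz zb h1 h2.
  have := nrm_tri (P y - Q y) (P z - Q z) (P x - Q x); lra.
move=> c cab; have [d d0 H] := hP c cab; have [d' d'0 H'] := hQ c cab.
exists (Num.min d d'); first by rewrite lt_min d0.
move=> s t xs sc ct tz; rewrite lt_min => /andP[s1 s2].
have := H s t xs sc ct tz s1; have := H' s t xs sc ct tz s2.
set u := _ - _ - _; set w := _ - _ - _ => hu hw.
have -> : P t - Q t - (P s - Q s) = w - u by rewrite /u /w; modring R[i].
have := ler_nrmB w u; lra.
Qed.

Lemma approx_prim_sub (f P : R -> E) (e a b x y : R) : a <= x -> y <= b ->
  approx_prim f P e a b -> approx_prim f P e x y.
Proof.
move=> ax yb h c cxy; have [d d0 H] := h c ltac:(lra).
exists d => // s t *; apply: H; lra.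
Qed.

(** By [approx_prim_close] the approximate primitives, normalized at [a], are Cauchy even for the
    Lipschitz seminorm. The difference [S - Q n] has Lipschitz constant [en n], which transfers the
    derivative to the limit [S]. *)
Lemma prim_ex (f : R -> E) (a b : R) : a <= b ->
  (forall c, a <= c <= b -> cont rc `[a, b] f c) ->
  exists P : R -> E, P a = 0 /\ forall c, a <= c <= b -> der rc `[a, b] P c (f c).
Proof.
move=> ab fc.
have ba0 : 0 < b - a + 1 by lra.
have en0 n : 0 < n.+1%:R^-1 / (b - a + 1) :> R by rewrite divr_gt0 // invr_gt0.
pose en (n : nat) : R := n.+1%:R^-1 / (b - a + 1).
have [P hP] := choice (fun n => approx_prim_ex ab (en0 n) fc).
have hle (e : R) : 0 < e -> exists N, forall n, (N <= n)%N -> en n <= e.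
  move=> e0; exists (Num.bound (e * (b - a + 1))^-1) => n hn.
  have e1 : 0 < e * (b - a + 1) by rewrite mulr_gt0.
  rewrite /en ler_pdivrMr // invf_ple ?posrE //.
  rewrite (le_trans (ltW (archi_boundP _))) ?invr_ge0 ?ltW // ltr_nat ltnS.
  exact: hn.
pose Q n t := P n t - P n a.
have hQ n t t' : a <= t -> t <= t' -> t' <= b ->
    forall m, nrm ((Q n t' - Q m t') - (Q n t - Q m t)) <= (en n + en m) * (t' - t).
  move=> a1 tt' b1 m.
  have h1 := approx_prim_sub a1 b1 (hP n); have h2 := approx_prim_sub a1 b1 (hP m).
  have := approx_prim_close tt' h1 h2.
  by rewrite /Q; congr (nrm _ <= _); modring R[i].
have Qa n : Q n a = 0 by rewrite /Q subrr.
have en0' n : 0 <= en n by apply: ltW; exact: en0.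
have lim t : a <= t <= b -> exists l, forall e : R, 0 < e -> exists N, forall n,
     (N <= n)%N -> nrm (Q n t - l) <= e.
  move=> tab; apply: Ec => e e0.
  have [N hN] := hle (e / 2 / (b - a + 1)) ltac:(by rewrite !divr_gt0).
  exists N => m n hm hn.
  have := hQ m a t (lexx _) ltac:(lra) ltac:(lra) n; rewrite !Qa subrr subr0.
  move=> /le_trans; apply.
  apply: le_trans (_ : (en m + en n) * (b - a + 1) <= _).
    by rewrite ler_wpM2l ?addr_ge0 //; lra.
  have := hN m hm; have := hN n hn; rewrite !ler_pdivlMr //; lra.
pose S t := xget 0 [set l | forall e : R, 0 < e -> exists N, forall n,
     (N <= n)%N -> nrm (Q n t - l) <= e].
have hS t : a <= t <= b -> forall e : R, 0 < e -> exists N, forall n,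
     (N <= n)%N -> nrm (Q n t - S t) <= e.
  by move=> /lim[l hl]; rewrite /S; case: xgetP => [x _|/(_ l)] //.
exists S; split.
  apply: (@nrm_le_eps _ _ _ 1) => e e0; have [N hN] := hS a ltac:(lra) e e0.
  by have := hN N (leqnn _); rewrite Qa sub0r nrmN mulr1.
have SQ n t t' : a <= t -> t <= t' -> t' <= b ->
    nrm ((Q n t' - S t') - (Q n t - S t)) <= en n * (t' - t).
  move=> a1 tt' b1; apply/ler_addgt0Pl => e e0.
  have e3 : 0 < e / 3 by rewrite divr_gt0.
  have e4 : 0 < e / 3 / (b - a + 1) by rewrite divr_gt0.
  have [N1 h1] := hS t ltac:(lra) _ e3.
  have [N2 h2] := hS t' ltac:(lra) _ e3.
  have [N3 h3] := hle _ e4.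
  pose m := maxn N1 (maxn N2 N3).
  have {}h1 := h1 m (leq_maxl _ _).
  have {}h2 := h2 m ltac:(by rewrite !leq_max leqnn orbT).
  have {}h3 := h3 m ltac:(by rewrite !leq_max leqnn !orbT).
  have h4 := hQ n t t' a1 tt' b1 m.
  have h5 : en m * (t' - t) <= e / 3.
    apply: le_trans (_ : en m * (b - a + 1) <= _).
      by rewrite ler_wpM2l //; lra.
    by move: h3; rewrite ler_pdivlMr.
  have -> : Q n t' - S t' - (Q n t - S t) =
    ((Q n t' - Q m t') - (Q n t - Q m t)) + ((Q m t' - S t') - (Q m t - S t)).
    by modring R[i].
  have := ler_nrmD ((Q n t' - Q m t') - (Q n t - Q m t)) ((Q m t' - S t') - (Q m t - S t)).
  have := ler_nrmB (Q m t' - S t') (Q m t - S t); lra.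
move=> c cab e e0.
have e2 : 0 < e / 2 by rewrite divr_gt0.
have [N hN] := hle _ e2.
have {hN} HN : en N <= e / 2 by exact: hN.
have [d d0 H] := hP N c cab.
exists d => // s /=; rewrite in_itv /= => sab; rewrite nrmRB => sd.
have key s1 s2 : a <= s1 -> s1 <= c -> c <= s2 -> s2 <= b -> s2 - s1 < d ->
    nrm (S s2 - S s1 - (s2 - s1)%:C *: f c) <= e * (s2 - s1).
  move=> k1 k2 k3 k4 k5.
  have := H s1 s2 k1 k2 k3 k4 k5; have := SQ N s1 s2 k1 ltac:(lra) k4.
  set u := _ - _ - _; set w := _ - _ - _ => hu hw.
  have -> : S s2 - S s1 - (s2 - s1)%:C *: f c = w - u.
    by rewrite /u /w /Q; modring R[i].
  have h6 : en N * (s2 - s1) <= e / 2 * (s2 - s1) by rewrite ler_wpM2r //; lra.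
  have := ler_nrmB w u; rewrite -/(en N) in hw; lra.
case: (leP s c) => sc.
  have := key s c ltac:(lra) sc (lexx _) ltac:(lra).
  rewrite (abs_le sc) in sd *; move=> /(_ sd); rewrite -nrmN.
  by congr (nrm _ <= _); rewrite !rmorphB /=; modring R[i].
have := key c s ltac:(lra) (lexx _) (ltW sc) ltac:(lra).
rewrite (abs_ge (ltW sc)) in sd *; move=> /(_ sd).
by congr (nrm _ <= _); rewrite !rmorphB /=; modring R[i].
Qed.

End RealVar.

(** * The complex exponential *)

Section Cexp.
Context {R : realType}.
Local Notation rc := (real_complex R).
Implicit Types z w h : R[i].

Lemma cexpE (x y : R) : cexp (x +i* y) = (expR x)%:C * (cos y +i* sin y).
Proof. by []. Qed.

Lemma cexpD z w : cexp (z + w) = cexp z * cexp w.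
Proof.
case: z w => a b [c d]; rewrite !cexpE expRD sinD cosD.
by apply/eqP; rewrite eq_complex /=; apply/andP; split; apply/eqP; ring.
Qed.

Lemma cexp0 : cexp (0 : R[i]) = 1.
Proof. by rewrite cexpE expR0 cos0 sin0 mul1r. Qed.

Lemma cexpN z : cexp z * cexp (- z) = 1.
Proof. by rewrite -cexpD subrr cexp0. Qed.

Lemma cexp_neq0 z : cexp z != 0.
Proof. by apply/eqP => h; have := cexpN z; rewrite h mul0r => /esym/eqP; rewrite oner_eq0. Qed.

Lemma cexpNV z : cexp (- z) = (cexp z)^-1.
Proof. by apply: (mulfI (cexp_neq0 z)); rewrite cexpN divff // cexp_neq0. Qed.

Lemma cexpR (x : R) : cexp x%:C = (expR x)%:C.
Proof. by rewrite cexpE cos0 sin0 mulr1. Qed.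

Lemma nrm_cexp z : nrm (cexp z) = expR (complex.Re z).
Proof.
rewrite /cexp nrmM nrmC ger0_norm ?expR_ge0 // /nrm normc_def /=.
by rewrite cos2Dsin2 sqrtr1 mulr1.
Qed.

Lemma nrm_cexp_le z : nrm (cexp z) <= expR (nrm z).
Proof. by rewrite nrm_cexp ler_expR (le_trans (ler_norm _)) // ler_nrm_Re. Qed.

Lemma is_derive_der (D : set R) (f : R -> R) (x v : R) : is_derive x 1 f v ->
  der rc D (fun t => (f t)%:C : R[i]^o) x (v%:C : R[i]^o).
Proof.
move=> [fd fv] e e0.
have : (fun h : R => h^-1 *: (f (h *: 1 + x) - f x)) @ 0^' --> v.
  by rewrite -fv; exact: fd.
move=> /cvgrPdist_le /(_ e e0); rewrite near_withinE => -[d /= d0 H].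
exists d => // s _; rewrite nrmRB => sd.
rewrite regE -!rmorphB -rmorphM -rmorphB !nrmC.
have [->|sx] := eqVneq s x; first by rewrite !subrr mul0r subrr normr0 mulr0.
have := H (s - x); rewrite /ball_ /= sub0r normrN => /(_ sd).
rewrite subr_eq0 => /(_ sx); rewrite /GRing.scale /= mulr1 subrK => h.
have sx0 : 0 < `|s - x| by rewrite normr_gt0 subr_eq0.
rewrite -ler_pdivrMr // -normf_div -normrN.
apply: le_trans h; rewrite le_eqVlt; apply/orP; left; apply/eqP; congr `|_|.
by field; rewrite subr_eq0.
Qed.

(** Near 0 this is read off from the real exponential, cosine and sine; the functional equation
    carries it to every [t]. *)
Lemma der_cexp_line (D : set R) h (t : R) :
  der rc D (fun t => cexp (t%:C * h) : R[i]^o) t (h * cexp (t%:C * h) : R[i]^o).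
Proof.
have h0 : der rc setT (fun t => cexp (t%:C * h) : R[i]^o) 0 (h : R[i]^o).
  case: h => a b.
  have E s : cexp (s%:C * (a +i* b)) = (expR (s * a))%:C *
      ((cos (s * b))%:C + 'i%C * (sin (s * b))%:C).
    rewrite /cexp; congr (_ * _); first by rewrite /= mul0r subr0.
    by rewrite [LHS]complexE /= !mul0r addr0.
  have d1 : der rc setT (fun t => (expR (t * a))%:C : R[i]^o) 0 (a%:C : R[i]^o).
    apply: is_derive_der; apply: is_derive_eq.
    by rewrite mul0r expR0 /GRing.scale /= !mul1r mul0r add0r mulr1 ?mul1r.
  have d2 : der rc setT (fun t => (cos (t * b))%:C : R[i]^o) 0 ((0:R)%:C : R[i]^o).
    by apply: is_derive_der; apply: is_derive_eq; rewrite mul0r sin0 /GRing.scale /= oppr0 mul0r.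
  have d3 : der rc setT (fun t => (sin (t * b))%:C : R[i]^o) 0 (b%:C : R[i]^o).
    apply: is_derive_der; apply: is_derive_eq.
    by rewrite mul0r cos0 /GRing.scale /= !mul1r mul0r add0r mulr1 ?mul1r.
  have := derS d1 (derD d2 (derZ 'i%C d3)).
  rewrite !mul0r cos0 expR0 sin0 => hh.
  apply: der_eq (der_ext (_ : forall s, setT s -> _ = _) _ hh) => //.
    by rewrite !regE mulr0 addr0 mulr1 mul1r add0r [RHS]complexE.
move=> e e0; have p := expR_gt0 (complex.Re (t%:C * h)).
have [d d0 H] := h0 _ (divr_gt0 e0 p).
exists d => // s _ sd.
have := H (s - t) I; rewrite !nrmRB subr0 in sd *; move=> /(_ sd).
rewrite mul0r cexp0 !regE subr0 => K.
have -> : cexp (s%:C * h) - cexp (t%:C * h) - (s%:C - t%:C) * (h * cexp (t%:C * h))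
  = cexp (t%:C * h) * (cexp ((s - t)%:C * h) - 1 - (s - t)%:C * h).
  rewrite -[in cexp (s%:C * h)](subrK t s) rmorphD /= mulrDl cexpD rmorphB /=; ring.
rewrite nrmM nrm_cexp mulrC -ler_pdivlMr // mulrAC.
exact: K.
Qed.

Lemma cexp_sub1 h : nrm (cexp h - 1) <= nrm h * expR (nrm h).
Proof.
have := @mvt_cst R (R[i]^o : normedModType R[i]) (fun t => cexp (t%:C * h))
  (fun t => h * cexp (t%:C * h)) (nrm h * expR (nrm h)) setT 0 1 ler01 (fun _ _ => I).
rewrite mul1r mul0r cexp0 subr0 mulr1; apply => c c01; first exact: der_cexp_line.
rewrite nrmM ler_wpM2l ?nrm_ge0 // nrm_cexp ler_expR.
apply: (le_trans (ler_norm _)); apply: (le_trans (ler_nrm_Re _)).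
rewrite nrmM nrmC ger0_norm; last lra.
by rewrite ler_piMl ?nrm_ge0 //; lra.
Qed.

(** Mean value inequality for e^{t h} - t h on [0, 1], with [cexp_sub1] bounding the derivative.
    This quadratic remainder drives the differentiations in [lap_deriv] and [Lap_deriv]. *)
Lemma cexp_sub2 h : nrm (cexp h - 1 - h) <= nrm h ^+ 2 * expR (nrm h).
Proof.
have := @mvt_cst R (R[i]^o : normedModType R[i]) (fun t => cexp (t%:C * h) - t%:C *: (h : R[i]^o))
  (fun t => h * cexp (t%:C * h) - 1 *: (h : R[i]^o)) (nrm h ^+ 2 * expR (nrm h)) setT 0 1 ler01 (fun _ _ => I).
rewrite mul1r mul0r cexp0 !scale1r scale0r !subr0 mulr1 addrAC; apply => c c01.
  apply: derB; first exact: der_cexp_line.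
  have := derS (der_id rc setT c) (der_cst rc setT (h : R[i]^o) c).
  by rewrite scaler0 addr0 scale1r.
rewrite (_ : _ - _ = h * (cexp (c%:C * h) - 1)); last by rewrite mulrBr mulr1.
rewrite [X in X <= _]nrmM expr2 -mulrA ler_wpM2l ?nrm_ge0 //.
apply: (le_trans (cexp_sub1 _)).
have hc : nrm (c%:C * h) <= nrm h.
  rewrite nrmM nrmC ger0_norm; last lra.
  by rewrite ler_piMl ?nrm_ge0 //; lra.
by apply: ler_pM; rewrite ?nrm_ge0 ?expR_ge0 ?ler_expR.
Qed.

Lemma cexp_diff s z :
  cexp s - cexp z - (s - z) * cexp z = cexp z * (cexp (s - z) - 1 - (s - z)).
Proof.
have -> : cexp s = cexp (s - z) * cexp z by rewrite -cexpD subrK.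
by ring.
Qed.

Lemma cder_cexp (D : set R[i]) z : der id D (cexp : R[i] -> R[i]^o) z (cexp z).
Proof.
move=> e e0; have p : 0 < expR (complex.Re z) * expR 1 by rewrite mulr_gt0 ?expR_gt0.
exists (Num.min 1 (e / (expR (complex.Re z) * expR 1))).
  by rewrite lt_min ltr01 divr_gt0.
move=> s _ /=; rewrite lt_min => /andP[s1 s2]; rewrite regE.
rewrite [X in nrm X](cexp_diff s z).
rewrite nrmM nrm_cexp.
move: s2; rewrite ltr_pdivlMr // => s2.
apply: le_trans (_ : expR (complex.Re z) * (nrm (s - z) ^+ 2 * expR 1) <= _).
  rewrite ler_wpM2l ?expR_ge0 // (le_trans (cexp_sub2 _)) //.
  by rewrite ler_wpM2l ?exprn_ge0 ?nrm_ge0 // ler_expR ltW.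
have := nrm_ge0 (s - z); rewrite expr2; nra.
Qed.

Section Comp.
Context {T : Type} (i : T -> R[i]).

Lemma der_cexp (D : set T) (g : T -> R[i]^o) t (a : R[i]^o) : der i D g t a ->
  der i D (fun s => cexp (g s) : R[i]^o) t (a * cexp (g t)).
Proof.
move=> hg; apply: (@der_comp _ _ i _ id (R[i]^o : normedModType R[i]) D setT g cexp t a (cexp (g t))) => //.
exact: cder_cexp.
Qed.

Lemma inv_diff (s z : R[i]) : s != 0 -> z != 0 ->
  s^-1 - z^-1 - (s - z) * - z^-1 ^+ 2 = (s - z) * ((s - z) * (s^-1 * z^-1 ^+ 2)).
Proof. by move=> s0 z0; field; rewrite s0 z0. Qed.

Lemma cder_inv (z : R[i]) : z != 0 ->
  der id [set z : R[i] | z != 0] (fun z => z^-1 : R[i]^o) z (- z^-1 ^+ 2).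
Proof.
move=> g0 e e0.
have z0 : 0 < nrm z.
  by rewrite lt_neqAle nrm_ge0 andbT eq_sym; apply/eqP => /nrm_eq0/eqP; rewrite (negbTE g0).
have zp : 0 < e * (nrm z ^+ 3 / 2) by rewrite mulr_gt0 // divr_gt0 // exprn_gt0.
exists (Num.min (nrm z / 2) (e * (nrm z ^+ 3 / 2))).
  by rewrite lt_min zp divr_gt0.
move=> s /= s0; rewrite lt_min => /andP[s1 s2]; rewrite regE.
rewrite [X in nrm X](inv_diff s0 g0) [X in X <= _]nrmM mulrC ler_wpM2r ?nrm_ge0 //.
rewrite [X in X <= _](nrmM (s - z) (s^-1 * z^-1 ^+ 2)) (nrmM s^-1 (z^-1 ^+ 2)) nrmX !nrmV.
have sz : nrm z / 2 <= nrm s by have := nrm_sub_le z s; rewrite nrmB; lra.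
have sp : 0 < nrm s by apply: lt_le_trans sz; rewrite divr_gt0.
rewrite exprVn -invfM ler_pdivrMr ?mulr_gt0 ?exprn_gt0 //.
apply: le_trans (ltW s2) _; rewrite ler_wpM2l ?(ltW e0) //.
by rewrite exprS mulrAC ler_wpM2r ?exprn_ge0 ?nrm_ge0.
Qed.

Lemma der_cinv (D : set T) (g : T -> R[i]^o) t (a : R[i]^o) : der i D g t a ->
  (forall s, D s -> g s != 0) -> D t ->
  der i D (fun s => (g s)^-1 : R[i]^o) t (- a * (g t)^-1 ^+ 2).
Proof.
move=> hg gn0 Dt; have g0 := gn0 _ Dt.
apply: der_eq (der_comp (i' := id) (D' := [set z : R[i] | z != 0]) _ hg (cder_inv g0)); last exact: gn0.
by rewrite regE mulrN mulNr.
Qed.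

End Comp.
End Cexp.

(** * Goursat's theorem *)

Section Goursat.
Context {R : realType} {E : normedModType R[i]}.
Hypothesis Ec : seq_complete E.
Local Notation rc := (real_complex R).
Implicit Types (V : set R[i]) (f : R[i] -> E) (a b c z : R[i]).

Definition cconvex V : Prop := forall a b (t : R), V a -> V b -> 0 <= t <= 1 ->
  V (a + t%:C * (b - a)).

Definition cclosed V : Prop := forall z,
  (forall e : R, 0 < e -> exists2 y, V y & nrm (y - z) <= e) -> V z.

(** A relation: the value is the increment of some primitive of the pulled-back integrand, with
    existence in [is_seg_ex] and uniqueness in [is_seg_uniq]. [is_contour] and [is_int] follow the
    same pattern. *)
Definition is_seg f a b (v : E) : Prop := exists P : R -> E,
  (forall t, 0 <= t <= 1 -> der rc `[0, 1] P t ((b - a) *: f (a + t%:C * (b - a))))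
  /\ v = P 1 - P 0.

Lemma is_seg_close f g a b v w (K : R) :
  is_seg f a b v -> is_seg g a b w ->
  (forall t, 0 <= t <= 1 -> nrm (f (a + t%:C * (b - a)) - g (a + t%:C * (b - a))) <= K) ->
  nrm (v - w) <= K * nrm (b - a).
Proof.
move=> [P [hP ->]] [Q [hQ ->]] hK.
have -> : P 1 - P 0 - (Q 1 - Q 0) = (P 1 - Q 1) - (P 0 - Q 0) by modring R[i].
rewrite -[X in _ <= X]mulr1 -[X in _ * X]subr0.
apply: (@mvt_cst R E (fun t => P t - Q t) (fun t => (b - a) *: f (a + t%:C * (b - a)) -
  (b - a) *: g (a + t%:C * (b - a))) _ `[0, 1]) => //.
  by move=> t t01; apply: derB; [exact: hP|exact: hQ].
by move=> t t01; rewrite -scalerBr nrmZ mulrC ler_wpM2r ?nrm_ge0 ?hK.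
Qed.

Lemma is_seg_uniq f a b v w : is_seg f a b v -> is_seg f a b w -> v = w.
Proof.
move=> hv hw; apply/eqP; rewrite -subr_eq0; apply/eqP/nrm_eq0/eqP.
rewrite eq_le nrm_ge0 andbT -(mul0r (nrm (b - a))).
by apply: is_seg_close hv hw _ => t _; rewrite subrr nrm0.
Qed.

Lemma is_seg_rev f a b v : is_seg f a b v -> is_seg f b a (- v).
Proof.
move=> [P [hP ->]]; exists (fun t => P (1 - t)); split; last first.
  by rewrite subrr subr0 opprB.
move=> t t01; have t01' : 0 <= 1 - t <= 1 by lra.
have hg : der rc `[0, 1] (rc \o (fun s : R => 1 - s) : R -> R[i]^o) t (-1 : R[i]^o).
  apply: der_eq (der_ext (_ : forall s, _ s -> _ = _) _ (derB (der_cst rc `[0,1] (1 : R[i]^o) t) (der_id rc `[0,1] t))).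
  - by rewrite sub0r.
  - by move=> s _ /=; rewrite rmorphB.
  - by rewrite /= in_itv.
have := der_comp (D' := `[0, 1]) _ hg (hP _ t01').
have -> : a + (1 - t)%:C * (b - a) = b + t%:C * (a - b) by rewrite rmorphB /=; ring.
rewrite scaleN1r -scaleNr opprB; apply => s /=; rewrite !in_itv /=; lra.
Qed.

Lemma is_seg_sub f a b v (s : R) : 0 <= s <= 1 -> is_seg f a b v ->
  exists w, is_seg f a (a + s%:C * (b - a)) w /\
            is_seg f (a + s%:C * (b - a)) b (v - w).
Proof.
move=> s01 [P [hP ->]]; exists (P s - P 0).
have aff (u k : R) t : 0 <= u -> 0 <= k -> u + k <= 1 -> 0 <= t <= 1 ->
   der rc `[0, 1] (fun t => P (u + t * k)) t (k%:C *: ((b - a) *: f (a + (u + t * k)%:C * (b - a)))).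
  move=> u0 k0 uk t01.
  have t01' : 0 <= u + t * k <= 1 by nra.
  have hg : der rc `[0, 1] (rc \o (fun s : R => u + s * k) : R -> R[i]^o) t (k%:C : R[i]^o).
    apply: der_eq (der_ext (_ : forall s, _ s -> _ = _) _ (derD (der_cst rc `[0,1] (u%:C : R[i]^o) t) (derZ k%:C (der_id rc `[0,1] t)))).
    - by rewrite add0r regE mulr1.
    - by move=> s' _ /=; rewrite regE rmorphD rmorphM /= mulrC.
    - by rewrite /= in_itv.
  have := der_comp (D' := `[0, 1]) _ hg (hP _ t01').
  by apply => s' /=; rewrite !in_itv /=; nra.
split.
  exists (fun t => P (0 + t * s)); split; last by rewrite mul1r mul0r addr0 add0r.
  move=> t t01; have := aff 0 s t (lexx _) ltac:(lra) ltac:(lra) t01.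
  by rewrite scalerA add0r rmorphM /= [a + _ - a]addrAC subrr add0r mulrA.
exists (fun t => P (s + t * (1 - s))); split; last first.
  have -> : s + 1 * (1 - s) = 1 by ring.
  have -> : s + 0 * (1 - s) = s by ring.
  by modring R[i].
move=> t t01; have := aff s (1 - s) t ltac:(lra) ltac:(lra) ltac:(lra) t01.
rewrite scalerA.
have -> : (1 - s)%:C * (b - a) = b - (a + s%:C * (b - a)) by rewrite rmorphB /=; ring.
have -> // : a + (s + t * (1 - s))%:C * (b - a) =
  a + s%:C * (b - a) + t%:C * (b - (a + s%:C * (b - a))).
by rewrite rmorphD rmorphM rmorphB /=; ring.
Qed.

(** Around a triangle these midpoint values cancel; [goursat] compares [f] with its first-order
    expansion at the limit point, which has this form. *)
Lemma is_seg_affine (u v : E) z a b :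
  is_seg (fun y => u + (y - z) *: v) a b ((b - a) *: (u + ((a + b) / 2 - z) *: v)).
Proof.
exists (fun t => (t%:C * (b - a)) *: u + ((t%:C * (b - a)) * (a - z) + (t%:C * (b - a)) ^+ 2 / 2) *: v).
split; last by rewrite mul0r mul1r; modring R[i]; field.
move=> t t01.
pose L s : R[i]^o := s%:C * (b - a).
have hL : der rc `[0, 1] L t (b - a).
  apply: der_eq (derS (der_id rc `[0,1] t) (der_cst rc `[0,1] (b - a : R[i]^o) t)).
  by rewrite scale1r scaler0 addr0.
have h1 := derS hL (der_cst rc `[0,1] u t).
have h2 := derS hL (der_cst rc `[0,1] (a - z : R[i]^o) t).
have h3 := derZ (2^-1) (derS hL hL).
have := derD h1 (derS (derD h2 h3) (der_cst rc `[0,1] v t)).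
rewrite !scaler0 !addr0 !regE => h.
apply: der_eq (der_ext (_ : forall s, _ s -> _ = _) (_ : `[0,1]%classic t) h).
- by rewrite /L; modring R[i]; field.
- by move=> s _; rewrite /L !regE; congr (_ *: _ + _ *: _); field.
- by rewrite /= in_itv.
Qed.

Variables (V : set R[i]) (f : R[i] -> E).
Hypotheses (Vconv : cconvex V) (Vcl : cclosed V).
Hypothesis fcont : forall z, V z -> cont id V f z.

Lemma is_seg_ex a b : V a -> V b -> exists v, is_seg f a b v.
Proof.
move=> Va Vb.
have Vt t : 0 <= t <= 1 -> V (a + t%:C * (b - a)) by exact: Vconv.
have hc t : 0 <= t <= 1 ->
    cont rc `[0, 1] (fun t => (b - a) *: f (a + t%:C * (b - a))) t.
  move=> t01; apply: contZ; apply: (cont_comp (i' := id) (D' := V) (f := f)); last exact: fcont (Vt _ t01).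
    by move=> s; rewrite /= in_itv /=; exact: Vt.
  apply: der_cont; apply: derD; first exact: (der_cst rc `[0,1] (a : R[i]^o)).
  exact: (derS (der_id rc `[0,1] t) (der_cst rc `[0,1] (b - a : R[i]^o) t)).
have [P [_ hP]] := prim_ex Ec ler01 hc.
by exists (P 1 - P 0), P.
Qed.

Definition seg a b : E := xget 0 [set v | is_seg f a b v].

Lemma segP a b : V a -> V b -> is_seg f a b (seg a b).
Proof.
move=> Va Vb; have [v hv] := is_seg_ex Va Vb.
by rewrite /seg; case: xgetP => [x _ //|/(_ v)].
Qed.

Lemma seg_rev a b : V a -> V b -> seg b a = - seg a b.
Proof. by move=> Va Vb; apply: is_seg_uniq (segP Vb Va) (is_seg_rev (segP Va Vb)). Qed.

Definition mid a b : R[i] := a + (2^-1 : R)%:C * (b - a).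

Lemma V_mid a b : V a -> V b -> V (mid a b).
Proof. by move=> Va Vb; apply: Vconv => //; lra. Qed.

Lemma midE a b : mid a b = (a + b) / 2.
Proof. by rewrite /mid fmorphV /= rmorph_nat; field. Qed.

Lemma seg_mid a b : V a -> V b -> seg a b = seg a (mid a b) + seg (mid a b) b.
Proof.
move=> Va Vb; have h : 0 <= (2^-1 : R) <= 1 by lra.
have [w [h1 h2]] := is_seg_sub h (segP Va Vb).
rewrite (is_seg_uniq (segP Va (V_mid Va Vb)) h1).
by rewrite (is_seg_uniq (segP (V_mid Va Vb) Vb) h2); modring R[i].
Qed.

Definition tri (T : R[i] * R[i] * R[i]) : E :=
  let: (a, b, c) := T in seg a b + seg b c + seg c a.
Definition per (T : R[i] * R[i] * R[i]) : R :=
  let: (a, b, c) := T in nrm (b - a) + nrm (c - b) + nrm (a - c).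
Definition inV (T : R[i] * R[i] * R[i]) : Prop :=
  let: (a, b, c) := T in [/\ V a, V b & V c].

Lemma nrm_half (z : R[i]) : nrm (z / 2) = nrm z / 2.
Proof. 
have -> : 2 = (2 : R)%:C :> R[i] by rewrite rmorph_nat.
by rewrite nrmM nrmV nrmC ger0_norm. Qed.

(** The last conclusion follows the first vertex: its moves are summable, so the first vertices form
    a Cauchy sequence and the limit point is found without intersecting triangles. *)
Lemma tri_step T : inV T -> exists T', [/\ inV T', nrm (tri T) / 4 <= nrm (tri T'),
  per T' = per T / 2 & nrm (T'.1.1 - T.1.1) <= per T / 2].
Proof.
case: T => [[a b] c] [Va Vb Vc].
pose x := mid a b; pose y := mid b c; pose z := mid c a.
have [Vx Vy Vz] : [/\ V x, V y & V z] by split; exact: V_mid.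
have sum : tri (a, b, c) = tri (a, x, z) + tri (x, b, y) + tri (z, y, c) + tri (x, y, z).
  rewrite /tri (seg_mid Va Vb) (seg_mid Vb Vc) (seg_mid Vc Va) -/x -/y -/z.
  by rewrite (seg_rev Vx Vz) (seg_rev Vx Vy) (seg_rev Vy Vz); modring R[i].
have n0 : nrm (tri (a, b, c)) <= nrm (tri (a, x, z)) + nrm (tri (x, b, y)) +
    nrm (tri (z, y, c)) + nrm (tri (x, y, z)).
  rewrite sum; have := ler_nrmD (tri (a, x, z) + tri (x, b, y) + tri (z, y, c)) (tri (x, y, z)).
  have := ler_nrmD (tri (a, x, z) + tri (x, b, y)) (tri (z, y, c)).
  have := ler_nrmD (tri (a, x, z)) (tri (x, b, y)); lra.
have xE : x = (a + b) / 2 by exact: midE.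
have yE : y = (b + c) / 2 by exact: midE.
have zE : z = (c + a) / 2 by exact: midE.
have ba := nrm_ge0 (b - a); have cb := nrm_ge0 (c - b); have ac := nrm_ge0 (a - c).
have half u v w : u = v / 2 -> nrm v = w -> nrm u = w / 2 :> R.
  by move=> -> <-; exact: nrm_half.
have p1 : nrm (x - a) = nrm (b - a) / 2 by apply: half erefl; rewrite xE; field.
have p2 : nrm (b - x) = nrm (b - a) / 2 by apply: half erefl; rewrite xE; field.
have p3 : nrm (y - b) = nrm (c - b) / 2 by apply: half erefl; rewrite yE; field.
have p4 : nrm (c - y) = nrm (c - b) / 2 by apply: half erefl; rewrite yE; field.
have p5 : nrm (z - c) = nrm (a - c) / 2 by apply: half erefl; rewrite zE; field.
have p6 : nrm (a - z) = nrm (a - c) / 2 by apply: half erefl; rewrite zE; field.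
have p7 : nrm (z - x) = nrm (c - b) / 2 by apply: half erefl; rewrite zE xE; field.
have p8 : nrm (x - y) = nrm (a - c) / 2 by apply: half erefl; rewrite yE xE; field.
have p9 : nrm (y - z) = nrm (b - a) / 2 by apply: half erefl; rewrite yE zE; field.
have dxa : nrm (x - a) <= per (a, b, c) / 2 by rewrite /per; lra.
have dza : nrm (z - a) <= per (a, b, c) / 2 by rewrite nrmB /per; lra.
case: (leP (nrm (tri (a,b,c)) / 4) (nrm (tri (a, x, z)))) => h1.
  exists (a, x, z); split; [by []|by []|rewrite /per; lra|].
  by rewrite /= subrr nrm0; lra.
case: (leP (nrm (tri (a,b,c)) / 4) (nrm (tri (x, b, y)))) => h2.
  by exists (x, b, y); split; [by []|by []|rewrite /per; lra|].
case: (leP (nrm (tri (a,b,c)) / 4) (nrm (tri (z, y, c)))) => h3.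
  by exists (z, y, c); split; [by []|by []|rewrite /per; lra|].
exists (x, y, z); split; [by []|lra| |by []].
by rewrite /per (nrmB y x) (nrmB z y) (nrmB x z); lra.
Qed.

Hypothesis fder : forall z, V z -> exists v, der id V f z v.

Lemma goursat a b c : V a -> V b -> V c -> seg a b + seg b c + seg c a = 0.
Proof.
move=> Va Vb Vc.
have [step hstep] := @choice _ _ (fun T T' => inV T -> [/\ inV T', nrm (tri T) / 4 <= nrm (tri T'),
    per T' = per T / 2 & nrm (T'.1.1 - T.1.1) <= per T / 2]) ltac:(move=> T;
  have [/tri_step[T' hT']|nV] := pselect (inV T); [by exists T'|by exists T]).
pose u n := iter n step (a, b, c).
have uV n : inV (u n).
  by elim: n => //= n /hstep[].
pose p0 := per (a, b, c).
have uper n : per (u n) = p0 / 2 ^+ n.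
  elim: n => [|n ih]; first by rewrite expr0 divr1.
  by have [_ _ -> _] := hstep _ (uV n); rewrite ih exprSr invfM mulrA.
have utri n : nrm (tri (a, b, c)) / 4 ^+ n <= nrm (tri (u n)).
  elim: n => [|n ih]; first by rewrite expr0 divr1.
  have [_ h _ _] := hstep _ (uV n); apply: le_trans h.
  by rewrite exprSr invfM mulrA ler_pM2r.
have p00 : 0 <= p0 by rewrite /p0 /per !addr_ge0 ?nrm_ge0.
have pn m : 0 <= p0 / 2 ^+ m by rewrite divr_ge0 // exprn_ge0.
have udist n k : nrm ((u (n + k)%N).1.1 - (u n).1.1) <= p0 / 2 ^+ n - p0 / 2 ^+ (n + k).
  elim: k => [|k ih]; first by rewrite addn0 subrr nrm0 subrr.
  rewrite addnS; have [_ _ _ h] := hstep _ (uV (n + k)%N).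
  have := nrm_tri (u (n + k)%N).1.1 (u (n + k).+1).1.1 (u n).1.1.
  move: h; rewrite uper -/(u (n + k).+1) => h.
  have -> : p0 / 2 ^+ (n + k).+1 = p0 / 2 ^+ (n + k) / 2 by rewrite exprSr invfM mulrA.
  lra.
have udist' n m : (n <= m)%N -> nrm ((u m).1.1 - (u n).1.1) <= p0 / 2 ^+ n.
  move=> /subnKC <-; have := udist n (m - n)%N; have := pn (n + (m - n))%N; lra.
have psmall (e : R) : 0 < e -> exists N, p0 / 2 ^+ N <= e.
  move=> e0; exists (Num.bound (p0 / e)); rewrite ler_pdivrMr ?exprn_gt0 // mulrC -ler_pdivrMr //.
  rewrite (le_trans (ltW (archi_boundP _))) ?divr_ge0 ?(ltW e0) //.
  by rewrite -natrX ler_nat ltnW // ltn_expl.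
have [z hz] : exists z : R[i], forall e : R, 0 < e -> exists N, forall n,
     (N <= n)%N -> nrm ((u n).1.1 - z) <= e.
  apply: (@complex_complete R (fun n => (u n).1.1)) => e e0.
  have e2 : 0 < e / 2 by rewrite divr_gt0.
  have [N hN] := psmall _ e2.
  exists N => m n Nm Nn; have := udist' _ _ Nm; have := udist' _ _ Nn.
  have := nrm_tri (u N).1.1 (u m).1.1 (u n).1.1; rewrite (nrmB (u N).1.1).
  rewrite -[nrm ((u m).1.1 - (u n).1.1 : R[i]^o)]/(nrm ((u m).1.1 - (u n).1.1 : R[i])); lra.
have zdist n : nrm ((u n).1.1 - z) <= p0 / 2 ^+ n.
  apply/ler_addgt0Pl => e e0; have [N hN] := hz _ e0.
  have := hN (maxn N n) (leq_maxl _ _); have := udist' _ _ (leq_maxr N n).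
  have := nrm_tri (u (maxn N n)).1.1 (u n).1.1 z.
  rewrite (nrmB (u n).1.1 (u (maxn N n)).1.1); lra.
have Vz : V z.
  apply: Vcl => e /psmall[N hN]; exists (u N).1.1.
    by have := uV N; case: (u N) => [[? ?] ?] [].
  exact: le_trans (zdist N) hN.
have [v hv] := fder Vz.
rewrite -[LHS]/(tri (a, b, c)).
(* After [N] subdivisions the integral is still at least [4 ^- N] times the original one, while the
   perimeter [p0 / 2 ^+ N] bounds it by [2 * e] times its square: the powers of 2 cancel. *)
apply: (@nrm_le_eps _ _ _ (2 * p0 ^+ 2)) => e e0.
have [d d0 H] := hv _ e0.
(* All points of the triangle are then within [d / 2] of [z], twice its perimeter being a safe bound
   for the distance. *)
have [N hN] := psmall (d / 4) ltac:(by rewrite divr_gt0).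
have := utri N; rewrite ler_pdivrMr ?exprn_gt0 // => h; apply: le_trans h _.
pose g y := f z + (y - z) *: v.
set p := p0 / 2 ^+ N in hN.
have side x y : V x -> V y -> nrm (x - z) <= 2 * p -> nrm (y - z) <= 2 * p ->
    nrm (seg x y - (y - x) *: (f z + ((x + y) / 2 - z) *: v)) <= e * (2 * p) * nrm (y - x).
  move=> Vx Vy hx hy; apply: is_seg_close (segP Vx Vy) (is_seg_affine _ _ _ _ _) _.
  move=> t t01; set w := x + _.
  have hw : nrm (w - z) <= 2 * p.
    have -> : w - z = (1 - t)%:C * (x - z) + t%:C * (y - z) by rewrite /w rmorphB /=; ring.
    apply: le_trans (ler_nrmD _ _) _; rewrite !nrmM !nrmC !ger0_norm; [|lra|lra].
    have : (1 - t) * nrm (x - z) <= (1 - t) * (2 * p) by rewrite ler_wpM2l //; lra.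
    have : t * nrm (y - z) <= t * (2 * p) by rewrite ler_wpM2l //; lra.
    lra.
  have Vw : V w by exact: Vconv.
  have := H w Vw ltac:(simpl; lra); rewrite opprD addrA => /le_trans; apply.
  by rewrite ler_wpM2l ?(ltW e0).
move: (uper N) (uV N) (zdist N); case: (u N) => [[x y] t] /= hper [Vx Vy Vt] hx.
have py : 0 <= p by exact: pn.
have hy : nrm (y - z) <= 2 * p.
  have := nrm_tri x y z; have := nrm_ge0 (t - y); have := nrm_ge0 (x - t).
  rewrite /= in hx hper *; rewrite -/p in hx hper; lra.
have ht : nrm (t - z) <= 2 * p.
  have := nrm_tri x t z; have := nrm_ge0 (t - y); have := nrm_ge0 (y - x).
  rewrite /= in hx hper *; rewrite -/p in hx hper; rewrite (nrmB t x); lra.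
have hx' : nrm (x - z) <= 2 * p by rewrite -/p in hx; lra.
have s1 := side _ _ Vx Vy hx' hy; have s2 := side _ _ Vy Vt hy ht; have s3 := side _ _ Vt Vx ht hx'.
have : nrm (seg x y + seg y t + seg t x) <= e * (2 * p) * p.
  set A := _ - _ in s1; set B := _ - _ in s2; set C := _ - _ in s3.
  have -> : seg x y + seg y t + seg t x = A + B + C.
    by rewrite /A /B /C; modring R[i]; field.
  have := ler_nrmD (A + B) C; have := ler_nrmD A B.
  have : e * (2 * p) * (nrm (y - x) + nrm (t - y) + nrm (x - t)) = e * (2 * p) * p by rewrite hper.
  rewrite !mulrDr; lra.
move=> h; apply: le_trans (_ : e * (2 * p) * p * 4 ^+ N <= _).
  by rewrite ler_wpM2r ?exprn_ge0.
have -> : (4 : R) ^+ N = 2 ^+ N * 2 ^+ N by rewrite -exprMn; congr (_ ^+ _); ring.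
rewrite /p le_eqVlt; apply/orP; left; apply/eqP; field.
by rewrite expf_neq0.
Qed.

Lemma primitive_ex : exists P, forall z, V z -> der id V P z (f z).
Proof.
have [[z0 Vz0]|nV] := pselect (exists z0, V z0); last first.
  by exists f => z Vz; case: nV; exists z.
exists (seg z0) => z Vz e e0.
have [d d0 H] := fcont Vz e0.
exists d => // s Vs sd.
have -> : seg z0 s - seg z0 z = seg z s.
  have := goursat Vz0 Vz Vs; rewrite (seg_rev Vz0 Vs) => h.
  have -> : seg z0 s = (seg z0 z + seg z s - seg z0 s) + seg z0 s by rewrite h add0r.
  modring R[i].
have := is_seg_affine (f z) 0 z z s; rewrite scaler0 addr0 => haff.
apply: is_seg_close (segP Vz Vs) haff _ => t t01.
rewrite scaler0 addr0; apply: H; first exact: Vconv.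
rewrite addrAC subrr add0r nrmM nrmC ger0_norm; last lra.
apply: le_lt_trans sd; rewrite ler_piMl ?nrm_ge0 //; lra.
Qed.

End Goursat.

(** * Contour integrals on strips *)

Section Contour.
Context {R : realType} {E : normedModType R[i]}.
Hypothesis Ec : seq_complete E.
Local Notation rc := (real_complex R).
Implicit Types (g G h : R[i] -> E) (w z : R[i]) (th x y : R).

Definition strip th : set R[i] := [set w | `|complex.Im w| <= th].

Lemma strip_convex th : cconvex (strip th).
Proof.
move=> [a1 a2] [b1 b2] t; rewrite /strip /= !ler_norml => h1 h2 h3.
by rewrite mul0r addr0; nra.
Qed.

Lemma strip_closed th : cclosed (strip th).
Proof.
move=> z h; rewrite /strip /=; apply/ler_addgt0Pl => e /h[y hy hyz].
have := ler_nrm_Im (y - z); case: y z hy hyz {h} => [a b] [c d] /=; rewrite /strip /=.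
by rewrite !ler_norml; lra.
Qed.

Lemma strip_sub th th' : th <= th' -> strip th `<=` strip th'.
Proof. by move=> h w /= hw; exact: le_trans hw h. Qed.

Definition lim_infty (F : R -> E) (l : E) : Prop :=
  forall e : R, 0 < e -> exists X : R, forall x, X <= x -> nrm (F x - l) <= e.

Definition is_prim th g G : Prop :=
  forall w, strip th w -> der id (strip th) G w (g w).

(* The integral of g over the boundary of a half-strip, from +oo - i th to +oo + i th,
   expressed by a primitive of g. *)
Definition is_contour th g (v : E) : Prop := exists G, is_prim th g G /\
  exists l1 l2, [/\ lim_infty (fun x => G (x +i* th)) l1,
                    lim_infty (fun x => G (x -i* th)) l2 & v = l1 - l2].

Lemma der_hpath (D : set R) y x : der rc D (fun t : R => t +i* y : R[i]^o) x (1 : R[i]^o).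
Proof.
move=> e e0; exists 1 => // s _ _.
rewrite (_ : _ - _ - _ = 0) ?nrm0 ?mulr_ge0 ?nrm_ge0 ?(ltW e0) //.
by rewrite regE; apply/eqP; rewrite eq_complex /=; apply/andP; split; apply/eqP; ring.
Qed.

Lemma der_vpath (D : set R) x y : der rc D (fun t : R => x +i* t : R[i]^o) y ('i%C : R[i]^o).
Proof.
move=> e e0; exists 1 => // s _ _.
rewrite (_ : _ - _ - _ = 0) ?nrm0 ?mulr_ge0 ?nrm_ge0 ?(ltW e0) //.
by rewrite regE; apply/eqP; rewrite eq_complex /=; apply/andP; split; apply/eqP; ring.
Qed.

Lemma prim_hline th g G x y : is_prim th g G -> `|y| <= th ->
  der rc setT (fun t : R => G (t +i* y)) x (g (x +i* y)).
Proof.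
move=> hG hy; have := der_comp (i' := id) (D' := strip th) _ (der_hpath setT y x) (hG (x +i* y) hy).
by rewrite scale1r; apply => s _.
Qed.

Lemma prim_vline th g G x y : is_prim th g G -> `|y| <= th ->
  der rc `[- th, th] (fun t : R => G (x +i* t)) y ('i%C *: g (x +i* y)).
Proof.
move=> hG hy; have := der_comp (i' := id) (D' := strip th) _ (der_vpath `[-th, th] x y) (hG (x +i* y) hy).
by apply => s; rewrite /= in_itv /strip /= ler_norml.
Qed.

Lemma prim_ray_le th g G (x1 x2 y N : R) : is_prim th g G -> `|y| <= th -> x1 <= x2 ->
  (forall x, x1 <= x -> nrm (g (x +i* y)) <= N * expR (- x)) ->
  nrm (G (x2 +i* y) - G (x1 +i* y)) <= N * expR (- x1) - N * expR (- x2).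
Proof.
move=> hG hy x12 hN.
have -> : N * expR (- x1) - N * expR (- x2) =
   - N * expR (- x2) - - N * expR (- x1) by ring.
apply: (@mvt R E (fun x => G (x +i* y)) (fun x => g (x +i* y)) (fun x => - N * expR (- x))
  (fun x => N * expR (- x)) setT) => //.
- by move=> c _; exact: prim_hline hG hy.
- move=> c _; apply: is_derive_der; apply: is_derive_eq.
  by rewrite /GRing.scale /=; ring.
- by move=> c /andP[xc _]; exact: hN.
Qed.

Lemma prim_vert_le th g G (x y1 y2 N : R) : is_prim th g G -> `|y1| <= th ->
  `|y2| <= th -> y1 <= y2 ->
  (forall y, y1 <= y <= y2 -> nrm (g (x +i* y)) <= N) ->
  nrm (G (x +i* y2) - G (x +i* y1)) <= N * (y2 - y1).
Proof.
rewrite !ler_norml => hG h1 h2 y12 hN.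
apply: (@mvt_cst R E (fun y => G (x +i* y)) (fun y => 'i%C *: g (x +i* y)) N `[-th, th]) => //.
- by move=> c cy; rewrite /= in_itv /=; lra.
- by move=> c cy; apply: prim_vline hG _; rewrite ler_norml; lra.
- by move=> c cy; rewrite nrmZ nrm_i mul1r hN.
Qed.

Lemma expRN_small (N e : R) : 0 <= N -> 0 < e -> exists X : R, 0 <= X /\
  forall x, X <= x -> N * expR (- x) <= e.
Proof.
move=> N0 e0; exists (N / e); split=> [|x hx]; first by rewrite divr_ge0 // ltW.
rewrite expRN ler_pdivrMr ?expR_gt0 // mulrC -ler_pdivrMr //.
by apply: (le_trans hx); apply: (le_trans _ (expR_ge1Dx x)); lra.
Qed.

(** Completeness is sequential: the limit is taken along the integers, and the tail bound [K]
    extends it to all real [x]. *)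
Lemma ray_lim th g G (x1 y N : R) : is_prim th g G -> `|y| <= th ->
  (forall x, x1 <= x -> nrm (g (x +i* y)) <= N * expR (- x)) ->
  exists l, lim_infty (fun x => G (x +i* y)) l.
Proof.
move=> hG hy hN.
have N0 : 0 <= N.
  by have := le_trans (nrm_ge0 _) (hN x1 (lexx _)); rewrite pmulr_lge0 // expR_gt0.
have K x x' : x1 <= x -> x <= x' -> nrm (G (x' +i* y) - G (x +i* y)) <= N * expR (- x).
  move=> h1 h2; have := prim_ray_le hG hy h2 (fun t ht => hN t (le_trans h1 ht)).
  have : 0 <= N * expR (- x') by rewrite mulr_ge0 ?expR_ge0.
  lra.
have natbig (X : R) : exists n : nat, X <= n%:R.
  by exists (Num.bound `|X|); rewrite (le_trans (ler_norm _)) // ltW // archi_boundP.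
have [|l hl] := Ec (u := fun n => G (n%:R +i* y)).
  move=> e e0; have e2 : 0 < e / 2 by rewrite divr_gt0.
  have [X [X0 hX]] := expRN_small N0 e2; have [n hn] := natbig (Num.max X x1).
  move: hn; rewrite ge_max => /andP[nX nx1].
  exists n => m k nm nk.
  have h1 := K n%:R m%:R nx1 ltac:(by rewrite ler_nat).
  have h2 := K n%:R k%:R nx1 ltac:(by rewrite ler_nat).
  have := hX _ nX.
  have := nrm_tri (G (n%:R +i* y)) (G (m%:R +i* y)) (G (k%:R +i* y)).
  rewrite (nrmB (G (n%:R +i* y))); lra.
exists l => e e0; have e2 : 0 < e / 2 by rewrite divr_gt0.
have [X [X0 hX]] := expRN_small N0 e2; have [n hn] := hl _ e2.
exists (Num.max X x1) => x; rewrite ge_max => /andP[h1 h2].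
have [m hm] := natbig x.
have hm' : x <= (maxn n m)%:R by apply: le_trans hm _; rewrite ler_nat leq_maxr.
have := hn (maxn n m) (leq_maxl _ _); have := K x _ h2 hm'; have := hX x h1.
have := nrm_tri (G ((maxn n m)%:R +i* y)) (G (x +i* y)) l.
rewrite (nrmB (G (x +i* y)) (G ((maxn n m)%:R +i* y))); lra.
Qed.

Lemma lim_infty_le (F : R -> E) l (a : E) (X B : R) : lim_infty F l ->
  (forall x, X <= x -> nrm (F x - a) <= B) -> nrm (l - a) <= B.
Proof.
move=> hl hB; apply/ler_addgt0Pl => e /hl[X' hX'].
have := hX' (Num.max X X') ltac:(by rewrite le_max lexx orbT).
have := hB (Num.max X X') ltac:(by rewrite le_max lexx).
have := nrm_tri (F (Num.max X X')) l a; rewrite (nrmB l (F _)); lra.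
Qed.

Lemma lim_infty_uniq (F : R -> E) l l' : lim_infty F l -> lim_infty F l' -> l = l'.
Proof.
move=> hl hl'; apply/eqP; rewrite -subr_eq0; apply/eqP.
apply: (@nrm_le_eps _ _ _ 1) => e e0; rewrite mulr1.
by have [X hX] := hl' _ e0; apply: lim_infty_le hl hX.
Qed.

Lemma lim_inftyB (F F' : R -> E) l l' : lim_infty F l -> lim_infty F' l' ->
  lim_infty (fun x => F x - F' x) (l - l').
Proof.
move=> hl hl' e e0; have e2 : 0 < e / 2 by rewrite divr_gt0.
have [X hX] := hl _ e2; have [X' hX'] := hl' _ e2.
exists (Num.max X X') => x; rewrite ge_max => /andP[/hX h1 /hX' h2].
have := ler_nrmB (F x - l) (F' x - l').
have -> : F x - l - (F' x - l') = F x - F' x - (l - l') by modring R[i].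
lra.
Qed.

Lemma lim_inftyZD (c : R[i]) (F F' : R -> E) l l' : lim_infty F l -> lim_infty F' l' ->
  lim_infty (fun x => c *: F x + F' x) (c *: l + l').
Proof.
move=> hl hl' e e0; have e2 : 0 < e / 2 by rewrite divr_gt0.
have c0 : 0 < nrm c + 1 by rewrite ltr_wpDl ?nrm_ge0.
have [X hX] := hl _ (divr_gt0 e2 c0); have [X' hX'] := hl' _ e2.
exists (Num.max X X') => x; rewrite ge_max => /andP[/hX h1 /hX' h2].
have := ler_nrmD (c *: (F x - l)) (F' x - l').
have -> : c *: (F x - l) + (F' x - l') = c *: F x + F' x - (c *: l + l') by modring R[i].
rewrite nrmZ => h; apply: (le_trans h); rewrite [e]splitr lerD //.
move: h1; rewrite ler_pdivlMr // mulrC; apply: le_trans.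
by rewrite ler_wpM2r ?nrm_ge0 // lerDl.
Qed.

Lemma lim_infty_near (F F' : R -> E) l : lim_infty F l ->
  (forall e : R, 0 < e -> exists X : R, forall x, X <= x -> nrm (F' x - F x) <= e) ->
  lim_infty F' l.
Proof.
move=> hl h e e0; have e2 : 0 < e / 2 by rewrite divr_gt0.
have [X hX] := hl _ e2; have [X' hX'] := h _ e2.
exists (Num.max X X') => x; rewrite ge_max => /andP[/hX h1 /hX' h2].
by have := nrm_tri (F x) (F' x) l; lra.
Qed.

Lemma th_in th : 0 <= th -> `|th| <= th.
Proof. by move=> h; rewrite ger0_norm. Qed.
Lemma thN_in th : 0 <= th -> `|- th| <= th.
Proof. by move=> h; rewrite normrN ger0_norm. Qed.

Lemma strip_prim_ex th g : (forall w, strip th w -> exists v, der id (strip th) g w v) ->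
  exists G, is_prim th g G.
Proof.
move=> hg; apply: primitive_ex => //.
- exact: strip_convex.
- exact: strip_closed.
- by move=> z Vz; have [v hv] := hg z Vz; exact: der_cont hv.
Qed.

Lemma contour_ex th g (x1 N : R) : 0 <= th ->
  (forall w, strip th w -> exists v, der id (strip th) g w v) ->
  (forall x, x1 <= x -> nrm (g (x +i* th)) <= N * expR (- x)) ->
  (forall x, x1 <= x -> nrm (g (x -i* th)) <= N * expR (- x)) ->
  exists v, is_contour th g v.
Proof.
move=> th0 /strip_prim_ex[G hG] h1 h2.
have [l1 hl1] := ray_lim hG (th_in th0) h1.
have [l2 hl2] := ray_lim hG (thN_in th0) h2.
by exists (l1 - l2), G; split => //; exists l1, l2.
Qed.

(** The primitive lives on the whole strip, so the two rays may be started at any abscissa [x1] and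
    joined by a vertical segment of length [2 * th]. The freedom in [x1] is what makes the later
    estimates uniform in |z|. *)
Lemma contour_bound th g v (x1 N N' : R) : 0 <= th -> is_contour th g v ->
  (forall x, x1 <= x -> nrm (g (x +i* th)) <= N * expR (- x)) ->
  (forall x, x1 <= x -> nrm (g (x -i* th)) <= N * expR (- x)) ->
  (forall y, `|y| <= th -> nrm (g (x1 +i* y)) <= N') ->
  nrm v <= 2 * N * expR (- x1) + 2 * th * N'.
Proof.
move=> th0 [G [hG [l1 [l2 [hl1 hl2 ->]]]]] h1 h2 h3.
have N0 : 0 <= N.
  by have := le_trans (nrm_ge0 _) (h1 x1 (lexx _)); rewrite pmulr_lge0 // expR_gt0.
have hx x : 0 <= N * expR (- x) by rewrite mulr_ge0 ?expR_ge0.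
have k1 : nrm (l1 - G (x1 +i* th)) <= N * expR (- x1).
  apply: (lim_infty_le (X := x1) hl1) => x hx1.
  by have := prim_ray_le hG (th_in th0) hx1 h1; have := hx x; lra.
have k2 : nrm (l2 - G (x1 -i* th)) <= N * expR (- x1).
  apply: (lim_infty_le (X := x1) hl2) => x hx1.
  by have := prim_ray_le hG (thN_in th0) hx1 h2; have := hx x; lra.
have k3 : nrm (G (x1 +i* th) - G (x1 -i* th)) <= N' * (th - - th).
  apply: prim_vert_le hG (thN_in th0) (th_in th0) _ _; first lra.
  by move=> y hy; apply: h3; rewrite ler_norml.
have -> : l1 - l2 = (l1 - G (x1 +i* th)) - (l2 - G (x1 -i* th)) + (G (x1 +i* th) - G (x1 -i* th)).
  by modring R[i].
have := ler_nrmD ((l1 - G (x1 +i* th)) - (l2 - G (x1 -i* th))) (G (x1 +i* th) - G (x1 -i* th)).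
have := ler_nrmB (l1 - G (x1 +i* th)) (l2 - G (x1 -i* th)); lra.
Qed.

Lemma contourZD th g g' v v' (c : R[i]) : is_contour th g v -> is_contour th g' v' ->
  is_contour th (fun w => c *: g w + g' w) (c *: v + v').
Proof.
move=> [G [hG [l1 [l2 [hl1 hl2 ->]]]]] [G' [hG' [l1' [l2' [hl1' hl2' ->]]]]].
exists (fun w => c *: G w + G' w); split.
  by move=> w sw; apply: derD; [apply: derZ; exact: hG|exact: hG'].
exists (c *: l1 + l1'), (c *: l2 + l2'); split; [exact: lim_inftyZD|exact: lim_inftyZD|].
by modring R[i].
Qed.

Lemma contour_ext th g g' v : (forall w, strip th w -> g w = g' w) ->
  is_contour th g v -> is_contour th g' v.
Proof.
by move=> gg [G [hG H]]; exists G; split => // w sw; rewrite -gg //; exact: hG.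
Qed.

Lemma contour0 th v : 0 <= th -> is_contour th (fun=> 0) v -> v = 0.
Proof.
move=> th0 /(contour_bound (x1 := 0) (N := 0) (N' := 0) th0) h.
apply: nrm_eq0; apply/eqP; rewrite eq_le nrm_ge0 andbT.
apply: le_trans (h _ _ _) _; rewrite ?mulr0 ?mul0r ?addr0 // => *; by rewrite nrm0 ?mul0r.
Qed.

Lemma contour_uniq th g v v' : 0 <= th -> is_contour th g v -> is_contour th g v' -> v = v'.
Proof.
move=> th0 h h'; have := contourZD (-1) h h'.
move=> /(contour_ext (g' := fun=> 0)) H.
have {}H := contour0 th0 (H _).
have {H} : -1 *: v + v' = 0 by apply: H => w _; rewrite scaleN1r addNr.
by rewrite scaleN1r addrC => /subr0_eq.
Qed.

(** Between the heights [phi x] and [th] the integrand is at most [N * expR (- x)] on segments of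
    bounded length, so the ends of the contour may slide along them. A suitable [phi] leaves only
    the arc in a half-plane where relations for [q] hold. *)
Lemma contour_arcs th g v (phi : R -> R) (x1 N : R) : is_contour th g v ->
  (forall x, 0 <= phi x <= th) ->
  (forall x y, x1 <= x -> phi x <= `|y| -> `|y| <= th -> nrm (g (x +i* y)) <= N * expR (- x)) ->
  exists G, is_prim th g G /\
    lim_infty (fun x => G (x +i* phi x) - G (x -i* phi x)) v.
Proof.
move=> [G [hG [l1 [l2 [hl1 hl2 ->]]]]] hphi hN; exists G; split => //.
have th0 : 0 <= th by have := hphi 0; lra.
have N0 : 0 <= N.
  have := hphi x1 => hp; have := le_trans (nrm_ge0 _) (hN x1 th (lexx _) _ (th_in th0)).
  rewrite ger0_norm // => h; have := h ltac:(lra); by rewrite pmulr_lge0 // expR_gt0.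
have small (e : R) : 0 < e -> exists X, forall x, X <= x -> x1 <= x /\ N * expR (- x) * (th + th) <= e.
  move=> e0; have T0 : 0 <= N * (th + th) by rewrite mulr_ge0 //; lra.
  have [X [_ hX]] := expRN_small T0 e0; exists (Num.max X x1) => x.
  by rewrite ge_max => /andP[/hX h ->]; split => //; rewrite mulrAC.
apply: lim_inftyB.
  apply: lim_infty_near hl1 _ => e /small[X hX]; exists X => x /hX[h1 h2].
  have hp := hphi x; apply: le_trans h2; rewrite nrmB.
  apply: le_trans (prim_vert_le (N := N * expR (- x)) hG _ (th_in th0) _ _) _.
  - by rewrite ger0_norm; lra.
  - lra.
  - by move=> y hy; apply: hN => //; rewrite ger0_norm; lra.
  - by rewrite ler_wpM2l ?mulr_ge0 ?expR_ge0 //; lra.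
apply: lim_infty_near hl2 _ => e /small[X hX]; exists X => x /hX[h1 h2].
have hp := hphi x; apply: le_trans h2.
apply: le_trans (prim_vert_le (N := N * expR (- x)) hG (thN_in th0) _ _ _) _.
- by rewrite normrN ger0_norm; lra.
- lra.
- by move=> y hy; apply: hN => //; rewrite ler0_norm; lra.
- by rewrite ler_wpM2l ?mulr_ge0 ?expR_ge0 //; lra.
Qed.

(** Sliding the ends down to the constant height [th] expresses [v] through a primitive on the wider
    strip; on the narrower one it differs by a constant from any other primitive. *)
Lemma contour_indep th th' g v (x1 N : R) : 0 <= th <= th' -> is_contour th' g v ->
  (forall x y, x1 <= x -> th <= `|y| -> `|y| <= th' -> nrm (g (x +i* y)) <= N * expR (- x)) ->
  (exists v', is_contour th g v') -> is_contour th g v.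
Proof.
move=> tt hc hN [v' hv'].
have [G [hG hl]] := contour_arcs (phi := fun=> th) hc (fun _ => tt) hN.
case: (hv') => [G' [hG' [l1 [l2 [hl1 hl2 E']]]]].
have : lim_infty (fun x => G (x +i* th) - G (x -i* th)) v'.
  rewrite E'; apply: lim_infty_near (lim_inftyB hl1 hl2) _ => e e0; exists 0 => x _.
  rewrite (_ : _ - _ - _ = 0) ?nrm0 ?(ltW e0) //.
  have Hd := @prim_vert_le th (fun w => 0) (fun w => G w - G' w) x (- th) th 0.
  apply: nrm_eq0; apply/eqP; rewrite eq_le nrm_ge0 andbT.
  have th0 : 0 <= th by lra.
  apply: le_trans (_ : nrm (G (x +i* th) - G' (x +i* th) - (G (x -i* th) - G' (x -i* th))) <= _).
    by rewrite le_eqVlt; apply/orP; left; apply/eqP; congr nrm; modring R[i].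
  rewrite -(mul0r (th - - th)); apply: Hd; rewrite ?thN_in ?th_in //; last 2 first.
  - lra.
  - by move=> y _; rewrite nrm0.
  move=> w sw; rewrite -(subrr (g w)); apply: derB; last exact: hG'.
  apply: der_sub (hG w _); apply: strip_sub; first lra.
  by case/andP: tt.
  by apply: strip_sub sw; case/andP: tt.
by move=> /(lim_infty_uniq hl) ->.
Qed.

End Contour.

(** * Contour integrals with the kernel e^{z e^w} *)

Section Kernel.
Context {R : realType} {E : normedModType R[i]}.
Hypothesis Ec : seq_complete E.
Local Notation rc := (real_complex R).
Implicit Types (h : R[i] -> E) (w z : R[i]) (th x y k : R).

Definition dir y : R[i] := cos y +i* sin y.
Definition kern z w : R[i] := cexp (z * cexp w).
(** Re (z e^{i y}) <= - k makes the kernel at most exp (- k e^x) on the ray of height y. Only the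
    two edges of the strip are asked for, since inside it the kernel may grow. *)
Definition decay th k z : Prop :=
  complex.Re (z * dir th) <= - k /\ complex.Re (z * dir (- th)) <= - k.

Lemma cexp_polar x y : cexp (x +i* y) = (expR x)%:C * dir y.
Proof. by []. Qed.

Lemma nrm_dir y : nrm (dir y) = 1.
Proof. by rewrite /dir /nrm normc_def /= cos2Dsin2 sqrtr1. Qed.

Lemma nrm_cexpP x y : nrm (cexp (x +i* y)) = expR x.
Proof. by rewrite nrm_cexp. Qed.

Lemma ReM_real (r : R) z : complex.Re (r%:C * z) = r * complex.Re z.
Proof. by case: z => a b; rewrite /= mul0r subr0. Qed.

Lemma nrm_kern z x y : nrm (kern z (x +i* y)) = expR (expR x * complex.Re (z * dir y)).
Proof. by rewrite /kern nrm_cexp cexp_polar mulrCA ReM_real. Qed.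

Lemma kern_ray z x y k : complex.Re (z * dir y) <= - k ->
  nrm (kern z (x +i* y)) <= expR (- (k * expR x)).
Proof.
by move=> hz; rewrite nrm_kern ler_expR mulrC -mulNr ler_wpM2r ?expR_ge0.
Qed.

Lemma kern_le z x y : nrm (kern z (x +i* y)) <= expR (nrm z * expR x).
Proof.
by apply: le_trans (nrm_cexp_le _) _; rewrite ler_expR nrmM nrm_cexpP.
Qed.

(** From u^{m+1} <= (m+1)! e^u with u = k e^x: one power more than the given [m] is spent, and it
    becomes the factor [expR (- x)] that the contour lemmas expect. *)
Lemma exp_poly k x m : 0 < k -> expR (- (k * expR x)) * expR x ^+ m <=
  (m.+1)`!%:R / k ^+ m.+1 * expR (- x).
Proof.
move=> k0; have ex := expR_gt0 x; have u0 : 0 <= k * expR x by rewrite mulr_ge0 ?ltW.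
have := @expR_ge1Dxn R _ m u0; set u := k * expR x => h.
have f0 : 0 < (m.+1)`!%:R :> R by rewrite ltr0n fact_gt0.
have {}h : u ^+ m.+1 <= (m.+1)`!%:R * expR u.
  rewrite mulrC -ler_pdivrMr //; apply: le_trans h; rewrite -[X in X <= _]add0r lerD //.
rewrite !expRN -[X in _ <= X]mulrA -invfM ler_pdivlMr ?mulr_gt0 ?exprn_gt0 //.
rewrite -[X in X <= _]mulrA ler_pdivrMl ?expR_gt0 //.
have -> : expR x ^+ m * (k ^+ m.+1 * expR x) = u ^+ m.+1.
  by rewrite /u exprMn !exprS; ring.
by rewrite mulrC.
Qed.

Lemma decay_add th k z (s : R[i]) : decay th k z -> decay th (k - nrm s) (z + s).
Proof.
have H y : complex.Re (z * dir y) <= - k -> complex.Re ((z + s) * dir y) <= - (k - nrm s).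
  move=> h; rewrite mulrDl; have := ler_nrm_Re (s * dir y); rewrite nrmM nrm_dir mulr1.
  case: (z * dir y) h (s * dir y) => a b /= h [c d] /=; rewrite ler_norml; lra.
by move=> [h1 h2]; split; exact: H.
Qed.

(** The [z] for which the kernel decays on both edges; for [th = pi / 2 + g] this is the sector of
    half-angle [g], see [sector_sectorial] and [sectorial_sector]. *)
Definition sectorial th : set R[i] := [set z |
  complex.Re (z * dir th) < 0 /\ complex.Re (z * dir (- th)) < 0].

Lemma sectorial_decay th z : sectorial th z -> exists2 k, 0 < k & decay th k z.
Proof.
move=> [h1 h2]; exists (- Num.max (complex.Re (z * dir th)) (complex.Re (z * dir (- th)))).
  by rewrite oppr_gt0 gt_max h1.
by split; rewrite opprK le_max lexx ?orbT.
Qed.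

Lemma decay_sectorial th k z : 0 < k -> decay th k z -> sectorial th z.
Proof. by move=> k0 [h1 h2]; split; lra. Qed.

Definition cdiff_on (V : set R[i]) h : Prop := forall w, V w -> exists v, der id V h w v.

(* With l = e^w this is the integral of e^{z l} h(ln l) dl / l. *)
Definition is_lap th z h v : Prop := is_contour th (fun w => kern z w *: h w) v.

Lemma der_kern (V : set R[i]) z w :
  der id V (kern z : R[i] -> R[i]^o) w (z * cexp w * kern z w).
Proof. by apply: der_cexp; exact: derZ (cder_cexp V w). Qed.

Lemma cdiff_scale (V : set R[i]) (f : R[i] -> R[i]^o) h :
  (forall w, V w -> exists v : R[i]^o, der id V f w v) -> cdiff_on V h ->
  cdiff_on V (fun w => f w *: h w).
Proof.
by move=> hf hh w Vw; have [a ha] := hf w Vw; have [v hv] := hh w Vw;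
  exists (a *: h w + f w *: v); exact: derS.
Qed.

Lemma cdiff_kern th z h : cdiff_on (strip th) h ->
  cdiff_on (strip th) (fun w => kern z w *: h w).
Proof. by apply: cdiff_scale => w _; exists (z * cexp w * kern z w); exact: der_kern. Qed.

Lemma cdiff_cexp (V : set R[i]) h : cdiff_on V h -> cdiff_on V (fun w => cexp w *: h w).
Proof. by apply: cdiff_scale => w _; exists (cexp w); exact: cder_cexp. Qed.

Lemma in_strip th x y : `|y| <= th -> strip th (x +i* y).
Proof. by []. Qed.

Section LapBound.
Variables (th k : R) (z : R[i]) (h : R[i] -> E) (m : nat) (x1 M : R).
Hypotheses (th0 : 0 <= th) (k0 : 0 < k) (hz : decay th k z) (M0 : 0 <= M).
Hypothesis hM : forall w, strip th w -> x1 <= complex.Re w ->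
  nrm (h w) <= M * expR (complex.Re w) ^+ m.

Lemma lap_ray y x : `|y| <= th -> complex.Re (z * dir y) <= - k -> x1 <= x ->
  nrm (kern z (x +i* y) *: h (x +i* y)) <=
  M * ((m.+1)`!%:R / k ^+ m.+1) * expR (- x).
Proof.
move=> hy hk hx; rewrite nrmZ.
apply: le_trans (_ : expR (- (k * expR x)) * (M * expR x ^+ m) <= _).
  by apply: ler_pM; rewrite ?nrm_ge0 ?kern_ray //; exact: hM.
by rewrite mulrCA -mulrA ler_wpM2l // exp_poly.
Qed.

Lemma lap_ex : cdiff_on (strip th) h -> exists v, is_lap th z h v.
Proof.
move=> hd; apply: (contour_ex Ec (x1 := x1) (N := M * ((m.+1)`!%:R / k ^+ m.+1))) => //.
- exact: cdiff_kern.
- by move=> x hx; apply: lap_ray; rewrite ?th_in //; case: hz.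
- by move=> x hx; apply: lap_ray; rewrite ?thN_in //; case: hz.
Qed.

Lemma lap_bound v : is_lap th z h v ->
  nrm v <= 2 * (M * ((m.+1)`!%:R / k ^+ m.+1)) * expR (- x1) +
           2 * th * (expR (nrm z * expR x1) * (M * expR x1 ^+ m)).
Proof.
move=> hv; apply: (contour_bound th0 hv).
- by move=> x hx; apply: lap_ray; rewrite ?th_in //; case: hz.
- by move=> x hx; apply: lap_ray; rewrite ?thN_in //; case: hz.
- move=> y hy; rewrite nrmZ; apply: ler_pM; rewrite ?nrm_ge0 ?kern_le //.
  exact: (hM (in_strip _ hy)).
Qed.

End LapBound.

Lemma lapZD th z h h' v v' (c : R[i]) : is_lap th z h v -> is_lap th z h' v' ->
  is_lap th z (fun w => c *: h w + h' w) (c *: v + v').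
Proof.
move=> hv hv'; apply: contour_ext (contourZD c hv hv') => w _.
by modring R[i].
Qed.

Lemma lap_ext th z h h' v : (forall w, strip th w -> h w = h' w) ->
  is_lap th z h v -> is_lap th z h' v.
Proof. by move=> hh; apply: contour_ext => w /hh ->. Qed.

(** Apart from [kern z w] and [h w], the remainder has the integrand e^{s mu} - 1 - s mu with mu =
    e^w, at most |s|^2 |mu|^2 e^{|s| |mu|}: half of the rate [k] absorbs the exponential and two
    powers are lost, whence [m.+3]. The bound is proportional to [M], so with [M] a multiple of |x|
    it controls the operator norm in [contour_value_quad]. *)
Lemma lap_deriv th k z (s : R[i]) h (m : nat) (M : R) v v1 v' : 0 <= th -> 0 < k ->
  decay th k z -> 0 <= M -> nrm s <= k / 2 ->
  (forall w, strip th w -> 0 <= complex.Re w -> nrm (h w) <= M * expR (complex.Re w) ^+ m) ->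
  is_lap th z h v -> is_lap th z (fun w => cexp w *: h w) v1 ->
  is_lap th (z + s) h v' ->
  nrm (v' - v - s *: v1) <= M * (2 * ((m.+3)`!%:R / (k / 2) ^+ m.+3) +
     2 * th * (expR (nrm z) * expR k)) * nrm s ^+ 2.
Proof.
move=> th0 k0 hz M0 hs hM hv hv1 hv'.
have k2 : 0 < k / 2 by rewrite divr_gt0.
have H : is_contour th (fun w => kern z w *: ((cexp (s * cexp w) - 1 - s * cexp w) *: h w))
    (v' - v - s *: v1).
  have := contourZD (-1) hv (contourZD (- s) hv1 hv').
  rewrite (_ : -1 *: v + _ = v' - v - s *: v1); last by modring R[i].
  apply: contour_ext => w _; rewrite [in kern (z + s)]/kern mulrDl cexpD -/(kern z w).
  by modring R[i].
have err w : strip th w -> 0 <= complex.Re w -> nrm ((cexp (s * cexp w) - 1 - s * cexp w) *: h w)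
   <= expR (nrm s * expR (complex.Re w)) * (M * nrm s ^+ 2 * expR (complex.Re w) ^+ m.+2).
  move=> sw w0; rewrite nrmZ.
  apply: le_trans (ler_pM _ _ (cexp_sub2 _) (hM w sw w0)) _; rewrite ?nrm_ge0 //.
  by rewrite nrmM nrm_cexp le_eqVlt; apply/orP; left; apply/eqP; rewrite !exprS; ring.
have Ms0 : 0 <= M * nrm s ^+ 2 by rewrite mulr_ge0 // exprn_ge0 // nrm_ge0.
have ray y : `|y| <= th -> complex.Re (z * dir y) <= - k -> forall x, 0 <= x ->
  nrm (kern z (x +i* y) *: ((cexp (s * cexp (x +i* y)) - 1 - s * cexp (x +i* y)) *: h (x +i* y)))
  <= M * nrm s ^+ 2 * ((m.+3)`!%:R / (k / 2) ^+ m.+3) * expR (- x).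
  move=> hy hk x x0; rewrite nrmZ.
  apply: le_trans (ler_pM _ _ (kern_ray x hk) (err _ (in_strip x hy) x0)) _; rewrite ?nrm_ge0 //=.
  rewrite [X in X <= _]mulrA -expRD.
  apply: le_trans (_ : expR (- (k / 2 * expR x)) * (M * nrm s ^+ 2 * expR x ^+ m.+2) <= _).
    rewrite ler_wpM2r //; first by rewrite mulr_ge0 // exprn_ge0 // expR_ge0.
    by rewrite ler_expR; have := expR_gt0 x; nra.
  by rewrite mulrCA -[X in _ <= X]mulrA ler_wpM2l // exp_poly.
have [hz1 hz2] := hz.
have := contour_bound (x1 := 0) th0 H (ray _ (th_in th0) hz1) (ray _ (thN_in th0) hz2)
  (N' := expR (nrm z) * (expR k * (M * nrm s ^+ 2))).
move=> /(_ _)/le_trans; apply.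
  move=> y hy; rewrite nrmZ; apply: ler_pM; rewrite ?nrm_ge0 //.
    by have := kern_le z 0 y; rewrite expR0 mulr1.
  apply: le_trans (err _ (in_strip 0 hy) (lexx _)) _; rewrite /= expR0 expr1n !mulr1.
  by rewrite ler_wpM2r // ler_expR; lra.
rewrite oppr0 expR0 mulr1 le_eqVlt; apply/orP; left; apply/eqP; ring.
Qed.

Lemma lap_der th h (m : nat) (M : R) (F : R[i] -> E) z v1 : 0 <= th -> 0 <= M ->
  (forall w, strip th w -> 0 <= complex.Re w -> nrm (h w) <= M * expR (complex.Re w) ^+ m) ->
  (forall s, sectorial th s -> is_lap th s h (F s)) ->
  sectorial th z -> is_lap th z (fun w => cexp w *: h w) v1 ->
  der id (sectorial th) F z v1.
Proof.
move=> th0 M0 hM hF hz hv1; have [k k0 hk] := sectorial_decay hz.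
set C := M * (2 * ((m.+3)`!%:R / (k / 2) ^+ m.+3) + 2 * th * (expR (nrm z) * expR k)).
have C0 : 0 <= C.
  have k20 : 0 <= (k / 2) ^- m.+3 by rewrite invr_ge0 exprn_ge0 // divr_ge0 // ltW.
  by rewrite mulr_ge0 // addr_ge0 ?mulr_ge0 ?expR_ge0 ?ler0n.
move=> e e0; have C1 : 0 < C + 1 by lra.
exists (Num.min (k / 2) (e / (C + 1))); first by rewrite lt_min !divr_gt0.
move=> s hs /=; rewrite lt_min => /andP[s1 s2].
have hs' : is_lap th (z + (s - z)) h (F s) by rewrite addrC subrK; exact: hF.
have := lap_deriv th0 k0 hk M0 (ltW s1) hM (hF _ hz) hv1 hs'.
rewrite -/C => /le_trans; apply; rewrite expr2 mulrA ler_wpM2r ?nrm_ge0 //.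
move: s2; rewrite ltr_pdivlMr // => s2; have := nrm_ge0 (s - z); nra.
Qed.

End Kernel.

(** * Maximum principle and three-lines theorem *)

Section MaxPrinciple.
Context {R : realType} {E : normedModType R[i]}.
Local Notation rc := (real_complex R).
Implicit Types (D h : R[i] -> E) (w z : R[i]) (x y : R).

Definition cdiff2_on (V : set R[i]) D : Prop := exists D1 : R[i] -> E,
  (forall w, V w -> der id V D w (D1 w)) /\ cdiff_on V D1.

Lemma taylor2 (V : set R[i]) D D1 w (D2 : E) : cconvex V -> V w ->
  (forall w, V w -> der id V D w (D1 w)) -> der id V D1 w D2 ->
  forall e : R, 0 < e -> exists2 d : R, 0 < d & forall s : R[i], V (w + s) -> nrm s < d ->
    nrm (D (w + s) - D w - s *: D1 w - (s ^+ 2 / 2) *: D2) <= e * nrm s ^+ 2.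
Proof.
move=> Vc Vw hD hD1 e e0; have [d d0 H] := hD1 _ e0; exists d => // s Vs sd.
have Vt t : `[0, 1]%classic t -> V (w + t%:C * s).
  by rewrite /= in_itv /= => t01; have := Vc _ _ t Vw Vs t01; rewrite addrAC subrr add0r.
have dt t : der rc `[0, 1] (fun t => w + t%:C * s : R[i]^o) t (s : R[i]^o).
  apply: der_eq (derD (der_cst rc `[0,1] (w : R[i]^o) t) (derS (der_id rc `[0,1] t) (der_cst rc `[0,1] (s : R[i]^o) t))).
  by rewrite scale1r scaler0 add0r addr0.
have dt0 t : der rc `[0, 1] (fun t => t%:C : R[i]^o) t (1 : R[i]^o) by exact: der_id.
have := @mvt_cst R E (fun t => D (w + t%:C * s) - (t%:C *: (s *: D1 w) + (t%:C *: t%:C : R[i]^o) *: ((s ^+ 2 / 2) *: D2)))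
  (fun t => s *: (D1 (w + t%:C * s) - D1 w - (t%:C * s) *: D2)) (e * nrm s ^+ 2) `[0, 1] 0 1 ler01.
rewrite subr0 mulr1 mul0r mul1r addr0 scale1r !scale0r addr0 subr0.
rewrite (_ : _ - (_ + _) - _ = D (w + s) - D w - s *: D1 w - (s ^+ 2 / 2) *: D2); last by modring R[i].
apply.
- by move=> c; rewrite /= in_itv.
- move=> c c01; have c01' : `[0, 1]%classic c by rewrite /= in_itv.
  have d1 : der rc `[0, 1] (fun t => D (w + t%:C * s)) c (s *: D1 (w + c%:C * s)) :=
    der_comp (i' := id) Vt (dt c) (hD _ (Vt c c01')).
  have d2 := derS (dt0 c) (der_cst rc `[0,1] (s *: D1 w) c).
  have d3 := derS (derS (dt0 c) (dt0 c)) (der_cst rc `[0,1] ((s ^+ 2 / 2) *: D2) c).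
  apply: der_eq (derB d1 (derD d2 d3)).
  rewrite -[1 *: c%:C + _]/(1 * c%:C + c%:C * 1).
  by set X := D1 (w + c%:C * s); modring R[i]; field.
- move=> c c01; have c01' : `[0, 1]%classic c by rewrite /= in_itv.
  rewrite nrmZ expr2 mulrA mulrC -mulrA mulrC.
  have cs : nrm (c%:C * s) <= nrm s.
    rewrite nrmM nrmC ger0_norm; last lra.
    by rewrite ler_piMl ?nrm_ge0 //; lra.
  have := H _ (Vt c c01'); rewrite /= [w + _ - w]addrAC subrr add0r => /(_ ltac:(lra)) h.
  have := nrm_ge0 s; move: h; set u := nrm _ => h s0.
  have : e * nrm (c%:C * s) <= e * nrm s by rewrite ler_wpM2l ?(ltW e0).
  by move=> h'; nra.
Qed.

Lemma rect_max (f : R -> R -> R) (x1 x2 y1 y2 : R) : x1 <= x2 -> y1 <= y2 ->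
  (forall a b, x1 <= a <= x2 -> y1 <= b <= y2 -> forall e : R, 0 < e -> exists2 d : R, 0 < d &
     forall x y, x1 <= x <= x2 -> y1 <= y <= y2 -> `|x - a| < d -> `|y - b| < d ->
       `|f x y - f a b| <= e) ->
  exists a b, [/\ x1 <= a <= x2, y1 <= b <= y2 &
    forall x y, x1 <= x <= x2 -> y1 <= y <= y2 -> f x y <= f a b].
Proof.
move=> x12 y12 fc.
pose A : set (R * R) := `[x1, x2] `*` `[y1, y2].
have Ac : compact A by apply: compact_setX; exact: segment_compact.
have A0 : A !=set0 by exists (x1, y1); split; rewrite /= in_itv /= lexx.
have Af : {within A, continuous (fun p : R * R => f p.1 p.2)}.
  apply/subspace_continuousP => -[a b] [/= ha hb].
  apply/cvgrPdist_le => e e0.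
  move: ha hb; rewrite !in_itv /= => ha hb; have [d d0 H] := fc a b ha hb e e0.
  rewrite near_withinE; apply/nbhs_ballP; exists d => // -[x y] [/= bx by'] [/= Ax Ay].
  rewrite distrC; move: Ax Ay; rewrite !in_itv /= => Ax Ay; apply: H => //.
    by rewrite distrC.
  by rewrite distrC.
have [[a b] /set_mem[/= ha hb] H] := compact_EVT_max A0 Ac Af.
exists a, b; move: ha hb; rewrite !in_itv /= => ha hb; split => // x y hx hy.
by apply: (H (x, y)); rewrite inE; split; rewrite /= in_itv.
Qed.

(* Adding a small multiple of |w|^2 excludes an interior maximum: the Taylor terms of
   order 1 and 2 cancel in the mean over four points w + i^k r. *)
Lemma max_principle (th x1 x2 y1 y2 B : R) D : 0 <= th -> x1 <= x2 -> - th <= y1 -> y1 <= y2 ->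
  y2 <= th -> cdiff2_on (strip th) D ->
  (forall x y, x1 <= x <= x2 -> y1 <= y <= y2 ->
     [|| x == x1, x == x2, y == y1 | y == y2] -> nrm (D (x +i* y)) <= B) ->
  forall x y, x1 <= x <= x2 -> y1 <= y <= y2 -> nrm (D (x +i* y)) <= B.
Proof.
move=> th0 x12 hy1 y12 hy2 [D1 [hD hD1]] hB x0 y0 hx0 hy0.
rewrite leNgt; apply/negP => Blt.
have St x y : y1 <= y <= y2 -> strip th (x +i* y).
  by move=> hy; rewrite /strip /= ler_norml; lra.
pose Q := (x1 ^+ 2 + x2 ^+ 2) + (y1 ^+ 2 + y2 ^+ 2).
have Q0 : 0 <= Q by rewrite /Q !addr_ge0 ?sqr_ge0.
have hQ x y : x1 <= x <= x2 -> y1 <= y <= y2 -> x ^+ 2 + y ^+ 2 <= Q.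
  have sqb (u p1 p2 : R) : p1 <= u <= p2 -> u ^+ 2 <= p1 ^+ 2 + p2 ^+ 2.
    move=> hu; have := sqr_ge0 p1; have := sqr_ge0 p2.
    by case: (leP 0 u) => u0; rewrite !expr2; nra.
  by rewrite /Q => hx hy; rewrite lerD // sqb.
(* So small that adding [ep] times |w|^2 on the rectangle cannot make up for the excess of
   [nrm (D (x0 +i* y0))] over [B]: the maximum of [phi] is not on the boundary. *)
pose ep := (nrm (D (x0 +i* y0)) - B) / (2 * (Q + 1)).
have Q1 : 0 < 2 * (Q + 1) by lra.
have ep0 : 0 < ep by rewrite divr_gt0 // subr_gt0.
have epQ : ep * Q < nrm (D (x0 +i* y0)) - B.
  have : ep * (2 * (Q + 1)) = nrm (D (x0 +i* y0)) - B by rewrite /ep divfK // gt_eqF.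
  by have : 0 <= ep * Q by [rewrite mulr_ge0 // ltW]; lra.
pose phi x y := nrm (D (x +i* y)) + ep * (x ^+ 2 + y ^+ 2).
have [a [b [ha hb hmax]]] : exists a b, [/\ x1 <= a <= x2, y1 <= b <= y2 &
    forall x y, x1 <= x <= x2 -> y1 <= y <= y2 -> phi x y <= phi a b].
  apply: rect_max => // a b ha hb e e0.
  have e2 : 0 < e / 2 by rewrite divr_gt0.
  have [d d0 H] := der_cont (hD _ (St a b hb)) e2.
  pose M := 2 * (`|x1| + `|x2| + (`|y1| + `|y2|)) + 1.
  have M0 : 0 < M by rewrite ltr_wpDl // mulr_ge0 // !addr_ge0.
  have eM : 0 < e / 2 / (ep * (M + M)) by rewrite !divr_gt0 // mulr_gt0 //; lra.
  exists (Num.min (d / 2) (e / 2 / (ep * (M + M)))); first by rewrite lt_min eM divr_gt0.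
  move=> x y hx hy; rewrite !lt_min => /andP[xa xa'] /andP[yb yb'].
  have h1 : nrm (D (x +i* y) - D (a +i* b)) <= e / 2.
    apply: H; first exact: St.
    by apply: le_lt_trans (ler_nrm_ReIm _) _ => /=; clear -xa yb; lra.
  have h2 : `|nrm (D (x +i* y)) - nrm (D (a +i* b))| <= e / 2.
    rewrite ler_norml; have := nrm_sub_le (D (x +i* y)) (D (a +i* b)).
    have := nrm_sub_le (D (a +i* b)) (D (x +i* y)); rewrite (nrmB (D (a +i* b))); clear -h1; lra.
  have sq u v p1 p2 : p1 <= u <= p2 -> p1 <= v <= p2 -> `|p1| + `|p2| <= (M - 1) / 2 ->
      `|u ^+ 2 - v ^+ 2| <= `|u - v| * M.
    move=> hu hv hp; rewrite subr_sqr normrM ler_wpM2l //.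
    have := ler_norm p1; have := ler_norm p2; have := ler_norm (- p1); have := ler_norm (- p2).
    by rewrite !normrN ler_norml; clear -hu hv hp; lra.
  have h3 := sq x a x1 x2 hx ha _; have {}h3 := h3 ltac:(rewrite /M; have := normr_ge0 y1; have := normr_ge0 y2; clear; lra).
  have h4 := sq y b y1 y2 hy hb _; have {}h4 := h4 ltac:(rewrite /M; have := normr_ge0 x1; have := normr_ge0 x2; clear; lra).
  have h5 : `|x ^+ 2 - a ^+ 2| + `|y ^+ 2 - b ^+ 2| <= e / 2 / ep.
    have k1 : `|x - a| * M <= e / 2 / (ep * (M + M)) * M by rewrite ler_wpM2r // ltW.
    have k2 : `|y - b| * M <= e / 2 / (ep * (M + M)) * M by rewrite ler_wpM2r // ltW.
    have k3 : e / 2 / (ep * (M + M)) * M + e / 2 / (ep * (M + M)) * M = e / 2 / ep.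
      by clear -M0 ep0; field; rewrite !gt_eqF //; lra.
    by clear -h3 h4 k1 k2 k3; lra.
  have h6 : ep * (`|x ^+ 2 - a ^+ 2| + `|y ^+ 2 - b ^+ 2|) <= e / 2.
    by rewrite mulrC -ler_pdivlMr.
  rewrite /phi [e]splitr.
  have -> : nrm (D (x +i* y)) + ep * (x ^+ 2 + y ^+ 2) - (nrm (D (a +i* b)) + ep * (a ^+ 2 + b ^+ 2)) =
     (nrm (D (x +i* y)) - nrm (D (a +i* b))) + ep * ((x ^+ 2 - a ^+ 2) + (y ^+ 2 - b ^+ 2)) by ring.
  apply: le_trans (ler_normD _ _) _; rewrite lerD // normrM (gtr0_norm ep0).
  apply: le_trans h6; rewrite ler_wpM2l ?(ltW ep0) // ler_normD //.
have m0 := hmax _ _ hx0 hy0.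
have a0 : 0 <= ep * (x0 ^+ 2 + y0 ^+ 2) by rewrite mulr_ge0 ?(ltW ep0) // addr_ge0 ?sqr_ge0.
have int : ~~ [|| a == x1, a == x2, b == y1 | b == y2].
  apply/negP => /(hB _ _ ha hb) h.
  have := hQ _ _ ha hb => h'; have : ep * (a ^+ 2 + b ^+ 2) <= ep * Q by rewrite ler_wpM2l ?(ltW ep0).
  by move: m0; rewrite /phi; lra.
have [ia1 ia2 ib1 ib2] : [/\ x1 < a, a < x2, y1 < b & b < y2].
  move: int; rewrite !negb_or => /and4P[n1 n2 n3 n4].
  by rewrite !lt_neqAle n2 n4 (eq_sym x1) n1 (eq_sym y1) n3; move: ha hb => /andP[-> ->] /andP[-> ->].
have [D2 hD2] := hD1 _ (St a b hb).
have [d d0 H] := taylor2 (@strip_convex R th) (St a b hb) hD hD2 (divr_gt0 ep0 (ltr0n _ 2)).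
pose r := Num.min (d / 2) (Num.min (Num.min (a - x1) (x2 - a)) (Num.min (b - y1) (y2 - b))).
have r0 : 0 < r by rewrite !lt_min !subr_gt0 ia1 ia2 ib1 ib2 divr_gt0.
have [rd r1 r2 r3 r4] : [/\ r <= d / 2, r <= a - x1, r <= x2 - a, r <= b - y1 & r <= y2 - b].
  by rewrite /r !ge_min !lexx !orbT.
clearbody r; set w := a +i* b.
have step (u v : R) : nrm (u +i* v : R[i]) = r -> y1 <= b + v <= y2 -> x1 <= a + u <= x2 ->
    nrm (D (w + (u +i* v)) - D w - (u +i* v) *: D1 w - ((u +i* v) ^+ 2 / 2) *: D2) <= ep / 2 * r ^+ 2
    /\ nrm (D (w + (u +i* v))) <= phi a b - ep * ((a + u) ^+ 2 + (b + v) ^+ 2).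
  move=> hr hv hu; split.
    by rewrite -hr; apply: H; [exact: St|rewrite hr; clear -rd d0; lra].
  by have := hmax _ _ hu hv; rewrite /phi /w /=; clear; lra.
have nr (u : R) : `|u| = r -> nrm (u +i* 0 : R[i]) = r /\ nrm (0 +i* u : R[i]) = r.
  by move=> <-; rewrite /nrm !normc_def /= expr0n /= addr0 add0r sqrtr_sqr.
have [n1 n2] := nr r (gtr0_norm r0).
have [n3 n4] := nr (- r) ltac:(by rewrite normrN gtr0_norm).
have [s1 t1] := step _ _ n1 ltac:(clear -r0 r3 r4 ib1 ib2; lra) ltac:(clear -r0 r1 r2 ia1 ia2; lra).
have [s2 t2] := step _ _ n2 ltac:(clear -r0 r3 r4 ib1 ib2; lra) ltac:(clear -r0 r1 r2 ia1 ia2; lra).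
have [s3 t3] := step _ _ n3 ltac:(clear -r0 r3 r4 ib1 ib2; lra) ltac:(clear -r0 r1 r2 ia1 ia2; lra).
have [s4 t4] := step _ _ n4 ltac:(clear -r0 r3 r4 ib1 ib2; lra) ltac:(clear -r0 r1 r2 ia1 ia2; lra).
set A1 := _ - _ in s1; set A2 := _ - _ in s2; set A3 := _ - _ in s3; set A4 := _ - _ in s4.
have q1 : (r +i* 0) = r%:C :> R[i] by [].
have q3 : (- r +i* 0) = - r%:C :> R[i] by rewrite -rmorphN.
have q2 : (0 +i* r) = 'i%C * r%:C :> R[i] by apply/eqP; rewrite eq_complex /= !mul0r !mul1r ?subr0 ?add0r ?addr0 !eqxx.
have q4 : (0 +i* - r) = - ('i%C * r%:C) :> R[i].
  by apply/eqP; rewrite eq_complex /= !mul0r !mul1r ?subr0 ?add0r ?addr0 ?oppr0 !eqxx.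
have ii : 'i%C * 'i%C = -1 :> R[i] by rewrite -expr2 sqr_i.
have sum : 4 *: D w = D (w + (r +i* 0)) + D (w + (0 +i* r)) + D (w + (- r +i* 0)) + D (w + (0 +i* - r))
   - (A1 + A2 + A3 + A4).
  have e4 : (4 : R[i]) = 1 + 1 + 1 + 1 by ring.
  rewrite e4 /A1 /A2 /A3 /A4 q1 q2 q3 q4 !sqrrN exprMn sqr_i mulN1r mulNr scaleNr !scaleNr !scalerDl !scale1r.
  by modring R[i].
have n4' : nrm (4 *: D w) = 4 * nrm (D w).
  by rewrite nrmZ -[4](rmorph_nat (real_complex R)) nrmC ger0_norm.
have := ler_nrmB (D (w + (r +i* 0)) + D (w + (0 +i* r)) + D (w + (- r +i* 0)) + D (w + (0 +i* - r))) (A1 + A2 + A3 + A4).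
rewrite -sum n4'.
have := ler_nrmD (D (w + (r +i* 0)) + D (w + (0 +i* r)) + D (w + (- r +i* 0))) (D (w + (0 +i* - r))).
have := ler_nrmD (D (w + (r +i* 0)) + D (w + (0 +i* r))) (D (w + (- r +i* 0))).
have := ler_nrmD (D (w + (r +i* 0))) (D (w + (0 +i* r))).
have := ler_nrmD (A1 + A2 + A3) A4; have := ler_nrmD (A1 + A2) A3; have := ler_nrmD A1 A2.
have pe : phi a b = nrm (D w) + ep * (a ^+ 2 + b ^+ 2) by [].
(* The mean of |.|^2 over the four points exceeds |w|^2 by [r ^+ 2], so the four values of [nrm D]
   sum to at most [4 * nrm (D w) - 4 * ep * r ^+ 2]; the Taylor errors return at most
   [2 * ep * r ^+ 2], a contradiction. *)
have er : 0 < ep * r ^+ 2 by rewrite mulr_gt0 // exprn_gt0.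
move: t1 t2 t3 t4; rewrite pe !expr2 in er s1 s2 s3 s4 *; clear -er s1 s2 s3 s4; lra.
Qed.

Lemma cdiff2_scale (V : set R[i]) (f : R[i] -> R[i]^o) D :
  (exists f1 : R[i] -> R[i]^o, (forall w, V w -> der id V f w (f1 w)) /\
     forall w, V w -> exists v : R[i]^o, der id V f1 w v) ->
  cdiff2_on V D -> cdiff2_on V (fun w => f w *: D w).
Proof.
move=> [f1 [hf hf1]] [D1 [hD hD1]].
exists (fun w => f1 w *: D w + f w *: D1 w); split.
  by move=> w Vw; apply: derS; [exact: hf|exact: hD].
move=> w Vw; have [a ha] := hf1 w Vw; have [v hv] := hD1 w Vw.
by eexists; apply: derD; apply: derS; [exact: ha|exact: hD|exact: hf|exact: hv].
Qed.

(* the Gaussian localizes the three-lines argument to a bounded rectangle *)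
Definition gauss (L x0 : R) w : R[i]^o := cexp (- ('i%C * L%:C * w) - (w - x0%:C) ^+ 2).

Lemma gauss_diff2 (V : set R[i]) L x0 :
  exists f1 : R[i] -> R[i]^o, (forall w, V w -> der id V (gauss L x0) w (f1 w)) /\
     forall w, V w -> exists v : R[i]^o, der id V f1 w v.
Proof.
have d0 w : der id V (id : R[i] -> R[i]^o) w 1 by exact: der_id.
pose p w : R[i]^o := - ('i%C * L%:C * w) - (w - x0%:C) ^+ 2.
pose p1 w : R[i]^o := - ('i%C * L%:C) - 2 * (w - x0%:C).
have dp1 w : der id V p1 w (- 2 : R[i]^o).
  apply: der_eq (derB (der_cst id V (- ('i%C * L%:C) : R[i]^o) w)
    (derZ 2 (derB (d0 w) (der_cst id V (x0%:C : R[i]^o) w)))).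
  by rewrite subr0 sub0r regE mulr1.
have dp w : der id V p w (p1 w).
  have k := derB (d0 w) (der_cst id V (x0%:C : R[i]^o) w).
  have := derB (derN (derZ ('i%C * L%:C) (d0 w))) (derS k k).
  rewrite !subr0 => h; apply: der_eq h.
  by rewrite /p1 !regE; ring.
exists (fun w => p1 w * gauss L x0 w); split=> w _.
  exact: der_cexp (dp w).
by eexists; apply: derS (dp1 w) (der_cexp (dp w)).
Qed.

Lemma nrm_gauss (L x0 x y : R) :
  nrm (gauss L x0 (x +i* y) : R[i]) = expR (L * y - (x - x0) ^+ 2 + y ^+ 2).
Proof. by rewrite /gauss nrm_cexp; congr expR; rewrite /= ; ring. Qed.

(** The real axis cuts the strip into two halves, treated alike with [s = 1] and [s = -1]. On a
    rectangle in one half the weight [gauss] makes the weighted [D] at most e exp (- L th) on all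
    four sides, while at [(x0, y0)] the weight itself is at least exp (- L th). *)
Lemma three_lines (th th' M : R) D : 0 <= th < th' -> 0 <= M -> cdiff2_on (strip th') D ->
  (forall w, strip th' w -> nrm (D w) <= M) ->
  (forall e : R, 0 < e -> exists X : R, forall x, X <= x -> nrm (D x%:C) <= e) ->
  forall e : R, 0 < e -> exists X : R, forall x y, X <= x -> `|y| <= th -> nrm (D (x +i* y)) <= e.
Proof.
move=> tt M0 hD hM h0 e e0.
have th'0 : 0 < th' - th by lra.
have M1 : 0 < M + 1 by lra.
have big (a : R) : 0 < a -> exists2 B : R, 0 <= B & (M + 1) * expR (- B) <= a.
  move=> a0; have [X [X0 hX]] := expRN_small (ltW M1) a0.
  by exists X => //; apply: hX.
have [B B0 hB] := big _ e0.
(* Gives exp (- L th' + th'^2) = exp (- B - L th): on the far horizontal side the weight beats the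
   bound [M + 1] by the choice of [B]. *)
pose L := (B + th' ^+ 2) / (th' - th).
have L0 : 0 <= L by rewrite /L divr_ge0 ?(ltW th'0) // addr_ge0 ?sqr_ge0.
have LE : L * (th' - th) = B + th' ^+ 2 by rewrite divfK // gt_eqF.
(* Since [1 <= S], the Gaussian factor exp (- S^2) is at most exp (- S), which beats the same bound
   on the two vertical sides. *)
pose S := B + L * th + th' ^+ 2 + 1.
have Lth0 : 0 <= L * th by rewrite mulr_ge0 //; lra.
have S1 : 1 <= S by rewrite /S; have := sqr_ge0 th'; lra.
have eS : 0 < e * expR (- S) by rewrite mulr_gt0 ?expR_gt0.
have [X hX] := h0 _ eS.
exists (X + S) => x0 y0 hx0 hy0.
have key (s y1 y2 : R) : s ^+ 2 = 1 -> - th' <= y1 -> y1 <= y2 -> y2 <= th' ->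
    (forall y, y1 <= y <= y2 -> 0 <= s * y <= th') ->
    (forall y, y == y1 \/ y == y2 -> y = 0 \/ s * y = th') ->
    y1 <= y0 <= y2 -> nrm (D (x0 +i* y0)) <= e.
  move=> s2 h1 h2 h3 hs hb hy.
  have sq y : y ^+ 2 = (s * y) ^+ 2 by rewrite exprMn s2 mul1r.
  have cd : cdiff2_on (strip th') (fun w => gauss (- (L * s)) x0 w *: D w).
    by apply: cdiff2_scale => //; exact: gauss_diff2.
  have bnd := @max_principle th' (x0 - S) (x0 + S) y1 y2 (e * expR (- (L * th))) _
     ltac:(lra) ltac:(lra) h1 h2 h3 cd _ x0 y0 ltac:(lra) hy.
  have : nrm (gauss (- (L * s)) x0 (x0 +i* y0) *: D (x0 +i* y0)) <= e * expR (- (L * th)).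
    apply: bnd => x y hx hxy hor; rewrite nrmZ (nrm_gauss _ _ x y).
    have hsy := hs y hxy.
    have -> : - (L * s) * y - (x - x0) ^+ 2 + y ^+ 2 = - (L * (s * y)) - (x - x0) ^+ 2 + (s * y) ^+ 2.
      by rewrite -sq; ring.
    have sy2 : (s * y) ^+ 2 <= th' ^+ 2 by rewrite !expr2; nra.
    have Lsy : 0 <= L * (s * y) by rewrite mulr_ge0 //; case/andP: hsy.
    have xx := sqr_ge0 (x - x0).
    have Sxy : strip th' (x +i* y) by rewrite /strip /= ler_norml; clear -hxy h1 h3; lra.
    have DM : nrm (D (x +i* y)) <= M + 1 by rewrite (le_trans (hM _ Sxy)) // lerDl.
    have comb (u : R) : u <= - B - L * th -> expR u * nrm (D (x +i* y)) <= e * expR (- (L * th)).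
      move=> hu; apply: le_trans (_ : expR (- B - L * th) * (M + 1) <= _).
        by apply: ler_pM; rewrite ?expR_ge0 ?nrm_ge0 // ler_expR.
      by rewrite expRD mulrAC [expR (- B) * _]mulrC ler_wpM2r ?expR_ge0.
    have side : x = x0 - S \/ x = x0 + S -> - (L * (s * y)) - (x - x0) ^+ 2 + (s * y) ^+ 2 <= - B - L * th.
      move=> hxx; have : (x - x0) ^+ 2 = S ^+ 2 by case: hxx => ->; ring.
      have : S <= S ^+ 2 by rewrite expr2 ler_peMr // (le_trans ler01).
      by clear -xx sy2 Lsy Lth0 B0; rewrite /S; lra.
    have hory : y == y1 \/ y == y2 -> expR (- (L * (s * y)) - (x - x0) ^+ 2 + (s * y) ^+ 2) * nrm (D (x +i* y)) <= e * expR (- (L * th)).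
      move=> /hb[y00|syt].
        rewrite y00 mulr0 mulr0 oppr0 sub0r expr0n /= addr0.
        have := hX x ltac:(clear -hx hx0; lra); rewrite -[x%:C]/(x +i* 0) => hd.
        apply: le_trans (_ : 1 * (e * expR (- S)) <= _).
          by apply: ler_pM; rewrite ?expR_ge0 ?nrm_ge0 // -expR0 ler_expR; clear -xx; lra.
        rewrite mul1r ler_wpM2l ?(ltW e0) // ler_expR.
        by rewrite /S; have := sqr_ge0 th'; clear -B0; lra.
      apply: comb; rewrite syt; have : L * th' = B + th' ^+ 2 + L * th by rewrite -LE; ring.
      by clear -xx; lra.
    case/or4P: hor => /eqP hh.
    - by apply: comb; apply: side; left.
    - by apply: comb; apply: side; right.
    - by apply: hory; left; apply/eqP.
    - by apply: hory; right; apply/eqP.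
  rewrite nrmZ (nrm_gauss _ _ x0 y0) => hh.
  have hsy := hs y0 hy.
  have syt : s * y0 <= th.
    have : `|s * y0| <= th by rewrite normrM (_ : `|s| = 1) ?mul1r //;
      apply/eqP; rewrite -(@eqrXn2 _ 2) // ?expr1n ?real_normK ?num_real // s2.
    by rewrite ler_norml => /andP[].
  have : expR (- (L * th)) * nrm (D (x0 +i* y0)) <= e * expR (- (L * th)).
    apply: le_trans hh; rewrite ler_wpM2r ?nrm_ge0 // ler_expR subrr expr0n /= subr0.
    have := sqr_ge0 y0; have : L * (s * y0) <= L * th by rewrite ler_wpM2l.
    lra.
  by rewrite mulrC ler_pM2r // expR_gt0.
move: hy0; rewrite ler_norml => hy0.
case: (leP 0 y0) => y00.
  apply: (key 1 0 th'); try lra.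
  - by move=> y; rewrite mul1r.
  - by move=> y [/eqP ->|/eqP ->]; [left|right; rewrite mul1r].
apply: (key (-1) (- th') 0); try lra.
- by move=> y; lra.
- by move=> y [/eqP ->|/eqP ->]; [right; ring|left].
Qed.

End MaxPrinciple.

(** * Behaviour of the contour integrals as z tends to 0 *)

Section Vanish.
Context {R : realType} {E : normedModType R[i]}.
Hypothesis Ec : seq_complete E.
Local Notation rc := (real_complex R).
Implicit Types (h : R[i] -> E) (w z : R[i]) (th x y k : R).

Definition lapC th k (m : nat) : R := 2 * ((m.+1)`!%:R / k ^+ m.+1) + 2 * th * expR 1.

Lemma lapC_ge0 th k m : 0 <= th -> 0 < k -> 0 <= lapC th k m.
Proof.
move=> th0 k0; rewrite /lapC addr_ge0 ?mulr_ge0 ?expR_ge0 ?ler0n //.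
by rewrite invr_ge0 exprn_ge0 // ltW.
Qed.

(* The contour is started at radius 1 / |z|, which makes the estimate scale invariant. *)
Lemma lap_scaled th k z h m (M : R) v : 0 <= th -> 0 < k -> 0 < nrm z ->
  decay th (k * nrm z) z -> 0 <= M ->
  (forall w, strip th w -> - ln (nrm z) <= complex.Re w ->
     nrm (h w) <= M * expR (complex.Re w) ^+ m) ->
  is_lap th z h v -> nrm v * nrm z ^+ m <= M * lapC th k m.
Proof.
move=> th0 k0 z0 hz M0 hM hv.
have := lap_bound th0 (mulr_gt0 k0 z0) hz M0 hM hv.
rewrite opprK expRN lnK ?posrE // divff ?gt_eqF //.
have zm : 0 < nrm z ^+ m by rewrite exprn_gt0.
rewrite -(ler_pM2r zm) => /le_trans; apply; rewrite le_eqVlt; apply/orP; left; apply/eqP.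
rewrite /lapC exprVn exprMn !exprS; move: ((m.+1)`!%:R) => f.
by field; rewrite !expf_neq0 ?gt_eqF.
Qed.

Lemma strip_addr th w (s : R) : strip th w -> strip th (w + s%:C).
Proof. by case: w => a b; rewrite /strip /= addr0. Qed.

Lemma der_shift th (s : R) P p w : strip th w -> (forall w, strip th w -> der id (strip th) P w (p w : E)) ->
  der id (strip th) (fun w => P (w + s%:C)) w (p (w + s%:C)).
Proof.
move=> sw hP.
have := der_comp (i' := id) (D' := strip th) (f := P) _ (derD (der_id id (strip th) w) (der_cst id (strip th) (s%:C : R[i]^o) w)) (hP _ (strip_addr s sw)).
by rewrite addr0 scale1r; apply => w'; exact: strip_addr.
Qed.

Lemma shift_le th (P p : R[i] -> E) (s M : R) w : 0 <= s -> strip th w ->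
  (forall w, strip th w -> der id (strip th) P w (p w)) ->
  (forall t : R, 0 <= t -> nrm (p (w + t%:C)) <= M) ->
  nrm (P (w + s%:C) - P w) <= M * s.
Proof.
case: w => a b s0 sw hP hM.
have := @mvt_cst R E (fun t => P (t +i* b)) (fun t => p (t +i* b)) M setT a (a + s) ltac:(lra).
rewrite [a + s - a]addrAC subrr add0r.
have -> : (a +i* b) + s%:C = (a + s) +i* b :> R[i] by rewrite /= -[LHS]/((a + s) +i* (b + 0)) addr0.
apply => // c hc; first by have := prim_hline c hP sw.
have := hM (c - a) ltac:(lra).
by rewrite (_ : (a +i* b) + (c - a)%:C = c +i* b) // -[LHS]/((a + (c - a)) +i* (b + 0)) addr0 addrC subrK.
Qed.

(** Integration by parts: the integrand is the derivative of [kern z w *: U w], which tends to 0 at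
    both ends of the contour. *)
Lemma kern_diff_contour th z U U' (M : R) : 0 <= th -> sectorial th z ->
  (forall w, strip th w -> der id (strip th) U w (U' w : E)) ->
  (forall w, strip th w -> nrm (U w) <= M) ->
  is_contour th (fun w => (z * cexp w * kern z w) *: U w + kern z w *: U' w) 0.
Proof.
move=> th0 hz hU hM; exists (fun w => kern z w *: U w); split.
  by move=> w sw; apply: derS; [exact: der_kern|exact: hU].
have [k k0 [hk1 hk2]] := sectorial_decay hz.
have M0 : 0 <= M by apply: le_trans (nrm_ge0 _) (hM 0 _); rewrite /strip /= normr0.
have lim0 y : `|y| <= th -> complex.Re (z * dir y) <= - k ->
    lim_infty (fun x => kern z (x +i* y) *: U (x +i* y)) 0.
  move=> hy hk e e0.
  have MK : 0 <= M * (1 / k) by rewrite mulr_ge0 // divr_ge0 // ltW.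
  have [X [_ hX]] := expRN_small MK e0; exists X => x /hX; apply: le_trans.
  rewrite subr0 nrmZ.
  apply: le_trans (_ : expR (- (k * expR x)) * M <= _).
    by apply: ler_pM; rewrite ?nrm_ge0 ?kern_ray // hM.
  have := exp_poly x 0 k0; rewrite expr0 mulr1 expr1 => h.
  by rewrite mulrC -mulrA ler_wpM2l.
exists 0, 0; split; [by apply: lim0; rewrite ?th_in|by apply: lim0; rewrite ?thN_in|by rewrite subr0].
Qed.

Lemma cdiff_ext (V : set R[i]) h h' : (forall w, V w -> h w = h' w) -> cdiff_on V h -> cdiff_on V h'.
Proof. by move=> hh hd w Vw; have [v hv] := hd w Vw; exists v; exact: der_ext hh Vw hv. Qed.

Lemma cdiff_strip_sub th th' h : th <= th' -> cdiff_on (strip th') h -> cdiff_on (strip th) h.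
Proof.
move=> tt hd w sw; have [v hv] := hd w (strip_sub tt sw); exists v.
by apply: der_sub hv; exact: strip_sub.
Qed.

(** [three_lines] takes two derivatives and [h] comes with one, so [h] is replaced by its mean [hs]
    over a translation by [s], which keeps the bound and the limit on the axis. The difference
    [hs - h] is the derivative of [U], where |U| <= s M; integration by parts turns its integral
    into [z] times that of [cexp w *: U w], up to sign, and [lap_scaled] bounds this by a multiple
    of [s] uniformly in [z]. Hence [s] is fixed before [z]. *)
Lemma lap_vanish (th th' M k : R) h : 0 <= th < th' -> 0 < k -> 0 <= M ->
  cdiff_on (strip th') h -> (forall w, strip th' w -> nrm (h w) <= M) ->
  (forall e : R, 0 < e -> exists X : R, forall x, X <= x -> nrm (h x%:C) <= e) ->
  forall e : R, 0 < e -> exists2 d : R, 0 < d & forall z v, 0 < nrm z -> nrm z < d ->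
    decay th (k * nrm z) z -> is_lap th z h v -> nrm v <= e.
Proof.
move=> tt k0 M0 hd hM h0 e e0.
have th0 : 0 <= th by lra. have th'0 : 0 <= th' by lra.
have tht : th <= th' by lra.
have [P hP] := strip_prim_ex Ec hd.
have [Q hQ] : exists Q, is_prim th' P Q.
  by apply: strip_prim_ex => // w sw; exists (h w); exact: hP.
have C1 := lapC_ge0 1 th0 k0; have C0 := lapC_ge0 0 th0 k0.
have MC : 0 < M * lapC th k 1 + 1 by rewrite ltr_wpDl // mulr_ge0.
pose s := e / 2 / (M * lapC th k 1 + 1).
have s0 : 0 < s by rewrite !divr_gt0.
have hsC : s * M * lapC th k 1 <= e / 2.
  rewrite -mulrA /s mulrAC ler_pdivrMr // ler_wpM2l //; lra.
have sC : s%:C != 0 :> R[i] by rewrite -[0]/((0:R)%:C) (inj_eq (@complexI R)) gt_eqF.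
pose hs w := s^-1%:C *: (P (w + s%:C) - P w).
pose U w := s^-1%:C *: (Q (w + s%:C) - Q w) - P w.
have dU w : strip th' w -> der id (strip th') U w (hs w - h w).
  move=> sw; apply: derB; last exact: hP.
  by apply: derZ; apply: derB; [exact: der_shift|exact: hQ].
have dhs w : strip th' w -> der id (strip th') hs w (s^-1%:C *: (h (w + s%:C) - h w)).
  by move=> sw; apply: derZ; apply: derB; [exact: der_shift|exact: hP].
have nsv : nrm (s^-1%:C : R[i]) = s^-1 by rewrite nrmC ger0_norm // invr_ge0 ltW.
have hsM w : strip th' w -> nrm (hs w) <= M.
  move=> sw; rewrite nrmZ nsv mulrC ler_pdivrMr //.
  by apply: shift_le hP _ => //; [exact: ltW|move=> t _; apply: hM; exact: strip_addr].
have UM w : strip th' w -> nrm (U w) <= s * M.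
  move=> sw; have -> : U w = s^-1%:C *: (Q (w + s%:C) - Q w - s%:C *: P w).
    by rewrite scalerBr scalerA -rmorphM /= mulVf ?gt_eqF // scale1r.
  rewrite nrmZ nsv ler_pdivrMl //.
  case: w sw => a b sw.
  have := @mvt_cst R E (fun t => Q (t +i* b) - t%:C *: P (a +i* b)) (fun t => P (t +i* b) - P (a +i* b)) (s * M) setT a (a + s) ltac:(lra).
  rewrite [a + s - a]addrAC subrr add0r.
  have -> : (a +i* b) + s%:C = (a + s) +i* b :> R[i] by rewrite -[LHS]/((a + s) +i* (b + 0)) addr0.
  rewrite (_ : _ - _ - _ = Q ((a + s) +i* b) - Q (a +i* b) - s%:C *: P (a +i* b)); last first.
    by rewrite rmorphD /=; modring R[i].
  rewrite [X in _ -> _ <= X]mulrC; apply => // c hc.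
    apply: derB; first exact: prim_hline hQ sw.
    have := derS (der_id rc setT c) (der_cst rc setT (P (a +i* b)) c).
    by rewrite scale1r scaler0 addr0.
  have := shift_le (w := a +i* b) (s := c - a) ltac:(lra) sw hP (fun t _ => hM _ (strip_addr t sw)).
  rewrite (_ : (a +i* b) + (c - a)%:C = c +i* b); last first.
    by rewrite -[LHS]/((a + (c - a)) +i* (b + 0)) addr0 addrC subrK.
  move=> /le_trans; apply; rewrite mulrC ler_wpM2r //; lra.
have hs0 (e' : R) : 0 < e' -> exists X : R, forall x, X <= x -> nrm (hs x%:C) <= e'.
  move=> e'0; have [X hX] := h0 _ e'0; exists X => x hx.
  rewrite nrmZ nsv mulrC ler_pdivrMr //.
  apply: shift_le hP _ => //; [exact: ltW|by rewrite /strip /= normr0|].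
  by move=> t t0; rewrite -rmorphD; apply: hX; lra.
have cd2 : cdiff2_on (strip th') hs.
  exists (fun w => s^-1%:C *: (h (w + s%:C) - h w)); split => // w sw.
  have [v hv] := hd _ (strip_addr s sw); have [v' hv'] := hd _ sw.
  exists (s^-1%:C *: (v - v')); apply: derZ; apply: derB => //.
  have := der_comp (i' := id) (D' := strip th') (f := h) _ (derD (der_id id (strip th') w) (der_cst id (strip th') (s%:C : R[i]^o) w)) hv.
  by rewrite addr0 scale1r; apply => w'; exact: strip_addr.
have e20 : 0 < e / 2 by rewrite divr_gt0.
have C01 : 0 < lapC th k 0 + 1 by lra.
have [X hX] := three_lines tt M0 cd2 hsM hs0 (divr_gt0 e20 C01).
(* For |z| < e^{-X} the contour starts at Re w = - ln |z| >= X, where [hs] is already small. *)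
exists (expR (- X)); first exact: expR_gt0.
move=> z v z0 zX hz hv.
have lnz : X <= - ln (nrm z).
  by rewrite lerNr -[leRHS](expRK (- X)) ler_ln ?posrE ?expR_gt0 // ltW.
have hsec : sectorial th z by apply: decay_sectorial hz; rewrite mulr_gt0.
have hdth : cdiff_on (strip th) h by exact: cdiff_strip_sub hd.
have hsd : cdiff_on (strip th) hs.
  by move=> w sw; exists (s^-1%:C *: (h (w + s%:C) - h w)); apply: der_sub (dhs w (strip_sub tht sw)); exact: strip_sub.
have hsX w : strip th w -> - ln (nrm z) <= complex.Re w ->
    nrm (hs w) <= e / 2 / (lapC th k 0 + 1) * expR (complex.Re w) ^+ 0.
  by case: w => a b sw aX; rewrite expr0 mulr1; apply: hX => //; exact: le_trans aX.
have eC0 : 0 <= e / 2 / (lapC th k 0 + 1) by rewrite !divr_ge0 ?(ltW e0) ?(ltW C01).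
have [vs hvs] := lap_ex Ec th0 (mulr_gt0 k0 z0) hz eC0 hsX hsd.
have b1 := lap_scaled th0 k0 z0 hz eC0 hsX hvs.
have Uth w : strip th w -> der id (strip th) U w (hs w - h w).
  by move=> sw; apply: der_sub (dU w (strip_sub tht sw)); exact: strip_sub.
have hc := kern_diff_contour th0 hsec Uth (fun w sw => UM w (strip_sub tht sw)).
have Ud : cdiff_on (strip th) (fun w => cexp w *: U w).
  by apply: cdiff_cexp => w /Uth hw; exists (hs w - h w).
have UX w : strip th w -> - ln (nrm z) <= complex.Re w ->
    nrm (cexp w *: U w) <= s * M * expR (complex.Re w) ^+ 1.
  move=> sw _; rewrite nrmZ nrm_cexp expr1 mulrC ler_wpM2r ?expR_ge0 //.
  by apply: UM; exact: strip_sub sw.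
have sM0 : 0 <= s * M by rewrite mulr_ge0 // ltW.
have [u hu] := lap_ex Ec th0 (mulr_gt0 k0 z0) hz sM0 UX Ud.
have b2 := lap_scaled th0 k0 z0 hz sM0 UX hu.
have E1 : v = vs + z *: u.
  have h2 : is_contour th (fun w => kern z w *: h w) (z *: u + (vs - 0)).
    have := contourZD z hu (contourZD (-1) hc hvs).
    rewrite scaler0 add0r => h3; rewrite subr0; apply: contour_ext h3 => w sw.
    by rewrite /hs; modring R[i].
  by rewrite (contour_uniq th0 hv h2) subr0 addrC.
rewrite E1; apply: le_trans (ler_nrmD _ _) _; rewrite [e]splitr lerD //.
  move: b1; rewrite expr0 mulr1 => /le_trans; apply.
  rewrite -mulrA ger_pMr // mulrC ler_pdivrMr //; lra.
by rewrite nrmZ mulrC; move: b2; rewrite expr1 => /le_trans; apply.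
Qed.

End Vanish.

(** * Primitives on the half-line *)

Section HalfLine.
Context {R : realType} {E : normedModType R[i]}.
Hypothesis Ec : seq_complete E.
Local Notation rc := (real_complex R).

Definition halfline : set R := [set t | 0 <= t].

Lemma prim_halfline (f : R -> E) :
  (forall t : R, 0 <= t -> cont rc halfline f t) ->
  exists P : R -> E, P 0 = 0 /\ forall t : R, 0 <= t -> der rc halfline P t (f t).
Proof.
move=> fc.
have exn (n : nat) : exists P : R -> E, P 0 = 0 /\
    forall c, 0 <= c <= n%:R -> der rc `[0, n%:R] P c (f c).
  apply: prim_ex => // c /andP[c0 _]; apply: cont_sub (fc c c0) => s /=.
  by rewrite in_itv /= => /andP[].
have [P hP] := choice exn.
have agree n m t : 0 <= t <= n%:R -> t <= m%:R -> P n t = P m t.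
  move=> /andP[t0 tn] tm; have [n0 hn] := hP n; have [m0 hm] := hP m.
  apply/eqP; rewrite -subr_eq0 -(subrr (0 : E)) -{1}n0 -m0; apply/eqP.
  apply: (@der0_cst R E (fun t => P n t - P m t) `[0, t] 0 t) => //.
  move=> c hc; rewrite -(subrr (f c)); apply: derB.
    by apply: der_sub (hn c _); [move=> s /=; rewrite !in_itv /=; lra|lra].
  by apply: der_sub (hm c _); [move=> s /=; rewrite !in_itv /=; lra|lra].
exists (fun t => P (Num.bound t) t); split; first by have [] := hP (Num.bound (0 : R)).
move=> t t0 e e0.
have [n hn] : exists n : nat, t + 1 <= n%:R.
  by exists (Num.bound (t + 1)); rewrite ltW // archi_boundP //; lra.
have [_ /(_ t ltac:(lra) e e0)[d d0 H]] := hP n.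
exists (Num.min d 1); first by rewrite lt_min d0 ltr01.
move=> s s0; rewrite lt_min nrmRB => /andP[sd s1].
have sn : s <= n%:R by move: s1; rewrite ltr_norml; lra.
have B x : 0 <= x -> x <= n%:R -> P (Num.bound x) x = P n x.
  by move=> x0 xn; apply: agree; rewrite ?x0 //= ltW // archi_boundP.
rewrite (B s s0 sn) (B t t0); last lra.
by rewrite -nrmRB; apply: H; rewrite ?nrmRB //= in_itv /= sn andbT.
Qed.

End HalfLine.

(** * The Laplace transform of the kernel *)

Section LebesgueKernel.
Context {R : realType}.
Local Notation rc := (real_complex R).
Local Notation mu := (@lebesgue_measure R).
Implicit Types (f g : R -> R) (K F : R -> R[i]) (D : set R).

Definition cintegrable D K : Prop :=
  mu.-integrable D (EFin \o (fun t => complex.Re (K t))) /\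
  mu.-integrable D (EFin \o (fun t => complex.Im (K t))).

Lemma Rint_itv_sub f (a b : R) : 0 <= a -> a <= b -> mu.-integrable `[0, b] (EFin \o f) ->
  (\int[mu]_(t in `[0, b]) f t) - (\int[mu]_(t in `[0, a]) f t) = \int[mu]_(t in `[a, b]) f t.
Proof.
move=> a0 ab fi; rewrite Rintegral_itvB ?bnd_simp // Rintegral_itv_obnd_cbnd //.
apply: integrableS fi => //; apply: subset_itv; rewrite bnd_simp //.
Qed.

Lemma cintegral_itv_sub K (a b : R) : 0 <= a -> a <= b -> cintegrable `[0, b] K ->
  cintegral `[0, b] K - cintegral `[0, a] K = cintegral `[a, b] K.
Proof.
move=> a0 ab [h1 h2]; rewrite /cintegral -(Rint_itv_sub a0 ab h1) -(Rint_itv_sub a0 ab h2).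
by [].
Qed.

Lemma cintegralM D (z : R[i]) K : measurable (D : set (measurableTypeR R)) -> cintegrable D K ->
  cintegral D (fun t => z * K t) = z * cintegral D K.
Proof.
move=> mD [h1 h2]; case: z => a b; rewrite /cintegral.
have i1 c : mu.-integrable D (EFin \o (fun t => c * complex.Re (K t))).
  by have := integrableZl mD c h1.
have i2 c : mu.-integrable D (EFin \o (fun t => c * complex.Im (K t))).
  by have := integrableZl mD c h2.
rewrite -[RHS]/((a * _ - b * _) +i* (a * _ + b * _)); congr (_ +i* _).
  rewrite -!RintegralZl // -RintegralB //; apply: eq_Rintegral => t _.
  by case: (K t).
rewrite -!RintegralZl // -RintegralD //; apply: eq_Rintegral => t _.
by case: (K t).
Qed.

Lemma cintegralB D K F : measurable (D : set (measurableTypeR R)) -> cintegrable D K -> cintegrable D F ->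
  cintegral D (fun t => K t - F t) = cintegral D K - cintegral D F.
Proof.
move=> mD [h1 h2] [h3 h4]; rewrite /cintegral.
rewrite -[RHS]/((_ - _) +i* (_ - _)); congr (_ +i* _).
  by rewrite -RintegralB //; apply: eq_Rintegral => t _; case: (K t) (F t) => ? ? [].
by rewrite -RintegralB //; apply: eq_Rintegral => t _; case: (K t) (F t) => ? ? [].
Qed.

Lemma cintegrableB D K F : measurable (D : set (measurableTypeR R)) -> cintegrable D K -> cintegrable D F ->
  cintegrable D (fun t => K t - F t).
Proof.
move=> mD [h1 h2] [h3 h4]; split.
  have := integrableB mD h1 h3; apply: eq_integrable => // t _ /=.
  by case: (K t) (F t) => ? ? [].
have := integrableB mD h2 h4; apply: eq_integrable => // t _ /=.
by case: (K t) (F t) => ? ? [].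
Qed.

Lemma cintegrableM D (z : R[i]) K : measurable (D : set (measurableTypeR R)) -> cintegrable D K ->
  cintegrable D (fun t => z * K t).
Proof.
move=> mD [h1 h2]; case: z => a b; split.
  have := integrableB mD (integrableZl mD a h1) (integrableZl mD b h2).
  by apply: eq_integrable => // t _ /=; case: (K t).
have := integrableD mD (integrableZl mD a h2) (integrableZl mD b h1).
by apply: eq_integrable => // t _ /=; case: (K t).
Qed.

Lemma nrm_cintegral_le D K g (eta : R) : measurable (D : set (measurableTypeR R)) -> 0 <= eta -> cintegrable D K ->
  mu.-integrable D (EFin \o g) -> (forall t, D t -> nrm (K t) <= eta * g t) ->
  nrm (cintegral D K) <= 2 * eta * \int[mu]_(t in D) g t.
Proof.
move=> mD e0 [h1 h2] gi hK.
have gi' : mu.-integrable D (EFin \o (fun t => eta * g t)) by have := integrableZl mD eta gi.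
have P f : mu.-integrable D (EFin \o f) -> (forall t, D t -> `|f t| <= eta * g t) ->
    `|\int[mu]_(t in D) f t| <= eta * \int[mu]_(t in D) g t.
  move=> fi hf; apply: le_trans (le_normr_Rintegral mD fi) _.
  rewrite -RintegralZl //; apply: le_Rintegral => //.
  have := integrable_abse fi; by apply: eq_integrable.
apply: le_trans (ler_nrm_ReIm _) _ => /=.
have := P _ h1 (fun t Dt => le_trans (ler_nrm_Re _) (hK t Dt)).
have := P _ h2 (fun t Dt => le_trans (ler_nrm_Im _) (hK t Dt)).
move=> k2 k1; apply: le_trans (lerD k1 k2) _.
by rewrite -[X in _ <= X]mulrA mulr_natl mulr2n.
Qed.

Lemma cont_measurable (p : R[i] -> R) (c : R -> R[i]^o) :
  (forall x y, p (x - y) = p x - p y) -> (forall z, `|p z| <= nrm z) ->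
  (forall t, cont rc setT c t) -> measurable_fun (setT : set (measurableTypeR R)) (p \o c : R -> R).
Proof.
move=> pB pn cc; apply: open_continuous_measurable_fun; first exact: openT.
move=> t _.
apply/cvgrPdist_le => e e0; have [d d0 H] := cc t e e0.
apply/nbhs_ballP; exists d => // s /= sd.
rewrite -pB; apply: le_trans (pn _) _; rewrite nrmB; apply: H => //.
by rewrite nrmRB distrC.
Qed.

Lemma cintegrable_scale (a b M : R) (c : R -> R[i]^o) K :
  (forall t, cont rc setT c t) -> (forall t, a <= t <= b -> nrm (c t) <= M) ->
  cintegrable `[a, b] K -> cintegrable `[a, b] (fun t => c t * K t).
Proof.
move=> cc cM [h1 h2].
have mc1 : measurable_fun (`[a, b] : set (measurableTypeR R)) ((@complex.Re R) \o c).
  apply: measurable_funS (cont_measurable _ ler_nrm_Re cc) => // x y.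
  exact: (raddfB (@complex.Re R : Rcomplex R -> R)).
have mc2 : measurable_fun (`[a, b] : set (measurableTypeR R)) ((@complex.Im R) \o c).
  apply: measurable_funS (cont_measurable _ ler_nrm_Im cc) => // x y.
  exact: (raddfB (@complex.Im R : Rcomplex R -> R)).
have bd (p : R[i] -> R) : (forall z, `|p z| <= nrm z) -> [bounded (p \o c) x | x in `[a, b]].
  move=> pn; exists M; split; first exact: num_real.
  move=> N MN t /=; rewrite in_itv /= => tab; apply: le_trans (pn _) _.
  by apply: le_trans (cM t tab) _; exact: ltW.
have mI : measurable (`[a, b] : set (measurableTypeR R)) by [].
split.
  have := integrableB mI (integrableMr mI mc1 (bd _ ler_nrm_Re) h1) (integrableMr mI mc2 (bd _ ler_nrm_Im) h2).
  by apply: eq_integrable => // t _ /=; case: (c t) (K t) => ? ? [].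
have := integrableD mI (integrableMr mI mc1 (bd _ ler_nrm_Re) h2) (integrableMr mI mc2 (bd _ ler_nrm_Im) h1).
by apply: eq_integrable => // t _ /=; case: (c t) (K t) => ? ? [].
Qed.

Section Parts.
Variable K : R -> R[i].
Hypothesis hK : locally_integrable_halfline K.
Local Notation Theta := (kernel_primitive K).

Lemma locint_itv (b : R) : cintegrable `[0, b] K.
Proof.
case: (leP 0 b) => b0; first exact: hK.
by split; rewrite set_itv_ge ?bnd_simp -?ltNge //; exact: integrable_set0.
Qed.

Lemma locint_sub (a b : R) : 0 <= a -> cintegrable `[a, b] K.
Proof.
move=> a0; have [h1 h2] := locint_itv b.
by split; [apply: integrableS h1|apply: integrableS h2] => //; apply: subset_itv; rewrite bnd_simp.
Qed.

Definition absK (t : R) : R := `|complex.Re (K t)| + `|complex.Im (K t)|.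
(** Its increments dominate those of [Theta] up to a factor 2, and it plays the part of a Stieltjes
    measure in [laplace_parts]. *)
Definition varK (t : R) : R := \int[mu]_(s in `[0, t]) absK s.

Lemma absK_int (a b : R) : 0 <= a -> mu.-integrable `[a, b] (EFin \o absK).
Proof.
move=> a0; have [h1 h2] := locint_sub b a0.
have mI : measurable (`[a, b] : set (measurableTypeR R)) by [].
have := integrableD mI (integrable_abse h1) (integrable_abse h2).
by apply: eq_integrable.
Qed.

Lemma varK_sub (a b : R) : 0 <= a -> a <= b ->
  varK b - varK a = \int[mu]_(s in `[a, b]) absK s.
Proof. by move=> a0 ab; apply: Rint_itv_sub => //; exact: absK_int. Qed.

Lemma varK_mono (a b : R) : 0 <= a -> a <= b -> varK a <= varK b.
Proof.
by move=> a0 ab; rewrite -subr_ge0 varK_sub // Rintegral_ge0 // => x _; rewrite addr_ge0.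
Qed.

Lemma varK_cont (t : R) : 0 <= t -> forall e : R, 0 < e -> exists2 d : R, 0 < d &
  forall s : R, 0 <= s -> `|s - t| < d -> `|varK s - varK t| <= e.
Proof.
move=> t0 e e0; have b0 : 0 <= t + 1 by lra.
have := parameterized_integral_continuous b0 (absK_int (t + 1) (lexx 0)).
move=> /subspace_continuousP /(_ t) /=; rewrite in_itv /= => /(_ ltac:(lra)).
move=> /cvgrPdist_le /(_ e e0); rewrite near_withinE => /nbhs_ballP[d /= d0 H].
exists (Num.min d 1); first by rewrite lt_min d0 ltr01.
move=> s s0; rewrite lt_min => /andP[sd s1].
have := H s; rewrite /ball /= distrC => /(_ sd); rewrite in_itv /=.
move: s1; rewrite ltr_norml => s1 /(_ ltac:(lra)); by rewrite distrC.
Qed.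

Lemma nrm_absK t : nrm (K t) <= absK t.
Proof. exact: ler_nrm_ReIm. Qed.

Lemma Theta_sub (a b : R) : 0 <= a -> a <= b -> Theta b - Theta a = cintegral `[a, b] K.
Proof. by move=> a0 ab; apply: cintegral_itv_sub => //; exact: locint_itv. Qed.

Lemma Theta0 : Theta 0 = 0.
Proof. by rewrite /kernel_primitive /cintegral set_itv1 !Rintegral_set1. Qed.

Lemma Theta_var (a b : R) : 0 <= a -> a <= b ->
  nrm (Theta b - Theta a) <= 2 * (varK b - varK a).
Proof.
move=> a0 ab; rewrite Theta_sub // varK_sub // -[2]mulr1.
apply: nrm_cintegral_le => //; [exact: locint_sub|exact: absK_int|].
by move=> t _; rewrite mul1r; exact: nrm_absK.
Qed.

Lemma Theta_cont (t : R) : 0 <= t -> cont rc halfline (Theta : R -> R[i]^o) t.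
Proof.
move=> t0 e e0; have e2 : 0 < e / 2 by rewrite divr_gt0.
have [d d0 H] := varK_cont t0 e2; exists d => // s s0; rewrite nrmRB => /(H s s0) h.
have A (x y : R) : x - y <= `|x - y| by exact: ler_norm.
case: (leP s t) => st.
  rewrite [nrm _]nrmB; apply: le_trans (Theta_var s0 st) _.
  by rewrite distrC in h; have := A (varK t) (varK s); lra.
apply: le_trans (Theta_var t0 (ltW st)) _.
have := A (varK s) (varK t); lra.
Qed.

Variable l : R[i].
Local Notation c := (fun t : R => cexp (- (l * t%:C)) : R[i]^o).

Lemma c_der D (t : R) : der rc D c t (- l * c t).
Proof.
have := der_cexp_line D (- l) t; have -> : (fun t0 : R => cexp (t0%:C * - l) : R[i]^o) = c.
  by apply: funext => s; rewrite mulrN mulrC.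
by rewrite mulrN (mulrC t%:C).
Qed.

Lemma nrm_c (t : R) : nrm (c t : R[i]) = expR (- (complex.Re l * t)).
Proof. by rewrite nrm_cexp; case: l => a b /=; rewrite mulr0 subr0. Qed.

Lemma cK_int (a b : R) : 0 <= a -> cintegrable `[a, b] (fun t => c t * K t).
Proof.
move=> a0; apply: (@cintegrable_scale _ _ (expR (`|complex.Re l| * `|b|))); last exact: locint_sub.
  by move=> t; exact: der_cont (c_der _ _).
move=> t tab; rewrite [nrm _]nrm_c ler_expR.
apply: le_trans (ler_norm _) _; rewrite normrN normrM ler_wpM2l //.
by rewrite !ger0_norm; lra.
Qed.

Lemma cK_locint : locally_integrable_halfline (fun t => c t * K t).
Proof. by move=> T T0; exact: cK_int. Qed.

(** Integration by parts against [Theta], an indefinite Lebesgue integral. The defect [U] vanishes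
    at 0, and its increment over a short interval is at most 2 ep times that of [varK] plus o(y -
    x); [mvt_gen] sums these up, and [ep] is arbitrary. *)
Lemma laplace_parts : exists P : R -> R[i]^o, [/\ P 0 = 0,
  forall t, 0 <= t -> der rc halfline P t (c t * Theta t) &
  forall T, 0 <= T -> laplace_upto K l T = c T * Theta T + l * P T].
Proof.
have [P [P0 hP]] : exists P : R -> R[i]^o, P 0 = 0 /\ forall t : R, 0 <= t -> der rc halfline P t (c t *: (Theta t : R[i]^o)).
  apply: (prim_halfline (@complex_complete R)) => t t0.
  by apply: contS; [exact: der_cont (c_der _ _)|exact: Theta_cont].
exists P; split => // T T0.
pose J t := cintegral `[0, t] (fun t => c t * K t).
pose U t : R[i]^o := J t - c t * Theta t - l * P t.
have U0 : U 0 = 0.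
  rewrite /U P0 Theta0 !mulr0 !subr0 /J /cintegral set_itv1 !Rintegral_set1 //.
have key (ep : R) : 0 < ep -> nrm (U T - U 0) <= 2 * ep * varK T - 2 * ep * varK 0.
  move=> ep0; apply: (@mvt_gen R (R[i]^o : normedModType R[i]) U (fun t => 2 * ep * varK t) 0 T T0).
  move=> x0 hx0 e e0.
  have x00 : 0 <= x0 by case/andP: hx0.
  (* Collects the coefficients of the three error terms [B2], [B3] and [B4], each proportional to
     [eta * (y - x)]. *)
  pose M := nrm (Theta x0 : R[i]) + nrm l + nrm (l * c x0 : R[i]) + 2.
  have M0 : 0 < M by rewrite /M ltr_wpDl // !addr_ge0 ?nrm_ge0.
  have eM : 0 < Num.min 1 (e / (3 * M)) by rewrite lt_min ltr01 divr_gt0 // mulr_gt0.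
  set eta := Num.min 1 (e / (3 * M)) in eM.
  have etaM : eta * (3 * M) <= e by rewrite -ler_pdivlMr ?mulr_gt0 // ge_min lexx orbT.
  have eta1 : eta <= 1 by rewrite ge_min lexx.
  clearbody eta.
  have ep2 : 0 < ep / 2 by rewrite divr_gt0.
  have [d1 d10 H1] := der_straddle (c_der halfline x0) eM.
  have [d2 d20 H2] := der_straddle (hP x0 x00) eM.
  have [d3 d30 H3] := Theta_cont x00 eM.
  have [d4 d40 H4] := der_cont (c_der halfline x0) ep2.
  exists (Num.min (Num.min d1 d2) (Num.min d3 d4)); first by rewrite !lt_min d10 d20 d30.
  move=> x y hx xx0 x0y yT; rewrite !lt_min => /andP[/andP[s1 s2] /andP[s3 s4]].
  have xy : x <= y := le_trans xx0 x0y; have hy : 0 <= y := le_trans hx xy.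
  have K1 := H1 x y hx hy xx0 x0y s1.
  have K2 := H2 x y hx hy xx0 x0y s2.
  have K3 := H3 x hx ltac:(rewrite nrmRB abs_le //; clear -s3 x0y; lra).
  have K4 z : x <= z -> z <= y -> nrm (c z - c y : R[i]) <= ep.
    move=> xz zy.
    have q1 := H4 z (le_trans hx xz) ltac:(rewrite nrmRB ltr_norml; clear -s4 xz zy xx0 x0y; lra).
    have q2 := H4 y hy ltac:(rewrite nrmRB ltr_norml; clear -s4 xy xx0 x0y; lra).
    have := nrm_tri (c x0 : R[i]) (c z) (c y); rewrite (nrmB (c x0 : R[i])).
    move=> q3; apply: le_trans q3 _; rewrite [leRHS]splitr; exact: lerD.
  (* On a short interval [c] is nearly constant, so the Laplace integral grows nearly by [c y] times
     the increment of [Theta]; the error is measured by ep and |K|. *)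
  have JE : J y - J x - c y * (Theta y - Theta x) = cintegral `[x, y] (fun s => (c s - c y) * K s).
    rewrite (cintegral_itv_sub hx xy (cK_int y (lexx 0))) (Theta_sub hx xy).
    have mI : measurable (`[x, y] : set (measurableTypeR R)) by [].
    rewrite -(cintegralM _ mI (locint_sub y hx)) -cintegralB //; last 2 first.
      exact: cK_int. exact: cintegrableM (locint_sub y hx).
    by congr cintegral; apply: funext => s; rewrite mulrBl.
  have J1 : nrm (J y - J x - c y * (Theta y - Theta x)) <= 2 * ep * (varK y - varK x).
    rewrite JE varK_sub //; apply: nrm_cintegral_le => //; first exact: ltW.
    - have mI : measurable (`[x, y] : set (measurableTypeR R)) by [].
      have := cintegrableB mI (cK_int y hx) (cintegrableM (c y) mI (locint_sub y hx)).
      by congr cintegrable; apply: funext => s; rewrite mulrBl.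
    - exact: absK_int.
    - move=> t /=; rewrite in_itv /= => /andP[t1 t2]; rewrite nrmM.
      by apply: ler_pM; rewrite ?nrm_ge0 ?K4 ?nrm_absK.
  have UE : U y - U x = (J y - J x - c y * (Theta y - Theta x))
     - ((c y - c x - (y - x)%:C * (- l * c x0)) * Theta x)
     + ((y - x)%:C * (l * c x0)) * (Theta x - Theta x0)
     - l * (P y - P x - (y - x)%:C * (c x0 * Theta x0)).
    by rewrite /U; ring.
  have yx0 : 0 <= y - x by rewrite subr_ge0.
  rewrite UE; set A1 := J y - J x - _ in J1 *.
  move: K1 K2 K3; rewrite !regE; set A2 := c y - c x - _; set A4 := P y - P x - _ => K1 K2 K3.
  have nTx : nrm (Theta x : R[i]) <= nrm (Theta x0 : R[i]) + 1.
    by have := nrm_sub_le (Theta x : R[i]) (Theta x0); move: K3; rewrite [X in X <= _](_ : _ = nrm (Theta x - Theta x0 : R[i])) //; clear -eta1; lra.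
  have B2 : nrm (A2 * Theta x : R[i]) <= eta * (y - x) * (nrm (Theta x0 : R[i]) + 1).
    by rewrite nrmM; apply: ler_pM; rewrite ?nrm_ge0.
  have B3 : nrm (((y - x)%:C * (l * c x0)) * (Theta x - Theta x0) : R[i]) <= (y - x) * nrm (l * c x0 : R[i]) * eta.
    by rewrite nrmM; apply: ler_pM; rewrite ?nrm_ge0 // nrmM nrmC ger0_norm.
  have B4 : nrm (l * A4 : R[i]) <= nrm l * (eta * (y - x)).
    by rewrite nrmM ler_wpM2l ?nrm_ge0.
  have : nrm (A1 - A2 * Theta x + ((y - x)%:C * (l * c x0)) * (Theta x - Theta x0) - l * A4 : R[i])
     <= 2 * ep * (varK y - varK x) + eta * (y - x) * (nrm (Theta x0 : R[i]) + 1) +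
        (y - x) * nrm (l * c x0 : R[i]) * eta + nrm l * (eta * (y - x)).
    apply: le_trans (ler_nrmB _ _) _; rewrite lerD //.
    apply: le_trans (ler_nrmD _ _) _; rewrite lerD //.
    apply: le_trans (ler_nrmB _ _) _; rewrite lerD //.
  move=> h; apply: le_trans h _.
  have eyx : (y - x) * (eta * (3 * M)) <= (y - x) * e by rewrite ler_wpM2l.
  have : 0 <= (y - x) * eta * M by rewrite !mulr_ge0 // ltW.
  have m1 : eta * (y - x) * (nrm (Theta x0 : R[i]) + 1) + (y - x) * nrm (l * c x0 : R[i]) * eta + nrm l * (eta * (y - x)) <= (y - x) * eta * M.
    rewrite /M; have : 0 <= (y - x) * eta by rewrite mulr_ge0 // ltW.
    by clear; lra.
  by clear -eyx m1; lra.
have : U T = 0.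
  apply: (@nrm_le_eps _ _ _ (2 * (varK T - varK 0))) => ep /key.
  by rewrite U0 subr0 => /le_trans; apply; lra.
rewrite /U -/(laplace_upto K l T) => /eqP; rewrite subr_eq0 subr_eq => /eqP; rewrite addrC.
by [].
Qed.

End Parts.
End LebesgueKernel.

Section KernelLaplace.
Context {R : realType}.
Local Notation rc := (real_complex R).
Local Notation mu := (@lebesgue_measure R).
Variable K : R -> R[i].
Hypothesis hK : locally_integrable_halfline K.
Local Notation Theta := (kernel_primitive K).

(** Lebesgue differentiation of [f] cut off to [0, n]: the primitive is constantly 0, hence so is
    its derivative, which is the function almost everywhere. *)
Lemma ae_zero_of_primitive (f : R -> R) :
  (forall T : R, 0 <= T -> mu.-integrable `[0, T] (EFin \o f)) ->
  (forall T : R, 0 <= T -> \int[mu]_(t in `[0, T]) f t = 0) ->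
  {ae mu, forall t : R, 0 <= t -> f t = 0}.
Proof.
move=> fi f0.
have H (n : nat) : {ae mu, forall t : R, 0 <= t -> t <= n%:R -> f t = 0}.
  pose g := f \_ `[0, n%:R].
  have mI : measurable (`[0, n%:R] : set (measurableTypeR R)) by [].
  have gl : locally_integrable setT g := integrable_locally mI (fi n%:R (ler0n _ _)).
  have gE : EFin \o g = (EFin \o f) \_ `[0, n%:R].
    by apply: funext => t; rewrite /g /= !patchE; case: ifP.
  (* The integrals start at -1, so that the differentiation theorem also covers [t = 0]. *)
  have gi (y : R) : mu.-integrable [set` Interval (BLeft (-1)) (BRight y)] (EFin \o g).
    have mJ : measurable ([set` Interval (BLeft (-1)) (BRight y)] : set (measurableTypeR R)) by [].
    apply: (@integrableS _ _ _ _ setT) => //.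
    by rewrite gE -integrable_mkcond //; exact: fi.
  have G0 (y : R) : \int[mu]_(t in [set` Interval (BLeft (-1)) (BRight y)]) g t = 0.
    rewrite -Rintegral_mkcondr.
    have -> : ([set` Interval (BLeft (-1)) (BRight y)] `&` `[0, n%:R])%classic = `[0, Num.min y n%:R]%classic.
      by apply/seteqP; split=> t /=; rewrite !in_itv /= le_min; [move=> [/andP[_ ->] /andP[-> ->]]|move=> /and3P[t0 -> ->]; split => //; rewrite ?t0 //; lra].
    case: (leP 0 (Num.min y n%:R)) => h; first exact: f0.
    by rewrite set_itv_ge ?Rintegral_set0 // bnd_simp -ltNge.
  have := FTC1 gi gl; apply: filterS; first exact: (ae_filter_ringOfSetsType mu).
  move=> t ht t0 tn.
  have [_] := ht ltac:(rewrite lte_fin /=; lra).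
  have -> : (fun x => \int[mu]_(t0 in [set` Interval (BLeft (-1)) (BRight x)]) g t0)%R = cst 0.
    by apply: funext => y; exact: G0.
  rewrite derive1_cst /g patchE mem_set //= in_itv /= t0 tn.
  by [].
have := ae_foralln H; apply: filterS => t ht t0; apply: (ht (Num.bound t)) => //.
by rewrite ltW // archi_boundP.
Qed.

Lemma zero_kernel_of_primitive : (forall t : R, 0 <= t -> Theta t = 0) -> zero_kernel K.
Proof.
move=> T0.
have hre : {ae mu, forall t : R, 0 <= t -> complex.Re (K t) = 0}.
  apply: ae_zero_of_primitive => T hT; first by have [] := hK hT.
  by have := T0 T hT => /(congr1 (@complex.Re R)).
have him : {ae mu, forall t : R, 0 <= t -> complex.Im (K t) = 0}.
  apply: ae_zero_of_primitive => T hT; first by have [] := hK hT.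
  by have := T0 T hT => /(congr1 (@complex.Im R)).
have F : Filter (almost_everywhere mu) by exact: (ae_filter_ringOfSetsType mu).
rewrite /zero_kernel; apply: filterS2 hre him => t h1 h2 t0.
by have := h1 t0; have := h2 t0; case: (K t) => a b /= -> ->.
Qed.

Lemma der_expR (D : set R) (a c t : R) :
  der rc D (fun s => (c * expR (a * s))%:C : R[i]^o) t ((c * (a * expR (a * t)))%:C : R[i]^o).
Proof.
apply: is_derive_der; apply: is_derive_eq.
by rewrite /GRing.scale /=; ring.
Qed.

Lemma mvt_exp {E : normedModType R[i]} (D : set R) (f f' : R -> E) (M a x y : R) :
  x <= y -> a != 0 -> (forall t, x <= t <= y -> D t) ->
  (forall t, x <= t <= y -> der rc D f t (f' t)) ->
  (forall t, x <= t <= y -> nrm (f' t) <= M * expR (a * t)) ->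
  nrm (f y - f x) <= M / a * expR (a * y) - M / a * expR (a * x).
Proof.
move=> xy a0 hD hf hM.
apply: (@mvt R E f f' (fun t => M / a * expR (a * t)) (fun t => M * expR (a * t)) D) => // t _.
by apply: der_eq (der_expR D a (M / a) t); rewrite mulrA divfK.
Qed.

Lemma varK_bound (T X : R) : 0 <= T -> T <= X -> nrm (Theta T) <= 2 * varK K X.
Proof.
move=> T0 TX; have v0 : varK K 0 = 0 by rewrite /varK set_itv1 Rintegral_set1.
have := Theta_var hK (lexx 0) T0; rewrite (Theta0 K) subr0 v0 subr0 => h.
by apply: le_trans h _; rewrite ler_wpM2l // varK_mono.
Qed.

End KernelLaplace.

Section KernelLaplace2.
Context {R : realType}.
Local Notation rc := (real_complex R).
Variable K : R -> R[i].
Hypothesis hK : locally_integrable_halfline K.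
Local Notation Theta := (kernel_primitive K).

Lemma laplace_upto_bounded (l : R[i]) : laplace_exists K l ->
  exists M : R, 0 <= M /\ forall T : R, 0 <= T -> nrm (laplace_upto K l T : R[i]) <= M.
Proof.
move=> /cvgrPdist_le /(_ 1 ltr01)[X [_ hX]].
set v := lim _ in hX.
have hK0 := cK_locint hK l.
pose X' := Num.max 0 (X + 1).
exists (2 * varK (fun t => cexp (- (l * t%:C)) * K t) X' + (nrm (v : R[i]) + 1)).
have p1 : 0 <= 2 * varK (fun t => cexp (- (l * t%:C)) * K t) X'.
  have X'0 : 0 <= X' by rewrite le_max lexx.
  by apply: le_trans (nrm_ge0 _) (varK_bound hK0 (lexx 0) X'0).
have p2 : 0 <= nrm (v : R[i]) + 1 by rewrite addr_ge0 ?nrm_ge0.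
split => [|T T0]; first exact: addr_ge0.
case: (leP T X') => TX.
  by apply: le_trans (varK_bound hK0 T0 TX) _; rewrite lerDl.
have TX1 : X < T by apply: lt_trans TX; rewrite lt_max ltrDl ltr01 orbT.
have := hX T TX1; rewrite /= nrmE -[1]/((1 : R)%:C) lecR nrmB => h.
have := nrm_sub_le (laplace_upto K l T : R[i]) v.
rewrite -[nrm (laplace_upto K l T - v : R[i]^o)]/(nrm (laplace_upto K l T - v : R[i])) in h; lra.
Qed.

Variable omega : R.
Hypothesis omega_ge : (maxe 0 (laplace_abs K) <= omega%:E)%E.

Lemma omega_ge0 : 0 <= omega.
Proof. by move: omega_ge; rewrite ge_max => /andP[]; rewrite lee_fin. Qed.

(** To the left of [a] there is an [l] at which the Laplace integral converges, perhaps only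
    conditionally, so its partial integrals are bounded. [Theta] is recovered from them by
    [laplace_parts] for the kernel e^{-l t} K at the exponent [- l], at the price of a factor e^{a
    t}. *)
Lemma Theta_exp_bound (a : R) : omega < a ->
  exists M : R, 0 <= M /\ forall t : R, 0 <= t -> nrm (Theta t) <= M * expR (a * t).
Proof.
move=> oa; have o0 := omega_ge0; have a0 : 0 < a by lra.
have habs : (laplace_abs K < a%:E)%E.
  move: omega_ge; rewrite ge_max => /andP[_ h]; apply: le_lt_trans h _.
  by rewrite lte_fin.
have [_ [l hl <-]] := ereal_inf_lt habs; rewrite lte_fin => la.
have [M [M0 hM]] := laplace_upto_bounded hl.
have hK0 := cK_locint hK l.
have [P [P0 hP hE]] := laplace_parts hK0 (- l).
have cc (t : R) : nrm (cexp (- (- l * t%:C)) : R[i]) <= expR (a * t) \/ t < 0.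
  case: (ltP t 0) => t0; [by right|left].
  rewrite nrm_cexp; case: (l) la => b c /= ba.
  by rewrite ler_expR; rewrite mulr0 subr0 mulNr opprK; nra.
exists (M + nrm l * (M / a)); split.
  by rewrite addr_ge0 // mulr_ge0 ?nrm_ge0 // divr_ge0 // ltW.
move=> t t0.
have -> : Theta t = cexp (- (- l * t%:C)) * laplace_upto K l t + - l * P t.
  rewrite -(hE t t0) /laplace_upto /kernel_primitive; congr cintegral; apply: funext => s.
  by rewrite mulrA -cexpD mulNr opprK subrr cexp0 mul1r.
have ct : nrm (cexp (- (- l * t%:C)) : R[i]) <= expR (a * t) by case: (cc t) => //; lra.
have Pt : nrm (P t : R[i]) <= M / a * expR (a * t).
  have := @mvt_exp R (R[i]^o) halfline P _ M a 0 t t0 ltac:(by rewrite gt_eqF) (fun s hs => (andP hs).1) (fun s hs => hP s (andP hs).1).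
  rewrite P0 subr0 mulr0 expR0 mulr1 => h.
  apply: le_trans (h _) _; last by rewrite gerBl divr_ge0 // ltW.
  move=> s /andP[s0 _]; rewrite [X in X <= _](nrmM (cexp (- (- l * s%:C))) _) mulrC.
  apply: ler_pM; rewrite ?nrm_ge0 //; first exact: hM.
  by case: (cc s) => //; lra.
apply: le_trans (ler_nrmD _ _) _; rewrite mulrDl lerD // nrmM.
  by rewrite mulrC; apply: ler_pM; rewrite ?nrm_ge0 ?hM.
by rewrite nrmN -mulrA ler_wpM2l ?nrm_ge0.
Qed.

Definition is_Lap (f : R -> R[i]^o) (l : R[i]) (v : R[i]^o) : Prop :=
  exists P : R -> R[i]^o, [/\ P 0 = 0,
    forall t : R, 0 <= t -> der rc halfline P t (cexp (- (l * t%:C)) *: f t) &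
    lim_infty P v].

(** The limit of [laplace_parts]: with [a] strictly between [omega] and Re l, the boundary term is
    O(e^{(a - Re l) T}). The possibly conditional integral of [K] is thereby traded for the
    transform of a continuous function of controlled growth. *)
Lemma laplaceE (l v : R[i]) : omega < complex.Re l ->
  is_Lap (Theta : R -> R[i]^o) l v -> laplace K l = l * v.
Proof.
move=> ol [P [P0 hP hlim]].
have [P' [P'0 hP' hE]] := laplace_parts hK l.
have PP t : 0 <= t -> P' t = P t.
  move=> t0; apply/eqP; rewrite -subr_eq0 -(subrr (0 : R[i]^o)) -{1}P'0 -P0; apply/eqP.
  apply: (@der0_cst R (R[i]^o : normedModType R[i]) (fun t => P' t - P t) halfline 0 t t0).
    by move=> c /andP[].
  move=> c /andP[c0 _]; rewrite -(subrr (cexp (- (l * c%:C)) * Theta c)).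
  by apply: derB; [exact: hP'|exact: hP].
pose a := (omega + complex.Re l) / 2.
have [M [M0 hM]] := Theta_exp_bound (a := a) ltac:(rewrite /a; lra).
rewrite /laplace; apply: (@cvg_lim (R[i]^o)); first exact: norm_hausdorff.
apply/cvgrPdist_le => e e0.
have eE : e = (complex.Re e)%:C by rewrite RRe_real // gtr0_real.
have e1 : 0 < complex.Re e by move: e0; rewrite eE -[0]/((0:R)%:C) ltcR.
have l1 : 0 < nrm l + 1 by rewrite ltr_wpDl ?nrm_ge0.
have e2 : 0 < complex.Re e / 2 by rewrite divr_gt0.
have [X1 h1] := hlim _ (divr_gt0 e2 l1).
pose d := complex.Re l - a.
have d0 : 0 < d by rewrite /d /a; lra.
have [X2 [_ h2]] := expRN_small M0 e2.
exists (Num.max (Num.max 0 X1) (X2 / d)); split; first exact: num_real.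
move=> T; rewrite !gt_max => /andP[/andP[T0 T1] T2].
rewrite nrmE eE lecR (hE T (ltW T0)) (PP T (ltW T0)).
have k1 := h1 T (ltW T1).
have k2 := h2 (d * T) ltac:(by rewrite mulrC -ler_pdivrMr // ltW).
have n1 : nrm (cexp (- (l * T%:C)) * Theta T : R[i]) <= complex.Re e / 2.
  apply: le_trans k2; rewrite nrmM nrm_cexp mulrC.
  apply: le_trans (_ : M * expR (a * T) * expR (- (complex.Re l * T)) <= _).
    apply: ler_pM; rewrite ?nrm_ge0 ?expR_ge0 ?hM ?(ltW T0) // ler_expR.
    by case: (l) => b c /=; rewrite mulr0 subr0.
  by rewrite -mulrA -expRD ler_wpM2l // ler_expR /d; lra.
have n2 : nrm (l * (P T - v) : R[i]) <= complex.Re e / 2.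
  rewrite nrmM; move: k1; rewrite ler_pdivlMr // mulrC; apply: le_trans.
  by rewrite ler_wpM2r ?nrm_ge0 // lerDl.
rewrite nrmB [complex.Re e]splitr.
have -> : cexp (- (l * T%:C)) * Theta T + l * P T - l * v = cexp (- (l * T%:C)) * Theta T + l * (P T - v).
  by ring.
by apply: le_trans (ler_nrmD _ _) _; exact: lerD.
Qed.

End KernelLaplace2.

(** * Laplace transforms of continuous functions of exponential growth *)

Section Transform.
Context {R : realType}.
Local Notation rc := (real_complex R).
Implicit Types (f : R -> R[i]^o) (l k : R[i]) (a M : R).

Definition exp_class a M f : Prop := [/\ 0 <= M, forall t : R, 0 <= t -> cont rc halfline f t &
  forall t : R, 0 <= t -> nrm (f t : R[i]) <= M * expR (a * t)].

Local Notation cc l := (fun t : R => cexp (- (l * t%:C)) : R[i]^o).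

Lemma nrm_cc l (t : R) : nrm (cexp (- (l * t%:C)) : R[i]) = expR (- (complex.Re l * t)).
Proof. by rewrite nrm_cexp; case: l => a b /=; rewrite mulr0 subr0. Qed.

Lemma lap_integrand_le a M f l (t : R) : exp_class a M f -> 0 <= t ->
  nrm (cexp (- (l * t%:C)) *: f t : R[i]^o) <= M * expR ((a - complex.Re l) * t).
Proof.
move=> [M0 _ hM] t0; rewrite nrmZ nrm_cc.
apply: le_trans (_ : expR (- (complex.Re l * t)) * (M * expR (a * t)) <= _).
  by rewrite ler_wpM2l ?expR_ge0 ?hM.
by rewrite mulrCA -expRD ler_wpM2l // ler_expR; lra.
Qed.

Definition is_Lapint f l (P : R -> R[i]^o) : Prop := P 0 = 0 /\
  forall t : R, 0 <= t -> der rc halfline P t (cexp (- (l * t%:C)) *: f t).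

Lemma lapint_ex a M f l : exp_class a M f -> exists P, is_Lapint f l P.
Proof.
move=> [_ fc _]; apply: (prim_halfline (@complex_complete R)) => t t0.
by apply: contS; [exact: der_cont (c_der l _ _)|exact: fc].
Qed.

Lemma lapint_le a M f l P (x y : R) : exp_class a M f -> a < complex.Re l ->
  is_Lapint f l P -> 0 <= x -> x <= y ->
  nrm (P y - P x) <= M / (complex.Re l - a) * expR ((a - complex.Re l) * x).
Proof.
move=> hf al [P0 hP] x0 xy; have [M0 _ _] := hf.
have d0 : 0 < complex.Re l - a by lra.
have := @mvt_exp R (R[i]^o) halfline P _ M (a - complex.Re l) x y xy _ _
  (fun t ht => hP t (le_trans x0 (andP ht).1)).
have an0 : a - complex.Re l != 0 by lra.
move=> /(_ an0 (fun t ht => le_trans x0 (andP ht).1)) h; apply: le_trans (h _) _.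
  by move=> t /andP[xt _]; apply: lap_integrand_le => //; exact: le_trans xt.
have -> : M / (a - complex.Re l) = - (M / (complex.Re l - a)).
  by rewrite -[a - _]opprB invrN mulrN.
rewrite !mulNr opprK addrC gerBl mulr_ge0 ?expR_ge0 //.
by rewrite divr_ge0 // ltW.
Qed.

Lemma exp_lim (C b e : R) : 0 <= C -> 0 < b -> 0 < e -> exists2 X : R, 0 <= X &
  forall x, X <= x -> C * expR (- b * x) <= e.
Proof.
move=> C0 b0 e0; have [X [X0 hX]] := expRN_small C0 e0; exists (X / b).
  by rewrite divr_ge0 // ltW.
by move=> x hx; rewrite mulNr; apply: hX; rewrite mulrC -ler_pdivrMr.
Qed.

Lemma Lap_ex a M f l : exp_class a M f -> a < complex.Re l ->
  exists v P, [/\ is_Lapint f l P, lim_infty P v &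
    forall T : R, 0 <= T -> nrm (v - P T : R[i]^o) <= M / (complex.Re l - a) * expR ((a - complex.Re l) * T)].
Proof.
move=> hf al; have [M0 _ _] := hf; have [P hP] := lapint_ex l hf.
have d0 : 0 < complex.Re l - a by lra.
have C0 : 0 <= M / (complex.Re l - a) by rewrite divr_ge0 // ltW.
have natbig (X : R) : exists n : nat, X <= n%:R.
  by exists (Num.bound `|X|); rewrite (le_trans (ler_norm _)) // ltW // archi_boundP.
have [|v hv] := @complex_complete R (fun n => P n%:R).
  move=> e e0; have e2 : 0 < e / 2 by rewrite divr_gt0.
  have [X X0 hX] := exp_lim C0 d0 e2; have [N hN] := natbig X.
  have K (m : nat) : (N <= m)%N -> nrm (P m%:R - P N%:R) <= e / 2.
    move=> Nm; apply: le_trans (lapint_le hf al hP (ler0n _ _) _) _; first by rewrite ler_nat.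
    by have := hX _ hN; rewrite opprB.
  exists N => m n /K h1 /K h2.
  have := nrm_tri (P N%:R) (P m%:R) (P n%:R); rewrite (nrmB (P N%:R) (P n%:R)); lra.
have key (T : R) : 0 <= T -> nrm (v - P T) <= M / (complex.Re l - a) * expR ((a - complex.Re l) * T).
  move=> T0; apply/ler_addgt0Pl => e e0; have [N hN] := hv _ e0.
  have [m hm] := natbig T; have := hN (maxn N m) (leq_maxl _ _).
  have h2 : T <= (maxn N m)%:R by apply: le_trans hm _; rewrite ler_nat leq_maxr.
  have := lapint_le hf al hP T0 h2.
  have := nrm_tri (P (maxn N m)%:R) v (P T); rewrite (nrmB v (P (maxn N m)%:R)); lra.
exists v, P; split => // e e0; have [X X0 hX] := exp_lim C0 d0 e0.
exists X => x hx; rewrite nrmB; apply: le_trans (key x (le_trans X0 hx)) _.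
by have := hX _ hx; rewrite opprB.
Qed.

Definition Lap f l : R[i]^o := xget 0 [set v | is_Lap f l v].

Lemma is_Lap_uniq f l v w : is_Lap f l v -> is_Lap f l w -> v = w.
Proof.
move=> [P [P0 hP hv]] [Q [Q0 hQ hw]].
apply: (lim_infty_uniq hv); apply: lim_infty_near hw _ => e e0; exists 0 => x x0.
rewrite (_ : P x - Q x = 0) ?nrm0 ?(ltW e0) // -(subrr (0 : R[i]^o)) -{1}P0 -Q0.
apply: (@der0_cst R (R[i]^o : normedModType R[i]) (fun t => P t - Q t) halfline 0 x x0).
  by move=> c /andP[].
move=> c /andP[c0 _]; rewrite -(subrr (cexp (- (l * c%:C)) *: f c)).
by apply: derB; [exact: hP|exact: hQ].
Qed.

Lemma LapP a M f l : exp_class a M f -> a < complex.Re l -> is_Lap f l (Lap f l).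
Proof.
move=> hf al; have [v [P [[P0 hP] hv _]]] := Lap_ex hf al.
have h : is_Lap f l v by exists P.
by rewrite /Lap; case: xgetP => [x _ //|/(_ v)].
Qed.

Lemma lim_infty_exp_le (P p : R -> R[i]^o) v (C b : R) : 0 < b -> 0 <= C -> P 0 = 0 ->
  (forall t : R, 0 <= t -> der rc halfline P t (p t)) ->
  (forall t : R, 0 <= t -> nrm (p t : R[i]^o) <= C * expR (- b * t)) ->
  lim_infty P v -> nrm (v : R[i]^o) <= C / b.
Proof.
move=> b0 C0 P0 hP hp hv; rewrite -[v]subr0; apply: (lim_infty_le (X := 0) hv) => x x0.
rewrite -P0; have := @mvt_exp R (R[i]^o) halfline P p C (- b) 0 x x0 _ _
  (fun t ht => hP t (andP ht).1) (fun t ht => hp t (andP ht).1).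
have bn : - b != 0 by lra.
move=> /(_ bn (fun t ht => (andP ht).1)) /le_trans; apply.
rewrite mulr0 expR0 mulr1 invrN mulrN mulNr opprK addrC gerBl.
by rewrite mulr_ge0 ?expR_ge0 // divr_ge0 // ltW.
Qed.

Lemma is_Lap_lim f g l m (c : R[i]) (v w : R[i]^o) : is_Lap f l v -> is_Lap g m w ->
  exists Q : R -> R[i]^o, [/\ Q 0 = 0,
   (forall t : R, 0 <= t -> der rc halfline Q t (c *: (cexp (- (l * t%:C)) *: f t) + cexp (- (m * t%:C)) *: g t)) &
   lim_infty Q (c *: v + w)].
Proof.
move=> [P [P0 hP hv]] [Q [Q0 hQ hw]]; exists (fun t => c *: P t + Q t); split.
- by rewrite P0 Q0 scaler0 addr0.
- by move=> t t0; apply: derD; [apply: derZ; exact: hP|exact: hQ].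
- exact: lim_inftyZD.
Qed.

Lemma Lap_norm a M f l : exp_class a M f -> a < complex.Re l ->
  nrm (Lap f l : R[i]^o) <= M / (complex.Re l - a).
Proof.
move=> hf al; have [P [P0 hP hv]] := LapP hf al; have [M0 _ _] := hf.
apply: (@lim_infty_exp_le P _ _ _ (complex.Re l - a) _ _ P0 hP) hv => //; first lra.
by move=> t t0; rewrite opprB; exact: lap_integrand_le.
Qed.

Definition tmul f : R -> R[i]^o := fun t => t%:C *: f t.

Lemma tmul_class a a' M f : a < a' -> exp_class a M f ->
  exp_class a' (M / (a' - a)) (tmul f).
Proof.
move=> aa [M0 fc fM]; have d0 : 0 < a' - a by lra.
split; first by rewrite divr_ge0 // ltW.
  by move=> t t0; apply: contS; [exact: der_cont (der_id _ _ _)|exact: fc].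
move=> t t0; rewrite (nrmM t%:C (f t)) nrmC ger0_norm //.
apply: le_trans (_ : t * (M * expR (a * t)) <= _); first by rewrite ler_wpM2l // fM.
have -> : a' * t = a * t + (a' - a) * t by ring.
rewrite expRD mulrCA -mulrA ler_wpM2l // mulrCA [X in X <= _]mulrC ler_wpM2l ?expR_ge0 //.
by rewrite ler_pdivlMl //; have := expR_ge1Dx ((a' - a) * t); lra.
Qed.

Lemma sq_le_exp (d t : R) : 0 < d -> 0 <= t -> t ^+ 2 <= 2 / d ^+ 2 * expR (d * t).
Proof.
move=> d0 t0; have u0 : 0 <= d * t by rewrite mulr_ge0 // ltW.
have := @expR_ge1Dxn R _ 1 u0; rewrite exprMn => h.
have -> : t ^+ 2 = 2 / d ^+ 2 * (d ^+ 2 * t ^+ 2 / 2) by field; rewrite gt_eqF.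
rewrite ler_wpM2l ?divr_ge0 ?exprn_ge0 ?(ltW d0) //.
by apply: le_trans h; rewrite -[X in X <= _]add0r lerD.
Qed.

(** The gap d = Re l - a is spent in thirds: one on t^2 <= 2 / (d/3)^2 e^{d t / 3}, one on e^{|k|
    t}, one on the convergence of what remains; 54 is twice 3^3. *)
Lemma Lap_deriv a M f l k : exp_class a M f -> a < complex.Re l ->
  nrm k <= (complex.Re l - a) / 3 ->
  nrm (Lap f (l + k) - Lap f l + k *: Lap (tmul f) l : R[i]^o) <=
    54 * M / (complex.Re l - a) ^+ 3 * nrm k ^+ 2.
Proof.
move=> hf al hk; have [M0 _ fM] := hf; set d := complex.Re l - a in hk *.
have d0 : 0 < d by rewrite /d; lra.
have rk : - nrm k <= complex.Re k by have := ler_nrm_Re k; rewrite ler_norml => /andP[].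
have Elk : complex.Re (l + k) = complex.Re l + complex.Re k by case: (l) (k) => ? ? [? ?].
have alk : a < complex.Re (l + k) by rewrite Elk; move: rk hk; rewrite /d; lra.
have aa' : a < a + d / 2 by lra.
have htf := tmul_class aa' hf.
have al' : a + d / 2 < complex.Re l by rewrite /d; lra.
have L1 := LapP hf al; have L2 := LapP hf alk.
have L3 := LapP htf al'.
have [Q [Q0 hQ hl]] := is_Lap_lim (-1) L1 L2.
move: L3 => [P3 [P30 hP3 hl3]].
have hl' := lim_inftyZD k hl3 hl.
have := @lim_infty_exp_le (fun t => k *: P3 t + Q t) _ _ (M * (nrm k ^+ 2 * (2 / (d / 3) ^+ 2))) (d / 3)
  ltac:(lra) _ _ (fun t t0 => derD (derZ k (hP3 t t0)) (hQ t t0)) _ hl'.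
have E : k *: Lap (tmul f) l + (-1 *: Lap f l + Lap f (l + k)) =
  Lap f (l + k) - Lap f l + k *: Lap (tmul f) l :> R[i]^o by modring R[i].
rewrite E => /(_ _ _ _)/le_trans; apply.
- by rewrite mulr_ge0 // mulr_ge0 ?exprn_ge0 ?nrm_ge0 // divr_ge0 // exprn_ge0 //; lra.
- by rewrite P30 Q0 scaler0 addr0.
- move=> t t0.
  have -> : k *: (cexp (- (l * t%:C)) *: tmul f t) + (-1 *: (cexp (- (l * t%:C)) *: f t) + cexp (- ((l + k) * t%:C)) *: f t)
     = (cexp (- (k * t%:C)) - 1 - - (k * t%:C)) *: (cexp (- (l * t%:C)) *: f t) :> R[i]^o.
    rewrite mulrDl opprD cexpD /tmul !scalerA -scaleNr.
    by modring R[i].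
  rewrite nrmZ.
  have nkt : nrm (- (k * t%:C)) = nrm k * t by rewrite nrmN nrmM nrmC ger0_norm.
  apply: le_trans (ler_pM (nrm_ge0 _) (nrm_ge0 _) (cexp_sub2 _) (lap_integrand_le l hf t0)) _.
  rewrite nkt -opprB -/d exprMn.
  apply: le_trans (_ : nrm k ^+ 2 * (2 / (d / 3) ^+ 2 * expR (d / 3 * t)) * expR (d / 3 * t) * (M * expR (- d * t)) <= _).
    rewrite ler_wpM2r ?mulr_ge0 ?expR_ge0 //; apply: ler_pM; rewrite ?expR_ge0 ?mulr_ge0 ?exprn_ge0 ?nrm_ge0 //.
      by rewrite ler_wpM2l ?exprn_ge0 ?nrm_ge0 // sq_le_exp //; lra.
    by rewrite ler_expR ler_wpM2r.
  have -> : - (d / 3) * t = d / 3 * t + d / 3 * t + - d * t by field.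
  by rewrite !expRD le_eqVlt; apply/orP; left; apply/eqP; ring.
- by rewrite le_eqVlt; apply/orP; left; apply/eqP; field; rewrite gt_eqF.
Qed.

Lemma Lap_der (V : set R[i]) a M f l : exp_class a M f -> a < complex.Re l ->
  der id V (Lap f : R[i] -> R[i]^o) l (- Lap (tmul f) l).
Proof.
move=> hf al; have d0 : 0 < complex.Re l - a by lra.
have [M0 _ _] := hf.
set C := 54 * M / (complex.Re l - a) ^+ 3.
have C0 : 0 <= C by rewrite /C divr_ge0 ?mulr_ge0 ?exprn_ge0 //; lra.
move=> e e0; have C1 : 0 < C + 1 by lra.
exists (Num.min ((complex.Re l - a) / 3) (e / (C + 1))); first by rewrite lt_min !divr_gt0.
move=> s _ /=; rewrite lt_min => /andP[s1 s2].
have := Lap_deriv hf al (ltW s1).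
have -> : l + (s - l) = s by ring.
rewrite scalerN opprK -/C.
move=> /le_trans; apply; rewrite expr2 mulrA ler_wpM2r ?nrm_ge0 //.
by move: s2; rewrite ltr_pdivlMr // => s2; have := nrm_ge0 (s - l); nra.
Qed.

End Transform.

(** * Identity theorem and inversion of the Laplace transform *)

Section Identity.
Context {R : realType}.
Local Notation rc := (real_complex R).
Implicit Types (f : R -> R[i]^o) (l k : R[i]) (a M : R).

Definition tpow n f : R -> R[i]^o := fun t => (t ^+ n)%:C *: f t.

Lemma tmul_tpow n f : tmul (tpow n f) = tpow n.+1 f.
Proof. by apply/funext => t; rewrite /tmul /tpow scalerA -rmorphM -exprS. Qed.

Lemma tpow0 f : tpow 0 f = f.
Proof. by apply/funext => t; rewrite /tpow expr0 scale1r. Qed.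

Lemma cont_tpow n f (t : R) : 0 <= t -> cont rc halfline f t -> cont rc halfline (tpow n f) t.
Proof.
move=> t0 fc; elim: n => [|n ih]; first by rewrite tpow0.
by rewrite -tmul_tpow; apply: contS => //; exact: der_cont (der_id _ _ _).
Qed.

Lemma tpow_class n a d M f : 0 < d -> exp_class a M f ->
  exp_class (a + d) (M * (n`!%:R / d ^+ n)) (tpow n f).
Proof.
move=> d0 [M0 fc fM]; have F0 : 0 <= n`!%:R / d ^+ n :> R.
  by rewrite divr_ge0 // exprn_ge0 // ltW.
split; first by rewrite mulr_ge0.
  by move=> t t0; apply: cont_tpow; last exact: fc.
move=> t t0; rewrite /tpow (nrmM (t ^+ n)%:C (f t)) nrmC ger0_norm ?exprn_ge0 //.
have dt0 : 0 <= d * t by rewrite mulr_ge0 // ltW.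
have h : t ^+ n <= n`!%:R / d ^+ n * expR (d * t).
  case: n F0 => [|n] F0; first by rewrite expr0 fact0 expr0 divr1 mul1r -expR0 ler_expR.
  have := @expR_ge1Dxn R _ n dt0; rewrite exprMn => h.
  have -> : t ^+ n.+1 = n.+1`!%:R / d ^+ n.+1 * (d ^+ n.+1 * t ^+ n.+1 / n.+1`!%:R).
    have fn0 : (n.+1`!%:R : R) != 0 by rewrite pnatr_eq0 -lt0n fact_gt0.
    have dn0 : d ^+ n.+1 != 0 by rewrite expf_neq0 ?gt_eqF.
    by move: fn0 dn0; move: (n.+1`!%:R : R) (d ^+ n.+1) (t ^+ n.+1) => x y z x0 y0; field; rewrite x0 y0.
  by rewrite ler_wpM2l //; apply: le_trans h; rewrite -[X in X <= _]add0r lerD.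
apply: le_trans (ler_pM (exprn_ge0 _ t0) (nrm_ge0 _) h (fM t t0)) _.
by rewrite mulrDl expRD le_eqVlt; apply/orP; left; apply/eqP; ring.
Qed.

Lemma der_zero_open (F : R[i] -> R[i]^o) l (r : R) v : 0 < r ->
  (forall s, nrm (s - l) < r -> F s = 0) -> der id [set s : R[i] | nrm (s - l) < r] F l v -> v = 0.
Proof.
move=> r0 F0 Fd; apply: (@nrm_le_eps _ _ _ 1) => e e0; rewrite mulr1.
have [d d0 hd] := Fd e e0; set p := Num.min r d / 2.
have m0 : 0 < Num.min r d by rewrite lt_min r0 d0.
have p0 : 0 < p by rewrite divr_gt0.
have pm : p < Num.min r d by rewrite /p; lra.
have /andP[pr pd] : (p < r) && (p < d) by rewrite -lt_min.
have E : nrm (l + p%:C - l) = p by rewrite addrC addKr nrmC gtr0_norm.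
have := hd (l + p%:C); rewrite /= E => /(_ pr pd).
rewrite (F0 (l + p%:C)) ?E // (F0 l) ?subrr ?nrm0 // sub0r nrmN (addrC l) addrK nrmZ nrmC gtr0_norm //.
by rewrite mulrC ler_pM2r.
Qed.

(** By induction on [n]: [Lap_der] identifies the next transform with minus the derivative of the
    previous one, which vanishes on a smaller disc. *)
Lemma Lap_tpow_zero n a M f l (r : R) : exp_class a M f -> a < complex.Re l -> 0 < r ->
  (forall s, nrm (s - l) < r -> Lap f s = 0) -> Lap (tpow n f) l = 0.
Proof.
move=> hf; elim: n l r => [|n ih] l r al r0 hz.
  by rewrite tpow0; apply: hz; rewrite subrr nrm0.
set d := (complex.Re l - a) / 2; have d0 : 0 < d by rewrite /d; lra.
have hc := tpow_class n d0 hf; have al' : a + d < complex.Re l by rewrite /d; lra.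
rewrite -tmul_tpow -[LHS]opprK; apply/eqP; rewrite oppr_eq0; apply/eqP.
have m0 : 0 < Num.min (r / 2) d by rewrite lt_min d0 divr_gt0.
apply: (der_zero_open m0 _ (Lap_der _ hc al')).
move=> s; rewrite lt_min => /andP[s1 s2]; apply: (ih s (r / 2)); last first.
- by move=> s' h; apply: hz; have := nrm_tri s s' l; lra.
- by rewrite divr_gt0.
- have : `|complex.Re (s - l)| < d by apply: le_lt_trans (ler_nrm_Re _) s2.
  rewrite ltr_norml (_ : complex.Re (s - l) = complex.Re s - complex.Re l); last by case: (s) (l) => ? ? [? ?].
  by move=> /andP[+ _]; rewrite /d; lra.
Qed.

Lemma der_cpow (D : set R) (c : R) n (t : R) :
  der rc D (fun t => (c * t ^+ n.+1)%:C : R[i]^o) t ((c * (n.+1%:R * t ^+ n))%:C : R[i]^o).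
Proof.
apply: is_derive_der; have h := is_deriveZ c (is_deriveX n.+1 (is_derive_id t (1 : R))).
have -> : (fun t0 : R => c * t0 ^+ n.+1) = c \*: (id ^+ n.+1 : R -> R) by apply/funext => x; rewrite /= exprfctE.
by apply: (@is_derive_eq _ _ _ _ _ _ _ _ h); rewrite /GRing.scale /= mulr1.
Qed.

(* All derivatives +- Lap (t^n f) vanish at l, and their growth, controlled by n!,
   makes the Taylor expansion converge. *)
Lemma Lap_zero_step a M f l k (r : R) : exp_class a M f -> a < complex.Re l -> 0 < r ->
  (forall s, nrm (s - l) < r -> Lap f s = 0) ->
  nrm k <= (complex.Re l - a) / 4 -> Lap f (l + k) = 0.
Proof.
move=> hf al r0 hz hk.
have [d d0 dE] : exists2 d : R, 0 < d & complex.Re l = a + 2 * d.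
  by exists ((complex.Re l - a) / 2); lra.
have [M0 _ _] := hf; have kn := nrm_ge0 k.
have hc n := tpow_class n d0 hf.
have Rel (s : R) : 0 <= s <= 1 -> a + d + d / 2 <= complex.Re (l + s%:C * k).
  move=> /andP[s0 s1]; have -> : complex.Re (l + s%:C * k) = complex.Re l + s * complex.Re k.
    by case: (l) (k) => ? ? [? ?] /=; rewrite mul0r subr0.
  have := ler_nrm_Re k; rewrite ler_norml => /andP[h _]; nra.
pose B n := M * (n`!%:R / d ^+ n) / (d / 2).
have B0 n : 0 <= B n.
  by apply: divr_ge0; [apply: mulr_ge0 => //; apply: divr_ge0 => //; exact/exprn_ge0/ltW|lra].
(* Taylor's formula by successive integrations from [s = 0], where every derivative vanishes: each
   step trades [tpow n] for [tpow n.+1] and gains a factor |k| and one power of [s]. *)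
have key j : forall n (s : R), 0 <= s <= 1 ->
  nrm (Lap (tpow n f) (l + s%:C * k)) <= B (n + j)%N * nrm k ^+ j / j`!%:R * s ^+ j.
  elim: j => [|j ih] n s hs.
    rewrite addn0 !expr0 fact0 divr1 !mulr1.
    have h : a + d < complex.Re (l + s%:C * k) by have := Rel s hs; lra.
    apply: le_trans (Lap_norm (hc n) h) _; rewrite /B ler_wpM2l //.
      by rewrite mulr_ge0 ?divr_ge0 ?exprn_ge0 // ltW.
    by rewrite lef_pV2 ?posrE ?divr_gt0 //; have := Rel s hs; lra.
  have /andP[s0 s1] := hs.
  have z0 : Lap (tpow n f) (l + 0%:C * k) = 0.
    by rewrite mul0r addr0; exact: (Lap_tpow_zero n hf al r0 hz).
  pose c := B (n + j.+1)%N * nrm k ^+ j.+1 / j.+1`!%:R.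
  have J0 : (j.+1%:R : R) != 0 by rewrite pnatr_eq0.
  have J1 : (j`!%:R : R) != 0 by rewrite pnatr_eq0 -lt0n fact_gt0.
  have D (t : R) : 0 <= t <= s -> der rc `[0, s] (fun t => Lap (tpow n f) (l + t%:C * k)) t
      (k *: - Lap (tpow n.+1 f) (l + t%:C * k)).
    move=> /andP[t0 ts]; have ht : 0 <= t <= 1 by rewrite t0 (le_trans ts).
    apply: (der_comp (i' := id) (D' := setT) (g := fun t : R => l + t%:C * k)) => //.
      have h := derD (der_cst rc `[0, s] (l : R[i]^o) t) (derS (der_id rc `[0, s] t) (der_cst rc `[0, s] (k : R[i]^o) t)).
      by move: h; rewrite scaler0 addr0 add0r scale1r.
    by rewrite -tmul_tpow; apply: Lap_der (hc n) _; have := Rel t ht; lra.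
  have := @mvt R (R[i]^o) _ _ (fun t => c * t ^+ j.+1) (fun t => B (n + j.+1)%N * nrm k ^+ j.+1 / j`!%:R * t ^+ j)
    `[0, s] 0 s s0 _ D.
  rewrite z0 subr0 expr0n mulr0 subr0; apply.
  - by move=> t; rewrite /= in_itv.
  - move=> t _; have -> : B (n + j.+1)%N * nrm k ^+ j.+1 / j`!%:R * t ^+ j = c * (j.+1%:R * t ^+ j).
      rewrite /c factS natrM; move: (j.+1%:R : R) J0 (j`!%:R : R) J1 => x x0 y y0.
      by move: (B _) (nrm k ^+ _) (t ^+ j) => b1 b2 b3; field; rewrite x0 y0.
    exact: der_cpow.
  - move=> t /andP[t0 ts]; rewrite nrmZ nrmN.
    have ht : 0 <= t <= 1 by rewrite t0 (le_trans ts).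
    apply: le_trans (ler_wpM2l kn (ih n.+1 t ht)) _.
    by rewrite addSnnS exprS le_eqVlt; apply/orP; left; apply/eqP; ring.
have h1 : (0 : R) <= (1 : R) <= (1 : R) by rewrite ler01 lexx.
(* The factorials cancel and leave the powers of |k| / d, which is at most 1/2 by the hypothesis on
   [k]. *)
have half n : B n * nrm k ^+ n / n`!%:R <= M / (d / 2) * 2^-1 ^+ n.
  have -> : B n * nrm k ^+ n / n`!%:R = M / (d / 2) * (nrm k / d) ^+ n.
    have fn0 : (n`!%:R : R) != 0 by rewrite pnatr_eq0 -lt0n fact_gt0.
    have dn0 : d ^+ n != 0 by rewrite expf_neq0 ?gt_eqF.
    rewrite /B exprMn exprVn; move: (d ^+ n) dn0 (n`!%:R : R) fn0 (nrm k ^+ n) => x x0 y y0 b.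
    by field; rewrite x0 y0 gt_eqF.
  rewrite ler_wpM2l ?divr_ge0 ?(ltW d0) //.
  apply: lerXn2r; rewrite ?nnegrE ?invr_ge0 ?divr_ge0 ?(ltW d0) //.
  by rewrite ler_pdivrMr //; lra.
set m := M / (d / 2) in half.
have m0 : 0 <= m by rewrite /m divr_ge0 //; lra.
apply: (@nrm_le_eps _ _ _ 1) => e e0; rewrite mulr1.
have [n hn] : exists n : nat, m * 2^-1 ^+ n <= e.
  exists (Num.bound (m / e)); set n := Num.bound _.
  have hn : m / e < n%:R by rewrite archi_boundP // divr_ge0 // ltW.
  rewrite exprVn ler_pdivrMr ?exprn_gt0 //.
  have h2 : (n%:R : R) <= 2 ^+ n by rewrite -natrX ler_nat ltnW // ltn_expl.
  by move: hn; rewrite ltr_pdivrMr // => hn; nra.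
have := key n 0%N 1 h1; rewrite tpow0 expr1n mulr1 mul1r add0n => /le_trans; apply.
exact: le_trans (half n) hn.
Qed.

(** Moving to the right keeps the distance to the line Re = a at least [d], so the discs of
    [Lap_zero_step] do not shrink, and finitely many steps of length at most [d / 8] reach [s]. *)
Lemma Lap_zero_right a M f l (r : R) : exp_class a M f -> a < complex.Re l -> 0 < r ->
  (forall s, nrm (s - l) < r -> Lap f s = 0) ->
  forall s, complex.Re l <= complex.Re s -> Lap f s = 0.
Proof.
move=> hf al r0 hz s ls; set d := complex.Re l - a; have d0 : 0 < d by rewrite /d; lra.
have key k n : 0 <= complex.Re k -> nrm k <= d / 8 ->
    exists2 r' : R, 0 < r' & forall s, nrm (s - (l + n%:R * k)) < r' -> Lap f s = 0.
  move=> k0 kd; elim: n => [|n [r' r'0 ih]]; first by exists r => // s'; rewrite mul0r addr0; exact: hz.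
  exists (d / 8); first by rewrite divr_gt0.
  move=> s' hs'; rewrite -[s'](subrK (l + n%:R * k)) addrC.
  have Re0 : complex.Re l <= complex.Re (l + n%:R * k).
    have -> : complex.Re (l + n%:R * k) = complex.Re l + n%:R * complex.Re k.
      have -> : (n%:R : R[i]) = (n%:R : R)%:C by rewrite rmorph_nat.
      by case: (l) (k) => ? ? [? ?] /=; rewrite mul0r subr0.
    by rewrite lerDl mulr_ge0.
  apply: (Lap_zero_step hf _ r'0 ih); first by lra.
  have := nrm_tri (l + n.+1%:R * k) s' (l + n%:R * k).
  have -> : l + n.+1%:R * k - (l + n%:R * k) = k by rewrite -natr1; ring.
  by move: Re0 d0 hs' kd; rewrite /d; lra.
pose n := (Num.bound (8 * nrm (s - l) / d)).+1.
have n0 : (n%:R : R[i]) != 0 by rewrite pnatr_eq0.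
have nR : (0 : R) < n%:R by rewrite ltr0n.
have nC : (n%:R : R[i]) = (n%:R : R)%:C by rewrite rmorph_nat.
pose k := (n%:R^-1 : R)%:C * (s - l).
have kE : l + n%:R * k = s by rewrite /k nC mulrA -rmorphM mulfV ?gt_eqF // mul1r addrC subrK.
have [|| r' r'0 h] := key k n.
- have -> : complex.Re k = n%:R^-1 * (complex.Re s - complex.Re l).
    by rewrite /k; case: (s) (l) => ? ? [? ?] /=; rewrite mul0r subr0.
  by rewrite mulr_ge0 ?invr_ge0 ?(ltW nR) // subr_ge0.
- rewrite /k nrmM nrmC ger0_norm ?invr_ge0 ?(ltW nR) // mulrC ler_pdivrMr //.
  have : 8 * nrm (s - l) / d < n%:R.
    apply: lt_trans (archi_boundP _) _; last by rewrite /n ltr_nat.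
    by rewrite divr_ge0 ?mulr_ge0 ?nrm_ge0 // ltW.
  by rewrite ltr_pdivrMr //; nra.
by apply: h; rewrite kE subrr nrm0.
Qed.

End Identity.

(** * Integrals over an interval and differentiation under the integral *)

Section IntervalIntegral.
Context {R : realType} {E : normedModType R[i]}.
Local Notation rc := (real_complex R).
Implicit Types (g : R -> E) (a b : R).

Definition is_int a b g (v : E) : Prop := exists P : R -> E,
  (forall y, a <= y <= b -> der rc `[a, b] P y (g y)) /\ v = P b - P a.

Lemma in_itv_cc a b y : a <= y <= b -> y \in `[a, b].
Proof. by rewrite in_itv. Qed.

Lemma int_le a b g v (M : R) : a <= b -> is_int a b g v ->
  (forall y, a <= y <= b -> nrm (g y) <= M) -> nrm v <= M * (b - a).
Proof.
move=> ab [P [hP ->]] hM; apply: (mvt_cst (D := `[a, b]%classic) ab _ hP hM).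
by move=> y /in_itv_cc.
Qed.

Lemma int_ex (Ec : seq_complete E) a b g : a <= b ->
  (forall y, a <= y <= b -> cont rc `[a, b] g y) -> exists v, is_int a b g v.
Proof.
by move=> ab hg; have [P [_ hP]] := prim_ex Ec ab hg; exists (P b - P a), P.
Qed.

Lemma intZD a b g g' v v' (c : R[i]) : is_int a b g v -> is_int a b g' v' ->
  is_int a b (fun y => c *: g y + g' y) (c *: v + v').
Proof.
move=> [P [hP ->]] [Q [hQ ->]]; exists (fun y => c *: P y + Q y); split; last by modring R[i].
by move=> y hy; apply: derD; [apply: derZ; exact: hP|exact: hQ].
Qed.

Lemma int_sub_le a b g g' v v' (M : R) : a <= b -> is_int a b g v -> is_int a b g' v' ->
  (forall y, a <= y <= b -> nrm (g y - g' y) <= M) -> nrm (v - v') <= M * (b - a).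
Proof.
move=> ab hv hv' hM; have := intZD (-1) hv' hv.
rewrite scaleN1r addrC => /(int_le ab); apply => y /hM.
by rewrite scaleN1r addrC.
Qed.

Lemma der_int (D : set R) a b (Phi Psi : R -> R -> E) (F : R -> E) J (T0 : R) : a <= b ->
  D T0 -> (forall T, D T -> is_int a b (Phi T) (F T)) -> is_int a b (Psi T0) J ->
  (forall e : R, 0 < e -> exists2 d : R, 0 < d & forall T y, D T -> `|T - T0| < d -> a <= y <= b ->
     nrm (Phi T y - Phi T0 y - (T - T0)%:C *: Psi T0 y) <= e * `|T - T0|) ->
  der rc D F T0 J.
Proof.
move=> ab DT0 hF hJ hd e e0.
have e1 : 0 < e / (b - a + 1) by rewrite divr_gt0 //; lra.
have [d d0 h] := hd _ e1; exists d => // T DT; rewrite /= -rmorphB nrmC => Td.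
have K := intZD (- (T - T0)%:C) hJ (intZD (-1) (hF _ DT0) (hF _ DT)).
have -> : F T - F T0 - (T - T0)%:C *: J = - (T - T0)%:C *: J + (-1 *: F T0 + F T) by modring R[i].
apply: le_trans (int_le ab K (M := e / (b - a + 1) * `|T - T0|) _) _.
  move=> y hy; apply: le_trans (h T y DT Td hy).
  by rewrite le_eqVlt; apply/orP; left; apply/eqP; congr nrm; modring R[i].
rewrite mulrAC ler_wpM2r // mulrAC ler_pdivrMr; last by lra.
by rewrite ler_wpM2l; lra.
Qed.

Lemma mvt_halfline (F F' : R -> E) (M x y : R) : 0 <= x -> 0 <= y ->
  (forall t : R, 0 <= t -> der rc halfline F t (F' t)) ->
  (forall t, Num.min x y <= t <= Num.max x y -> nrm (F' t) <= M) ->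
  nrm (F y - F x) <= M * `|y - x|.
Proof.
move=> x0 y0 hF hM; have [xy|yx] := lerP x y.
  apply: (@mvt_cst _ _ F F' _ halfline _ _ xy).
  - by move=> c /andP[xc _]; rewrite /halfline /=; lra.
  - by move=> c /andP[xc _]; apply: hF; lra.
  - by move=> c hc; apply: hM; rewrite (min_idPl xy) (max_idPr xy).
have yx' := ltW yx; rewrite nrmB; apply: (@mvt_cst _ _ F F' _ halfline _ _ yx').
- by move=> c /andP[xc _]; rewrite /halfline /=; lra.
- by move=> c /andP[xc _]; apply: hF; lra.
- by move=> c hc; apply: hM; rewrite (min_idPr yx') (max_idPl yx').
Qed.

End IntervalIntegral.

(** * The inversion kernel on arcs of circles *)

Section Kernel.
Context {R : realType}.
Local Notation rc := (real_complex R).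
Implicit Types (u x y c rho phi : R).

(** With mu = e^w, [entire u w] dw is e^{u mu} dmu / mu^2, the inversion integrand of 1 / mu^2,
    whose original is max(u, 0). *)
Definition entire u (w : R[i]) : R[i]^o := kern u%:C w * cexp (- w).

Lemma nrm_entire u x y : nrm (entire u (x +i* y) : R[i]) = expR (u * (expR x * cos y) - x).
Proof.
rewrite /entire nrmM nrm_kern nrm_cexp /= -expRD; congr expR; congr (_ + _).
by rewrite /=; ring.
Qed.

Lemma vshift x y (t : R) : x +i* (y + t) = x +i* y + 'i%C * t%:C.
Proof. by apply/eqP; rewrite eq_complex /=; apply/andP; split; apply/eqP; ring. Qed.

Lemma cexp_2pi (w : R[i]) : cexp (w + 'i%C * (2 * pi)%:C) = cexp w.
Proof.
case: w => x y; rewrite -vshift !cexpE; congr (_ * (_ +i* _)).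
  by rewrite mulrDl mul1r addrA !cosDpi opprK.
by rewrite mulrDl mul1r addrA !sinDpi opprK.
Qed.

Lemma entire_2pi u x y : entire u (x +i* (y + 2 * pi)) = entire u (x +i* y).
Proof. by rewrite vshift /entire /kern !cexpNV !cexp_2pi. Qed.

Lemma cdiff_entire u V : cdiff_on V (entire u).
Proof.
move=> w _; have h := derS (der_kern V u%:C w) (der_cexp (derN (der_id id V w))).
by eexists; exact: h.
Qed.

(* The integral does not depend on x, and as x -> -oo the integrand approaches
   e^{-w} + u, whose integral over a period is 2 pi i u. *)
Lemma entire_period u y0 P : - (2 * pi) <= y0 -> y0 <= 0 ->
  is_prim (2 * pi) (entire u) P -> forall x,
  P (x +i* (y0 + 2 * pi)) - P (x +i* y0) = 'i%C * (2 * pi)%:C * u%:C.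
Proof.
move=> y1 y2 hP x; have p0 := pi_gt0 R.
have hy0 : `|y0| <= 2 * pi by rewrite ler_norml; lra.
have hy1 : `|y0 + 2 * pi| <= 2 * pi by rewrite ler_norml; lra.
pose D t := P (t +i* (y0 + 2 * pi)) - P (t +i* y0).
have Dc (s : R) : s <= x -> D s = D x.
  move=> sx; apply/esym; apply: (@der0_cst R (R[i]^o : normedModType R[i]) D setT s x sx) => // c _.
  apply: der_eq (derB (prim_hline c hP hy1) (prim_hline c hP hy0)).
  by rewrite entire_2pi subrr.
apply/eqP; rewrite -subr_eq0; apply/eqP; set v := _ - _.
set K := 2 * pi * (u ^+ 2 * expR `|u|).
have K0 : 0 <= K.
  by apply: mulr_ge0; [lra|apply: mulr_ge0; rewrite ?sqr_ge0 ?expR_ge0].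
apply: (@nrm_le_eps _ _ _ 1) => e e0; rewrite mulr1.
have [X [X0 hX]] := expRN_small K0 e0.
set s := Num.min x (- X); have sx : s <= x by rewrite /s ge_min lexx.
have sX : X <= - s by rewrite lerNr /s ge_min lexx orbT.
apply: le_trans (hX _ sX); rewrite opprK /v -/(D x) -(Dc s sx) /D.
have d1 (y : R) : y0 <= y <= y0 + 2 * pi -> der rc `[y0, y0 + 2 * pi] 
   (fun y => P (s +i* y) - (- cexp (- (s +i* y)) + u%:C * (s +i* y))) y
   ('i%C * (entire u (s +i* y) - (cexp (- (s +i* y)) + u%:C)) : R[i]^o).
  move=> /andP[ya yb]; have sub : `[y0, y0 + 2 * pi]%classic `<=` `[- (2 * pi), 2 * pi]%classic.
    by move=> t; rewrite /= !in_itv /= => /andP[ta tb]; apply/andP; split; lra.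
  have hy : `|y| <= 2 * pi by rewrite ler_norml; lra.
  have hv := der_vpath `[y0, y0 + 2 * pi] s y.
  have h1 := derN (der_cexp (derN hv)).
  have h2 := derD h1 (derZ u%:C hv).
  apply: der_eq (derB (der_sub sub (prim_vline s hP hy)) h2).
  by rewrite !regE; ring.
have ab : y0 <= y0 + 2 * pi by lra.
have B y : y0 <= y <= y0 + 2 * pi -> nrm ('i%C * (entire u (s +i* y) - (cexp (- (s +i* y)) + u%:C)) : R[i]^o) <= u ^+ 2 * expR `|u| * expR s.
  move=> _; set w := s +i* y.
  have -> : entire u w - (cexp (- w) + u%:C) = cexp (- w) * (cexp (u%:C * cexp w) - 1 - u%:C * cexp w).
    by rewrite /entire /kern; have := cexpN w; move: (cexp w) (cexp (- w)) => p q pq; ring: pq.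
  rewrite nrmM nrm_i mul1r nrmM nrm_cexp /=.
  have nw : nrm (u%:C * cexp w) = `|u| * expR s by rewrite nrmM nrmC nrm_cexp.
  apply: le_trans (ler_wpM2l (expR_ge0 _) (cexp_sub2 _)) _; rewrite nw.
  have s0 : s <= 0 by lra.
  have es : expR s <= 1 by rewrite -expR0 ler_expR.
  have -> : u ^+ 2 * expR `|u| * expR s = expR (- s) * ((`|u| * expR s) ^+ 2 * expR `|u|).
    by rewrite exprMn real_normK ?num_real // expRN; field; rewrite gt_eqF ?expR_gt0.
  rewrite ler_wpM2l ?expR_ge0 // ler_wpM2l ?exprn_ge0 ?mulr_ge0 ?expR_ge0 //.
  by rewrite ler_expR -[X in _ <= X]mulr1 ler_wpM2l.
have := mvt_cst (D := `[y0, y0 + 2 * pi]%classic) ab _ d1 B.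
have -> : y0 + 2 * pi - y0 = 2 * pi by ring.
have -> : K * expR s = u ^+ 2 * expR `|u| * expR s * (2 * pi) by rewrite /K; ring.
move=> /(_ (fun c h => in_itv_cc h)); congr (nrm _ <= _).
have -> : cexp (- (s +i* (y0 + 2 * pi))) = cexp (- (s +i* y0)) by rewrite vshift !cexpNV cexp_2pi.
rewrite [X in u%:C * X]vshift.
by set a := P _; set b := P _; ring.
Qed.

Lemma ler_cos_arc phi y : 0 <= phi <= pi -> `|y| <= phi -> cos phi <= cos y.
Proof.
move=> /andP[p0 p1] hy; rewrite -(cos_norm y).
by rewrite leNgt ltr_cos -?leNgt ?in_itv /= ?normr_ge0 ?p0 ?p1 ?(le_trans hy).
Qed.

Lemma ler_cos_coarc phi y : 0 <= phi <= pi -> phi <= y -> y <= 2 * pi - phi -> cos y <= cos phi.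
Proof.
move=> /andP[p0 p1] y1 y2; have [yp|yp] := lerP y pi.
  by rewrite leNgt ltr_cos -?leNgt ?in_itv /= ?p0 ?p1 ?(le_trans p0) ?yp.
have -> : cos y = cos (2 * pi - y).
  have -> : 2 * pi - y = - y + pi + pi by ring.
  by rewrite !cosDpi opprK cosN.
by rewrite leNgt ltr_cos -?leNgt ?in_itv /= ?p0 ?p1 ?andbT //; lra.
Qed.

Lemma Re_cexp x y : complex.Re (cexp (x +i* y)) = expR x * cos y.
Proof. by rewrite cexpE /= mul0r subr0. Qed.

(* For u > 0 the rest of the circle lies in Re mu <= c, where the integrand is small, and
   the whole circle gives 2 pi i u; for u <= 0 the integrand is small on the arc. *)
Lemma arc_kernel u c x phi j : 0 <= phi <= pi / 2 -> expR x * cos phi = c ->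
  is_int (- phi) phi (fun y => 'i%C *: entire u (x +i* y)) j ->
  nrm (j - 'i%C * (2 * pi)%:C * (Num.max u 0)%:C : R[i]^o) <= 2 * pi * expR (c * u) * expR (- x).
Proof.
move=> /andP[p0 p1] hc hj; have pp := pi_gt0 R.
have hphi : 0 <= phi <= pi by lra.
have N y : nrm ('i%C *: entire u (x +i* y)) = expR (u * (expR x * cos y)) * expR (- x).
  by rewrite (nrmM 'i%C (entire u (x +i* y))) nrm_i mul1r nrm_entire expRD.
have ee (y : R) : u * (expR x * cos y) <= c * u -> expR (u * (expR x * cos y)) * expR (- x) <= expR (c * u) * expR (- x).
  by move=> h; rewrite ler_wpM2r ?expR_ge0 // ler_expR.
have pos : 0 <= expR (c * u) * expR (- x) by rewrite mulr_ge0 ?expR_ge0.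
have [u0|u0] := lerP u 0.
  rewrite mulr0 subr0.
  have ab : - phi <= phi by lra.
  apply: le_trans (int_le ab hj (M := expR (c * u) * expR (- x)) _) _.
    move=> y hy; rewrite N ee // [c * u]mulrC -hc ler_wnM2l // ler_wpM2l ?expR_ge0 //.
    by apply: ler_cos_arc => //; rewrite ler_norml.
  by nra.
have [P hP] := strip_prim_ex (@complex_complete R) (th := 2 * pi) (fun w hw => cdiff_entire u hw).
have E0 : P (x +i* (- phi + 2 * pi)) - P (x +i* - phi) = 'i%C * (2 * pi)%:C * u%:C.
  by apply: entire_period hP _; lra.
have ab : - phi <= phi by lra.
have jE : j = P (x +i* phi) - P (x +i* - phi).
  have [Q [hQ ->]] := hj.
  apply/eqP; rewrite -subr_eq0; apply/eqP; set G := fun y => Q y - P (x +i* y).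
  have -> : Q phi - Q (- phi) - (P (x +i* phi) - P (x +i* - phi)) = G phi - G (- phi) :> R[i]^o by rewrite /G; ring.
  apply/eqP; rewrite subr_eq0; apply/eqP.
  apply: (@der0_cst R (R[i]^o : normedModType R[i]) G `[- phi, phi] _ _ ab) => c0 hc0; first exact: in_itv_cc.
  have sub : `[- phi, phi]%classic `<=` `[- (2 * pi), 2 * pi]%classic.
    by move=> t; rewrite /= !in_itv /= => /andP[ta tb]; apply/andP; split; lra.
  have hy : `|c0| <= 2 * pi by rewrite ler_norml; lra.
  by apply: der_eq (derB (hQ _ hc0) (der_sub sub (prim_vline x hP hy))); rewrite subrr.
have -> : j - 'i%C * (2 * pi)%:C * u%:C = - (P (x +i* (- phi + 2 * pi)) - P (x +i* phi)).
  by rewrite -E0 jE; ring.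
rewrite nrmN.
have b1 : phi <= - phi + 2 * pi by lra.
have hb1 : `|phi| <= 2 * pi by rewrite ler_norml; lra.
have hb2 : `|- phi + 2 * pi| <= 2 * pi by rewrite ler_norml; lra.
apply: le_trans (prim_vert_le hP hb1 hb2 b1 (N := expR (c * u) * expR (- x)) _) _.
  move=> y /andP[y1 y2]; have := N y; rewrite (nrmM 'i%C (entire u (x +i* y))) nrm_i mul1r => ->.
  rewrite ee // [c * u]mulrC -hc ler_wpM2l ?(ltW u0) // ler_wpM2l ?expR_ge0 //.
  by apply: ler_cos_coarc => //; lra.
by nra.
Qed.

End Kernel.

(** * Laplace inversion for the second primitive *)

Section ArcInversion.
Context {R : realType}.
Local Notation rc := (real_complex R).
Variables (a M c : R) (f : R -> R[i]^o).
Hypotheses (hf : exp_class a M f) (c0 : 0 < c) (ac : a < c).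
Implicit Types (mu k : R[i]) (T : R).

Lemma lapint_bound mu T : c <= complex.Re mu -> 0 <= T ->
  nrm (cexp (- (mu * T%:C)) *: f T : R[i]^o) <= M.
Proof.
move=> hmu T0; have [M0 _ _] := hf.
apply: le_trans (lap_integrand_le mu hf T0) _.
rewrite -[X in _ <= X]mulr1 ler_wpM2l // -expR0 ler_expR.
by rewrite mulr_le0_ge0 // subr_le0 (le_trans (ltW ac)).
Qed.

(** Crude in [T], which stays fixed: this serves the continuity of the truncated integrand along the
    arc. *)
Lemma lapint_lip mu k P Q T : c <= complex.Re mu -> is_Lapint f mu P ->
  is_Lapint f (mu + k) Q -> 0 <= T ->
  nrm (Q T - P T) <= nrm k * T * expR (nrm k * T) * M * T.
Proof.
move=> hmu [P0 hP] [Q0 hQ] T0.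
have := @mvt_halfline R _ (fun T => Q T - P T) _ (nrm k * T * expR (nrm k * T) * M) 0 T (lexx _) T0
  (fun t ht => derB (hQ t ht) (hP t ht)).
rewrite P0 Q0 !subr0 (ger0_norm T0); apply.
move=> s; rewrite (min_idPl T0) (max_idPr T0) => /andP[s0 sT].
have -> : cexp (- ((mu + k) * s%:C)) *: f s - cexp (- (mu * s%:C)) *: f s =
  (cexp (- (k * s%:C)) - 1) *: (cexp (- (mu * s%:C)) *: f s) :> R[i]^o.
  by rewrite mulrDl opprD cexpD !regE; ring.
rewrite (nrmM (_ - _)); apply: ler_pM; rewrite ?nrm_ge0 ?lapint_bound //.
apply: le_trans (cexp_sub1 _) _; rewrite nrmN nrmM nrmC ger0_norm //.
have h : nrm k * s <= nrm k * T by rewrite ler_wpM2l ?nrm_ge0.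
by apply: ler_pM; rewrite ?ler_expR ?expR_ge0 ?mulr_ge0 ?nrm_ge0.
Qed.

(** Uniformity in [mu] is what differentiation under the arc integral by [der_int] requires; the arc
    is covered by |mu| <= rho and Re mu >= c. *)
Lemma lapint_der_unif (rho T0 : R) : 0 <= T0 -> 0 <= rho ->
  forall e : R, 0 < e -> exists2 d : R, 0 < d & forall mu P T,
    nrm mu <= rho -> c <= complex.Re mu -> is_Lapint f mu P -> 0 <= T -> `|T - T0| < d ->
    nrm (P T - P T0 - (T - T0)%:C *: (cexp (- (mu * T0%:C)) *: f T0)) <= e * `|T - T0|.
Proof.
move=> T00 rho0 e e0; have [M0 fc _] := hf.
have e2 : 0 < e / 2 by rewrite divr_gt0.
have [d1 d10 hd1] := fc T0 T00 _ e2.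
have F0 := nrm_ge0 (f T0); set F := nrm (f T0) in F0.
have r1 : 0 < rho + 1 by lra.
have F1 : 0 < 2 * (rho + 1) * expR 1 * (F + 1) by rewrite !mulr_gt0 ?expR_gt0 //; lra.
set d := Num.min d1 (Num.min (rho + 1)^-1 (e / (2 * (rho + 1) * expR 1 * (F + 1)))).
have d0 : 0 < d by rewrite /d !lt_min d10 invr_gt0 r1 divr_gt0.
have hd : [/\ d <= d1, d * (rho + 1) <= 1 & d * (2 * (rho + 1) * expR 1 * (F + 1)) <= e].
  by rewrite -ler_pdivlMr // -ler_pdivlMr // div1r /d !ge_min !lexx ?orbT.
exists d => // mu P T hmu rmu [P0 hP] T1 TT.
set kap := cexp (- (mu * T0%:C)) *: f T0.
have := @mvt_halfline R _ (fun s => P s - s%:C *: kap) (fun s => cexp (- (mu * s%:C)) *: f s - kap) e T0 T T00 T1.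
have -> : P T - T%:C *: kap - (P T0 - T0%:C *: kap) = P T - P T0 - (T - T0)%:C *: kap.
  by rewrite rmorphB /=; modring R[i].
apply.
  move=> s s0; apply: der_eq (derB (hP s s0) (derS (der_id rc halfline s) (der_cst rc _ (kap : R[i]^o) s))).
  by rewrite scaler0 addr0 scale1r.
move=> s hs.
have [s0 sT] : 0 <= s /\ `|s - T0| < d.
  by move: hs TT T00 T1; rewrite ge_min le_max => /andP[/orP[h1|h1] /orP[h2|h2]]; rewrite !ltr_norml => /andP[h3 h4] h5 h6; clear -h1 h2 h3 h4 h5 h6; split; (try apply/andP; try split); lra.
have [dd1 dd2 dd3] := hd.
have -> : cexp (- (mu * s%:C)) *: f s - kap = cexp (- (mu * s%:C)) *: (f s - f T0) +
   cexp (- (mu * T0%:C)) *: ((cexp (- (mu * (s - T0)%:C)) - 1) *: f T0) :> R[i]^o.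
  have -> : - (mu * s%:C) = - (mu * T0%:C) + - (mu * (s - T0)%:C) by rewrite rmorphB /=; ring.
  by rewrite cexpD !regE /kap !regE; ring.
have cl (r : R) : 0 <= r -> nrm (cexp (- (mu * r%:C))) <= 1.
  by move=> r0; rewrite nrm_cc -expR0 ler_expR oppr_le0 mulr_ge0 // (le_trans (ltW c0)).
apply: le_trans (ler_nrmD _ _) _.
have h1 : nrm (cexp (- (mu * s%:C)) *: (f s - f T0)) <= e / 2.
  rewrite (nrmM _ (f s - f T0)); have := hd1 s s0; rewrite nrmRB => /(_ (lt_le_trans sT dd1)) h.
  by rewrite -[X in _ <= X]mul1r; apply: ler_pM; rewrite ?nrm_ge0 ?cl.
have h2 : nrm (cexp (- (mu * T0%:C)) *: ((cexp (- (mu * (s - T0)%:C)) - 1) *: f T0)) <= e / 2.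
  rewrite (nrmM _ (_ *: f T0)) (nrmM _ (f T0)) -[X in _ <= X]mul1r.
  apply: ler_pM; rewrite ?mulr_ge0 ?nrm_ge0 ?cl //.
  have q : nrm mu * `|s - T0| <= (rho + 1) * d.
    by apply: ler_pM; rewrite ?nrm_ge0 // ?(ltW sT) //; lra.
  apply: le_trans (_ : (rho + 1) * d * expR 1 * (F + 1) <= _); last by lra.
  apply: ler_pM; rewrite ?nrm_ge0 //; last by rewrite lerDl.
  apply: le_trans (cexp_sub1 _) _; rewrite nrmN nrmM nrmC.
  by apply: ler_pM; rewrite ?mulr_ge0 ?nrm_ge0 ?expR_ge0 // ler_expR; lra.
lra.
Qed.

Variables (t x phi : R) (Th1 Th2 : R -> R[i]^o).
Hypotheses (t0 : 0 <= t) (phi_b : 0 <= phi <= pi / 2) (hc : expR x * cos phi = c).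
Hypotheses (Th10 : Th1 0 = 0) (Th1d : forall s : R, 0 <= s -> der rc halfline Th1 s (f s)).
Hypotheses (Th20 : Th2 0 = 0) (Th2d : forall s : R, 0 <= s -> der rc halfline Th2 s (Th1 s)).
Local Notation mu y := (cexp (x +i* y)).
Local Notation arc := (is_int (- phi) phi).

Lemma arc_Re y : - phi <= y <= phi -> c <= complex.Re (mu y).
Proof.
move=> hy; rewrite Re_cexp -hc ler_wpM2l ?expR_ge0 // ler_cos_arc //.
  by have := pi_gt0 R; move: phi_b => /andP[? ?] ?; apply/andP; split; lra.
by rewrite ler_norml.
Qed.

Lemma arc_mu_der y : der rc `[- phi, phi] (fun y => mu y : R[i]^o) y ('i%C * mu y).
Proof. exact: der_cexp (der_vpath _ x y). Qed.

Lemma entire_arc_cont (u y : R) : cont rc `[- phi, phi] (fun y => entire u (x +i* y)) y.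
Proof.
have [v hv] := cdiff_entire u (I : setT (x +i* y)).
exact: (cont_comp (i' := id) (D' := setT) (fun _ _ => I) (der_cont (der_vpath _ x y)) (der_cont hv)).
Qed.

Lemma entire_shift (s y : R) : entire t (x +i* y) * cexp (- (mu y * s%:C)) = entire (t - s) (x +i* y).
Proof.
rewrite /entire /kern (_ : (t - s)%:C * mu y = t%:C * mu y + - (mu y * s%:C)).
  by rewrite cexpD; ring.
by rewrite rmorphB /=; ring.
Qed.

Lemma arc_alg (i e p q s k : R[i]) :
  i * (e * p) - i * (e * q) - s * (i * (e * k)) = i * (e * (p - q - s * k)).
Proof. ring. Qed.

(* By differentiation in T of the integral with f truncated to [0, T]. *)
Lemma arc_inversion v :
  arc (fun y => 'i%C *: (entire t (x +i* y) * Lap f (mu y))) v ->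
  nrm (v - 'i%C * (2 * pi)%:C * Th2 t : R[i]^o) <= 4 * pi * M * expR (c * t) / (c - a) * expR (- x).
Proof.
move=> hv; have [M0 fc fM] := hf; have pp := pi_gt0 R; have [p0 p1] := andP phi_b.
have ab : - phi <= phi by lra.
have d0 : 0 < c - a by rewrite subr_gt0.
have [Pf hPf] : {Pf : R[i] -> R -> R[i]^o & forall m, a < complex.Re m -> is_Lapint f m (Pf m) /\
   forall T, 0 <= T -> nrm (Lap f m - Pf m T) <= M / (complex.Re m - a) * expR ((a - complex.Re m) * T)}.
  apply: (@choice _ _ (fun m P => a < complex.Re m -> is_Lapint f m P /\
   forall T, 0 <= T -> nrm (Lap f m - P T) <= M / (complex.Re m - a) * expR ((a - complex.Re m) * T))) => m.
  have [am|] := ltP a (complex.Re m); last by exists (fun=> 0).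
  have [w [P [[P0 hP] hw hT]]] := Lap_ex hf am; exists P => _.
  have -> : Lap f m = w by apply: is_Lap_uniq (LapP hf am) _; exists P.
  by [].
have hmu y : - phi <= y <= phi -> is_Lapint f (mu y) (Pf (mu y)).
  by move=> /arc_Re h; have [] := hPf (mu y) (lt_le_trans ac h).
set B := expR (t * expR x - x).
have hB y : nrm (entire t (x +i* y) : R[i]) <= B.
  rewrite nrm_entire /B ler_expR lerD2r; apply: (ler_wpM2l t0).
  by rewrite ler_piMr ?expR_ge0 // cos_le1.
have trunc_cont T y : 0 <= T -> - phi <= y <= phi -> cont rc `[- phi, phi] (fun y => Pf (mu y) T) y.
  move=> T0 hy e e0.
  have K1 : 0 < T * expR T * M * T + 1 by apply: ltr_pwDr; rewrite ?mulr_ge0 ?expR_ge0.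
  have m0 : 0 < Num.min 1 (e / (T * expR T * M * T + 1)) by rewrite lt_min ltr01 divr_gt0.
  have [d dd0 hd] := der_cont (arc_mu_der y) (divr_gt0 m0 (ltr0n _ 2 : 0 < 2)).
  exists d => // s hs /(hd s hs) h.
  have hs' : - phi <= s <= phi by move: hs; rewrite /= in_itv.
  have h1 : is_Lapint f (mu y + (mu s - mu y)) (Pf (mu s)) by rewrite addrC subrK; exact: hmu.
  apply: le_trans (lapint_lip (arc_Re hy) (hmu y hy) h1 T0) _.
  set k := nrm _ in h *; have k0 : 0 <= k := nrm_ge0 _.
  have [k1 k2] : k <= 1 /\ k * (T * expR T * M * T + 1) <= e.
    have q : k <= Num.min 1 (e / (T * expR T * M * T + 1)) by lra.
    by rewrite -ler_pdivlMr //; apply/andP; rewrite -le_min.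
  apply: le_trans k2; apply: le_trans (_ : k * (T * expR T * M * T) <= _); last first.
    by rewrite ler_wpM2l // lerDl.
  rewrite -!mulrA ler_wpM2l // ler_wpM2l // ler_wpM2r ?mulr_ge0 // ler_expR.
  by rewrite -[X in _ <= X]mul1r ler_wpM2r.
have [D hD] : {D : R -> R[i]^o & forall T, 0 <= T ->
   arc (fun y => 'i%C *: (entire t (x +i* y) * Pf (mu y) T)) (D T)}.
  apply: (@choice _ _ (fun T d => 0 <= T -> arc (fun y => 'i%C *: (entire t (x +i* y) * Pf (mu y) T)) d)) => T.
  have [T0|] := leP 0 T; last by exists 0.
  have [d hd] := int_ex (@complex_complete R) ab (fun y hy => contZ 'i%C (contS (entire_arc_cont t y) (trunc_cont T y T0 hy))).
  by exists d => _.
have [J hJ] : {J : R -> R[i]^o & forall T, arc (fun y => 'i%C *: entire (t - T) (x +i* y)) (J T)}.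
  apply: (@choice _ _ (fun T d => arc (fun y => 'i%C *: entire (t - T) (x +i* y)) d)) => T.
  exact: int_ex (@complex_complete R) _ _ _ ab (fun y hy => contZ 'i%C (entire_arc_cont (t - T) y)).
have hJ' T : arc (fun y => 'i%C *: (entire t (x +i* y) * (cexp (- (mu y * T%:C)) *: f T))) (f T *: J T).
  have := intZD (f T) (hJ T) (intZD (- 1) (hJ 0) (hJ 0)).
  rewrite scaleN1r addNr addr0 => -[P [hP ->]]; exists P; split => // y hy.
  apply: der_eq (hP y hy); rewrite -(entire_shift T).
  by rewrite !regE; ring.
(* Differentiation under the arc integral: e^{t mu} e^{- mu T} is the kernel at time [t - T], and
   [f T] comes out as a factor. *)
have Dd T : 0 <= T -> der rc halfline D T (f T *: J T).
  move=> T0; apply: (der_int (Psi := fun T y => 'i%C *: (entire t (x +i* y) * (cexp (- (mu y * T%:C)) *: f T))) ab T0 hD (hJ' T)) => e e0.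
  have e1 : 0 < e / (B + 1) by rewrite divr_gt0 // ltr_pwDr ?expR_ge0.
  have [d dd0 hd] := lapint_der_unif T0 (expR_ge0 x) e1; exists d => // S y S0 Sd hy.
  have E := arc_alg 'i%C (entire t (x +i* y)) (Pf (mu y) S) (Pf (mu y) T) (S - T)%:C (cexp (- (mu y * T%:C)) * f T).
  apply: le_trans (_ : nrm ('i%C * (entire t (x +i* y) * (Pf (mu y) S - Pf (mu y) T - (S - T)%:C * (cexp (- (mu y * T%:C)) * f T)))) <= _).
    by rewrite le_eqVlt; apply/orP; left; apply/eqP; congr nrm; exact: E.
  rewrite nrmM nrm_i mul1r nrmM.
  have hn : nrm (mu y) <= expR x by rewrite nrm_cexp.
  apply: le_trans (ler_pM (nrm_ge0 _) (nrm_ge0 _) (hB y) (hd _ _ S hn (arc_Re hy) (hmu y hy) S0 Sd)) _.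
  rewrite mulrA ler_wpM2r // mulrCA ler_piMr ?(ltW e0) //.
  by rewrite ler_pdivrMr ?mul1r ?lerDl // ltr_pwDr ?expR_ge0.
set K := 2 * pi * M * expR (c * t) * expR (- x).
have K0 : 0 <= K by rewrite /K !mulr_ge0 ?expR_ge0 ?(ltW pp).
have Jb T : nrm (J T - 'i%C * (2 * pi)%:C * (Num.max (t - T) 0)%:C : R[i]^o) <= 2 * pi * expR (c * (t - T)) * expR (- x).
  exact: arc_kernel phi_b hc (hJ T).
have Kb T : 0 <= T -> nrm (f T) * (2 * pi * expR (c * (t - T)) * expR (- x)) <= K * expR ((a - c) * T).
  move=> T0; apply: le_trans (_ : M * expR (a * T) * (2 * pi * expR (c * (t - T)) * expR (- x)) <= _).
    by rewrite ler_wpM2r ?fM // !mulr_ge0 ?expR_ge0 ?(ltW pp).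
  have -> : c * (t - T) = c * t + - c * T by ring.
  have -> : (a - c) * T = a * T + - c * T by ring.
  by rewrite !expRD /K le_eqVlt; apply/orP; left; apply/eqP; ring.
have acn : a - c != 0 by rewrite subr_eq0 lt_eqF.
have Kd T : 0 <= T -> K / (a - c) * expR ((a - c) * T) <= 0.
  by move=> T0; rewrite pmulr_lle0 ?expR_gt0 // -[a - c]opprB invrN mulrN oppr_le0 divr_ge0 // ltW.
have Kd0 (s r : R) : 0 <= s -> 0 <= r -> K / (a - c) * expR ((a - c) * r) - K / (a - c) * expR ((a - c) * s) <= K / (c - a).
  move=> s0 r0; have := Kd r r0; suff: - (K / (a - c) * expR ((a - c) * s)) <= K / (c - a) by lra.
  rewrite -mulNr -mulrN -invrN opprB -[X in _ <= X]mulr1 ler_wpM2l ?divr_ge0 ?(ltW d0) //.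
  by rewrite -expR0 ler_expR; nra.
(* The value that [D T] would have if [J T] were exactly 2 pi i (t - T) for all [T]; at [T = t] the
   first term drops out and the wanted limit is left. *)
pose W T : R[i]^o := 'i%C * (2 * pi)%:C *: ((t - T)%:C * Th1 T + Th2 T).
have Wd T : 0 <= T -> der rc halfline W T ('i%C * (2 * pi)%:C *: ((t - T)%:C * f T) : R[i]^o).
  move=> T0; apply: derZ.
  have h := derS (derB (der_cst rc halfline (t%:C : R[i]^o) T) (der_id rc halfline T)) (Th1d T0).
  have h2 := derD h (Th2d T0).
  have -> : (t - T)%:C * f T = (0 - 1) *: Th1 T + (t%:C - T%:C) *: f T + Th1 T.
    by rewrite !regE rmorphB /=; ring.
  apply: der_ext h2 => // s _; by rewrite rmorphB regE.
have D00 : D 0 = 0.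
  have h := int_le ab (hD 0 (lexx _)) (M := 0).
  apply: nrm_eq0; apply/eqP; rewrite eq_le nrm_ge0 andbT.
  apply: le_trans (h _) _; last by rewrite mul0r.
  by move=> y /hmu [-> _]; rewrite mulr0 scaler0 nrm0.
have W00 : W 0 = 0 by rewrite /W Th10 Th20 mulr0 addr0 scaler0.
have Wt : W t = 'i%C * (2 * pi)%:C * Th2 t by rewrite /W subrr mul0r add0r.
have s1 : nrm (D t - W t) <= K / (c - a).
  have := @mvt_exp R _ halfline (fun T => D T - W T) _ K (a - c) 0 t t0 acn
    (fun T hT => (andP hT).1) (fun T hT => derB (Dd T (andP hT).1) (Wd T (andP hT).1)).
  rewrite D00 W00 !subr0; move=> /(_ _)/le_trans; apply; last exact: Kd0.
  move=> T /andP[T0 Tt]; apply: le_trans (Kb T T0).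
  have -> : f T *: J T - 'i%C * (2 * pi)%:C *: ((t - T)%:C * f T) = f T * (J T - 'i%C * (2 * pi)%:C * (Num.max (t - T) 0)%:C) :> R[i]^o.
    have -> : Num.max (t - T) 0 = t - T by apply/max_idPl; lra.
    by rewrite !regE; ring.
  by rewrite (nrmM (f T)) ler_wpM2l ?nrm_ge0.
have s2 T : t <= T -> nrm (D T - D t) <= K / (c - a).
  move=> tT; have pos S : t <= S <= T -> 0 <= S by move=> /andP[h _]; exact: le_trans t0 h.
  have := @mvt_exp R _ halfline D _ K (a - c) t T tT acn
    (fun T hT => pos T hT) (fun T hT => Dd T (pos T hT)).
  move=> /(_ _)/le_trans; apply; last by apply: Kd0; [exact: t0|exact: le_trans t0 tT].
  move=> S hS; apply: le_trans (Kb S (pos S hS)).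
  rewrite (nrmM (f S)) ler_wpM2l ?nrm_ge0 //; have := Jb S.
  have -> : Num.max (t - S) 0 = 0 by apply/max_idPr; move: hS => /andP[]; lra.
  by rewrite mulr0 subr0.
have s3 T : 0 <= T -> nrm (v - D T) <= B * (M / (c - a) * expR ((a - c) * T)) * (phi - - phi).
  move=> T0; apply: (int_sub_le ab hv (hD T T0)) => y hy.
  have h := arc_Re hy; have [_ hP] := hPf (mu y) (lt_le_trans ac h).
  have -> : 'i%C *: (entire t (x +i* y) * Lap f (mu y)) - 'i%C *: (entire t (x +i* y) * Pf (mu y) T) =
    'i%C * (entire t (x +i* y) * (Lap f (mu y) - Pf (mu y) T)) :> R[i]^o by rewrite !regE; ring.
  rewrite nrmM nrm_i mul1r nrmM; apply: ler_pM; rewrite ?nrm_ge0 //.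
  apply: le_trans (hP T T0) _.
  apply: ler_pM; rewrite ?divr_ge0 ?expR_ge0 //; first by lra.
    by rewrite ler_wpM2l // lef_pV2 ?posrE; lra.
  by rewrite ler_expR ler_wpM2r //; lra.
(* Two equal errors: on [0, t] from the comparison with [W] ([s1]), beyond [t] from the smallness of
   [J] ([s2]). The truncation error [s3] tends to 0. *)
have -> : 4 * pi * M * expR (c * t) / (c - a) * expR (- x) = 2 * (K / (c - a)) by rewrite /K; ring.
apply/ler_addgt0Pl => e e0.
have CC : 0 <= B * (M / (c - a)) * (phi - - phi).
  by rewrite mulr_ge0 ?subr_ge0 // mulr_ge0 ?expR_ge0 // divr_ge0 // ltW.
have [X X0 hX] := exp_lim CC d0 e0.
set T := Num.max X t; have tT : t <= T by rewrite /T le_max lexx orbT.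
have XT : X <= T by rewrite /T le_max lexx.
have h1 := s2 T tT; have h3 := s3 T (le_trans t0 tT); have h4 := hX T XT.
have h5 : B * (M / (c - a) * expR ((a - c) * T)) * (phi - - phi) <= e.
  by move: h4; rewrite opprB; congr (_ <= _); ring.
rewrite -Wt; have := nrm_tri (D T) v (W t); have := nrm_tri (D t) (D T) (W t); clear -h1 h3 h5 s1; lra.
Qed.

End ArcInversion.

(** * Transfer of closed relations *)

Section Transfer.
Context {R : realType} {E : normedModType R[i]}.
Hypothesis Ec : seq_complete E.
Local Notation rc := (real_complex R).

Definition closed_rel (Gr : E -> E -> Prop) : Prop := [/\ Gr 0 0,
  forall (a : R[i]) u v u' v', Gr u v -> Gr u' v' -> Gr (a *: u + u') (a *: v + v') &
  forall u v, (forall e : R, 0 < e -> exists u' v', [/\ Gr u' v', nrm (u' - u) <= e & nrm (v' - v) <= e]) -> Gr u v].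

Section Rel.
Variable Gr : E -> E -> Prop.
Hypothesis hG : closed_rel Gr.

Lemma relZ (a : R[i]) u v : Gr u v -> Gr (a *: u) (a *: v).
Proof.
have [G0 GL _] := hG => h; rewrite -[a *: u]addr0 -[a *: v]addr0; exact: GL.
Qed.

Lemma relB u v u' v' : Gr u v -> Gr u' v' -> Gr (u - u') (v - v').
Proof.
have [_ GL _] := hG => h h'; rewrite addrC [v - v']addrC -(scaleN1r u') -(scaleN1r v'); exact: GL.
Qed.

Lemma relD u v u' v' : Gr u v -> Gr u' v' -> Gr (u + u') (v + v').
Proof. by have [_ GL _] := hG => h h'; have := GL 1 _ _ _ _ h h'; rewrite !scale1r. Qed.

(** Riemann sums of the pair lie in the subspace, which is closed; [cousin] provides a pair of sums
    close to both integrals at once. *)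
Lemma rel_int (a b : R) g1 g2 v1 v2 : a <= b -> is_int a b g1 v1 -> is_int a b g2 v2 ->
  (forall y, a <= y <= b -> Gr (g1 y) (g2 y)) -> Gr v1 v2.
Proof.
move=> ab [P1 [hP1 ->]] [P2 [hP2 ->]] hg; have [G0 GL GC] := hG; apply: GC => e e0.
have b1 : 0 < b - a + 1 by lra.
have e1 : 0 < e / (b - a + 1) by rewrite divr_gt0.
pose Q x y := exists p q, [/\ Gr p q, nrm (P1 y - P1 x - p) <= e / (b - a + 1) * (y - x) &
  nrm (P2 y - P2 x - q) <= e / (b - a + 1) * (y - x)].
have : Q a b.
  apply: (cousin (Q := Q) ab).
    move=> x y z _ _ _ _ [p [q [h1 h2 h3]]] [p' [q' [h1' h2' h3']]].
    exists (p + p'), (q + q'); split; first exact: relD.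
      have -> : P1 z - P1 x - (p + p') = (P1 y - P1 x - p) + (P1 z - P1 y - p') by modring R[i].
      by apply: le_trans (ler_nrmD _ _) _; have := lerD h2 h2'; rewrite -mulrDr; congr (_ <= _ * _); ring.
    have -> : P2 z - P2 x - (q + q') = (P2 y - P2 x - q) + (P2 z - P2 y - q') by modring R[i].
    by apply: le_trans (ler_nrmD _ _) _; have := lerD h3 h3'; rewrite -mulrDr; congr (_ <= _ * _); ring.
  move=> c hc; have [d1 d10 h1] := der_straddle (hP1 c hc) e1.
  have [d2 d20 h2] := der_straddle (hP2 c hc) e1.
  exists (Num.min d1 d2); first by rewrite lt_min d10.
  move=> x y ax xc cy yb; rewrite lt_min => /andP[D1 D2].
  have Dx : `[a, b]%classic x by rewrite /= in_itv /= ax (le_trans xc) // (le_trans cy).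
  have Dy : `[a, b]%classic y by rewrite /= in_itv /= yb (le_trans ax) // (le_trans xc).
  by exists ((y - x)%:C *: g1 c), ((y - x)%:C *: g2 c); split; [apply: relZ; exact: hg|exact: h1|exact: h2].
move=> [p [q [h1 h2 h3]]]; exists p, q.
have be : e / (b - a + 1) * (b - a) <= e by rewrite mulrAC ler_pdivrMr // ler_wpM2l ?(ltW e0) //; lra.
by split => //; rewrite nrmB; apply: le_trans be.
Qed.

Lemma rel_der (F1 F2 : R -> E) (t : R) v1 v2 : 0 < t ->
  (forall s : R, 0 < s -> Gr (F1 s) (F2 s)) ->
  der rc [set s | 0 < s] F1 t v1 -> der rc [set s | 0 < s] F2 t v2 -> Gr v1 v2.
Proof.
move=> t0 hF h1 h2; have [_ _ GC] := hG; apply: GC => e e0.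
have [d1 d10 k1] := h1 e e0; have [d2 d20 k2] := h2 e e0.
set m := Num.min d1 d2; have m0 : 0 < m by rewrite lt_min d10.
set s := m / 2; have s0 : 0 < s by rewrite divr_gt0.
have sm : s < m by rewrite /s; lra.
have /andP[sd1 sd2] : (s < d1) && (s < d2) by rewrite -lt_min.
have ts : 0 < t + s by lra.
have E0 : nrm ((t + s)%:C - t%:C : R[i]) = s by rewrite nrmRB (addrC t) addrK gtr0_norm.
have sC : s%:C != 0 :> R[i] by apply/eqP => -[]/eqP; rewrite gt_eqF.
have q (F : R -> E) v : nrm (F (t + s) - F t - ((t + s)%:C - t%:C) *: v) <= e * s ->
    nrm (s%:C^-1 *: (F (t + s) - F t) - v) <= e.
  rewrite -rmorphB (addrC t) addrK => h.
  have -> : s%:C^-1 *: (F (s + t) - F t) - v = s%:C^-1 *: (F (s + t) - F t - s%:C *: v).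
    by rewrite [RHS]scalerBr scalerA mulVf // scale1r.
  by rewrite nrmZ nrmV nrmC gtr0_norm // mulrC ler_pdivrMr.
exists (s%:C^-1 *: (F1 (t + s) - F1 t)), (s%:C^-1 *: (F2 (t + s) - F2 t)); split.
- by apply: relZ; apply: relB; exact: hF.
- by apply: q; have := k1 _ ts; rewrite /= E0; apply.
- by apply: q; have := k2 _ ts; rewrite /= E0; apply.
Qed.

End Rel.

Definition reg n (u : R[i] -> E) (w : R[i]) : E := cexp (- w) ^+ n *: u w.

Lemma reg0 u w : reg 0 u w = u w. Proof. by rewrite /reg expr0 scale1r. Qed.

Lemma regS n u w : cexp w *: reg n.+1 u w = reg n u w.
Proof. by rewrite /reg exprS scalerA mulrA cexpN mul1r. Qed.

Lemma nrm_reg n u w : nrm (reg n u w) = expR (- complex.Re w) ^+ n * nrm (u w).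
Proof. by rewrite /reg nrmZ nrmX nrm_cexp; case: w. Qed.

Lemma reg_diff V n u : cdiff_on V u -> cdiff_on V (reg n u).
Proof.
move=> hu; elim: n => [|n ih]; first by apply: (cdiff_ext _ hu) => w _; rewrite reg0.
apply: (@cdiff_ext _ _ _ (fun w => cexp (- w) *: reg n u w)).
  by move=> w _; rewrite /reg exprS scalerA.
apply: cdiff_scale ih => w _; have h := der_cexp (derN (der_id id V w)).
by eexists; exact: h.
Qed.

Variables (th M : R) (th1 : pi / 2 < th) (th2 : th < pi) (M0 : 0 <= M).

Lemma th_ge0 : 0 <= th.
Proof. by have h := th1; have := pi_gt0 R; lra. Qed.

Lemma cos_th_lt0 : cos th < 0.
Proof.
have h1 := th1; have h2 := th2; have pp := pi_gt0 R.
rewrite -(@cos_pihalf R) ltr_cos // in_itv /=; apply/andP; split; lra.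
Qed.

Lemma sectorial_pos (t : R) : 0 < t -> sectorial th t%:C.
Proof.
move=> t0; rewrite /sectorial; split; rewrite ReM_real /dir /= ?cosN pmulr_rlt0 //; exact: cos_th_lt0.
Qed.

Section LapPrimitives.
Variable u : R[i] -> E.
Hypothesis hu : cdiff_on (strip th) u.
Hypothesis uM : forall w, strip th w -> 0 <= complex.Re w -> nrm (u w) <= M.

Lemma reg_le n w : strip th w -> 0 <= complex.Re w ->
  nrm (reg n u w) <= M * expR (complex.Re w) ^+ 0.
Proof.
move=> hw w0; rewrite nrm_reg expr0 mulr1 -[X in _ <= X]mul1r.
apply: ler_pM; rewrite ?exprn_ge0 ?expR_ge0 ?nrm_ge0 ?uM //.
by rewrite exprn_ile1 ?expR_ge0 // -expR0 ler_expR oppr_le0.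
Qed.

Lemma reg_lap n : exists V : R[i] -> E, forall z, sectorial th z -> is_lap th z (reg n u) (V z).
Proof.
have H z : exists v, sectorial th z -> is_lap th z (reg n u) v.
  have [hz|nz] := pselect (sectorial th z); last by exists 0.
  have [k k0 kz] := sectorial_decay hz.
  have [v hv] := lap_ex Ec th_ge0 k0 kz M0 (x1 := 0) (m := 0) (fun w => @reg_le n w) (reg_diff n hu).
  by exists v.
by have [V hV] := choice H; exists V.
Qed.

Lemma reg_der n V V' (t : R) : 0 < t ->
  (forall z, sectorial th z -> is_lap th z (reg n.+1 u) (V z)) ->
  (forall z, sectorial th z -> is_lap th z (reg n u) (V' z)) ->
  der rc [set s | 0 < s] (fun s => V s%:C) t (V' t%:C).
Proof.
move=> t0 hV hV'; have ht := sectorial_pos t0.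
have h := lap_der th_ge0 M0 (@reg_le n.+1) hV ht
  (lap_ext (fun w _ => esym (regS n u w)) (hV' _ ht)).
rewrite -[V' _]scale1r; apply: (der_comp (i' := id) (g := rc) (D' := sectorial th) _ (der_id _ _ _) h).
by move=> s; exact: sectorial_pos.
Qed.

(** For x >= 0 the angle satisfies e^x cos (phi x) = 1, so the discarded part of the circle has Re
    mu <= 1 and the kernel is at most e^t there; one of the factors e^{-w} then supplies
    [expR (- x)]. The absolute value keeps the argument of [acos] in (0, 1] for all [x]. *)
Lemma reg_arcs n V (t : R) : 0 < t -> is_lap th t%:C (reg n.+2 u) V ->
  let phi x := acos (expR (- `|x|)) in
  exists G, is_prim th (fun w => kern t%:C w *: reg n.+2 u w) G /\
    lim_infty (fun x => G (x +i* phi x) - G (x -i* phi x)) V.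
Proof.
move=> t0 hV phi; have pp := pi_gt0 R; have h1 := th1; have h2 := th2.
have ex (x : R) : 0 < expR (- `|x|) <= 1 by rewrite expR_gt0 /= -expR0 ler_expR oppr_le0 normr_ge0.
have exi (x : R) : -1 <= expR (- `|x|) <= 1 by have /andP[? ->] := ex x; rewrite andbT; lra.
have hphi x : 0 <= phi x <= pi / 2.
  rewrite acos_ge0 //= leNgt; apply/negP => h.
  have : cos (phi x) < 0.
    rewrite -(@cos_pihalf R) ltr_cos ?in_itv /= ?acos_ge0 ?acos_lepi //; lra.
  by rewrite acosK ?in_itv //= ltNge (ltW _) //; have /andP[] := ex x.
apply: (@contour_arcs R E th (fun w => kern t%:C w *: reg n.+2 u w) V phi 0 (expR t * M) hV).
  by move=> x; have := hphi x; lra.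
move=> x y x0 py yth; rewrite nrmZ nrm_kern ReM_real.
have hc : expR x * cos y <= 1.
  have : cos y <= expR (- x).
    rewrite -(cos_norm y) -[expR (- x)](@acosK R) ?in_itv /=; last by have := exi x; rewrite ger0_norm.
    rewrite leNgt ltr_cos ?in_itv /= ?normr_ge0 ?acos_ge0 ?acos_lepi //.
    - by rewrite -leNgt; move: py; rewrite /phi ger0_norm.
    - lra.
    - by have := exi x; rewrite ger0_norm.
    - by have := exi x; rewrite ger0_norm.
  by move=> h; rewrite -(expRxMexpNx_1 x) ler_wpM2l ?expR_ge0.
rewrite mulrAC -mulrA; apply: ler_pM; rewrite ?expR_ge0 ?nrm_ge0 //.
  by rewrite ler_expR mulrCA -[X in _ <= X]mulr1 ler_wpM2l // ltW.
rewrite nrm_reg /= exprS -mulrA ler_wpM2l ?expR_ge0 // -[M]mul1r.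
apply: ler_pM; rewrite ?exprn_ge0 ?expR_ge0 ?nrm_ge0 //.
  by rewrite exprn_ile1 ?expR_ge0 // -expR0 ler_expR oppr_le0.
by apply: uM.
Qed.

End LapPrimitives.

Lemma int_scalar (a b : R) (s : R -> R[i]^o) v (y : E) : is_int a b s v ->
  is_int a b (fun t => s t *: y) (v *: y).
Proof.
move=> [P [hP ->]]; exists (fun t => P t *: y); split; last by rewrite scalerBl.
move=> t ht; apply: der_eq (derS (hP t ht) (der_cst rc _ y t)).
by rewrite scaler0 addr0.
Qed.

(** The relation is assumed for Re mu >= 1, which the arcs of [reg_arcs] do not leave. Multiplied by
    i e^{t mu} e^{-2w}, its scalar term becomes the integrand of [arc_inversion]. The choice
    [y0 = 0] carries over plain commutation relations. *)
Lemma transfer Gr (u1 u2 : R[i] -> E) (f : R -> R[i]^o) (a Mf : R) (y0 : E) : closed_rel Gr ->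
  cdiff_on (strip th) u1 -> cdiff_on (strip th) u2 ->
  (forall w, strip th w -> 0 <= complex.Re w -> nrm (u1 w) <= M) ->
  (forall w, strip th w -> 0 <= complex.Re w -> nrm (u2 w) <= M) ->
  a < 1 -> exp_class a Mf f ->
  (forall w, strip th w -> 1 <= complex.Re (cexp w) ->
     Gr (u1 w) (u2 w - (cexp w * Lap f (cexp w)) *: y0)) ->
  forall (t : R) v1 v2, 0 < t -> is_lap th t%:C u1 v1 -> is_lap th t%:C u2 v2 ->
  Gr v1 (v2 - ('i%C * (2 * pi)%:C * f t) *: y0).
Proof.
move=> hG d1 d2 M1 M2 a1 hf hrel t v1 v2 t0 hv1 hv2.
have pp := pi_gt0 R; have [_ fc _] := hf.
have [Th1 [Th10 Th1d]] := prim_halfline (@complex_complete R) fc.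
have [Th2 [Th20 Th2d]] := prim_halfline (@complex_complete R) (fun s s0 => der_cont (Th1d s s0)).
have V1 n := reg_lap d1 M1 n; have V2 n := reg_lap d2 M2 n.
have [A2 hA2] := V1 2%N; have [A1 hA1] := V1 1%N; have [A0 hA0] := V1 0%N.
have [B2 hB2] := V2 2%N; have [B1 hB1] := V2 1%N; have [B0 hB0] := V2 0%N.
have arcs (s : R) : 0 < s -> Gr (A2 s%:C) (B2 s%:C - ('i%C * (2 * pi)%:C * Th2 s) *: y0).
  move=> s0; have hs := sectorial_pos s0.
  have [G1 [hG1 l1]] := reg_arcs M1 s0 (hA2 _ hs).
  have [G2 [hG2 l2]] := reg_arcs M2 s0 (hB2 _ hs).
  set phi := fun x : R => acos (expR (- `|x|)) in l1 l2.
  have [_ _ GC] := hG; apply: GC => e e0.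
  have Mf0 : 0 <= Mf by have [] := hf.
  set C := 4 * pi * Mf * expR (1 * s) / (1 - a).
  have C0 : 0 <= C.
    by rewrite /C divr_ge0 ?mulr_ge0 ?expR_ge0 ?(ltW pp) //; lra.
  have e2 : 0 < e / 2 / (nrm y0 + 1) by rewrite !divr_gt0 // ltr_pwDr // nrm_ge0.
  have e2' : 0 < e / 2 by rewrite divr_gt0.
  have [X1 k1] := l1 e e0; have [X2 k2] := l2 _ e2'.
  have [X3 [X30 k3]] := expRN_small C0 e2.
  set x := Num.max X3 (Num.max X1 X2).
  have [x3 x1 x2] : [/\ X3 <= x, X1 <= x & X2 <= x] by rewrite /x !le_max !lexx ?orbT.
  have x0 : 0 <= x by exact: le_trans x3.
  have px : phi x = acos (expR (- x)) by rewrite /phi ger0_norm.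
  have ex1 : expR (- x) <= 1 by rewrite -expR0 ler_expR oppr_le0.
  have ex : -1 <= expR (- x) <= 1 by rewrite ex1 andbT; have := expR_ge0 (- x); lra.
  have cphi : cos (phi x) = expR (- x) by rewrite px acosK // in_itv.
  have p0 : 0 <= phi x by rewrite px acos_ge0.
  have p1 : phi x <= pi / 2.
    rewrite leNgt; apply/negP => h; have : cos (phi x) < 0.
      by clear -h pp ex px; rewrite -(@cos_pihalf R) ltr_cos ?in_itv /= ?px ?acos_ge0 ?acos_lepi //; lra.
    by rewrite cphi ltNge expR_ge0.
  have ab : - phi x <= phi x by clear -p0; lra.
  have thp : phi x < th := le_lt_trans p1 th1.
  have sub : `[- phi x, phi x]%classic `<=` `[- th, th]%classic.
    by clear -thp => r; rewrite /= !in_itv /= => /andP[ra rb]; apply/andP; split; lra.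
  have inth r : - phi x <= r <= phi x -> `|r| <= th by clear -thp => hr; rewrite ler_norml; lra.
  have I1 : is_int (- phi x) (phi x) (fun r => 'i%C *: (kern s%:C (x +i* r) *: reg 2 u1 (x +i* r)))
      (G1 (x +i* phi x) - G1 (x -i* phi x)).
    by exists (fun r => G1 (x +i* r)); split => // r hr; exact: der_sub sub (prim_vline x hG1 (inth r hr)).
  have I2 : is_int (- phi x) (phi x) (fun r => 'i%C *: (kern s%:C (x +i* r) *: reg 2 u2 (x +i* r)))
      (G2 (x +i* phi x) - G2 (x -i* phi x)).
    by exists (fun r => G2 (x +i* r)); split => // r hr; exact: der_sub sub (prim_vline x hG2 (inth r hr)).
  have hb : 0 <= phi x <= pi / 2 by rewrite p0.
  have hc : expR x * cos (phi x) = 1 by rewrite cphi expRxMexpNx_1.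
  have Re1 r : - phi x <= r <= phi x -> 1 <= complex.Re (cexp (x +i* r)).
    by move=> hr; exact: arc_Re hb hc r hr.
  have cLap r : - phi x <= r <= phi x -> cont rc `[- phi x, phi x] (fun r => Lap f (cexp (x +i* r))) r.
    move=> hr; have hl := Lap_der setT hf (lt_le_trans a1 (Re1 r hr)).
    exact: (cont_comp (i' := id) (D' := setT) (fun _ _ => I) (der_cont (arc_mu_der x (phi x) r)) (der_cont hl)).
  have [S hS] := int_ex (@complex_complete R) ab
    (fun r hr => contZ 'i%C (contS (entire_arc_cont x (phi x) s r) (cLap r hr))).
  have hinv := arc_inversion hf ltr01 a1 (ltW s0) hb hc Th10 Th1d Th20 Th2d hS.
  (* Approximants at radius e^x: a pair of arc integrals that lies exactly in the subspace by
     [rel_int] and converges to the pair sought. *)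
  exists (G1 (x +i* phi x) - G1 (x -i* phi x)), (G2 (x +i* phi x) - G2 (x -i* phi x) - S *: y0); split.
  - have I3 := intZD (-1) (int_scalar y0 hS) I2.
    apply: (rel_int hG ab I1 (v2 := G2 (x +i* phi x) - G2 (x -i* phi x) - S *: y0)
      (g2 := fun r => -1 *: (('i%C *: (entire s (x +i* r) *: Lap f (cexp (x +i* r)))) *: y0) +
         'i%C *: (kern s%:C (x +i* r) *: reg 2 u2 (x +i* r)))).
      by move: I3; rewrite scaleN1r [- _ + _]addrC.
    move=> r hr; set w := x +i* r.
    have hw : strip th w by rewrite /strip /= inth.
    have := relZ hG ('i%C * kern s%:C w * cexp (- w) ^+ 2) (hrel w hw (Re1 r hr)).
    congr Gr; rewrite /reg; first by rewrite !scalerA.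
    rewrite /entire -/w -(scaleN1r (_ *: y0)).
    have -> : 'i%C *: ((kern s%:C w * cexp (- w)) *: Lap f (cexp w)) =
        'i%C * kern s%:C w * cexp (- w) ^+ 2 * (cexp w * Lap f (cexp w)) :> R[i].
      by rewrite !regE; have := cexpN w; move: (cexp w) (cexp (- w)) (kern _ _) (Lap _ _) => p q k l pq; ring: pq.
    by modring R[i].
  - exact: k1.
  have h2 := k2 x x2.
  have h3 : nrm ((S - 'i%C * (2 * pi)%:C * Th2 s) *: y0) <= e / 2.
    rewrite nrmZ; apply: le_trans (ler_wpM2r (nrm_ge0 _) (le_trans hinv (k3 x x3))) _.
    rewrite mulrAC ler_pdivrMr ?ltr_pwDr ?nrm_ge0 // ler_wpM2l ?(ltW e2') //; lra.
  have -> : G2 (x +i* phi x) - G2 (x -i* phi x) - S *: y0 - (B2 s%:C - ('i%C * (2 * pi)%:C * Th2 s) *: y0)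
     = G2 (x +i* phi x) - G2 (x -i* phi x) - B2 s%:C - (S - 'i%C * (2 * pi)%:C * Th2 s) *: y0.
    by rewrite scalerBl; modring R[i].
  by apply: le_trans (ler_nrmB _ _) _; clear -h2 h3; lra.
have sub : [set s : R | 0 < s] `<=` halfline by move=> s /ltW.
have dTh (F F' : R -> R[i]^o) (s : R) : 0 < s -> (forall r, 0 <= r -> der rc halfline F r (F' r)) ->
    der rc [set s | 0 < s] (fun s => ('i%C * (2 * pi)%:C * F s) *: y0) s (('i%C * (2 * pi)%:C * F' s) *: y0).
  move=> s0 hF; have h := derS (derZ ('i%C * (2 * pi)%:C) (der_sub sub (hF s (ltW s0)))) (der_cst rc _ y0 s).
  by apply: der_eq h; rewrite scaler0 addr0.
(* Each differentiation removes one factor e^{-w} from the integrands and one integration from the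
   scalar term. *)
have step1 (s : R) : 0 < s -> Gr (A1 s%:C) (B1 s%:C - ('i%C * (2 * pi)%:C * Th1 s) *: y0).
  move=> s0; apply: (rel_der hG s0 arcs).
    exact (reg_der M1 s0 hA2 hA1).
  exact: derB (reg_der M2 s0 hB2 hB1) (dTh _ _ _ s0 Th2d).
have step0 : Gr (A0 t%:C) (B0 t%:C - ('i%C * (2 * pi)%:C * f t) *: y0).
  apply: (rel_der hG t0 step1).
    exact (reg_der M1 t0 hA1 hA0).
  exact: derB (reg_der M2 t0 hB1 hB0) (dTh _ _ _ t0 Th1d).
have ht := sectorial_pos t0.
have E1 : A0 t%:C = v1.
  by apply: contour_uniq th_ge0 _ hv1; apply: lap_ext (hA0 _ ht) => w _; exact: reg0.
have E2 : B0 t%:C = v2.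
  by apply: contour_uniq th_ge0 _ hv2; apply: lap_ext (hB0 _ ht) => w _; exact: reg0.
by rewrite -E1 -E2.
Qed.

End Transfer.

(** * Bounded operators *)

Section Operators.
Context {R : realType} {E : completeNormedModType R[i]}.
Local Notation rc := (real_complex R).
Implicit Types (T : E -> E) (x : E).

Lemma bop_lin0 T : linear T -> T 0 = 0.
Proof. by move=> hT; have := hT (-1) 0 0; rewrite scaler0 addr0 scaleN1r addNr. Qed.

Lemma bop_linZ T (a : R[i]) x : linear T -> T (a *: x) = a *: T x.
Proof. by move=> hT; have := hT a x 0; rewrite !addr0 bop_lin0 // addr0. Qed.

Lemma bop_linB T x y : linear T -> T (x - y) = T x - T y.
Proof. by move=> hT; rewrite addrC -scaleN1r hT scaleN1r addrC. Qed.

Lemma lte0C (e : R) : (0 < e%:C :> R[i]) = (0 < e).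
Proof. by rewrite ltcR. Qed.

Lemma nrm_ltC (x : E) (e : R) : (`|x| < e%:C) = (nrm x < e).
Proof. by rewrite nrmE ltcR. Qed.

Lemma continuousP_eps T x : continuous T -> forall e : R, 0 < e -> exists2 d : R, 0 < d &
  forall y, nrm (x - y) < d -> nrm (T x - T y) <= e.
Proof.
move=> Tc e e0; have := Tc x; move/cvgrPdist_lt => /(_ e%:C); rewrite lte0C => /(_ e0).
move/nbhs_ballP => [d /= d0 hd]; exists (complex.Re d).
  by move: d0; rewrite ltcE /= => /andP[].
move=> y hy; apply: ltW; rewrite -nrm_ltC; apply: hd; rewrite -ball_normE /=.
have -> : d = (complex.Re d)%:C by move: d0; case: (d) => dr di; rewrite ltcE /= => /andP[/eqP -> _].
by rewrite nrm_ltC.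
Qed.

Lemma bop_bound T : bounded_operator T -> exists2 M : R, 0 <= M & forall x, nrm (T x) <= M * nrm x.
Proof.
move=> [Tl Tc]; have [d d0 hd] := continuousP_eps 0 Tc (@ltr01 R).
exists (2 / d) => [|x]; first by rewrite divr_ge0 // ltW.
have [->|x0] := eqVneq x 0; first by rewrite bop_lin0 // !nrm0 mulr0.
have nx : 0 < nrm x by rewrite lt_neqAle nrm_ge0 andbT eq_sym; apply: contraNneq x0 => /nrm_eq0 ->.
pose s := d / 2 / nrm x; have s0 : 0 < s by rewrite /s !divr_gt0.
have := hd (s%:C *: x); rewrite !sub0r !nrmN nrmZ nrmC gtr0_norm // bop_lin0 // sub0r nrmN.
rewrite bop_linZ // nrmZ nrmC gtr0_norm // {1}/s divfK ?gt_eqF // => h.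
have {}h : s * nrm (T x) <= 1 by apply: h; lra.
have -> : 2 / d * nrm x = s^-1 by rewrite /s; field; rewrite !gt_eqF.
by rewrite -[X in X <= _](mulKf (lt0r_neq0 s0)) ler_piMr // invr_ge0 ltW.
Qed.

Lemma opnorm_set_ub T (M : R) : 0 <= M -> (forall x, nrm (T x) <= M * nrm x) ->
  has_ubound [set complex.Re `|T x| | x in [set x : E | `|x| <= 1]].
Proof.
move=> M0 hM; exists M => _ [x /= x1 <-].
apply: le_trans (hM x) _; rewrite -[X in _ <= X]mulr1 ler_wpM2l //.
by move: x1; rewrite nrmE -[1](rmorph1 rc) lecR.
Qed.

Lemma opnorm_le T x : bounded_operator T -> nrm (T x) <= opnorm T * nrm x.
Proof.
move=> hT; have [Tl _] := hT; have [M M0 hM] := bop_bound hT.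
have [->|x0] := eqVneq x 0; first by rewrite bop_lin0 // !nrm0 mulr0.
have nx : 0 < nrm x by rewrite lt_neqAle nrm_ge0 andbT eq_sym; apply: contraNneq x0 => /nrm_eq0 ->.
have : nrm (T ((nrm x)^-1%:C *: x)) <= opnorm T.
  apply: (ub_le_sup (opnorm_set_ub M0 hM)); exists ((nrm x)^-1%:C *: x) => //=.
  by rewrite nrmE nrmZ nrmC ger0_norm ?invr_ge0 ?nrm_ge0 // mulVf ?gt_eqF.
by rewrite bop_linZ // nrmZ nrmC ger0_norm ?invr_ge0 ?nrm_ge0 // mulrC ler_pdivrMr.
Qed.

Lemma opnorm_ge0 T (M : R) : 0 <= M -> (forall x, nrm (T x) <= M * nrm x) -> 0 <= opnorm T.
Proof.
move=> M0 hM; apply: le_trans (nrm_ge0 (T 0)) _.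
by apply: (ub_le_sup (opnorm_set_ub M0 hM)); exists 0 => //=; rewrite normr0.
Qed.

Lemma opnorm_ub T (M : R) : 0 <= M -> (forall x, nrm (T x) <= M * nrm x) -> opnorm T <= M.
Proof.
move=> M0 hM; apply: ge_sup; first by exists (nrm (T 0)), 0 => //=; rewrite normr0.
move=> _ [x /= x1 <-]; apply: le_trans (hM x) _; rewrite -[X in _ <= X]mulr1 ler_wpM2l //.
by move: x1; rewrite nrmE -[1](rmorph1 rc) lecR.
Qed.

Lemma bop_of_bound T (M : R) : linear T -> (forall x, nrm (T x) <= M * nrm x) -> bounded_operator T.
Proof.
move=> Tl hM; split => // x; apply/cvgrPdist_le => e e0.
have eE : e = (complex.Re e)%:C by move: e0; case: (e) => er ei; rewrite ltcE /= => /andP[/eqP -> _].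
rewrite eE lte0C in e0; set r := complex.Re e in e0 eE.
have M1 : 0 < `|M| + 1 by rewrite ltr_pwDr.
apply/nbhs_ballP; exists (r / (`|M| + 1))%:C => /=; first by rewrite lte0C divr_gt0.
move=> y; rewrite -ball_normE /= nrm_ltC => hy; rewrite eE nrmE lecR -bop_linB //.
apply: le_trans (hM _) _; apply: le_trans (_ : (`|M| + 1) * nrm (x - y) <= _).
  by rewrite ler_wpM2r ?nrm_ge0 //; have := ler_norm M; lra.
by rewrite mulrC -ler_pdivlMr // ltW.
Qed.

Lemma bopB T T' : bounded_operator T -> bounded_operator T' -> bounded_operator (T - T').
Proof.
move=> hT hT'; have [Tl _] := hT; have [Tl' _] := hT'.
have [M _ hM] := bop_bound hT; have [M' _ hM'] := bop_bound hT'.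
apply: (@bop_of_bound _ (M + M')) => [a x y|x].
  by rewrite !fctE Tl Tl'; modring R[i].
rewrite !fctE; apply: le_trans (ler_nrmB _ _) _; rewrite mulrDl; exact: lerD.
Qed.

Lemma bopZ T (a : R[i]) : bounded_operator T -> bounded_operator (a *: T).
Proof.
move=> hT; have [Tl _] := hT; have [M _ hM] := bop_bound hT.
apply: (@bop_of_bound _ (nrm a * M)) => [b x y|x].
  by rewrite !fctE Tl; modring R[i].
by rewrite !fctE nrmZ -mulrA ler_wpM2l ?nrm_ge0.
Qed.

(** Evaluation at [x] is Lipschitz for the operator norm. From here on [q] is handled through the
    vector functions [q l x]. *)
Lemma analytic_der (U : set R[i]^o) (F : R[i]^o -> E -> E) z : analytic_on U F -> U z ->
  exists T : E -> E, forall x, der id (U : set R[i]) (fun z => F z x) z (T x).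
Proof.
move=> [Fb Fd] Uz; have [T Tb hT] := Fd z Uz; exists T => x e e0.
have e1 : 0 < e / (nrm x + 1) by rewrite divr_gt0 // ltr_pwDr // nrm_ge0.
move/cvgrPdist_lt: hT => /(_ _ e1); rewrite /dnbhs /within /= => /nbhs_ballP [d /= d0 hd].
have dE : d = (complex.Re d)%:C by move: d0; case: (d) => dr di; rewrite ltcE /= => /andP[/eqP -> _].
rewrite dE lte0C in d0; exists (complex.Re d) => // s Us sd /=.
have [->|sz] := eqVneq s z; first by rewrite !subrr scale0r oppr0 addr0 !nrm0 mulr0.
have sz0 : s - z != 0 by rewrite subr_eq0.
have := hd (s - z); rewrite -ball_normE /= sub0r normrN dE.
have -> : (`|(s - z : R[i]^o)| < (complex.Re d)%:C) = (nrm (s - z) < complex.Re d) by rewrite nrmE ltcR.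
move=> /(_ sd sz0); rewrite sub0r normrN (addrC z) subrK.
set D := _ - T => hD.
have Db : bounded_operator D by apply: bopB => //; apply: bopZ; apply: bopB; exact: Fb.
have := opnorm_le x Db; rewrite {1}/D !fctE => h.
have -> : F s x - F z x - (s - z) *: T x = (s - z) *: ((s - z)^-1 *: (F s x - F z x) - T x).
  by rewrite scalerBr scalerA mulfV // scale1r.
rewrite nrmZ mulrC ler_wpM2r ?nrm_ge0 //; apply: le_trans h _.
apply: le_trans (_ : e / (nrm x + 1) * nrm x <= _).
  by rewrite ler_wpM2r ?nrm_ge0 // ltW // (le_lt_trans (ler_norm _)).
by rewrite mulrAC ler_pdivrMr ?ltr_pwDr ?nrm_ge0 // ler_wpM2l ?(ltW e0) // lerDl.
Qed.

(* Uniformity in x is what gives differentiability in the operator norm. *)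
Definition quad (F : R[i] -> E -> E) z T : Prop := exists c d : R, [/\ 0 <= c, 0 < d &
  forall s x, nrm s < d -> nrm (F (z + s) x - F z x - s *: T x) <= c * nrm s ^+ 2 * nrm x].

Lemma analytic_of_quad (U : set R[i]^o) (F : R[i]^o -> E -> E) :
  (forall z, U z -> bounded_operator (F z)) ->
  (forall z, U z -> exists2 T, bounded_operator T & quad F z T) -> analytic_on U F.
Proof.
move=> Fb hq; split => // z Uz; have [T Tb [c [d [c0 d0 hc]]]] := hq z Uz; exists T => //.
apply/cvgrPdist_lt => e e0; rewrite /dnbhs /within /=.
have c1 : 0 < c + 1 by lra.
have m0 : 0 < Num.min d (e / (c + 1)) by rewrite lt_min d0 divr_gt0.
apply/nbhs_ballP; exists (Num.min d (e / (c + 1)))%:C => /=; first by rewrite lte0C.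
move=> s; rewrite -ball_normE /= sub0r normrN => hs s0.
have {}hs : nrm s < Num.min d (e / (c + 1)) by move: hs; rewrite (nrmE (s : R[i]^o)) ltcR.
have /andP[h1 h2] : (nrm s < d) && (nrm s < e / (c + 1)) by rewrite -lt_min.
have ns : 0 < nrm s by rewrite lt_neqAle nrm_ge0 andbT eq_sym; apply: contraNneq s0 => /nrm_eq0 ->.
have hD x : nrm ((s^-1 *: (F (z + s) - F z) - T) x) <= c * nrm s * nrm x.
  rewrite !fctE.
  have -> : s^-1 *: (F (z + s) x - F z x) - T x = s^-1 *: (F (z + s) x - F z x - s *: T x).
    by rewrite [RHS]scalerBr scalerA mulVf // scale1r.
  rewrite nrmZ nrmV mulrC ler_pdivrMr //.
  by apply: le_trans (hc s x h1) _; rewrite expr2 le_eqVlt; apply/orP; left; apply/eqP; ring.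
have cs0 : 0 <= c * nrm s by rewrite mulr_ge0 ?nrm_ge0.
rewrite sub0r normrN ger0_norm ?(opnorm_ge0 cs0 hD) //.
apply: le_lt_trans (opnorm_ub cs0 hD) _.
have : nrm s * (c + 1) < e by rewrite -ltr_pdivlMr.
by have := nrm_ge0 s; lra.
Qed.

End Operators.

(** * Uniqueness of the Laplace transform *)

Section ZeroFunction.
Context {R : realType}.
Local Notation rc := (real_complex R).

Lemma eq_rel (E : normedModType R[i]) : closed_rel (fun u v : E => u = v).
Proof.
split=> // [a u v u' v' -> -> //|u v h].
apply/eqP; rewrite -subr_eq0; apply/eqP; apply: (@nrm_le_eps _ _ _ 2) => e e0.
have [u' [v' [<- h1 h2]]] := h e e0; have := nrm_tri u' u v; rewrite (nrmB u u'); lra.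
Qed.

Lemma der_zero_halfline (F F' : R -> R[i]^o) : (forall t : R, 0 <= t -> der rc halfline F t (F' t)) ->
  (forall t : R, 0 < t -> F t = 0) -> forall t : R, 0 < t -> F' t = 0.
Proof.
move=> hF F0 t t0; have sub : [set s : R | 0 < s] `<=` halfline by move=> s /ltW.
apply/esym; apply: (rel_der (@eq_rel (R[i]^o)) (F1 := fun=> 0) (F2 := F) t0).
- by move=> s s0; rewrite F0.
- exact: der_cst.
- by apply: der_sub sub _; apply: hF; exact: ltW.
Qed.

(** All arc integrals are 0, so [arc_inversion] bounds [Th2 t] by a multiple of e^{-x} for every
    large x; two derivatives then lead from [Th2] to [f]. *)
Lemma Lap_zero_fun (a M c : R) (f : R -> R[i]^o) : exp_class a M f -> 0 < c -> a < c ->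
  (forall s, c <= complex.Re s -> Lap f s = 0) -> forall t : R, 0 < t -> f t = 0.
Proof.
move=> hf c0 ac hz; have [M0 fc _] := hf; have pp := pi_gt0 R.
have [Th1 [Th10 Th1d]] := prim_halfline (@complex_complete R) fc.
have [Th2 [Th20 Th2d]] := prim_halfline (@complex_complete R) (fun s s0 => der_cont (Th1d s s0)).
suff h2 (t : R) : 0 < t -> Th2 t = 0.
  exact: der_zero_halfline Th1d (der_zero_halfline Th2d h2).
move=> t0; set C := 4 * pi * M * expR (c * t) / (c - a).
have C0 : 0 <= C by rewrite /C divr_ge0 ?mulr_ge0 ?expR_ge0 ?(ltW pp) //; lra.
apply: (@nrm_le_eps _ _ _ 1) => e e0; rewrite mulr1.
have e1 : 0 < e * (2 * pi) by rewrite !mulr_gt0.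
(* Taking [x] at least [ln c] makes the circle of radius e^x meet the line Re = c. *)
have [X [X0 hX]] := expRN_small C0 e1; set x := Num.max X (ln c).
have hx : X <= x by rewrite /x le_max lexx.
have cx : c <= expR x by rewrite -[c]lnK ?posrE // ler_expR /x le_max lexx orbT.
have ux : 0 < c / expR x <= 1 by rewrite divr_gt0 ?expR_gt0 //= ler_pdivrMr ?expR_gt0 // mul1r.
have ux' : -1 <= c / expR x <= 1 by lra.
set phi := acos (c / expR x).
have cphi : cos phi = c / expR x by rewrite acosK // in_itv.
have hb : 0 <= phi <= pi / 2.
  rewrite acos_ge0 //= leNgt; apply/negP => h; have : cos phi < 0.
    by rewrite -(@cos_pihalf R) ltr_cos ?in_itv /= ?acos_ge0 ?acos_lepi //; lra.
  by rewrite cphi; lra.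
have hc : expR x * cos phi = c by rewrite cphi mulrC divfK // gt_eqF ?expR_gt0.
have hv : is_int (- phi) phi (fun y => 'i%C *: (entire t (x +i* y) * Lap f (cexp (x +i* y)))) 0.
  exists (fun=> 0); split; last by rewrite subrr.
  move=> y hy; have -> : Lap f (cexp (x +i* y)) = 0 by apply: hz; exact: arc_Re hb hc y hy.
  by rewrite mulr0 scaler0; exact: der_cst.
have := arc_inversion hf c0 ac (ltW t0) hb hc Th10 Th1d Th20 Th2d hv.
rewrite sub0r nrmN nrmM nrmM nrm_i mul1r nrmC ger0_norm; last by rewrite mulr_ge0 ?(ltW pp).
move=> h; have h3 := le_trans h (hX x hx).
by move: h3; rewrite mulrC ler_pM2r // mulr_gt0.
Qed.

End ZeroFunction.

(** * Riemann integrals of continuous functions *)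

Section RiemannIntegral.
Context {R : realType} {E : completeNormedModType R[i]}.
Local Notation rc := (real_complex R).

Lemma unif_cont (f : R -> E) (T e : R) : 0 <= T -> 0 < e ->
  (forall t : R, 0 <= t -> cont rc halfline f t) ->
  exists2 d : R, 0 < d & forall s s' : R, 0 <= s <= T -> 0 <= s' -> `|s - s'| < d -> nrm (f s - f s') <= e.
Proof.
move=> T0 e0 fc; pose Q x y := exists2 d : R, 0 < d & forall s s' : R, x <= s <= y -> 0 <= s' -> `|s - s'| < d ->
  nrm (f s - f s') <= e.
apply: (cousin (Q := Q) T0).
  move=> x y z _ _ _ _ [d d0 h] [d' d0' h']; exists (Num.min d d'); first by rewrite lt_min d0.
  move=> s s' /andP[xs sz] s'0; rewrite lt_min => /andP[h1 h2].
  have [sy|ys] := lerP s y; first by apply: h; rewrite ?xs.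
  by apply: h'; rewrite ?sz ?(ltW ys).
move=> c /andP[c0 cT]; have e2 : 0 < e / 2 by rewrite divr_gt0.
have [d d0 h] := fc c c0 _ e2; exists (d / 2); first by rewrite divr_gt0.
move=> x y x0 xc cy yT yx; exists (d / 2); first by rewrite divr_gt0.
move=> s s' /andP[xs sy] s'0; rewrite ltr_norml => /andP[h1 h2].
have hs : nrm (f s - f c) <= e / 2.
  by apply: h; rewrite ?nrmRB ?ltr_norml /halfline /=; [lra|apply/andP; split; lra].
have hs' : nrm (f s' - f c) <= e / 2.
  by apply: h; rewrite ?nrmRB ?ltr_norml /halfline /=; [lra|apply/andP; split; lra].
by have := nrm_tri (f c) (f s) (f s'); rewrite (nrmB (f c)); lra.
Qed.

Lemma riemann_sum_cons (f : R -> E) (a x : R) s xi :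
  riemann_sum f a (x :: s) xi = (x - a)%:C *: f (xi 0%N) + riemann_sum f x s (fun i => xi i.+1).
Proof. by rewrite /riemann_sum big_ord_recl. Qed.

(** On each cell the mean value inequality for P(t) - t f(xi) bounds the error by the oscillation of
    [f] times the length, and uniform continuity makes the oscillation small on all cells at
    once. *)
Lemma is_Rint_prim (f P : R -> E) (T : R) : 0 <= T ->
  (forall t : R, 0 <= t -> cont rc halfline f t) ->
  (forall t : R, 0 <= t -> der rc halfline P t (f t)) -> is_Rint f 0 T (P T - P 0).
Proof.
move=> T0 fc hP e e0; have T1 : 0 < T + 1 by lra.
have e1 : 0 < e / (T + 1) / 2 by rewrite !divr_gt0.
have [d d0 hd] := unif_cont T0 e1 fc; exists d => // s xi [sp sl] hxi.
have key : forall (a : R) xi, 0 <= a -> path <%R a s -> last a s = T ->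
    (forall i, (i < size s)%N -> (a :: s)`_i <= xi i <= s`_i /\ s`_i - (a :: s)`_i < d) ->
    nrm (riemann_sum f a s xi - (P T - P a)) <= e / (T + 1) / 2 * (T - a).
  move: sp sl hxi => _ _ _; elim: s => [|x s ih] a xi' a0 /=.
    by move=> _ <- _; rewrite /riemann_sum big_ord0 !subrr nrm0 mulr0.
  move=> /andP[ax sp] sl hxi; have x0 : 0 <= x by lra.
  have xT : x <= T.
    by rewrite -sl; move: sp; elim: (s) (x) => //= y s' ih' z /andP[zy] /ih'; apply: le_trans; exact: ltW.
  have := ih x (fun i => xi' i.+1) x0 sp sl (fun i hi => hxi i.+1 hi).
  rewrite riemann_sum_cons => h.
  have [/= /andP[c1 c2] c3] := hxi 0%N (ltn0Sn _).
  have h2 : nrm (P x - P a - (x - a)%:C *: f (xi' 0%N)) <= e / (T + 1) / 2 * (x - a).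
    have := @mvt_cst R E (fun t => P t - t%:C *: f (xi' 0%N)) (fun t => f t - f (xi' 0%N)) (e / (T + 1) / 2) halfline a x (ltW ax).
    have -> : P x - x%:C *: f (xi' 0%N) - (P a - a%:C *: f (xi' 0%N)) = P x - P a - (x - a)%:C *: f (xi' 0%N).
      by rewrite rmorphB /=; modring R[i].
    apply.
    - by move=> t /andP[t1 _]; rewrite /halfline /=; lra.
    - move=> t /andP[t1 _]; have t00 : 0 <= t by lra.
      apply: der_eq (derB (hP t t00) (derS (der_id rc halfline t) (der_cst rc _ (f (xi' 0%N)) t))).
      by rewrite scaler0 addr0 scale1r.
    - move=> t /andP[t1 t2]; apply: hd; rewrite ?ltr_norml; (try lra); apply/andP; split; lra.
  have -> : (x - a)%:C *: f (xi' 0%N) + riemann_sum f x s (fun i => xi' i.+1) - (P T - P a) =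
     riemann_sum f x s (fun i => xi' i.+1) - (P T - P x) - (P x - P a - (x - a)%:C *: f (xi' 0%N)) by modring R[i].
  apply: le_trans (ler_nrmB _ _) _; apply: le_trans (lerD h h2) _.
  by rewrite -mulrDr; have -> : T - x + (x - a) = T - a by ring.
have := key 0 xi (lexx _) sp (eqP sl) hxi => /le_lt_trans; apply.
rewrite subr0 mulrAC [e / _ * _]mulrAC ltr_pdivrMr // ltr_pdivrMr //; nra.
Qed.

End RiemannIntegral.

(** * Sectors *)

Section SectorGeometry.
Context {R : realType} {E : normedModType R[i]}.
Local Notation rc := (real_complex R).
Implicit Types (g t r y : R) (z w : R[i]).

Lemma sin_sector g0 g1 g t : g0 < g1 -> g1 <= g -> g < pi / 2 -> 0 <= g0 -> `|t| <= g0 ->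
  sin (g1 - g0) <= sin (t + g).
Proof.
move=> g01 g1g gp g00; rewrite ler_norml => /andP[t1 t2].
have [h|h] := lerP (t + g) (pi / 2).
  by rewrite leNgt ltr_sin -?leNgt ?in_itv /=; (try apply/andP; try split); lra.
have -> : sin (t + g) = sin (pi - t - g).
  by rewrite (_ : pi - t - g = - (t + g) + pi); [rewrite sinDpi sinN opprK|ring].
by rewrite leNgt ltr_sin -?leNgt ?in_itv /=; (try apply/andP; try split); lra.
Qed.

Lemma Re_dir r t y : complex.Re (r%:C * dir t * dir y) = r * cos (t + y).
Proof. by rewrite /dir /= cosD; ring. Qed.

Lemma nrm_polar r t : 0 < r -> nrm (r%:C * dir t) = r.
Proof. by move=> r0; rewrite nrmM nrmC nrm_dir mulr1 gtr0_norm. Qed.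

(** At the two edges the real part is - r sin (g + t) and - r sin (g - t), and |t| <= g0 keeps both
    sines above [sin (g1 - g0)]. The rate is the same for all edges with [g >= g1], as [lap_indep]
    requires. *)
Lemma Re_dir_le r g0 g1 g t : 0 < r -> g0 < g1 -> g1 <= g -> g < pi / 2 -> 0 <= g0 -> `|t| <= g0 ->
  decay (pi / 2 + g) (sin (g1 - g0) * r) (r%:C * dir t).
Proof.
move=> r0 g01 g1g gp g00 tg; split; rewrite Re_dir mulrC -mulNr ler_wpM2r ?(ltW r0) //.
  have -> : t + (pi / 2 + g) = t + g + pi / 2 by ring.
  by rewrite cosDpihalf lerN2 (@sin_sector g0 g1).
rewrite -cosN (_ : - (t + - (pi / 2 + g)) = - t + g + pi / 2); last by ring.
by rewrite cosDpihalf lerN2 (@sin_sector g0 g1) ?normrN.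
Qed.

Lemma sector_sectorial g z : 0 < g < pi / 2 -> sector g z -> sectorial (pi / 2 + g) z.
Proof.
move=> /andP[g0 gp] [r [t [r0 tg ->]]].
apply: (@decay_sectorial _ _ (sin (g - `|t|) * r)); last exact: Re_dir_le.
rewrite mulr_gt0 // sin_gt0_pihalf // subr_gt0 tg /=.
by have := normr_ge0 t; lra.
Qed.

Lemma polar_Re_gt0 (a b : R) : 0 < a -> let t := atan (b / a) in
  [/\ 0 < cos t, `|t| < pi / 2 & a +i* b = (a / cos t)%:C * (cos t +i* sin t)].
Proof.
move=> a0 t; have ct : 0 < cos t by rewrite cos_gt0_pihalf // atan_gtNpi2 atan_ltpi2.
split => //; first by rewrite ltr_norml atan_gtNpi2 atan_ltpi2.
have tE : sin t = b / a * cos t by rewrite -{1}(atanK (b / a)) -/t /tan divfK // gt_eqF.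
by apply/eqP; rewrite eq_complex /= tE; apply/andP; split; apply/eqP; field; rewrite ?gt_eqF.
Qed.

Lemma sector_half z : 0 < complex.Re z -> sector (pi / 2) z.
Proof.
case: z => a b /= a0; have [ct tp zE] := polar_Re_gt0 b a0.
by exists (a / cos (atan (b / a))), (atan (b / a)); rewrite divr_gt0.
Qed.

Lemma sectorial_sector g z : 0 < g < pi / 2 -> sectorial (pi / 2 + g) z -> sector g z.
Proof.
move=> /andP[g0 gp]; case: z => a b; rewrite /sectorial /dir /= cosN sinN.
rewrite (addrC (pi / 2)) cosDpihalf sinDpihalf => -[h1 h2].
have sg : 0 < sin g by rewrite sin_gt0_pihalf // g0.
have cg : 0 < cos g by rewrite cos_gt0_pihalf //; apply/andP; split; lra.
have a0 : 0 < a by nra.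
have gN : g \in `](- (pi / 2)), (pi / 2)[ by rewrite in_itv /=; apply/andP; split; lra.
have [ct _ zE] := polar_Re_gt0 b a0.
exists (a / cos (atan (b / a))), (atan (b / a)); split => //; first by rewrite divr_gt0.
rewrite ltr_norml; apply/andP; split.
  rewrite -[X in - X](tanK gN) -atanN; apply: lt_atan.
  by rewrite ltr_pdivlMr // /tan mulNr ltrNl mulrAC ltr_pdivlMr //; lra.
rewrite -[X in _ < X](tanK gN); apply: lt_atan.
by rewrite ltr_pdivrMr // /tan mulrAC ltr_pdivlMr //; lra.
Qed.

Lemma sector_mono g g' z : g <= g' -> sector g z -> sector g' z.
Proof. by move=> gg [r [t [r0 tg ->]]]; exists r, t; split=> //; exact: lt_le_trans tg gg. Qed.

Lemma sector_pos g t : 0 < g -> 0 < t -> sector g (t%:C : R[i]).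
Proof.
by move=> g0 t0; exists t, 0; rewrite normr0; split => //; rewrite cos0 sin0 -[1 +i* 0]/(1 : R[i]) mulr1.
Qed.

Lemma sector_nrm_gt0 g z : sector g z -> 0 < nrm z.
Proof. by move=> [r [t [r0 tg ->]]]; rewrite nrm_polar. Qed.

Lemma sector_decay g0 g z : 0 < g0 < g -> g < pi / 2 -> sector g0 z ->
  decay (pi / 2 + g) (sin (g - g0) * nrm z) z.
Proof.
move=> /andP[g00 g01] gp [r [t [r0 tg ->]]]; rewrite nrm_polar //.
by apply: Re_dir_le => //; apply: ltW.
Qed.

Lemma sector_Re_gt0 g z : g <= pi / 2 -> sector g z -> 0 < complex.Re z.
Proof.
move=> gp [r [t [r0 tg ->]]]; rewrite /= mul0r subr0 mulr_gt0 //.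
by rewrite cos_gt0_pihalf //; move: tg; rewrite ltr_norml => /andP[? ?]; apply/andP; split; lra.
Qed.

Lemma sin_gap g0 g : 0 < g0 < g -> g < pi / 2 -> 0 < sin (g - g0).
Proof. by move=> /andP[h1 h2] h3; rewrite sin_gt0_pihalf //; apply/andP; split; lra. Qed.

Lemma cexp_sector om a w : `|complex.Im w| < a -> shifted_sector om a (om%:C + cexp w).
Proof.
move=> hw; rewrite /shifted_sector /= addrC addKr; case: w hw => x y /= hy.
by exists (expR x), y; rewrite expR_gt0; split => //; rewrite cexpE.
Qed.

(** For |Im w| <= pi/2, adding [om >= 0] does not decrease the modulus; beyond that, the imaginary
    part alone is large enough. Division by l = om + e^w is thereby harmless on the strip. *)
Lemma nrm_shift_ge om th w : 0 <= om -> pi / 2 <= th -> th < pi -> `|complex.Im w| <= th ->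
  sin th * expR (complex.Re w) <= nrm (om%:C + cexp w).
Proof.
case: w => x y /= om0 th1 th2 yth.
have e0 := expR_gt0 x; have pp := pi_gt0 R.
have sth : 0 <= sin th by rewrite sin_ge0_pi //; apply/andP; split; lra.
have [hy|hy] := lerP `|y| (pi / 2).
  have cy : 0 <= cos y.
    by rewrite cos_ge0_pihalf //; move: hy; rewrite ler_norml.
  have h : expR x ^+ 2 <= nrm (om%:C + cexp (x +i* y)) ^+ 2.
    have -> : nrm (om%:C + cexp (x +i* y)) ^+ 2 = (om + expR x * cos y) ^+ 2 + (expR x * sin y) ^+ 2.
      rewrite /nrm normc_def /= sqr_sqrtr; last by rewrite addr_ge0 // sqr_ge0.
      by ring.
    have -> : expR x ^+ 2 = (expR x * cos y) ^+ 2 + (expR x * sin y) ^+ 2.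
      by rewrite !exprMn -mulrDr cos2Dsin2 mulr1.
    have ec : 0 <= expR x * cos y by rewrite mulr_ge0 // ltW.
    by nra.
  have {}h : expR x <= nrm (om%:C + cexp (x +i* y)).
    by rewrite -(ler_pXn2r (ltn0Sn 1)) ?nnegrE ?nrm_ge0 // ltW.
  by apply: le_trans h; rewrite ler_piMl ?(ltW e0) // sin_le1.
apply: le_trans (ler_nrm_Im _); rewrite cexpE /= mul0r addr0 add0r normrM gtr0_norm //.
rewrite mulrC ler_wpM2l ?(ltW e0) //.
have sN : sin `|y| <= `|sin y|.
  by have [y0|y0] := ger0P y; [exact: ler_norm|rewrite sinN -normrN; exact: ler_norm].
apply: le_trans sN.
have E1 (u : R) : sin u = sin (pi - u).
  by rewrite (_ : pi - u = - u + pi); [rewrite sinDpi sinN opprK|ring].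
rewrite E1 [X in _ <= X]E1 leNgt ltr_sin -?leNgt ?in_itv /=; (try apply/andP; try split); lra.
Qed.

(** For this [z] the kernel decays on every ray between the two angles, at a common rate, so
    [contour_indep] applies. *)
Lemma lap_indep g g' z (h : R[i] -> E) (M : R) v v' : 0 < g -> g <= g' -> g' < pi / 2 -> sector g z ->
  0 <= M -> (forall w, strip (pi / 2 + g') w -> nrm (h w) <= M) ->
  is_lap (pi / 2 + g) z h v -> is_lap (pi / 2 + g') z h v' -> v = v'.
Proof.
move=> g0 gg gp [r [t [r0 tg zE]]] M0 hM hv hv'; have pp := pi_gt0 R.
have th0 : 0 <= pi / 2 + g by lra.
set k := sin (g - `|t|) * r.
have k0 : 0 < k.
  by rewrite /k mulr_gt0 // sin_gt0_pihalf // subr_gt0 tg /=; have := normr_ge0 t; lra.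
have hM' w : strip (pi / 2 + g') w -> 0 <= complex.Re w -> nrm (h w) <= M * expR (complex.Re w) ^+ 0.
  by move=> hw _; rewrite expr0 mulr1 hM.
apply: (contour_uniq th0 hv); apply: (contour_indep (th' := pi / 2 + g') (x1 := 0) _ hv' _ (ex_intro _ v hv)).
  by rewrite th0 lerD2l.
move=> x y x0 y1 y2; apply: (lap_ray k0 M0 hM' y2) => //.
rewrite zE; have [dp dn] : decay (pi / 2 + (`|y| - pi / 2)) k (r%:C * dir t).
  by apply: Re_dir_le => //; lra.
move: dp dn; rewrite (_ : pi / 2 + (`|y| - pi / 2) = `|y|); last by ring.
by have [y0|y0] := ger0P y; rewrite ?opprK => h1 h2; [exact: h1|exact: h2].
Qed.

End SectorGeometry.

(** * The semigroup *)

Section Family.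
Context {R : realType} {E : completeNormedModType R[i]}.
Local Notation rc := (real_complex R).
Let Ec : @seq_complete R E := @cmod_complete R E.
Variables (om alpha : R) (q : R[i]^o -> E -> E).
Hypotheses (om0 : 0 <= om) (al : 0 < alpha <= pi / 2).
Hypothesis q_analytic : analytic_on (shifted_sector om (pi / 2 + alpha)) q.
Hypothesis q_bounded : forall gamma : R, 0 < gamma < alpha ->
  has_ubound [set opnorm ((l - om%:C) *: q l) | l in shifted_sector om (pi / 2 + gamma)].
Hypothesis q_infty : opnorm (l%:C *: q l%:C) @[l --> +oo%R] --> (0 : R).
Implicit Types (g : R) (x y : E) (z w : R[i]).

Definition integrand x w : E := cexp w *: q (om%:C + cexp w) x.

Lemma shift_sector g w : g < alpha -> strip (pi / 2 + g) w ->
  shifted_sector om (pi / 2 + alpha) (om%:C + cexp w).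
Proof. by move=> ga hw; apply: cexp_sector; apply: le_lt_trans hw _; rewrite ltrD2l. Qed.

Lemma q_bop g w : g < alpha -> strip (pi / 2 + g) w -> bounded_operator (q (om%:C + cexp w)).
Proof. by move=> ga hw; have [qb _] := q_analytic; apply: qb; exact: shift_sector hw. Qed.

Lemma integrand_lin g (a : R[i]) x y w : g < alpha -> strip (pi / 2 + g) w ->
  integrand (a *: x + y) w = a *: integrand x w + integrand y w.
Proof.
by move=> ga hw; have [ql _] := q_bop ga hw; rewrite /integrand ql scalerDr !scalerA (mulrC (cexp w)).
Qed.

Lemma q_diff g x : g < alpha -> cdiff_on (strip (pi / 2 + g)) (fun w => q (om%:C + cexp w) x).
Proof.
move=> ga w hw; have hs := shift_sector ga hw; have [T hT] := analytic_der q_analytic hs.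
have h1 := derD (der_cst id (strip (pi / 2 + g)) (om%:C : R[i]^o) w) (cder_cexp (strip (pi / 2 + g)) w).
eexists; apply: (der_comp (i' := id) (D' := shifted_sector om (pi / 2 + alpha))
  (g := fun w => om%:C + cexp w) (f := fun l => q l x) _ h1 (hT x)).
by move=> s /(shift_sector ga).
Qed.

Lemma integrand_diff g x : g < alpha -> cdiff_on (strip (pi / 2 + g)) (integrand x).
Proof. by move=> ga; apply: cdiff_cexp; exact: q_diff. Qed.

Lemma integrand_bound g : 0 < g < alpha -> exists2 M : R, 0 <= M &
  forall x w, strip (pi / 2 + g) w -> nrm (integrand x w) <= M * nrm x.
Proof.
(* The strip is closed and the sector open, hence the bound is taken at an angle strictly between
   [g] and [alpha]. *)
move=> /andP[g0 ga]; have gm : 0 < (g + alpha) / 2 < alpha by lra.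
have [M hM] := q_bounded gm; exists `|M| => // x w hw.
have b := bopZ (cexp w) (q_bop ga hw).
have := opnorm_le x b; rewrite fctE => /le_trans; apply.
rewrite ler_wpM2r ?nrm_ge0 //; apply: le_trans (ler_norm M); apply: hM.
exists (om%:C + cexp w); last by rewrite addrC addKr.
by apply: cexp_sector; apply: le_lt_trans hw _; rewrite ltrD2l; lra.
Qed.

Lemma integrand_infty x (e : R) : 0 < e -> exists X : R, forall xi, X <= xi -> nrm (integrand x xi%:C) <= e.
Proof.
move=> e0; have e1 : 0 < e / (nrm x + 1) by rewrite divr_gt0 // ltr_pwDr // nrm_ge0.
move/cvgrPdist_lt: q_infty => /(_ _ e1) [X [_ hX]].
have al0 : 0 < alpha by have /andP[] := al.
exists (ln (`|X| + 1)) => xi hxi; have X1 : 0 < `|X| + 1 by rewrite ltr_pwDr.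
have ex : `|X| + 1 <= expR xi by rewrite -[X in X <= _]lnK ?posrE // ler_expR.
set l := om + expR xi; have l0 : 0 < l by rewrite ltr_wpDl ?expR_gt0.
have Xl : X < l by have := ler_norm X; have := om0; rewrite /l; lra.
have hs : strip (pi / 2 + alpha / 2) xi%:C.
  by rewrite /strip /= normr0; have := pi_gt0 R; lra.
have ha2 : alpha / 2 < alpha by lra.
have b := bopZ l%:C (q_bop ha2 hs).
have lE : om%:C + cexp xi%:C = l%:C by rewrite cexpR -rmorphD.
rewrite lE in b; have := hX l Xl; rewrite sub0r normrN => h.
(* The hypothesis is on l q(l), the integrand is (l - om) q(l); the ratio of the two factors is at
   most 1. *)
have -> : integrand x xi%:C = (expR xi / l)%:C *: (l%:C *: q l%:C x).
  rewrite /integrand lE cexpR scalerA -rmorphM; congr (_%:C *: _).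
  by rewrite divfK // gt_eqF.
rewrite nrmZ nrmC ger0_norm ?divr_ge0 ?expR_ge0 ?(ltW l0) //.
have h1 : expR xi / l <= 1 by rewrite ler_pdivrMr // mul1r lerDr.
have := opnorm_le x b; rewrite fctE => h2.
apply: le_trans (_ : 1 * (e / (nrm x + 1) * nrm x) <= _).
  apply: ler_pM; rewrite ?divr_ge0 ?expR_ge0 ?nrm_ge0 ?(ltW l0) //.
  apply: le_trans h2 _; rewrite ler_wpM2r ?nrm_ge0 // ltW // (le_lt_trans (ler_norm _)) //.
by rewrite mul1r mulrAC ler_pdivrMr ?ltr_pwDr ?nrm_ge0 // ler_wpM2l ?(ltW e0) // lerDl.
Qed.

Lemma gamma_pi g : 0 < g < alpha -> [/\ 0 < g < pi / 2, 0 <= pi / 2 + g & g < alpha].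
Proof.
by have := al; have := pi_gt0 R => pp /andP[a0 ap] /andP[g0 ga]; split; rewrite ?ga //; lra.
Qed.

Lemma integrand_le0 g M x : (forall w, strip (pi / 2 + g) w -> nrm (integrand x w) <= M) ->
  forall w, strip (pi / 2 + g) w -> 0 <= complex.Re w -> nrm (integrand x w) <= M * expR (complex.Re w) ^+ 0.
Proof. by move=> h w hw _; rewrite expr0 mulr1 h. Qed.

(* All admissible strips give the same value, see lap_indep. *)
Definition contour_value z x : E := xget 0 [set v | exists g, [/\ 0 < g < alpha, sector g z &
  is_lap (pi / 2 + g) z (integrand x) v]].

Lemma contour_valueP g z x : 0 < g < alpha -> sector g z -> is_lap (pi / 2 + g) z (integrand x) (contour_value z x).
Proof.
move=> hg hz; have [gp th0 ga] := gamma_pi hg.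
have [M M0 hM] := integrand_bound hg.
have [k k0 kz] := sectorial_decay (sector_sectorial gp hz).
have Mx : 0 <= M * nrm x by rewrite mulr_ge0 // nrm_ge0.
have [v hv] := lap_ex Ec th0 k0 kz Mx (integrand_le0 (hM x)) (integrand_diff x ga).
have hex : exists g, [/\ 0 < g < alpha, sector g z & is_lap (pi / 2 + g) z (integrand x) v] by exists g.
rewrite /contour_value; case: xgetP => [v' _ [g' [hg' hz' hv']]|/(_ v)/(_ hex)//].
have [gp' th0' ga'] := gamma_pi hg'; have [M' M0' hM'] := integrand_bound hg'.
have Mx' : 0 <= M' * nrm x by rewrite mulr_ge0 // nrm_ge0.
have /andP[g0 gpp] := gp; have /andP[g0' gpp'] := gp'.
have [gg|/ltW gg] := lerP g g'.
  by rewrite -(lap_indep g0 gg gpp' hz Mx' (hM' x) hv hv').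
by rewrite (lap_indep g0' gg gpp hz' Mx (hM x) hv' hv).
Qed.

(** [lap_scaled] with exponent 0: the decay rate of the kernel is proportional to |z| on a smaller
    sector, so the bound does not depend on [z]. *)
Lemma contour_value_le g0 g : 0 < g0 < g -> g < alpha -> exists2 C : R, 0 <= C &
  forall z x, sector g0 z -> nrm (contour_value z x) <= C * nrm x.
Proof.
move=> /andP[g00 g01] ga; have hg : 0 < g < alpha by rewrite ga (lt_trans g00).
have [gp th0 _] := gamma_pi hg; have /andP[_ gpp] := gp.
have [M M0 hM] := integrand_bound hg; have hg0 : 0 < g0 < g by rewrite g00.
have k0 := sin_gap hg0 gpp.
exists (M * lapC (pi / 2 + g) (sin (g - g0)) 0) => [|z x hz]; first by rewrite mulr_ge0 // lapC_ge0.
have := lap_scaled (m := 0) th0 k0 (sector_nrm_gt0 hz) (sector_decay hg0 gpp hz)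
  (mulr_ge0 M0 (nrm_ge0 x)) _ (contour_valueP x hg (sector_mono (ltW g01) hz)).
rewrite expr0 mulr1 [M * nrm x * _]mulrAC; apply => w hw _.
by rewrite expr0 mulr1 hM.
Qed.

Lemma sector_shrink z : sector alpha z -> exists2 g, 0 < g < alpha & sector g z.
Proof.
move=> [r [t [r0 tal ->]]]; exists ((`|t| + alpha) / 2).
  by have := normr_ge0 t; have /andP[a0 _] := al; lra.
by exists r, t; split => //; lra.
Qed.

Lemma sector_shrink2 g0 : 0 < g0 < alpha -> exists2 g, 0 < g0 < g & g < alpha.
Proof. by move=> /andP[h1 h2]; exists ((g0 + alpha) / 2); lra. Qed.

Lemma contour_value_lin z : sector alpha z -> linear (contour_value z).
Proof.
move=> /sector_shrink[g hg hz] a x y; have [_ th0 ga] := gamma_pi hg.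
apply: (contour_uniq th0 (contour_valueP (a *: x + y) hg hz)).
apply: lap_ext (lapZD a (contour_valueP x hg hz) (contour_valueP y hg hz)) => w hw.
by rewrite (integrand_lin a x y ga hw).
Qed.

Lemma contour_value_bop z : sector alpha z -> bounded_operator (contour_value z).
Proof.
move=> hz; have [g0 hg0 hz0] := sector_shrink hz; have [g h1 h2] := sector_shrink2 hg0.
have [C C0 hC] := contour_value_le h1 h2; apply: (@bop_of_bound _ _ _ C); first exact: contour_value_lin.
by move=> x; exact: hC.
Qed.

(** The derivative is the contour integral of [cexp w *: integrand x w]. All constants of
    [lap_deriv] are multiples of |x|, and |s| < k / 2 keeps [z + s] within reach of the same
    contour. *)
Lemma contour_value_quad z : sector alpha z -> exists2 T, bounded_operator T & quad contour_value z T.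
Proof.
move=> hz; have [g0 hg0 hz0] := sector_shrink hz; have [g h1 h2] := sector_shrink2 hg0.
have /andP[g00 g01] := h1.
have hg : 0 < g < alpha by rewrite h2 (lt_trans g00).
have [gp th0 _] := gamma_pi hg; have /andP[_ gpp] := gp; have pp := pi_gt0 R.
have [M M0 hM] := integrand_bound hg.
have zn := sector_nrm_gt0 hz0; have dz := sector_decay h1 gpp hz0.
set k := sin (g - g0) * nrm z in dz; have k0 : 0 < k by rewrite mulr_gt0 // sin_gap.
have Mx x : 0 <= M * nrm x by rewrite mulr_ge0 // nrm_ge0.
have hM1 x w : strip (pi / 2 + g) w -> 0 <= complex.Re w ->
    nrm (cexp w *: integrand x w) <= M * nrm x * expR (complex.Re w) ^+ 1.
  move=> hw _; rewrite nrmZ nrm_cexp expr1 mulrC ler_wpM2r ?expR_ge0 //.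
  exact: hM.
have Tex x : exists v, is_lap (pi / 2 + g) z (fun w => cexp w *: integrand x w) v.
  exact (lap_ex (h := fun w => cexp w *: integrand x w) Ec th0 k0 dz (Mx x) (hM1 x) (cdiff_cexp (integrand_diff x h2))).
have [T hT] := choice Tex.
have Tl : linear T.
  move=> a x y; apply: (contour_uniq th0 (hT (a *: x + y))).
  apply: lap_ext (lapZD a (hT x) (hT y)) => w hw.
  by rewrite (integrand_lin a x y h2 hw) scalerDr !scalerA (mulrC a).
set B := 2 * ((1.+1)`!%:R / k ^+ 1.+1) * expR (- 0) + 2 * (pi / 2 + g) * (expR (nrm z * expR 0) * expR 0 ^+ 1).
exists T.
  apply: (@bop_of_bound _ _ _ (M * B) Tl) => x.
  apply: le_trans (lap_bound th0 k0 dz (Mx x) (hM1 x) (hT x)) _.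
  by rewrite /B le_eqVlt; apply/orP; left; apply/eqP; ring.
set C := M * (2 * (3`!%:R / (k / 2) ^+ 3) + 2 * (pi / 2 + g) * (expR (nrm z) * expR k)).
have C0 : 0 <= C.
  have k2 : 0 <= k / 2 by lra.
  apply: mulr_ge0 => //; apply: addr_ge0; apply: mulr_ge0; rewrite ?divr_ge0 ?exprn_ge0 ?mulr_ge0 ?expR_ge0 ?(ltW k0) ?th0 ?(ltW zn) ?(ltW (sin_gap h1 gpp)) //.
exists C, (k / 2); split => //; first by rewrite divr_gt0.
move=> s x sk; have dzs := decay_add s dz.
have ks : 0 < k - nrm s by lra.
have hzs : sector g (z + s) by apply: sectorial_sector => //; exact: decay_sectorial ks dzs.
have hz1 : sector g z := sector_mono (ltW g01) hz0.
have := lap_deriv th0 k0 dz (Mx x) (ltW sk) (integrand_le0 (hM x)) (contour_valueP x hg hz1) (hT x) (contour_valueP x hg hzs).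
by move/le_trans; apply; rewrite /C le_eqVlt; apply/orP; left; apply/eqP; ring.
Qed.

(** With l = omega + e^w, the exponential e^{l z} splits into e^{omega z} and [kern z w]; the first
    factor stays outside the contour integral together with 1 / (2 pi i). *)
Definition coef z : R[i] := cexp (om%:C * z) / ('i%C * (2 * pi)%:C).

Definition semigroup_ext z x : E := coef z *: contour_value z x.

Lemma nrm_coef z : nrm (coef z) = expR (om * complex.Re z) / (2 * pi).
Proof.
have pp := pi_gt0 R; rewrite /coef nrmM nrmV nrmM nrm_i mul1r nrmC gtr0_norm; last by lra.
by rewrite nrm_cexp ReM_real.
Qed.

Lemma semigroup_ext_bop z : sector alpha z -> bounded_operator (semigroup_ext z).
Proof. by move=> hz; exact: bopZ (contour_value_bop hz). Qed.

Lemma coef_quad z : exists2 c : R, 0 <= c & forall s, nrm s < 1 ->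
  nrm (coef (z + s) - coef z - s * (om%:C * coef z)) <= c * nrm s ^+ 2.
Proof.
exists (nrm (coef z) * om ^+ 2 * expR om) => [|s s1]; first by rewrite !mulr_ge0 ?nrm_ge0 ?sqr_ge0 ?expR_ge0.
have -> : coef (z + s) - coef z - s * (om%:C * coef z) = coef z * (cexp (om%:C * s) - 1 - om%:C * s).
  by rewrite /coef mulrDr cexpD; ring.
have -> : nrm (coef z) * om ^+ 2 * expR om * nrm s ^+ 2 = nrm (coef z) * (om ^+ 2 * nrm s ^+ 2 * expR om) by ring.
rewrite nrmM ler_wpM2l ?nrm_ge0 //; apply: le_trans (cexp_sub2 _) _.
rewrite nrmM nrmC ger0_norm // exprMn ler_wpM2l ?mulr_ge0 ?sqr_ge0 ?nrm_ge0 //.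
by rewrite ler_expR -[X in _ <= X]mulr1 ler_wpM2l // ltW.
Qed.

Lemma semigroup_ext_quad z : sector alpha z -> exists2 T, bounded_operator T & quad semigroup_ext z T.
Proof.
move=> hz; have [T Tb [c [d [c0 d0 hc]]]] := contour_value_quad hz.
have [CV CV0 hCV] := bop_bound (contour_value_bop hz); have [CT CT0 hCT] := bop_bound Tb.
have [c' c'0 hc'] := coef_quad z.
exists ((om%:C * coef z) *: contour_value z + coef z *: T).
  have [Vl _] := contour_value_bop hz; have [Tl _] := Tb.
  apply: (@bop_of_bound _ _ _ (nrm (om%:C * coef z) * CV + nrm (coef z) * CT)) => [a x y|x].
    by rewrite !fctE Vl Tl; modring R[i].
  rewrite !fctE; apply: le_trans (ler_nrmD _ _) _; rewrite !nrmZ mulrDl -!mulrA.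
  by apply: lerD; rewrite ler_wpM2l ?nrm_ge0.
set L := nrm (om%:C * coef z) + c'; have L0 : 0 <= L by rewrite addr_ge0 ?nrm_ge0.
exists ((nrm (coef z) + L) * c + c' * CV + L * CT), (Num.min d 1); split.
- by rewrite !addr_ge0 // mulr_ge0 // addr_ge0 ?nrm_ge0.
- by rewrite lt_min d0 ltr01.
move=> s x; rewrite lt_min => /andP[sd s1]; have s0 := nrm_ge0 s; have x0 := nrm_ge0 x.
have h1 := hc s x sd; have h2 := hc' s s1; have h3 := hCV x; have h4 := hCT x.
have lip : nrm (coef (z + s) - coef z) <= L * nrm s.
  have -> : coef (z + s) - coef z = (coef (z + s) - coef z - s * (om%:C * coef z)) + s * (om%:C * coef z) by ring.
  apply: le_trans (ler_nrmD _ _) _; rewrite (nrmM s) /L mulrDl addrC mulrC.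
  by apply: lerD => //; apply: le_trans h2 _; rewrite expr2 ler_wpM2l // ler_piMl // ltW.
have big : nrm (coef (z + s)) <= nrm (coef z) + L.
  have := nrm_sub_le (coef (z + s)) (coef z); have : L * nrm s <= L by rewrite ler_piMr // ltW.
  by lra.
have -> : semigroup_ext (z + s) x - semigroup_ext z x - s *: ((om%:C * coef z) *: contour_value z + coef z *: T) x =
   coef (z + s) *: (contour_value (z + s) x - contour_value z x - s *: T x) +
   ((coef (z + s) - coef z - s * (om%:C * coef z)) *: contour_value z x + (coef (z + s) - coef z) *: (s *: T x)).
  by rewrite /semigroup_ext !fctE; modring R[i].
apply: le_trans (ler_nrmD _ _) _.
have -> : ((nrm (coef z) + L) * c + c' * CV + L * CT) * nrm s ^+ 2 * nrm x =
  (nrm (coef z) + L) * (c * nrm s ^+ 2 * nrm x) + (c' * nrm s ^+ 2 * (CV * nrm x) + L * nrm s * (nrm s * (CT * nrm x))) by ring.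
apply: lerD; last apply: le_trans (ler_nrmD _ _) _; last apply: lerD.
- by rewrite nrmZ; apply: ler_pM; rewrite ?nrm_ge0.
- by rewrite nrmZ; apply: ler_pM; rewrite ?nrm_ge0.
- rewrite !nrmZ; apply: ler_pM; rewrite ?mulr_ge0 ?nrm_ge0 //.
  by rewrite ler_wpM2l.
Qed.

Lemma semigroup_ext_analytic : analytic_on (sector alpha) semigroup_ext.
Proof. by apply: analytic_of_quad; [exact: semigroup_ext_bop|exact: semigroup_ext_quad]. Qed.

Lemma semigroup_ext_expbound : exp_bounded_on_sectors alpha semigroup_ext.
Proof.
move=> g0 hg0; have [g h1 h2] := sector_shrink2 hg0; have [C C0 hC] := contour_value_le h1 h2.
have pp := pi_gt0 R; have /andP[_ gal] := hg0; have /andP[_ ap] := al.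
(* The added 1 makes both constants positive, since [C] and [om] are only known to be
   nonnegative. *)
exists (C / (2 * pi) + 1), (om + 1).
have C1 : 0 <= C / (2 * pi) by rewrite divr_ge0 //; lra.
split; [lra|have := om0; lra|move=> z hz].
have z0 : 0 < complex.Re z by apply: sector_Re_gt0 hz; lra.
apply: opnorm_ub => [|x]; first by rewrite mulr_ge0 ?expR_ge0 //; lra.
rewrite /semigroup_ext nrmZ nrm_coef.
apply: le_trans (ler_wpM2l _ (hC z x hz)) _; first by rewrite divr_ge0 ?expR_ge0 //; lra.
rewrite mulrA ler_wpM2r ?nrm_ge0 // mulrAC -mulrA mulrC; apply: ler_pM; rewrite ?expR_ge0 //.
  by rewrite lerDl.
by rewrite ler_expR ler_wpM2r ?(ltW z0) // lerDl.
Qed.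

Lemma semigroup_ext_small g0 x (e : R) : 0 < g0 < alpha -> 0 < e ->
  exists2 d : R, 0 < d & forall z, sector g0 z -> nrm z < d -> nrm (semigroup_ext z x) <= e.
Proof.
move=> hg0 e0; have [g h1 h2] := sector_shrink2 hg0; have /andP[g00 g01] := h1.
have hg : 0 < g < alpha by rewrite h2 (lt_trans g00).
(* Three angles: [z] ranges over the sector of [g0], the contour is at [g], and the bound on the
   wider strip at [g'] lets [three_lines] give uniform decay at [g]. *)
have [g' h1' h2'] := sector_shrink2 hg; have /andP[_ gg'] := h1'.
have hg' : 0 < g' < alpha by rewrite h2' (lt_trans _ gg') //; have /andP[] := hg.
have [gp th0 _] := gamma_pi hg; have /andP[_ gpp] := gp; have pp := pi_gt0 R.
have [M M0 hM] := integrand_bound hg'.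
have tt : 0 <= pi / 2 + g < pi / 2 + g' by rewrite th0 ltrD2l.
have e1 : 0 < e * (2 * pi) / expR om by rewrite divr_gt0 ?expR_gt0 // mulr_gt0 //; lra.
have [d d0 hd] := lap_vanish Ec tt (sin_gap h1 gpp) (mulr_ge0 M0 (nrm_ge0 x))
  (integrand_diff x h2') (hM x) (integrand_infty x) e1.
exists (Num.min d 1); first by rewrite lt_min d0 ltr01.
move=> z hz; rewrite lt_min => /andP[zd z1].
have := hd z (contour_value z x) (sector_nrm_gt0 hz) zd (sector_decay h1 gpp hz) (contour_valueP x hg (sector_mono (ltW g01) hz)).
rewrite /semigroup_ext nrmZ nrm_coef ler_pdivlMr ?expR_gt0 // => h.
have h3 : expR (om * complex.Re z) <= expR om.
  rewrite ler_expR -[X in _ <= X]mulr1 ler_wpM2l //.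
  by apply: le_trans (ler_norm _) (le_trans (ler_nrm_Re z) (ltW z1)).
rewrite mulrAC ler_pdivrMr; last by lra.
by apply: le_trans h; rewrite mulrC ler_wpM2l ?nrm_ge0.
Qed.

Lemma semigroup_ext_lim g0 x : 0 < g0 < alpha -> semigroup_ext z x @[z --> within (sector g0) (nbhs (0 : R[i]^o))] --> (0 : E).
Proof.
move=> hg0; apply/cvgrPdist_le => e e0.
have eE : e = (complex.Re e)%:C by move: e0; case: (e) => er ei; rewrite ltcE /= => /andP[/eqP -> _].
rewrite eE lte0C in e0; have [d d0 hd] := semigroup_ext_small x hg0 e0.
rewrite /within /=; apply/nbhs_ballP; exists d%:C => /=; first by rewrite lte0C.
move=> z; rewrite -ball_normE /= sub0r normrN => hz sz.
rewrite sub0r normrN eE nrmE lecR; apply: hd => //.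
by move: hz; rewrite (nrmE (z : R[i]^o)) ltcR.
Qed.

End Family.

(** * Points where the Laplace transform of the kernel is not zero *)

Section KernelDensity.
Context {R : realType}.
Local Notation rc := (real_complex R).
Variables (K : R -> R[i]) (om : R).
Hypotheses (hK : locally_integrable_halfline K) (K_neq0 : ~ zero_kernel K).
Hypothesis om_ge : (maxe 0 (laplace_abs K) <= om%:E)%E.
Local Notation Theta := (kernel_primitive K).
Implicit Types mu : R[i].

(** Its transform at mu is that of [K] at omega + mu, divided by omega + mu ([laplace_damped]). The
    damping brings the growth exponent down to 1/2, below the line Re mu = 1 on which the arcs end;
    the factor 1 fits [der_expR]. *)
Definition damped_primitive (t : R) : R[i]^o := (1 * expR (- om * t))%:C * Theta t.
Local Notation f := damped_primitive.

Lemma damped_class : exists M : R, exp_class 2^-1 M f.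
Proof.
have oh : om < om + 2^-1 by lra.
have [M [M0 hM]] := Theta_exp_bound hK om_ge oh; exists M; split => // t t0.
  have h := contS (der_cont (der_expR halfline (- om) 1 t)) (Theta_cont hK t0).
  by apply: (cont_ext _ _ h) => // s _; rewrite regE.
rewrite (nrmM _ (Theta t)) nrmC mul1r ger0_norm ?expR_ge0 //.
apply: le_trans (ler_wpM2l (expR_ge0 _) (hM t t0)) _.
rewrite mulrCA -expRD ler_wpM2l // ler_expR; lra.
Qed.

Lemma laplace_damped mu : 2^-1 < complex.Re mu ->
  laplace K (om%:C + mu) = (om%:C + mu) * Lap f mu.
Proof.
move=> hmu; have [M hf] := damped_class; apply: (laplaceE hK om_ge).
  have -> : complex.Re (om%:C + mu) = om + complex.Re mu by case: (mu).
  lra.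
have [P [P0 hP hv]] := LapP hf hmu; exists P; split => // t t0.
apply: der_eq (hP t t0); rewrite /f mul1r -cexpR !regE mulrA -cexpD; congr (cexp _ * _).
by rewrite rmorphM rmorphN; ring.
Qed.

Lemma laplace_neq0_dense mu (e : R) : 1 <= complex.Re mu -> 0 < e ->
  exists2 nu, nrm (nu - mu) < e & 2^-1 < complex.Re nu /\ laplace K (om%:C + nu) != 0.
Proof.
move=> hmu e0; have [M hf] := damped_class; apply: contrapT => no.
have om0 := omega_ge0 om_ge.
(* Radius at most 1/2 keeps the disc inside Re > 1/2, where [laplace_damped] holds and omega + s is
   not 0. *)
have m0 : 0 < Num.min e 2^-1 by rewrite lt_min e0 invr_gt0 ltr0n.
have hz s : nrm (s - mu) < Num.min e 2^-1 -> Lap f s = 0.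
  rewrite lt_min => /andP[se sh].
  have hs : 2^-1 < complex.Re s.
    have : `|complex.Re (s - mu)| < 2^-1 by apply: le_lt_trans sh; exact: ler_nrm_Re.
    rewrite (_ : complex.Re (s - mu) = complex.Re s - complex.Re mu); last by case: (s) (mu) => ? ? [? ?].
    by rewrite ltr_norml => /andP[]; lra.
  have /eqP : laplace K (om%:C + s) = 0.
    by apply/eqP; apply: contrapT => /negP h; apply: no; exists s.
  rewrite laplace_damped // mulf_eq0 => /orP[|/eqP //].
  move=> /eqP h; have : complex.Re (om%:C + s) = 0 by rewrite h.
  clear h; rewrite (_ : complex.Re (om%:C + s) = om + complex.Re s); last by case: (s).
  by move=> h; exfalso; lra.
have h1 : 2^-1 < complex.Re mu by lra.
have h0 : 0 < complex.Re mu by lra.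
have f0 := Lap_zero_fun hf h0 h1 (Lap_zero_right hf h1 m0 hz).
apply: K_neq0; apply: (zero_kernel_of_primitive hK) => t; rewrite le_eqVlt => /orP[/eqP<-|t0].
  exact: Theta0.
have /eqP := f0 t t0; rewrite /f mulf_eq0 => /orP[|/eqP //].
by move=> /eqP -[] /eqP; rewrite mul1r gt_eqF ?expR_gt0.
Qed.

End KernelDensity.

(** * The graphs of A and C, and the resolvent *)

Section Relations.
Context {R : realType} {E : completeNormedModType R[i]}.
Local Notation rc := (real_complex R).
Variables (A : linear_operator E) (C : E -> E).
Hypotheses (A_closed : closed_operator A) (C_bounded : bounded_operator C) (CA_AC : commutes_with C A).

Definition graphA (u v : E) : Prop := dom A u /\ v = A u.
Definition graphC (u v : E) : Prop := v = C u.

Lemma op0 : A 0 = 0.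
Proof.
have := opP (-1) (dom0 A) (dom0 A); rewrite scaler0 addr0 scaleN1r => h.
by rewrite [LHS]h addNr.
Qed.

Lemma graphA_rel : closed_rel graphA.
Proof.
split; first by split; [exact: dom0|rewrite op0].
  by move=> a u v u' v' [du ->] [du' ->]; split; [exact: domP|rewrite opP].
move=> u v h; move: A_closed; rewrite /closed_operator closure_id => cl.
suff : [set p : E * E | dom A p.1 /\ p.2 = A p.1] (u, v) by [].
rewrite cl => B /nbhs_ballP [d /= d0 hB].
have dE : d = (complex.Re d)%:C by move: d0; case: (d) => dr di; rewrite ltcE /= => /andP[/eqP -> _].
rewrite dE lte0C in d0; have d2 : 0 < complex.Re d / 2 by rewrite divr_gt0.
have [u' [v' [[du vE] h1 h2]]] := h _ d2.
exists (u', v'); split => //; apply: hB; split; rewrite -ball_normE /= dE nrm_ltC nrmB; lra.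
Qed.

Lemma graphC_rel : closed_rel graphC.
Proof.
have [Cl _] := C_bounded; have [M M0 hM] := bop_bound C_bounded; rewrite /graphC.
split; first by rewrite bop_lin0.
  by move=> a u v u' v' -> ->; rewrite Cl.
move=> u v h; apply/eqP; rewrite -subr_eq0; apply/eqP; apply: (@nrm_le_eps _ _ _ (M + 1)) => e e0.
have [u' [v' [-> h1 h2]]] := h e e0.
have := hM (u' - u); rewrite bop_linB // => h3.
have := nrm_tri (C u') v (C u); rewrite (nrmB v (C u')); have : M * nrm (u' - u) <= M * e by rewrite ler_wpM2l.
by move: h2 h3; lra.
Qed.

Lemma resolvent_spec l x : rhoC A C l ->
  dom A (resolventC A C l x) /\ l *: resolventC A C l x - A (resolventC A C l x) = C x.
Proof.
move=> [hr _]; have [y dy hy] : [set l *: y - A y | y in dom A] (C x) by apply: hr; exists x.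
by rewrite /resolventC; case: xgetP => [z _ //|/(_ y)]; case.
Qed.

Lemma resolvent_uniq l x y : rhoC A C l -> dom A y -> l *: y - A y = C x -> resolventC A C l x = y.
Proof.
move=> hl dy hy; have [d1 h1] := resolvent_spec x hl; have [_ inj] := hl.
by apply: inj; rewrite ?inE // h1.
Qed.

Lemma resolventC_C l x : rhoC A C l -> resolventC A C l (C x) = C (resolventC A C l x).
Proof.
move=> hl; have [d h] := resolvent_spec x hl; have [d' h'] := CA_AC d.
have [Cl _] := C_bounded.
by apply: resolvent_uniq => //; rewrite h' -bop_linZ // -bop_linB // h.
Qed.

(** With y = (l - A)^{-1} C x, the vector A y = l y - C x lies again in the domain, because C x
    does; and l - A maps it to A C x = C A x. *)
Lemma resolventC_A l x : rhoC A C l -> dom A x -> graphA (resolventC A C l x) (resolventC A C l (A x)).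
Proof.
move=> hl dx; have [d h] := resolvent_spec x hl; split=> //.
have [dC hC] := CA_AC dx.
have gy : graphA (resolventC A C l x) (A (resolventC A C l x)) by [].
have AE : A (resolventC A C l x) = l *: resolventC A C l x - C x.
  by rewrite -h opprB addrC subrK.
have g2 := relB graphA_rel (relZ graphA_rel l gy) (conj dC (erefl (A (C x)))).
rewrite -AE in g2; have [d2 h2] := g2.
by apply: resolvent_uniq => //; rewrite -h2 opprB addrC subrK hC.
Qed.

End Relations.

(** * The generation theorem *)

Section Generation.
Context {R : realType} {E : completeNormedModType R[i]}.
Local Notation rc := (real_complex R).
Let Ec : @seq_complete R E := @cmod_complete R E.
Variables (A : linear_operator E) (C : E -> E) (alpha : R) (K : R -> R[i]) (omega : R).
Variable q : R[i]^o -> E -> E.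
Hypotheses (A_closed : closed_operator A) (C_bounded : bounded_operator C) (CA_AC : commutes_with C A).
Hypothesis alpha_bounds : 0 < alpha <= pi / 2.
Hypotheses (K_L1loc : locally_integrable_halfline K) (K_neq0 : ~ zero_kernel K).
Hypothesis omega_ge : (maxe 0 (laplace_abs K) <= omega%:E)%E.
Hypothesis sub_rhoC : [set l : R[i] | omega < complex.Re l /\ laplace K l != 0] `<=` rhoC A C.
Hypothesis q_analytic : analytic_on (shifted_sector omega (pi / 2 + alpha)) q.
Hypothesis q_extends : forall l : R[i], omega < complex.Re l -> laplace K l != 0 ->
  forall x, q l x = laplace K l *: resolventC A C l x.
Hypothesis q_bounded : forall gamma : R, 0 < gamma < alpha ->
  has_ubound [set opnorm ((l - omega%:C) *: q l) | l in shifted_sector omega (pi / 2 + gamma)].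
Hypothesis q_infty : opnorm (l%:C *: q l%:C) @[l --> +oo%R] --> (0 : R).
Local Notation Theta := (kernel_primitive K).
Local Notation f := (damped_primitive K omega).
Local Notation half := [set nu : R[i] | 2^-1 < complex.Re nu].
Local Notation l_ nu := (omega%:C + nu).
Local Notation V := (contour_value omega alpha q).
Local Notation F := (semigroup_ext omega alpha q).
Local Notation hq := (integrand omega q).
Local Notation th := (pi / 2 + alpha / 2).
Implicit Types (x y : E) (mu nu w z : R[i]) (t : R).

Let om0 : 0 <= omega := omega_ge0 omega_ge.

Lemma Re_shift nu : complex.Re (l_ nu) = omega + complex.Re nu.
Proof. by case: nu. Qed.

Lemma rel_dense Gr (g1 g2 : R[i] -> E) mu : closed_rel Gr -> 1 <= complex.Re mu ->
  cont id half g1 mu -> cont id half g2 mu ->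
  (forall nu, half nu -> laplace K (l_ nu) != 0 -> Gr (g1 nu) (g2 nu)) -> Gr (g1 mu) (g2 mu).
Proof.
move=> [_ _ GC] hmu c1 c2 hG; apply: GC => e e0.
have [d1 d10 h1] := c1 e e0; have [d2 d20 h2] := c2 e e0.
have m0 : 0 < Num.min d1 d2 by rewrite lt_min d10.
have [nu nd [nh nz]] := laplace_neq0_dense K_L1loc K_neq0 omega_ge hmu m0.
move: nd; rewrite lt_min => /andP[nd1 nd2].
by exists (g1 nu), (g2 nu); split; [exact: hG|exact: h1|exact: h2].
Qed.

Lemma shift_der mu : der id half (fun nu => l_ nu : R[i]^o) mu 1.
Proof.
have h := derD (der_cst id half (omega%:C : R[i]^o) mu) (der_id id half mu).
by apply: der_eq h; rewrite add0r.
Qed.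

Lemma q_cont x mu : half mu -> cont id half (fun nu => q (l_ nu) x) mu.
Proof.
have ap : 0 < alpha by have /andP[] := alpha_bounds.
have inS nu : half nu -> shifted_sector omega (pi / 2 + alpha) (l_ nu).
  rewrite /= => hnu; rewrite /shifted_sector /= [_ - _]addrC addKr.
  by apply: (@sector_mono _ (pi / 2)); [rewrite lerDl ltW|apply: sector_half; lra].
move=> hmu; have [T hT] := analytic_der q_analytic (inS mu hmu).
apply: der_cont; apply: (der_comp (i' := id) (D' := shifted_sector omega (pi / 2 + alpha))
  (g := fun nu => l_ nu) (f := fun l => q l x) inS (shift_der mu) (hT x)).
Qed.

Lemma q_graphC x mu : 1 <= complex.Re mu -> graphC C (q (l_ mu) x) (q (l_ mu) (C x)).
Proof.
move=> hmu; have h2 : half mu by rewrite /=; lra.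
apply: (rel_dense (g1 := fun nu => q (l_ nu) x) (g2 := fun nu => q (l_ nu) (C x))
  (graphC_rel C_bounded) hmu (q_cont x h2) (q_cont (C x) h2)) => nu /= hnu nz.
have hl : omega < complex.Re (l_ nu) by rewrite Re_shift; lra.
have hr := sub_rhoC (conj hl nz); have [Cl _] := C_bounded.
by rewrite /graphC !q_extends // (resolventC_C C_bounded CA_AC) // bop_linZ.
Qed.

Lemma q_graphA x mu : dom A x -> 1 <= complex.Re mu -> graphA A (q (l_ mu) x) (q (l_ mu) (A x)).
Proof.
move=> dx hmu; have h2 : half mu by rewrite /=; lra.
apply: (rel_dense (g1 := fun nu => q (l_ nu) x) (g2 := fun nu => q (l_ nu) (A x))
  (graphA_rel A_closed) hmu (q_cont x h2) (q_cont (A x) h2)) => nu /= hnu nz.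
have hl : omega < complex.Re (l_ nu) by rewrite Re_shift; lra.
have hr := sub_rhoC (conj hl nz); rewrite !q_extends //.
by apply: (relZ (graphA_rel A_closed)); exact: resolventC_A.
Qed.

(** The equation (l - A) (l - A)^{-1} C x = C x times the transform of [K], which is l times
    [Lap f mu]. In this product form the relation keeps its meaning at the zeros of the
    transform. *)
Lemma q_resolvent x mu : 1 <= complex.Re mu ->
  graphA A (q (l_ mu) x) (l_ mu *: q (l_ mu) x - (l_ mu * Lap f mu) *: C x).
Proof.
move=> hmu; have h2 : half mu by rewrite /=; lra.
have [Mf hf] := damped_class K_L1loc omega_ge.
have cl := der_cont (shift_der mu); have cL := der_cont (Lap_der half hf h2).
have cq := q_cont x h2.
apply: (rel_dense (g1 := fun nu => q (l_ nu) x)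
  (g2 := fun nu => l_ nu *: q (l_ nu) x - (l_ nu * Lap f nu) *: C x) (graphA_rel A_closed) hmu cq).
  exact (contB (contS cl cq) (contS (contS cl cL) (cont_cst _ _ (C x) _))).
move=> nu /= hnu nz; rewrite -(laplace_damped K_L1loc omega_ge hnu).
have hl : omega < complex.Re (l_ nu) by rewrite Re_shift; lra.
have hr := sub_rhoC (conj hl nz); have [d h] := resolvent_spec x hr.
rewrite !q_extends // scalerA mulrC -scalerA -scalerBr.
apply: (relZ (graphA_rel A_closed)); split => //.
by rewrite -h opprB addrC subrK.
Qed.

(** Division by l corresponds to integration in time: the contour integral of [hres], multiplied by
    [coef], is a primitive of the family, see [hres_der]. *)
Definition hres x w : E := (l_ (cexp w))^-1 *: hq x w.

Lemma half_gamma : 0 < alpha / 2 < alpha.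
Proof. by have := alpha_bounds => /andP[? ?]; lra. Qed.

Lemma th_gt : pi / 2 < th.
Proof. by have /andP[a0 _] := alpha_bounds; lra. Qed.

Lemma th_lt : th < pi.
Proof. by have /andP[a0 ap] := alpha_bounds; have := pi_gt0 R; lra. Qed.

Lemma shift_neq0 w : strip th w -> l_ (cexp w) != 0.
Proof.
move=> hw; apply/eqP => h; have := nrm_shift_ge om0 (ltW th_gt) th_lt hw.
rewrite h nrm0 leNgt mulr_gt0 ?expR_gt0 // sin_gt0_pi // th_lt andbT.
by have := th_gt; have := pi_gt0 R; lra.
Qed.

Lemma hres_diff x : cdiff_on (strip th) (hres x).
Proof.
have /andP[_ ga] := half_gamma.
apply: cdiff_scale (integrand_diff q_analytic x ga) => w hw.
have h1 := derD (der_cst id (strip th) (omega%:C : R[i]^o) w) (cder_cexp (strip th) w).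
have h := der_cinv h1 (fun s hs => shift_neq0 hs) hw.
by eexists; exact: h.
Qed.

Lemma family_bounds x y : exists M : R, [/\ 0 <= M,
  forall w, strip th w -> 0 <= complex.Re w -> nrm (hq x w) <= M,
  forall w, strip th w -> 0 <= complex.Re w -> nrm (hq y w) <= M &
  forall w, strip th w -> 0 <= complex.Re w -> nrm (hres x w) <= M].
Proof.
have [M M0 hM] := integrand_bound q_analytic q_bounded half_gamma.
have s0 : 0 < sin th by rewrite sin_gt0_pi // th_lt andbT; have := th_gt; have := pi_gt0 R; lra.
have N0 : 0 <= M * (nrm x + nrm y) by rewrite mulr_ge0 // addr_ge0 ?nrm_ge0.
have N1 : 0 <= M * (nrm x + nrm y) / sin th by rewrite divr_ge0 // ltW.
have hx w : strip th w -> nrm (hq x w) <= M * (nrm x + nrm y).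
  by move=> hw; apply: le_trans (hM x w hw) _; rewrite ler_wpM2l // lerDl nrm_ge0.
have hy w : strip th w -> nrm (hq y w) <= M * (nrm x + nrm y).
  by move=> hw; apply: le_trans (hM y w hw) _; rewrite ler_wpM2l // lerDr nrm_ge0.
exists (M * (nrm x + nrm y) + M * (nrm x + nrm y) / sin th); split; first by rewrite addr_ge0.
- by move=> w hw _; apply: le_trans (hx w hw) _; rewrite lerDl.
- by move=> w hw _; apply: le_trans (hy w hw) _; rewrite lerDl.
move=> w hw w0; apply: le_trans (_ : M * (nrm x + nrm y) / sin th <= _); last by rewrite lerDr.
rewrite /hres nrmZ nrmV mulrC; apply: ler_pM; rewrite ?invr_ge0 ?nrm_ge0 ?hx //.
have h := nrm_shift_ge om0 (ltW th_gt) th_lt hw.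
have h1 : sin th <= nrm (l_ (cexp w)).
  by apply: le_trans h; rewrite ler_peMr ?(ltW s0) // -expR0 ler_expR.
by rewrite lef_pV2 ?posrE // (lt_le_trans s0).
Qed.

Lemma contour_value_lap t x : 0 < t -> is_lap th t%:C (hq x) (V t%:C x).
Proof.
move=> t0; have /andP[g0 _] := half_gamma.
exact: (contour_valueP alpha_bounds q_analytic q_bounded x half_gamma (sector_pos g0 t0)).
Qed.

Lemma integrand_graphC x w : 1 <= complex.Re (cexp w) -> graphC C (hq x w) (hq (C x) w).
Proof. by move=> hw; apply: (relZ (graphC_rel C_bounded)); exact: q_graphC. Qed.

Lemma integrand_graphA x w : dom A x -> 1 <= complex.Re (cexp w) -> graphA A (hq x w) (hq (A x) w).
Proof. by move=> dx hw; apply: (relZ (graphA_rel A_closed)); exact: q_graphA. Qed.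

(** [q_resolvent] divided by l and multiplied by e^w: the factor l of the scalar term cancels, which
    leaves the transform of the damped primitive in the form that [transfer] asks for. *)
Lemma hres_graphA x w : strip th w -> 1 <= complex.Re (cexp w) ->
  graphA A (hres x w) (hq x w - (cexp w * Lap f (cexp w)) *: C x).
Proof.
move=> sw hw; have h := relZ (graphA_rel A_closed) ((l_ (cexp w))^-1 * cexp w) (q_resolvent x hw).
have nz := shift_neq0 sw.
have {}h : graphA A (((l_ (cexp w))^-1 * cexp w) *: q (l_ (cexp w)) x)
    (((l_ (cexp w))^-1 * cexp w * l_ (cexp w)) *: q (l_ (cexp w)) x -
     ((l_ (cexp w))^-1 * cexp w * (l_ (cexp w) * Lap f (cexp w))) *: C x).
  by move: h; rewrite scalerBr !scalerA.
move: h; rewrite /hres /integrand scalerA.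
have -> : (l_ (cexp w))^-1 * cexp w * l_ (cexp w) = cexp w by rewrite mulrAC mulVf // mul1r.
by have -> : (l_ (cexp w))^-1 * cexp w * (l_ (cexp w) * Lap f (cexp w)) = cexp w * Lap f (cexp w)
  by rewrite mulrA -(mulrA _ (cexp w)) (mulrC (cexp w)) mulrA mulVf // mul1r.
Qed.

Lemma contour_value_C t x : 0 < t -> V t%:C (C x) = C (V t%:C x).
Proof.
move=> t0; have [M [M0 Mx My _]] := family_bounds x (C x); have [Mf hf] := damped_class K_L1loc omega_ge.
have /andP[_ ga] := half_gamma; have h1 : (2^-1 : R) < 1 by lra.
have := transfer Ec th_gt th_lt M0 (y0 := 0) (graphC_rel C_bounded) (integrand_diff q_analytic x ga)
  (integrand_diff q_analytic (C x) ga) Mx My h1 hf _ t0 (contour_value_lap x t0) (contour_value_lap (C x) t0).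
rewrite /graphC scaler0 subr0; apply => w sw hw; rewrite scaler0 subr0; exact: integrand_graphC.
Qed.

Lemma contour_value_A t x : 0 < t -> dom A x -> graphA A (V t%:C x) (V t%:C (A x)).
Proof.
move=> t0 dx; have [M [M0 Mx My _]] := family_bounds x (A x); have [Mf hf] := damped_class K_L1loc omega_ge.
have /andP[_ ga] := half_gamma; have h1 : (2^-1 : R) < 1 by lra.
have := transfer Ec th_gt th_lt M0 (y0 := 0) (graphA_rel A_closed) (integrand_diff q_analytic x ga)
  (integrand_diff q_analytic (A x) ga) Mx My h1 hf _ t0 (contour_value_lap x t0) (contour_value_lap (A x) t0).
rewrite scaler0 subr0; apply => w sw hw; rewrite scaler0 subr0; exact: integrand_graphA.
Qed.

Lemma hres_lap x : exists W : R[i] -> E, forall z, sectorial th z -> is_lap th z (hres x) (W z).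
Proof.
have [M [M0 _ _ hM]] := family_bounds x x.
have H z : exists v, sectorial th z -> is_lap th z (hres x) v.
  have [hz|nz] := pselect (sectorial th z); last by exists 0.
  have [k k0 kz] := sectorial_decay hz.
  have [|v hv] := @lap_ex R E Ec th k z (hres x) 0 0 M (th_ge0 th_gt) k0 kz M0 _ (hres_diff x).
    by move=> w hw w0; rewrite expr0 mulr1; exact: hM.
  by exists v.
by have [W hW] := choice H; exists W.
Qed.

Lemma hres_transfer t x v : 0 < t -> is_lap th t%:C (hres x) v ->
  graphA A v (V t%:C x - ('i%C * (2 * pi)%:C * f t) *: C x).
Proof.
move=> t0 hv; have [M [M0 Mx _ Mz]] := family_bounds x x; have [Mf hf] := damped_class K_L1loc omega_ge.
have /andP[_ ga] := half_gamma; have h1 : (2^-1 : R) < 1 by lra.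
apply: (transfer Ec th_gt th_lt M0 (graphA_rel A_closed) (hres_diff x) (integrand_diff q_analytic x ga)
  Mz Mx h1 hf _ t0 hv (contour_value_lap x t0)).
by move=> w sw hw; exact: hres_graphA.
Qed.

(** Differentiating e^{omega t} W(t) brings down omega + e^w = l under the contour integral, which
    undoes the division in [hres]. *)
Lemma hres_der x W t : 0 < t -> (forall z, sectorial th z -> is_lap th z (hres x) (W z)) ->
  der rc [set s | 0 < s] (fun s => coef omega s%:C *: W s%:C) t (F t%:C x).
Proof.
move=> t0 hW; have [M [M0 _ _ hM]] := family_bounds x x.
have ht := sectorial_pos th_gt th_lt t0.
have lin := lapZD (- omega%:C) (hW _ ht) (contour_value_lap x t0).
have ext : is_lap th t%:C (fun w => cexp w *: hres x w) (- omega%:C *: W t%:C + V t%:C x).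
  apply: lap_ext lin => w hw; have nz := shift_neq0 hw.
  have -> : hq x w = l_ (cexp w) *: hres x w by rewrite /hres scalerA mulfV // scale1r.
  by modring R[i].
have b w : strip th w -> 0 <= complex.Re w -> nrm (hres x w) <= M * expR (complex.Re w) ^+ 0.
  by move=> hw w0; rewrite expr0 mulr1; exact: hM.
have h := lap_der (th_ge0 th_gt) M0 b hW ht ext.
have h2 : der rc [set s | 0 < s] (fun s => W s%:C) t (- omega%:C *: W t%:C + V t%:C x).
  rewrite -[X in der _ _ _ _ X]scale1r; apply: (der_comp (i' := id) (g := rc) (D' := sectorial th) _ (der_id _ _ _) h).
  by move=> s hs; exact: (sectorial_pos th_gt th_lt hs).
have h3 : der rc [set s | 0 < s] (fun s => coef omega s%:C : R[i]^o) t (omega%:C * coef omega t%:C).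
  have h4 := der_cexp (derZ omega%:C (der_id rc [set s : R | 0 < s] t)).
  have h5 := derZ ('i%C * (2 * pi)%:C)^-1 h4.
  apply: der_eq (der_ext _ _ h5) => //; first by rewrite !regE mulr1 /coef; ring.
  by move=> s _; rewrite /coef !regE mulrC.
apply: der_eq (derS h3 h2); rewrite /semigroup_ext.
by modring R[i].
Qed.

(** The contour integral lives on the open sector; 0 is its limit at the origin in every smaller
    sector. *)
Definition convoluted (t : R) x : E := if 0 < t then F t%:C x else 0.

Lemma convoluted_pos t x : 0 < t -> convoluted t x = F t%:C x. Proof. by rewrite /convoluted => ->. Qed.
Lemma convoluted_0 x : convoluted 0 x = 0. Proof. by rewrite /convoluted ltxx. Qed.

Lemma alpha_gt0 : 0 < alpha. Proof. by have /andP[] := alpha_bounds. Qed.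

(** At 0 this is [semigroup_ext_small] on the positive axis; at t > 0 the quadratic estimate yields
    a Lipschitz bound near [t]. *)
Lemma convoluted_cont x t : 0 <= t -> cont rc halfline (fun t => convoluted t x) t.
Proof.
have /andP[g0 _] := half_gamma.
rewrite le_eqVlt => /orP[/eqP<-|t0] e e0.
  have [d d0 hd] := semigroup_ext_small om0 alpha_bounds q_analytic q_bounded q_infty x half_gamma e0.
  exists d => // s; rewrite /halfline /= convoluted_0 nrmRB !subr0 => s0 sd.
  rewrite /convoluted; case: ifP => h; last by rewrite nrm0 ltW.
  by apply: hd; [exact: sector_pos|rewrite nrmC].
have hz := sector_pos alpha_gt0 t0.
have [T Tb [c [d [c0 d0 hc]]]] := semigroup_ext_quad om0 alpha_bounds q_analytic q_bounded hz.
have [CT CT0 hCT] := bop_bound Tb.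
set L := (c * d + CT) * nrm x; have L0 : 0 <= L by rewrite mulr_ge0 ?nrm_ge0 // addr_ge0 // mulr_ge0 // ltW.
have L1 : 0 < L + 1 by lra.
exists (Num.min t (Num.min d (e / (L + 1)))); first by rewrite !lt_min t0 d0 divr_gt0.
move=> s /= s0; rewrite !lt_min => /andP[st /andP[sd se]].
have sp : 0 < s by move: st; rewrite nrmRB ltr_norml => /andP[]; lra.
rewrite !convoluted_pos //; have := hc (s%:C - t%:C) x sd.
have -> : t%:C + (s%:C - t%:C) = s%:C :> R[i] by ring.
move=> h.
have -> : F s%:C x - F t%:C x = F s%:C x - F t%:C x - (s%:C - t%:C) *: T x + (s%:C - t%:C) *: T x by rewrite subrK.
set k := nrm (s%:C - t%:C) in sd se h; have k0 : 0 <= k := nrm_ge0 _.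
have h2 : nrm ((s%:C - t%:C) *: T x) <= k * (CT * nrm x) by rewrite nrmZ -/k ler_wpM2l.
have h3 : c * k ^+ 2 * nrm x <= c * k * d * nrm x.
  by rewrite ler_wpM2r ?nrm_ge0 // expr2 mulrA ler_wpM2l ?mulr_ge0 // ltW.
have h4 : k * L <= e.
  by move: se; rewrite ltr_pdivlMr // mulrDr mulr1; lra.
apply: le_trans (ler_nrmD _ _) _; apply: le_trans (lerD h h2) _; apply: le_trans h4.
have -> : k * L = c * k * d * nrm x + k * (CT * nrm x) by rewrite /L; ring.
by rewrite lerD2r.
Qed.

(* The contour integral S1 of e^{l t} q(l) x / l satisfies A S1 = S - Theta C and
   S1' = S, so c = S1 - P is constant; letting t -> 0 in the closed relation gives
   A c = 0, and no limit of S1 at 0 is needed. *)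
Lemma convoluted_primitive t x P : 0 < t -> P 0 = 0 ->
  (forall s : R, 0 <= s -> der rc halfline P s (convoluted s x)) -> graphA A (P t) (convoluted t x - Theta t *: C x).
Proof.
move=> t0 P0 hP; have [W hW] := hres_lap x; have hG := graphA_rel A_closed; have pp := pi_gt0 R.
pose S1 (s : R) := coef omega s%:C *: W s%:C.
have rel (s : R) : 0 < s -> graphA A (S1 s) (convoluted s x - Theta s *: C x).
  move=> s0; have := relZ hG (coef omega s%:C) (hres_transfer s0 (hW _ (sectorial_pos th_gt th_lt s0))).
  rewrite scalerBr scalerA convoluted_pos //; congr (graphA A _ (_ - _ *: _)).
  have n2 : ('i%C * (2 * pi)%:C : R[i]) != 0.
    by apply/eqP => h; have := nrmM 'i%C ((2 * pi)%:C : R[i]); rewrite h nrm0 nrm_i nrmC gtr0_norm; lra.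
  have -> : coef omega s%:C * ('i%C * (2 * pi)%:C * f s) = cexp (omega%:C * s%:C) * f s.
    by rewrite /coef mulrA divfK.
  rewrite /f mul1r -cexpR mulrA -cexpD (_ : omega%:C * s%:C + (- omega * s)%:C = 0) ?cexp0 ?mul1r //.
  by rewrite rmorphM rmorphN /=; ring.
have cst (s r : R) : 0 < s -> s <= r -> S1 r - P r = S1 s - P s.
  move=> s0 sr; apply: (@der0_cst R E (fun s => S1 s - P s) [set s | 0 < s] s r sr) => u /andP[us ur].
    by rewrite /=; lra.
  have u0 : 0 < u by lra.
  rewrite -(subrr (F u%:C x)); apply: derB; first exact: hres_der.
  have sub : [set s : R | 0 < s] `<=` halfline by move=> r0 /ltW.
  by rewrite -convoluted_pos //; apply: der_sub sub _; apply: hP; exact: ltW.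
have c0 : graphA A (S1 t - P t) 0.
  have [_ _ GC] := hG; apply: GC => e e0.
  have e2 : 0 < e / 2 by rewrite divr_gt0.
  have e3 : 0 < e / 2 / (nrm (C x) + 1) by rewrite divr_gt0 // ltr_pwDr // nrm_ge0.
  have [d1 d10 h1] := der_cont (hP 0 (lexx _)) e0.
  have [d2 d20 h2] := convoluted_cont x (lexx 0) e2.
  have [d3 d30 h3] := Theta_cont K_L1loc (lexx 0) e3.
  pose m := Num.min (Num.min d1 d2) (Num.min d3 t).
  have m0 : 0 < m by rewrite !lt_min d10 d20 d30.
  pose s := m / 2; have s0 : 0 < s by rewrite divr_gt0.
  have sm : s < m by rewrite /s; lra.
  have [[sd1 sd2] [sd3 st]] : (s < d1 /\ s < d2) /\ (s < d3 /\ s < t).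
    by move: sm; rewrite !lt_min => /andP[/andP[-> ->] /andP[-> ->]].
  have hs : halfline s := ltW s0.
  have ns : nrm (s%:C - 0%:C) = s by rewrite nrmRB subr0 gtr0_norm.
  have k1 : nrm (P s) <= e by have := h1 s hs; rewrite P0 (subr0 (P s)) ns; exact.
  have k2 : nrm (convoluted s x) <= e / 2 by have := h2 s hs; rewrite convoluted_0 (subr0 (convoluted s x)) ns; exact.
  have k3 : nrm (Theta s : R[i]^o) <= e / 2 / (nrm (C x) + 1).
    by have := h3 s hs; rewrite Theta0 (subr0 (Theta s : R[i]^o)) ns; exact.
  exists (S1 s), (convoluted s x - Theta s *: C x); split; first exact: rel.
    by rewrite (cst s t s0 (ltW st)) opprB addrC subrK.
  rewrite subr0; apply: le_trans (ler_nrmB _ _) _; rewrite nrmZ.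
  have : nrm (Theta s : R[i]^o) * nrm (C x) <= e / 2.
    apply: le_trans (ler_wpM2r (nrm_ge0 _) k3) _.
    by rewrite mulrAC ler_pdivrMr ?ltr_pwDr ?nrm_ge0 // ler_wpM2l ?(ltW e2) // lerDl.
  by move: k2; lra.
by have := relB hG (rel t t0) c0; rewrite opprB addrC subrK subr0.
Qed.

Lemma convoluted_resolvent t x : 0 <= t -> exists v, [/\ is_Rint (fun s => convoluted s x) 0 t v, dom A v &
  A v = convoluted t x - Theta t *: C x].
Proof.
move=> t0; have [P [P0 hP]] := prim_halfline Ec (convoluted_cont x); exists (P t).
have hR : is_Rint (fun s => convoluted s x) 0 t (P t).
  by rewrite -[P t]subr0 -P0; apply: is_Rint_prim t0 (convoluted_cont x) hP.
move: t0; rewrite le_eqVlt => /orP[/eqP tE|t0].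
  by rewrite -tE P0 in hR *; rewrite op0 convoluted_0 Theta0 scale0r subrr; split => //; exact: dom0.
by have [d h] := convoluted_primitive t0 P0 hP; split.
Qed.

Lemma convoluted_within x : {within [set t : R | 0 <= t], continuous (fun t => convoluted t x)}.
Proof.
apply/subspace_continuousP => t /= t0; apply/cvgrPdist_le => e e0.
have eE : e = (complex.Re e)%:C by move: e0; case: (e) => er ei; rewrite ltcE /= => /andP[/eqP -> _].
rewrite eE lte0C in e0; have [d d0 hd] := convoluted_cont x t0 e0.
rewrite /within /=; apply/nbhs_ballP; exists d => //= s; rewrite /ball /= => sd s0.
rewrite eE nrmE lecR nrmB; apply: hd => //.
by rewrite nrmRB distrC.
Qed.

Lemma convoluted_subgenerator : is_subgenerator A K C convoluted.
Proof.
have [Cl _] := C_bounded; split.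
- move=> t t0; have [h|h] := boolP (0 < t).
    have -> : convoluted t = F t%:C by apply/funext => x; exact: convoluted_pos.
    by apply: (semigroup_ext_bop alpha_bounds q_analytic q_bounded); exact: sector_pos alpha_gt0 h.
  have -> : convoluted t = fun=> 0 by apply/funext => x; rewrite /convoluted (negbTE h).
  by apply: (@bop_of_bound _ _ _ 0) => [a x y|x]; rewrite ?scaler0 ?addr0 // nrm0 mul0r.
- exact: convoluted_within.
- move=> t t0 x; rewrite /convoluted; case: ifP => h; last by rewrite bop_lin0.
  by rewrite /semigroup_ext contour_value_C // bop_linZ.
- move=> t t0 x dx; rewrite /convoluted; case: ifP => h; last by rewrite op0; split => //; exact: dom0.
  by have [d h2] := relZ (graphA_rel A_closed) (coef omega t%:C) (contour_value_A h dx); split.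
- by move=> x t t0; exact: convoluted_resolvent.
Qed.

Lemma convoluted_generation : exp_bounded_analytic_convoluted A K C alpha convoluted.
Proof.
split; first exact: convoluted_subgenerator.
exists F; split; last exact: semigroup_ext_expbound.
split; first exact: semigroup_ext_analytic.
  by move=> t t0; apply/funext => x; rewrite convoluted_pos.
by move=> g hg x; exact: semigroup_ext_lim.
Qed.

End Generation.

Theorem theorem9 (R : realType) (E : completeNormedModType R[i])
    (A : linear_operator E) (C : E -> E)
    (A_closed : closed_operator A)
    (C_bounded : bounded_operator C) (C_inj : injective C)
    (CA_AC : commutes_with C A)
    (alpha : R) (alpha_bounds : 0 < alpha <= pi / 2)
    (K : R -> R[i])
    (K_L1loc : locally_integrable_halfline K) (K_neq0 : ~ zero_kernel K)
    (K_laplace : laplace_transformable K)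
    (omega : R) (omega_ge : (maxe 0 (laplace_abs K) <= omega%:E)%E)
    (sub_rhoC : [set l : R[i] | omega < complex.Re l /\ laplace K l != 0]
                  `<=` rhoC A C)
    (q : R[i]^o -> E -> E)
    (q_analytic : analytic_on (shifted_sector omega (pi / 2 + alpha)) q)
    (q_extends : forall l : R[i], omega < complex.Re l -> laplace K l != 0 ->
       forall x, q l x = laplace K l *: resolventC A C l x)
    (q_bounded : forall gamma : R, 0 < gamma < alpha ->
       has_ubound [set opnorm ((l - omega%:C) *: q l)
                  | l in shifted_sector omega (pi / 2 + gamma)])
    (q_infty : opnorm (l%:C *: q l%:C) @[l --> +oo%R] --> (0 : R)) :
  exists S : R -> E -> E, exp_bounded_analytic_convoluted A K C alpha S.
Proof.
exists (convoluted alpha omega q).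
exact: (convoluted_generation A_closed C_bounded CA_AC alpha_bounds K_L1loc K_neq0 omega_ge
  sub_rhoC q_analytic q_extends q_bounded q_infty).
Qed.
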